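(* Let $(A,\sigma)$ be an Azumaya algebra with involution over a commutative ring $R$ (with $2\in R^\times$). There exists a reference form $\eta$ for $(A,\sigma)$ such that $|\operatorname{sign}^{\mathscr M}_\bullet\eta|$ is a constant nonzero function on $\operatorname{Sper}R\setminus\operatorname{Nil}[A,\sigma]$; that is, there is an integer $c>0$ with $|\operatorname{sign}^{\mathscr M}_\alpha\eta|=c$ for all $\alpha\in\operatorname{Sper}R\setminus\operatorname{Nil}[A,\sigma]$.
   Context: All rings are unital, associative, with $2$ invertible. An Azumaya algebra with involution over $R$ is a pair $(A,\sigma)$ where $A$ is an $R$-algebra with $R$-linear involution $\sigma$, $A$ is separable over $R$ and projective as an $R$-module, and $r\mapsto r\cdot 1_A$ identifies $R$ with $\{z\in Z(A)\mid\sigma(z)=z\}$. A hermitian form over $(A,\sigma)$ is a pair $(M,h)$ (often just written $h$), with $M$ a finitely generated projective right $A$-module and $h:M\times M\to A$ biadditive with $h(xa,yb)=\sigma(a)h(x,y)b$ and $h(y,x)=\sigma(h(x,y))$; it need not be nonsingular. $\operatorname{Sper}R$ is the real spectrum: the set of orderings (prime cones) $\alpha\subseteq R$, with support the prime ideal $\operatorname{Supp}(\alpha)=\alpha\cap-\alpha$. Let $\kappa(\alpha)$ be the fraction field of $R/\operatorname{Supp}(\alpha)$, $\bar\alpha$ the ordering induced by $\alpha$ on it, $k(\alpha)$ the real closure of $\kappa(\alpha)$ at $\bar\alpha$, and $(A_\alpha,\sigma_\alpha)=(A\otimes_R k(\alpha),\sigma\otimes\mathrm{id})$, a central simple $k(\alpha)$-algebra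 with involution (simple, or a product of two simple algebras swapped by the involution). Then $A_\alpha\cong M_{n_\alpha}(D_\alpha)$ with $D_\alpha$ one of $k(\alpha)$, $k(\alpha)(\sqrt{-1})$, $(-1,-1)_{k(\alpha)}$ (Hamilton quaternions), $k(\alpha)\times k(\alpha)$, $(-1,-1)_{k(\alpha)}\times(-1,-1)_{k(\alpha)}$. Nil-orderings: $\operatorname{Nil}[A,\sigma]$ is the set of $\alpha\in\operatorname{Sper}R$ such that either $\sigma_\alpha$ is orthogonal and $D_\alpha=(-1,-1)_{k(\alpha)}$, or $\sigma_\alpha$ is symplectic and $D_\alpha=k(\alpha)$, or $\sigma_\alpha$ is unitary (second kind) and $D_\alpha$ is $k(\alpha)\times k(\alpha)$ or $(-1,-1)_{k(\alpha)}\times(-1,-1)_{k(\alpha)}$. Equivalently, $\operatorname{sign}^{\mathscr M}_\alpha$ (defined next) vanishes on all hermitian forms. $\mathscr M$-signature: if $\alpha\in\operatorname{Nil}[A,\sigma]$, $\operatorname{sign}^{\mathscr M}_\alpha h:=0$. Otherwise choose an isomorphism $(A_\alpha,\sigma_\alpha)\cong(M_n(D),\operatorname{Int}(\Psi)\circ\vartheta^t)$, where $(D,\vartheta)$ is $(k(\alpha),\mathrm{id})$, $(k(\alpha)(\sqrt{-1}),\text{conjugation})$ or $((-1,-1)_{k(\alpha)},\text{conjugation})$, $\vartheta^t$ is conjugate transposition, $\operatorname{Int}(\Psi)(x)=\Psi x\Psi^{-1}$, and $\Psi$ is invertible with $\vartheta^t(\Psi)=\Psi$. Then $\Psi^{-1}(h\otimes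 k(\alpha))$ is hermitian over $(M_n(D),\vartheta^t)$; restricting it to $(M\otimes_R k(\alpha))e_{11}$ gives a hermitian form over $(D,\vartheta)$, which is isometric to $\langle u_1,\dots,u_r\rangle_\vartheta$ with $u_i\in k(\alpha)$, and $\operatorname{sign}^{\mathscr M}_\alpha h:=\#\{i:u_i>0\}-\#\{i:u_i<0\}$. A different choice (a different hermitian Morita equivalence) changes $\operatorname{sign}^{\mathscr M}_\alpha$ at most by a global sign $\pm1$ independent of $h$; one choice is fixed for each $\alpha$. A hermitian form $\eta$ over $(A,\sigma)$ is a reference form for $(A,\sigma)$ if $\operatorname{sign}^{\mathscr M}_\alpha\eta\neq0$ for all $\alpha\in\operatorname{Sper}R\setminus\operatorname{Nil}[A,\sigma]$. *)

(* Defs.v *)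
From HB Require Import structures.
From mathcomp Require Import all_boot all_order all_algebra.
From mathcomp Require Import generic_quotient ring_quotient fraction.
From mathcomp Require Import boolp classical_sets.
From mathcomp Require Import complex ring.

Set Implicit Arguments.
Unset Strict Implicit.
Unset Printing Implicit Defensive.

Import Order.TTheory GRing.Theory Num.Theory.

Local Open Scope ring_scope.
Local Open Scope quotient_scope.

(* Right A-modules are left modules over the converse ring A^c, with x a
   written (a : A^c) *: x. *)

Definition projective (S : pzRingType) (M : lmodType S) : Prop :=
  forall (N P : lmodType S) (g : {linear N -> P}) (f : {linear M -> P}),
    (forall y, exists x, g x = y) ->
  exists f' : {linear M -> N}, forall x, g (f' x) = f x.

Definition fin_generated (S : pzRingType) (M : lmodType S) : Prop :=
  exists (n : nat) (v : 'I_n -> M), forall x : M,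
    exists a : 'I_n -> S, x = \sum_i a i *: v i.

Definition balanced (R : pzRingType) (M N : lmodType R) (P : zmodType)
    (f : M -> N -> P) : Prop :=
  [/\ forall m m' n, f (m + m') n = f m n + f m' n,
      forall m n n', f m (n + n') = f m n + f m n' &
      forall r m n, f (r *: m) n = f m (r *: n)].

Section TensorDef.
Variables (R : pzRingType) (M N : lmodType R).

Definition fsum_eval (P : zmodType) (f : M -> N -> P) (s : seq (M * N)) : P :=
  \sum_(p <- s) f p.1 p.2.

(* Two formal sums of symbols m (x) n agree in the tensor product iff no
   balanced map separates them. *)
Definition fsum_equiv (s t : seq (M * N)) : bool :=
  `[< forall (P : zmodType) (f : M -> N -> P), balanced f ->
        fsum_eval f s = fsum_eval f t >].

Lemma fsum_equivP : equiv_class_of fsum_equiv.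
Proof.
split=> [s|s t|t s u].
- exact/asboolP.
- by apply/asboolP/asboolP => h P f bf; rewrite h.
- by move=> /asboolP h1 /asboolP h2; apply/asboolP => P f bf; rewrite h1 ?h2.
Qed.

Canonical fsum_equiv_equiv := EquivRelPack fsum_equivP.
Canonical fsum_equiv_encModRel := defaultEncModRel fsum_equiv.

Definition tensor : Type := {eq_quot fsum_equiv}.
HB.instance Definition _ := Choice.on tensor.
HB.instance Definition _ := EqQuotient.on tensor.

Definition tens (m : M) (n : N) : tensor := \pi_tensor [:: (m, n)].

(* The map induced by a balanced f (a meaningless value otherwise). *)
Definition tlift (P : zmodType) (f : M -> N -> P) (t : tensor) : P :=
  fsum_eval f (repr t).

Lemma tlift_pi (P : zmodType) (f : M -> N -> P) s :
  balanced f -> tlift f (\pi s) = fsum_eval f s.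
Proof.
move=> bf; rewrite /tlift.
have /eqmodP /asboolP -> // : repr (\pi_tensor s) = s %[mod tensor].
by rewrite reprK.
Qed.

Lemma tlift_inj (t u : tensor) :
  (forall (P : zmodType) (f : M -> N -> P), balanced f ->
     tlift f t = tlift f u) -> t = u.
Proof.
by move=> h; rewrite -[t]reprK -[u]reprK; apply/eqmodP/asboolP => P f /h.
Qed.

Definition tens_add (t u : tensor) : tensor := \pi_tensor (repr t ++ repr u).
Definition tens_opp (t : tensor) : tensor :=
  \pi_tensor [seq (- p.1, p.2) | p <- repr t].
Definition tens_zero : tensor := \pi_tensor [::].

Lemma balancedN (P : zmodType) (f : M -> N -> P) m n : balanced f -> f (- m) n = - f m n.
Proof.
case=> fD _ _; have f0 : f 0 n = 0.
  by apply: (addrI (f 0 n)); rewrite -fD !addr0.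
by apply: (addrI (f m n)); rewrite -fD !subrr.
Qed.

Lemma tlift_add (P : zmodType) (f : M -> N -> P) t u :
  balanced f -> tlift f (tens_add t u) = tlift f t + tlift f u.
Proof. by move=> bf; rewrite tlift_pi // /fsum_eval big_cat. Qed.

Lemma tlift_opp (P : zmodType) (f : M -> N -> P) t :
  balanced f -> tlift f (tens_opp t) = - tlift f t.
Proof.
move=> bf; rewrite tlift_pi // /fsum_eval big_map -sumrN.
by apply: eq_bigr => p _; rewrite balancedN.
Qed.

Lemma tlift_zero (P : zmodType) (f : M -> N -> P) : balanced f -> tlift f tens_zero = 0.
Proof. by move=> bf; rewrite tlift_pi // /fsum_eval big_nil. Qed.

Lemma tens_addA : associative tens_add.
Proof. by move=> t u v; apply: tlift_inj => P f bf; rewrite !tlift_add ?addrA. Qed.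
Lemma tens_addC : commutative tens_add.
Proof. by move=> t u; apply: tlift_inj => P f bf; rewrite !tlift_add // addrC. Qed.
Lemma tens_add0 : left_id tens_zero tens_add.
Proof.
by move=> t; apply: tlift_inj => P f bf; rewrite !tlift_add // tlift_zero ?add0r.
Qed.
Lemma tens_addN : left_inverse tens_zero tens_opp tens_add.
Proof.
move=> t; apply: tlift_inj => P f bf.
by rewrite tlift_add // tlift_opp // tlift_zero ?addNr.
Qed.

HB.instance Definition _ :=
  GRing.isZmodule.Build tensor tens_addA tens_addC tens_add0 tens_addN.

Lemma tliftD (P : zmodType) (f : M -> N -> P) : balanced f ->
  forall t u, tlift f (t + u) = tlift f t + tlift f u.
Proof. by move=> bf t u; exact: tlift_add. Qed.

Lemma tlift0 (P : zmodType) (f : M -> N -> P) : balanced f -> tlift f 0 = 0.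
Proof. exact: tlift_zero. Qed.

Lemma tliftE (P : zmodType) (f : M -> N -> P) : balanced f ->
  forall m n, tlift f (tens m n) = f m n.
Proof. by move=> bf m n; rewrite tlift_pi // /fsum_eval big_seq1. Qed.

Lemma eq_tlift (P : zmodType) (f g : M -> N -> P) t :
  f =2 g -> tlift f t = tlift g t.
Proof. by move=> fg; apply: eq_bigr => p _; rewrite fg. Qed.

Lemma tlift_split (P : zmodType) (f g : M -> N -> P) t :
  tlift (fun m n => f m n + g m n) t = tlift f t + tlift g t.
Proof. by rewrite /tlift /fsum_eval big_split. Qed.

Lemma balanced_tens : balanced tens.
Proof.
split=> [m m' n|m n n'|r m n]; apply: tlift_inj => P f bf;
  rewrite ?(tliftD bf) !(tliftE bf); by case: bf => fDl fDr fZ.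
Qed.

Lemma tens_ind (Q : tensor -> Prop) :
  Q 0 -> (forall t u, Q t -> Q u -> Q (t + u)) -> (forall m n, Q (tens m n)) ->
  forall t, Q t.
Proof.
move=> Q0 QD Qt t; rewrite -[t]reprK; elim: (repr t) => [|[m n] s IHs] //.
suff -> : \pi_tensor ((m, n) :: s) = tens m n + \pi_tensor s by apply: QD.
apply: tlift_inj => P f bf.
by rewrite (tliftD bf) (tliftE bf) !tlift_pi // /fsum_eval big_cons.
Qed.

End TensorDef.

Section AlgTensor.
Variables (R : comNzRingType) (A B : algType R).

Definition algtensor : Type := tensor A B.
HB.instance Definition _ := GRing.Zmodule.on algtensor.

Definition at_mul (t u : algtensor) : algtensor :=
  tlift (fun a b => tlift (fun a' b' => tens (a * a') (b * b')) u) t.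
Definition at_one : algtensor := tens 1 1.

Let balI a b : balanced (fun (a' : A) (b' : B) => tens (a * a') (b * b')).
Proof.
have [tDl tDr tZ] := balanced_tens A B.
by split=> *; rewrite ?mulrDr ?tDl ?tDr // -!scalerAr tZ.
Qed.

Let balO (u : tensor A B) : balanced
  (fun (a : A) (b : B) => tlift (fun a' b' => tens (a * a') (b * b')) u).
Proof.
have [tDl tDr tZ] := balanced_tens A B.
split=> [m m' n|m n n'|r m n]; rewrite -?tlift_split; apply: eq_tlift => a b.
- by rewrite mulrDl tDl.
- by rewrite mulrDl tDr.
- by rewrite -!scalerAl tZ.
Qed.

Lemma at_mulE a b a' b' :
  at_mul (tens a b) (tens a' b') = tens (a * a') (b * b').
Proof. by rewrite /at_mul (tliftE (balO _)) (tliftE (balI _ _)). Qed.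

Lemma at_mulDl : left_distributive at_mul +%R.
Proof. by move=> t u v; rewrite /at_mul (tliftD (balO _)). Qed.

Lemma at_mulDr : right_distributive at_mul +%R.
Proof.
move=> t u v; rewrite /at_mul -tlift_split; apply: eq_tlift => a b.
by rewrite (tliftD (balI _ _)).
Qed.

Let at_mul0 t : at_mul t 0 = 0.
Proof. by apply: (addrI (at_mul t 0)); rewrite -at_mulDr !addr0. Qed.

Let at_0mul t : at_mul 0 t = 0.
Proof. by apply: (addrI (at_mul 0 t)); rewrite -at_mulDl !addr0. Qed.

Lemma at_mulA : associative at_mul.
Proof.
move=> t u v; elim/tens_ind: t => [|t t' IHt IHt'|a b].
- by rewrite !at_0mul.
- by rewrite !at_mulDl IHt IHt'.
elim/tens_ind: u => [|u u' IHu IHu'|a' b'].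
- by rewrite !(at_mul0, at_0mul).
- by rewrite !(at_mulDl, at_mulDr) IHu IHu'.
elim/tens_ind: v => [|v v' IHv IHv'|a'' b''].
- by rewrite !at_mul0.
- by rewrite !at_mulDr IHv IHv'.
by rewrite !at_mulE !mulrA.
Qed.

Lemma at_mul1 : left_id at_one at_mul.
Proof.
elim/tens_ind => [|t u IHt IHu|a b]; first exact: at_mul0.
  by rewrite at_mulDr IHt IHu.
by rewrite at_mulE !mul1r.
Qed.

Lemma at_1mul : right_id at_one at_mul.
Proof.
elim/tens_ind => [|t u IHt IHu|a b]; first exact: at_0mul.
  by rewrite at_mulDl IHt IHu.
by rewrite at_mulE !mulr1.
Qed.

HB.instance Definition _ := GRing.Zmodule_isPzRing.Build algtensor
  at_mulA at_mul1 at_1mul at_mulDl at_mulDr.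

End AlgTensor.

Section ConverseAlg.
Variables (R : comNzRingType) (A : algType R).

HB.instance Definition _ := GRing.Zmodule_isLmodule.Build R A^c
  (@scalerA R A) (@scale1r R A) (@scalerDr R A) (@scalerDl R A).

Let convAl (r : R) (u v : A^c) : r *: (u * v) = (r *: u) * v.
Proof. exact: (@scalerAr R A r v u). Qed.
Let convAr (r : R) (u v : A^c) : r *: (u * v) = u * (r *: v).
Proof. exact: (@scalerAl R A r v u). Qed.

HB.instance Definition _ := GRing.Lmodule_isLalgebra.Build R A^c convAl.
HB.instance Definition _ := GRing.Lalgebra_isAlgebra.Build R A^c convAr.

End ConverseAlg.

(* A as a module over A (x) A^op: (a (x) b) x = a x b. *)

Section EnvModule.
Variables (R : comNzRingType) (A : algType R).

Definition envmod : Type := A.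
HB.instance Definition _ := GRing.Zmodule.on envmod.

Definition env_scale (t : algtensor A A^c) (x : envmod) : envmod :=
  tlift (fun (a : A) (b : A^c) => a * (x : A) * (b : A)) t.

Let bal (x : A) : balanced (fun (a : A) (b : A^c) => a * x * (b : A)).
Proof.
split=> [m m' n|m n n'|r m n]; first by rewrite !mulrDl.
  exact: (mulrDr (m * x) (n : A) n').
by rewrite -!scalerAl; exact: (scalerAr r (m * x) (n : A)).
Qed.

Let envD : right_distributive env_scale +%R.
Proof.
move=> t x y; rewrite /env_scale -tlift_split; apply: eq_tlift => a b.
by rewrite mulrDr mulrDl.
Qed.

Let envDl x : {morph env_scale^~ x : t u / t + u}.
Proof. by move=> t u; rewrite /env_scale (tliftD (bal _)). Qed.

Let env0 x : env_scale 0 x = 0.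
Proof. exact: (tlift0 (bal _)). Qed.

Let envr0 t : env_scale t 0 = 0.
Proof. by apply: (addrI (env_scale t 0)); rewrite -envD !addr0. Qed.

Let env1 : left_id 1 env_scale.
Proof.
by move=> x; rewrite /env_scale (tliftE (bal _)) mul1r (mulr1 (x : A)).
Qed.

Let envA t u x : env_scale t (env_scale u x) = env_scale (t * u) x.
Proof.
elim/tens_ind: t => [|t t' IHt IHt'|a b].
- by rewrite (mul0r u) !env0.
- by rewrite (mulrDl (t : algtensor A A^c) t' u) !envDl IHt IHt'.
elim/tens_ind: u => [|u u' IHu IHu'|a' b'].
- by rewrite (mulr0 (tens a b : algtensor A A^c)) env0 envr0.
- rewrite (mulrDr (tens a b : algtensor A A^c) u u') !envDl envD.
  by rewrite IHu IHu'.
rewrite [_ * _]at_mulE /env_scale !(tliftE (bal _)).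
have -> : b * b' = (b' : A) * (b : A) :> A by [].
by rewrite !mulrA.
Qed.

HB.instance Definition _ := GRing.Zmodule_isLmodule.Build (algtensor A A^c)
  envmod envA env1 envD envDl.

End EnvModule.

Definition separable (R : comNzRingType) (A : algType R) : Prop :=
  projective (envmod A).

Definition is_involution (R : comNzRingType) (A : algType R)
    (sigma : {linear A -> A}) : Prop :=
  (forall a b, sigma (a * b) = sigma b * sigma a) /\
  (forall a, sigma (sigma a) = a).

Record azumaya_with_involution (R : comNzRingType) (A : algType R)
    (sigma : {linear A -> A}) : Prop := AzumayaWithInvolution {
  azumaya_involution : is_involution sigma;
  azumaya_separable : separable A;
  azumaya_projective : projective A;
  azumaya_scalar_inj : injective (fun r : R => r%:A : A);
  azumaya_sym_center : forall z : A,
    (exists r : R, z = r%:A) <-> ((forall a, z * a = a * z) /\ sigma z = z)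
}.

Record hermitian_form (R : comNzRingType) (A : algType R)
    (sigma : {linear A -> A}) := HermitianForm {
  hmod : lmodType A^c;
  hmod_projective : projective hmod;
  hmod_fin_generated : fin_generated hmod;
  hval :> hmod -> hmod -> A;
  hvalDl : forall x x' y, hval (x + x') y = hval x y + hval x' y;
  hvalDr : forall x y y', hval x (y + y') = hval x y + hval x y';
  hvalM : forall x y (a b : A),
    hval ((a : A^c) *: x) ((b : A^c) *: y) = sigma a * hval x y * b;
  hvalC : forall x y, hval y x = sigma (hval x y)
}.

Section ScalarAlg.
Variables (R K : comNzRingType) (rho : {rmorphism R -> K}).

(* K as an R-algebra through rho. *)
Definition via : Type := let _ := rho in K.
HB.instance Definition _ := GRing.ComNzRing.on via.

Let via_scale (r : R) (x : via) : via := (rho r : via) * x.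
Let viaA r s x : via_scale r (via_scale s x) = via_scale (r * s) x.
Proof. by rewrite /via_scale mulrA rmorphM. Qed.
Let via1 : left_id 1 via_scale.
Proof. by move=> x; rewrite /via_scale rmorph1 mul1r. Qed.
Let viaDr : right_distributive via_scale +%R.
Proof. by move=> r x y; rewrite /via_scale mulrDr. Qed.
Let viaDl x : {morph via_scale^~ x : r s / r + s}.
Proof. by move=> r s; rewrite /via_scale rmorphD mulrDl. Qed.
HB.instance Definition _ :=
  GRing.Zmodule_isLmodule.Build R via viaA via1 viaDr viaDl.

Let viaAl (r : R) (x y : via) : r *: (x * y) = (r *: x) * y.
Proof. exact: mulrA. Qed.
HB.instance Definition _ := GRing.Lmodule_isLalgebra.Build R via viaAl.
Let viaAr (r : R) (x y : via) : r *: (x * y) = x * (r *: y).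
Proof. exact: mulrCA. Qed.
HB.instance Definition _ := GRing.Lalgebra_isAlgebra.Build R via viaAr.

End ScalarAlg.

Section RightModule.
Variables (R : comNzRingType) (A : algType R) (M : lmodType A^c).

(* A right A-module as an R-module. *)
Definition rmod : Type := M.
HB.instance Definition _ := GRing.Zmodule.on rmod.

Let rmod_scale (r : R) (x : rmod) : rmod := ((r%:A : A) : A^c) *: (x : M).
Let rmodA r s x : rmod_scale r (rmod_scale s x) = rmod_scale (r * s) x.
Proof.
have rs : (s%:A : A) * r%:A = (r * s)%:A.
  by rewrite -scalerAr mulr1 scalerA.
by rewrite /rmod_scale scalerA -rs.
Qed.
Let rmod1 : left_id 1 rmod_scale.
Proof. by move=> x; rewrite /rmod_scale scale1r; exact: scale1r. Qed.
Let rmodDr : right_distributive rmod_scale +%R.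
Proof. by move=> r x y; rewrite /rmod_scale scalerDr. Qed.
Let rmodDl x : {morph rmod_scale^~ x : r s / r + s}.
Proof. by move=> r s; rewrite /rmod_scale scalerDl; exact: scalerDl. Qed.
HB.instance Definition _ :=
  GRing.Zmodule_isLmodule.Build R rmod rmodA rmod1 rmodDr rmodDl.

End RightModule.

Section BaseChange.
Variables (R : comNzRingType) (A : algType R) (sigma : {linear A -> A}).
Variables (K : comNzRingType) (rho : {rmorphism R -> K}).

Definition bc_alg : Type := algtensor A (via rho).
HB.instance Definition _ := GRing.PzRing.on bc_alg.

Definition bc_scalar (x : K) : bc_alg := tens (1 : A) (x : via rho).

Definition bc_inv (t : bc_alg) : bc_alg :=
  tlift (fun a (x : via rho) => tens (sigma a) x) t.

Variable h : hermitian_form sigma.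

Definition bc_mod : Type := tensor (rmod (hmod h)) (via rho).
HB.instance Definition _ := GRing.Zmodule.on bc_mod.

(* (m (x) x) . (a (x) y) = m a (x) x y *)
Definition bc_act (v : bc_mod) (t : bc_alg) : bc_mod :=
  tlift (fun (m : rmod (hmod h)) (x : via rho) =>
    tlift (fun (a : A) (y : via rho) =>
      tens (((a : A^c) *: (m : hmod h)) : rmod (hmod h)) (x * y)) t) v.

Definition bc_form (v w : bc_mod) : bc_alg :=
  tlift (fun (m : rmod (hmod h)) (x : via rho) =>
    tlift (fun (m' : rmod (hmod h)) (y : via rho) =>
      tens (h m m') (x * y)) w) v.

End BaseChange.

(* Hamilton quaternions (-1,-1)_K; (a, b, c, d) is a + b i + c j + d k. *)

Section Quaternion.
Variable K : comNzRingType.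

Definition quat : Type := (K * K * K * K)%type.
HB.instance Definition _ := GRing.Zmodule.on quat.

Definition qmul (p q : quat) : quat :=
  let: (a, b, c, d) := p in let: (a', b', c', d') := q in
  (a * a' - b * b' - c * c' - d * d',
   a * b' + b * a' + c * d' - d * c',
   a * c' - b * d' + c * a' + d * b',
   a * d' + b * c' - c * b' + d * a').

Definition quat_scalar (x : K) : quat := (x, 0, 0, 0).

Definition quat_conj (p : quat) : quat :=
  let: (a, b, c, d) := p in (a, - b, - c, - d).

Let qmulA : associative qmul.
Proof.
move=> [[[a b] c] d] [[[a' b'] c'] d'] [[[a'' b''] c''] d''] /=.
by congr (_, _, _, _); ring.
Qed.
Let qmul1 : left_id (quat_scalar 1) qmul.
Proof. by move=> [[[a b] c] d] /=; congr (_, _, _, _); ring. Qed.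
Let q1mul : right_id (quat_scalar 1) qmul.
Proof. by move=> [[[a b] c] d] /=; congr (_, _, _, _); ring. Qed.
Let qmulDl : left_distributive qmul +%R.
Proof.
move=> [[[a b] c] d] [[[a' b'] c'] d'] [[[a'' b''] c''] d''] /=.
by congr (_, _, _, _) => /=; ring.
Qed.
Let qmulDr : right_distributive qmul +%R.
Proof.
move=> [[[a b] c] d] [[[a' b'] c'] d'] [[[a'' b''] c''] d''] /=.
by congr (_, _, _, _) => /=; ring.
Qed.
Let q1neq0 : quat_scalar 1 != 0.
Proof. by apply/eqP => -[/eqP]; rewrite oner_eq0. Qed.

HB.instance Definition _ := GRing.Zmodule_isNzRing.Build quat
  qmulA qmul1 q1mul qmulDl qmulDr q1neq0.

End Quaternion.

Record sper (R : comNzRingType) := Sper {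
  ordering :> R -> Prop;
  orderingD : forall x y, ordering x -> ordering y -> ordering (x + y);
  orderingM : forall x y, ordering x -> ordering y -> ordering (x * y);
  ordering_total : forall x, ordering x \/ ordering (- x);
  ordering_proper : ~ (ordering 1 /\ ordering (- 1));
  ordering_prime : forall x y,
    ordering (x * y) /\ ordering (- (x * y)) ->
    (ordering x /\ ordering (- x)) \/ (ordering y /\ ordering (- y))
}.

Section ResidueField.
Variables (R : comNzRingType) (alpha : sper R).

Definition supp : {pred R} := fun x => `[< alpha x /\ alpha (- x) >].

Lemma supp_idealr : idealr_closed supp.
Proof.
have a0 : alpha 0.
  by case: (ordering_total alpha 0); rewrite ?oppr0.
split=> [||a x y]; rewrite -?topredE /=.
- by apply/asboolP; rewrite oppr0.
- by apply/asboolP/(ordering_proper (s := alpha)).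
move=> /asboolP [x1 x2] /asboolP [y1 y2]; apply/asboolP.
have [ap|an] := ordering_total alpha a; split.
- by apply: orderingD => //; apply: orderingM.
- by rewrite opprD -mulrN; apply: orderingD => //; apply: orderingM.
- by rewrite -mulrNN; apply: orderingD => //; apply: orderingM.
- by rewrite opprD -mulNr; apply: orderingD => //; apply: orderingM.
Qed.

Lemma supp_prime : prime_idealr_closed supp.
Proof.
move=> x y /asboolP /(ordering_prime (s := alpha)) [] h; apply/orP;
  by [left; apply/asboolP|right; apply/asboolP].
Qed.

HB.instance Definition _ := isIdealr.Build R supp supp_idealr.
HB.instance Definition _ := isPrimeIdealrClosed.Build R supp supp_prime.

Definition residue_ring : Type := {ideal_quot supp}.
HB.instance Definition _ := GRing.ComNzRing.on residue_ring.
HB.instance Definition _ := Quotient.on residue_ring.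

Definition rr_unit : {pred residue_ring} :=
  fun x => `[< exists y, y * x = 1 >].
Definition rr_inv (x : residue_ring) : residue_ring :=
  if pselect (exists y, y * x = 1) is left e then projT1 (cid e) else x.

Let rr_mulV : {in rr_unit, left_inverse 1 rr_inv *%R}.
Proof.
move=> x /asboolP ex; rewrite /rr_inv; case: pselect => // e.
by case: (cid e).
Qed.
Let rr_unitP x y : y * x = 1 -> rr_unit x.
Proof. by move=> yx; apply/asboolP; exists y. Qed.
Let rr_inv_out : {in [predC rr_unit], rr_inv =1 id}.
Proof.
move=> x; rewrite inE => /asboolPn nx; rewrite /rr_inv.
by case: pselect.
Qed.
HB.instance Definition _ :=
  GRing.ComNzRing_hasMulInverse.Build residue_ring rr_mulV rr_unitP rr_inv_out.
HB.instance Definition _ :=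
  GRing.ComUnitRing_isIntegral.Build residue_ring (@Quotient.rquot_IdomainAxiom R supp).

(* kappa(alpha) = Frac (R / Supp alpha) *)
Definition residue_field : fieldType := {fraction residue_ring}.

Definition residue_map : {rmorphism R -> residue_field} :=
  (@FracField.tofrac residue_ring) \o (\pi_residue_ring).

(* The ordering of kappa(alpha) induced by alpha. *)
Definition residue_nonneg (x : residue_field) : Prop :=
  exists a b, [/\ b \notin supp, alpha (a * b) &
                  x = residue_map a / residue_map b].

(* A real closure of kappa(alpha) at this ordering. *)
Record real_closure := RealClosure {
  rc_field :> rcfType;
  rc_emb : {rmorphism residue_field -> rc_field};
  rc_nonneg : forall x, residue_nonneg x -> 0 <= rc_emb x;
  rc_algebraic : forall y, algebraicOver rc_emb y
}.

End ResidueField.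

Inductive dkind := DReal | DComplex | DQuat.

Definition dring (K : rcfType) (d : dkind) : nzRingType :=
  match d with DReal => K | DComplex => K[i] | DQuat => quat K end.

Definition dscalar (K : rcfType) (d : dkind) : K -> dring K d :=
  match d with
  | DReal => fun x => x
  | DComplex => fun x => real_complex K x
  | DQuat => @quat_scalar K
  end.

Definition dconj (K : rcfType) (d : dkind) : dring K d -> dring K d :=
  match d with
  | DReal => fun x => x
  | DComplex => fun x => conjc x
  | DQuat => @quat_conj K
  end.
Arguments dconj {K d}.

Definition conjtr (K : rcfType) (d : dkind) (n : nat)
    (X : 'M[dring K d]_n) : 'M[dring K d]_n := map_mx dconj X^T.

Section Signature.
Variables (R : comNzRingType) (A : algType R) (sigma : {linear A -> A}).
Variables (alpha : sper R) (k : real_closure alpha).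

Definition to_rc : {rmorphism R -> k} := rc_emb k \o residue_map alpha.
Definition to_rcC : {rmorphism R -> k[i]} := real_complex k \o to_rc.

Let A_ := bc_alg A to_rc.
Let sigma_ : A_ -> A_ := bc_inv sigma (rho := to_rc).

Definition is_matrix_alg (D : nzRingType) (c : k -> D) : Prop :=
  exists (n : nat) (f : {rmorphism A_ -> 'M[D]_n.+1}),
    bijective f /\ forall x, f (bc_scalar A to_rc x) = (c x)%:M.

Definition matrix_over (d : dkind) : Prop := is_matrix_alg (@dscalar k d).

Definition matrix_over_double (d : dkind) : Prop :=
  is_matrix_alg (D := (dring k d * dring k d)%type)
    (fun x => (dscalar d x, dscalar d x)).

(* Over the splitting field k(alpha)(sqrt -1), sigma is the adjoint involution
   of the bilinear form (x, y) |-> x^T B y, with B^T = eps B invertible. *)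
Definition adjoint_type (eps : k[i]) : Prop :=
  exists (n : nat) (f : {rmorphism bc_alg A to_rcC -> 'M[k[i]]_n.+1})
         (B : 'M[k[i]]_n.+1),
    [/\ bijective f, forall x, f (bc_scalar A to_rcC x) = x%:M,
        B \in unitmx, B^T = eps *: B &
        forall t, f (bc_inv sigma t) = invmx B *m (f t)^T *m B].

Definition orthogonal_type : Prop := adjoint_type 1.
Definition symplectic_type : Prop := adjoint_type (- 1).
Definition unitary_type : Prop :=
  exists z : A_, (forall t, z * t = t * z) /\ sigma_ z <> z.

Definition nil_ordering : Prop :=
  [\/ orthogonal_type /\ matrix_over DQuat,
      symplectic_type /\ matrix_over DReal |
      unitary_type /\
        (matrix_over_double DReal \/ matrix_over_double DQuat)].

(* An isomorphism (A_alpha, sigma_alpha) = (M_n(D), Int(Psi) o conjtr). *)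
Record morita_datum := MoritaDatum {
  md_kind : dkind;
  md_size : nat;
  md_iso : {rmorphism A_ -> 'M[dring k md_kind]_md_size.+1};
  md_inv : 'M[dring k md_kind]_md_size.+1 -> A_;
  md_isoK : cancel md_iso md_inv;
  md_invK : cancel md_inv md_iso;
  md_scalar : forall x, md_iso (bc_scalar A to_rc x) = (dscalar md_kind x)%:M;
  md_Psi : 'M[dring k md_kind]_md_size.+1;
  md_Psi_inv : 'M[dring k md_kind]_md_size.+1;
  md_PsiK : md_Psi *m md_Psi_inv = 1%:M;
  md_PsiVK : md_Psi_inv *m md_Psi = 1%:M;
  md_Psi_herm : conjtr md_Psi = md_Psi;
  md_sigma : forall t,
    md_iso (sigma_ t) = md_Psi *m conjtr (md_iso t) *m md_Psi_inv
}.

Section Sign.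
Variables (mu : morita_datum) (h : hermitian_form sigma).
Let D := dring k (md_kind mu).
Let M_ := bc_mod to_rc h.

(* The element of A_alpha corresponding to d e_11 *)
Definition md_corner (d : D) : A_ := md_inv (m := mu) (d *: delta_mx 0 0).

(* Psi^-1 (h (x) k(alpha)) on (M (x) k(alpha)) e_11, with values in
   e_11 M_n(D) e_11 = D *)
Definition md_form (v w : M_) : D :=
  (md_Psi_inv mu *m md_iso mu (bc_form v w)) 0 0.

(* F is an isometry from <u_1, ..., u_r> to this form. *)
Definition diagonalizes (r : nat) (u : 'I_r -> k) (F : 'cV[D]_r -> M_) : Prop :=
  [/\ forall x y, F (x + y) = F x + F y,
      forall x d, F (x *m d%:M) = bc_act (F x) (md_corner d),
      injective F,
      forall v, (exists x, F x = v) <-> (exists w, v = bc_act w (md_corner 1)) &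
      forall x y, md_form (F x) (F y) =
        \sum_i dconj (x i 0) * dscalar (md_kind mu) (u i) * y i 0].

Definition is_sign (s : int) : Prop :=
  exists (r : nat) (u : 'I_r -> k) (F : 'cV[D]_r -> M_),
    diagonalizes u F /\
    s = #|[set i | 0 < u i]|%:Z - #|[set i | u i < 0]|%:Z.

End Sign.
End Signature.

(* A choice, for each alpha, of a Morita datum, if there is one. *)
Definition morita_choice (R : comNzRingType) (A : algType R)
    (sigma : {linear A -> A}) (k : forall alpha : sper R, real_closure alpha) :=
  forall alpha, inhabited (morita_datum sigma (k alpha)) ->
    morita_datum sigma (k alpha).

Section MSignature.
Variables (R : comNzRingType) (A : algType R) (sigma : {linear A -> A}).
Variables (k : forall alpha : sper R, real_closure alpha).
Variable mu : morita_choice sigma k.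

(* Outside nil_ordering a datum and a diagonalization exist, and the signature
   is unique by Sylvester's law; the two remaining values 0 are defaults. *)
Definition msign (alpha : sper R) (h : hermitian_form sigma) : int :=
  if pselect (nil_ordering sigma (k alpha)) then 0
  else if pselect (inhabited (morita_datum sigma (k alpha))) is left ex
  then xget 0 (is_sign (mu ex) h)
  else 0.

Definition reference_form (eta : hermitian_form sigma) : Prop :=
  forall alpha, ~ nil_ordering sigma (k alpha) -> msign alpha eta <> 0.

End MSignature.

(* Main.v *)
(* The signatures of quadratic forms over R, as functions on Sper R, form a ring,
   and the signatures of hermitian forms over (A, sigma) form a module over it. If
   h has Gram matrix S, the trace form X, Y |-> Tr (X^sigma S Y S) has signature
   (dim D_alpha) (sign h)^2 outside the nil-orderings, while the sign of the trace
   of sigma determines D_alpha there. Hence |sign h| is constant on the sets of a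
   finite clopen partition, and multiplying h by suitable quadratic forms makes it
   constant on one such set and zero elsewhere.

   At a single non-nil ordering, a hermitian form of nonzero signature exists: the
   form Psi over k(alpha) has coefficients in kappa(alpha)(theta), and its scaled
   transfers along theta have signatures sum_t sgn q(t) sign(Psi_t), t running over
   the real roots of the minimal polynomial of theta. By Thom's lemma these
   functions sgn q separate the roots, so that some q gives a nonzero value.

   Finitely many such forms suffice, because Sper R is compact and the nil-orderings
   form a clopen set: they are recognized by the signature of Tr (x y) together with
   the trace of sigma, and by the signs of Tr (z^2) for skew central z. The
   algebras over real closed fields are classified by Frobenius' theorem and an
   explicit form of the Skolem-Noether theorem. *)

From HB Require Import structures.
From mathcomp Require Import all_boot all_order all_algebra.
From mathcomp Require Import generic_quotient ring_quotient fraction.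
From mathcomp Require Import boolp classical_sets filter.
From mathcomp Require Import perm complex ring lra zify separable polyrcf.
From mathcomp.multinomials Require Import freeg.
Require Import Defs.

Set Implicit Arguments.
Unset Strict Implicit.
Unset Printing Implicit Defensive.

Import Order.TTheory GRing.Theory Num.Theory.
Local Open Scope ring_scope.
Local Open Scope quotient_scope.

(** * Signatures of symmetric forms *)

(** The sign of a hermitian signature depends on the Morita datum, and data at different orderings
    are unrelated, so the signature itself need not be continuous. Signs at different orderings are
    therefore never compared: [dsign] is defined for every datum, and only its square is matched
    with the signature of a matrix over $R$. Scaling by quadratic forms and orthogonal sums act
    uniformly in the datum, and absolute values survive a sum because the two summands in [goodU]
    have disjoint supports.

    Since $A$ is only projective over $R$, its trace forms are written on a finite generating family
    and may have a radical. This is why [has_sig] asks for surjective coordinates rather than a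
    basis: a signature can then be pulled back along any surjection.

    Compactness is used through ultrafilters. A limit of orderings with a Morita datum again has
    one: each marker of a nil-ordering at the limit would persist at some ordering with a datum,
    where it is impossible. *)

Lemma exists_left_kernel (k : fieldType) (P Q : finType) (M : P -> Q -> k) :
  (#|Q| < #|P|)%N ->
  exists c : P -> k, (exists a, c a != 0) /\ forall b, \sum_a c a * M a b = 0.
Proof.
move=> ltQP; pose N := \matrix_(i < #|P|, j < #|Q|) M (enum_val i) (enum_val j).
have : kermx N != 0.
  rewrite kermx_eq0 /row_free neq_ltn; apply/orP; left.
  by apply: leq_ltn_trans ltQP; exact: rank_leq_col.
case/rowV0Pn => v /sub_kermxP vN /rV0Pn [i vi].
exists (fun a => v 0 (enum_rank a)); split.
  by exists (enum_val i); rewrite enum_valK.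
move=> b; move/rowP/(_ (enum_rank b)): vN; rewrite !mxE => vN.
rewrite -[RHS]vN (reindex (@enum_val P predT)) /=; last first.
  by exists enum_rank => j _; rewrite ?enum_rankK ?enum_valK.
by apply: eq_bigr => j _; rewrite mxE enum_valK enum_rankK.
Qed.

(** The congruence $G = T^t\,\mathrm{diag}(u)\,T$. The right inverse [S] makes the coordinates $x
    \mapsto Tx$ surjective; $T$ need not be square and $u$ may have zeros. *)
Definition gram_diag (k : pzRingType) (I : finType) (G : I -> I -> k) (J : finType) (u : J -> k)
    (T : J -> I -> k) (S : I -> J -> k) : Prop :=
  (forall a b, \sum_i T a i * S i b = (a == b)%:R) /\
  (forall i j, G i j = \sum_a u a * (T a i * T a j)).

Section HasSig.
Variable k : realFieldType.
Implicit Types X Y : Type.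

(* [L] plays the role of linear coordinates in which the form is diagonal;
   bilinearity need not be recorded, as it follows from surjectivity of [L]. *)
Definition diag_by X (b : X -> X -> k) (J : finType) (u : J -> k)
    (L : X -> J -> k) : Prop :=
  (forall c : J -> k, exists x, forall j, L x j = c j) /\
  (forall x y, b x y = \sum_j u j * (L x j * L y j)).

Definition has_sig X (b : X -> X -> k) (s : int) : Prop :=
  exists (J : finType) (u : J -> k) (L : X -> J -> k),
    diag_by b u L /\ s = \sum_j sgz (u j).

Lemma sum_sgz (J : finType) (u : J -> k) :
  \sum_j sgz (u j) = #|[set j | 0 < u j]|%:Z - #|[set j | u j < 0]|%:Z.
Proof.
have card_sum (A : {set J}) : #|A|%:Z = \sum_j (j \in A)%:R.
  by rewrite -sum1_card -natz raddf_sum big_mkcond; apply: eq_bigr => j _; case: ifP.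
rewrite !card_sum -sumrB; apply: eq_bigr => j _; rewrite !inE.
by case: sgzP.
Qed.

(** The core of Sylvester's law of inertia. If the first diagonalization had more positive entries,
    some $x \neq 0$ supported on them would be orthogonal to the vectors dual to the positive
    coordinates of the second one; then $b(x,x)$ is positive by the first and at most $0$ by the
    second. *)
Lemma diag_pos_le X (b : X -> X -> k) (J : finType) (u : J -> k) L
    (J' : finType) (u' : J' -> k) L' :
  diag_by b u L -> diag_by b u' L' ->
  (#|[set j | (0 < u j)%R]| <= #|[set j | (0 < u' j)%R]|)%N.
Proof.
move=> [sL bL] [sL' bL']; rewrite leqNgt; apply/negP => lt.
have /choice [y yP] : forall j' : J', exists y, forall i, L' y i = (i == j')%:R.
  by move=> j'; exact: sL'.
pose P := {j : J | 0 < u j}; pose Q := {j : J' | 0 < u' j}.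
pose M (a : P) (c : Q) : k := u (val a) * L (y (val c)) (val a).
have [|c [[a0 ca0] cM]] := @exists_left_kernel k P Q M.
  by rewrite !card_sig; move: lt; rewrite !cardsE.
have [x xP] := sL (fun j => if insub j is Some a then c a else 0).
have bx z : b x z = \sum_(a : P) c a * (u (val a) * L z (val a)).
  rewrite bL (bigID (fun j => 0 < u j)) /= [X in _ + X]big1 ?addr0; last first.
    by move=> j nj; rewrite xP insubF ?mul0r ?mulr0 //; exact: negbTE.
  rewrite (reindex_omap (val : P -> J) insub) /=; last first.
    by move=> j pj; rewrite insubT.
  rewrite (eq_bigl xpredT); last by move=> a; rewrite (valP a) valK eqxx.
  by apply: eq_bigr => a _; rewrite xP valK; ring.
have L'x j' : 0 < u' j' -> L' x j' = 0.
  move=> pj; apply: (mulfI (lt0r_neq0 pj)); rewrite mulr0.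
  have <- : b x (y j') = u' j' * L' x j'.
    rewrite bL' (bigD1 j') //= yP eqxx mulr1 big1 ?addr0 // => i ni.
    by rewrite yP (negbTE ni) !mulr0.
  by rewrite bx -[RHS](cM (Sub j' pj)).
have : b x x <= 0.
  rewrite bL'; apply: sumr_le0 => j _; case: (ltP 0 (u' j)) => [/L'x ->|uj].
    by rewrite !mulr0.
  by apply: mulr_le0_ge0 => //; rewrite -expr2 sqr_ge0.
have : 0 < b x x.
  rewrite bx (bigD1 a0) //=; apply: ltr_wpDr.
    apply: sumr_ge0 => a _; rewrite xP valK mulrCA -expr2.
    by apply: mulr_ge0; [exact: ltW (valP a)|exact: sqr_ge0].
  rewrite xP valK mulrCA -expr2; apply: mulr_gt0; first exact: (valP a0).
  by rewrite exprn_even_gt0.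
by move=> /lt_le_trans h /h; rewrite ltxx.
Qed.

Lemma diag_byN X (b : X -> X -> k) (J : finType) (u : J -> k) L :
  diag_by b u L -> diag_by (fun x y => - b x y) (fun j => - u j) L.
Proof.
move=> [sL bL]; split=> // x y; rewrite bL -sumrN.
by apply: eq_bigr => j _; rewrite mulNr.
Qed.

Lemma has_sig_uniq X (b : X -> X -> k) s s' :
  has_sig b s -> has_sig b s' -> s = s'.
Proof.
move=> [J [u [L [d ->]]]] [J' [u' [L' [d' ->]]]]; rewrite !sum_sgz.
have E (I : finType) (w : I -> k) : [set j | w j < 0] = [set j | 0 < - w j].
  by apply/setP => j; rewrite !inE oppr_gt0.
rewrite !E; congr (_%:Z - _%:Z).
  by apply/eqP; rewrite eqn_leq (diag_pos_le d d') (diag_pos_le d' d).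
have [e e'] := (diag_byN d, diag_byN d').
by apply/eqP; rewrite eqn_leq (diag_pos_le e e') (diag_pos_le e' e).
Qed.

Lemma eq_has_sig X (b b' : X -> X -> k) s :
  b =2 b' -> has_sig b s -> has_sig b' s.
Proof.
move=> eb [J [u [L [[sL bL] ->]]]]; exists J, u, L; split => //.
by split=> // x y; rewrite -eb.
Qed.

(** This makes generating families as good as bases: a form may be computed on coefficient vectors
    that represent its arguments redundantly. *)
Lemma has_sig_pull X Y (p : X -> Y) (b : Y -> Y -> k) s :
  (forall y, exists x, p x = y) ->
  has_sig b s -> has_sig (fun x x' => b (p x) (p x')) s.
Proof.
move=> sp [J [u [L [[sL bL] ->]]]]; exists J, u, (fun x => L (p x)).
split=> //; split=> [c|x y]; last exact: bL.
by have [y yP] := sL c; have [x xy] := sp y; exists x => j; rewrite xy.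
Qed.

Lemma has_sigZ X (b : X -> X -> k) (a : k) s :
  has_sig b s -> has_sig (fun x y => a * b x y) (sgz a * s).
Proof.
move=> [J [u [L [[sL bL] ->]]]]; exists J, (fun j => a * u j), L; split.
  split=> // x y; rewrite bL mulr_sumr; apply: eq_bigr => j _.
  by rewrite mulrA.
by rewrite mulr_sumr; apply: eq_bigr => j _; rewrite sgzM.
Qed.

(** Pulling back along [T] keeps the signature, while changing the sign of the form negates it. *)
Lemma has_sig_anti X (b : X -> X -> k) (T : X -> X) s :
  (forall y, exists x, T x = y) -> (forall x y, b (T x) (T y) = - b x y) ->
  has_sig b s -> s = 0.
Proof.
move=> sT bT hs; have h1 := has_sig_pull sT hs.
have h2 := has_sigZ (-1) hs.
have : s = - s.
  rewrite -[RHS]mulN1r; apply: (has_sig_uniq h1).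
  rewrite sgzN1 in h2.
  by apply: eq_has_sig h2 => x y; rewrite bT mulN1r.
by lia.
Qed.

Lemma has_sigD X Y (b : X -> X -> k) (b' : Y -> Y -> k) s s' :
  has_sig b s -> has_sig b' s' ->
  has_sig (fun x y : X * Y => b x.1 y.1 + b' x.2 y.2) (s + s').
Proof.
move=> [J [u [L [[sL bL] ->]]]] [J' [u' [L' [[sL' bL'] ->]]]].
exists (J + J')%type, (fun j => match j with inl i => u i | inr i => u' i end).
exists (fun x j => match j with inl i => L x.1 i | inr i => L' x.2 i end).
split; last by rewrite big_sumType.
split=> [c|x y]; last by rewrite big_sumType bL bL'.
have [x xP] := sL (c \o inl); have [y yP] := sL' (c \o inr).
by exists (x, y) => -[] j; [exact: xP|exact: yP].
Qed.

Lemma has_sig_sum (P : finType) X (b : P -> X -> X -> k) (s : P -> int) :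
  (forall i, has_sig (b i) (s i)) ->
  has_sig (fun x y : P -> X => \sum_i b i (x i) (y i)) (\sum_i s i).
Proof.
move=> hs; pose J i := projT1 (cid (hs i)).
pose hJ i := projT2 (cid (hs i)); pose u i := projT1 (cid (hJ i)).
pose hu i := projT2 (cid (hJ i)); pose L i := projT1 (cid (hu i)).
have h i : diag_by (b i) (u i) (L i) /\ s i = \sum_j sgz (u i j).
  exact: projT2 (cid (hu i)).
exists {i : P & J i}, (fun j => u (tag j) (tagged j)).
exists (fun x j => L (tag j) (x (tag j)) (tagged j)); split; last first.
  rewrite (eq_bigr _ (fun i _ => (h i).2)).
  by rewrite sig_big_dep.
split=> [c|x y]; last first.
  rewrite (eq_bigr _ (fun i _ => (h i).1.2 (x i) (y i))).
  by rewrite sig_big_dep.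
have /choice [x xP] : forall i, exists x, forall j, L i x j = c (Tagged J j).
  by move=> i; exact: (h i).1.1.
by exists x => -[i j]; exact: xP.
Qed.

Definition gram (I : finType) (G : I -> I -> k) (x y : I -> k) : k :=
  \sum_i \sum_j x i * G i j * y j.

Lemma gram_diag_by (I : finType) (G : I -> I -> k) (J : finType) (u : J -> k) T S :
  gram_diag G u T S ->
  diag_by (gram G) u (fun x j => \sum_i T j i * x i).
Proof.
move=> [TS GT]; split=> [c|x y].
  exists (fun i => \sum_b S i b * c b) => j.
  under eq_bigr do rewrite mulr_sumr.
  rewrite exchange_big (bigD1 j) //= [X in _ + X]big1 ?addr0.
    under eq_bigr do rewrite mulrA.
    by rewrite -mulr_suml TS eqxx mul1r.
  move=> b nb; under eq_bigr do rewrite mulrA.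
  by rewrite -mulr_suml TS eq_sym (negbTE nb) mul0r.
transitivity (\sum_i \sum_j \sum_a u a * ((T a i * x i) * (T a j * y j))).
  apply: eq_bigr => i _; apply: eq_bigr => j _; rewrite GT mulr_sumr mulr_suml.
  by apply: eq_bigr => a _; ring.
under eq_bigr do rewrite exchange_big /=.
rewrite exchange_big; apply: eq_bigr => a _ /=.
rewrite big_distrlr mulr_sumr /=; apply: eq_bigr => i _.
by rewrite mulr_sumr.
Qed.

(** Products of coordinates of the two factors diagonalize the tensor product, with the products of
    the diagonal entries on the diagonal. *)
Lemma has_sig_tensor (I : finType) (G : I -> I -> k) (J : finType) (u : J -> k) T S
    X (b : X -> X -> k) s :
  gram_diag G u T S -> has_sig b s ->
  has_sig (fun x y : I -> X => \sum_i \sum_j G i j * b (x i) (y j))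
          ((\sum_a sgz (u a)) * s).
Proof.
move=> [TS GT] [J' [u' [L' [[sL' bL'] ->]]]].
exists (J * J')%type, (fun p => u p.1 * u' p.2).
exists (fun x p => \sum_i T p.1 i * L' (x i) p.2); split; last first.
  rewrite big_distrlr /= pair_big; apply: eq_bigr => -[a c] _ /=.
  by rewrite sgzM.
split=> [c|x y].
  have /choice [x xP] : forall i, exists x, forall j,
      L' x j = \sum_a S i a * c (a, j).
    by move=> i; exact: sL'.
  exists x => -[a j] /=; under eq_bigr do rewrite xP mulr_sumr.
  rewrite exchange_big (bigD1 a) //= [X in _ + X]big1 ?addr0.
    under eq_bigr do rewrite mulrA.
    by rewrite -mulr_suml TS eqxx mul1r.
  move=> d nd; under eq_bigr do rewrite mulrA.
  by rewrite -mulr_suml TS eq_sym (negbTE nd) mul0r.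
rewrite -(pair_bigA _ (fun a j => u a * u' j *
  ((\sum_i T a i * L' (x i) j) * (\sum_i T a i * L' (y i) j)))) /=.
transitivity (\sum_i \sum_j \sum_a \sum_l
   u a * u' l * ((T a i * L' (x i) l) * (T a j * L' (y j) l))).
  apply: eq_bigr => i _; apply: eq_bigr => j _; rewrite GT bL' mulr_suml.
  by apply: eq_bigr => a _; rewrite mulr_sumr; apply: eq_bigr => l _; ring.
etransitivity; first by apply: eq_bigr => i _; exact: exchange_big.
rewrite exchange_big; apply: eq_bigr => a _ /=.
transitivity (\sum_i \sum_l \sum_j
   u a * u' l * ((T a i * L' (x i) l) * (T a j * L' (y j) l))).
  by apply: eq_bigr => i _; exact: exchange_big.
rewrite exchange_big; apply: eq_bigr => l _ /=.
rewrite big_distrlr mulr_sumr /=; apply: eq_bigr => i _.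
by rewrite mulr_sumr.
Qed.

End HasSig.

(** * Diagonalization of hermitian matrices over a division ring *)

Section HermitianDiag.
Variables (D : nzRingType) (conj : D -> D).
Hypothesis conjD : {morph conj : x y / x + y}.
Hypothesis conjM : forall x y, conj (x * y) = conj y * conj x.
Hypothesis conjK : involutive conj.
Hypothesis divD : forall x : D, x != 0 -> exists y, x * y = 1 /\ y * x = 1.
Hypothesis two_neq0 : (2%:R : D) != 0.

Definition ctmx m n (X : 'M[D]_(m, n)) : 'M[D]_(n, m) := map_mx conj X^T.

Let conj0 : conj 0 = 0.
Proof. by apply: (addrI (conj 0)); rewrite -conjD !addr0. Qed.
Let conjN x : conj (- x) = - conj x.
Proof. by apply: (addrI (conj x)); rewrite -conjD !subrr. Qed.
Let conj1 : conj 1 = 1.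
Proof. by rewrite -[RHS]conjK -[conj 1 in RHS]mul1r conjM conjK mul1r. Qed.

Lemma ctmxD m n (X Y : 'M[D]_(m, n)) : ctmx (X + Y) = ctmx X + ctmx Y.
Proof. by apply/matrixP => i j; rewrite !mxE conjD. Qed.
Lemma ctmxN m n (X : 'M[D]_(m, n)) : ctmx (- X) = - ctmx X.
Proof. by apply/matrixP => i j; rewrite !mxE conjN. Qed.
Lemma ctmxK m n (X : 'M[D]_(m, n)) : ctmx (ctmx X) = X.
Proof. by apply/matrixP => i j; rewrite !mxE conjK. Qed.
Lemma ctmx0 m n : ctmx (0 : 'M[D]_(m, n)) = 0.
Proof. by apply/matrixP => i j; rewrite !mxE conj0. Qed.
Lemma ctmx1 n : ctmx (1%:M : 'M[D]_n) = 1%:M.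
Proof. by apply/matrixP => i j; rewrite !mxE eq_sym; case: eqP => _; rewrite ?conj0 ?conj1. Qed.
Lemma ctmxM m n p (X : 'M[D]_(m, n)) (Y : 'M[D]_(n, p)) :
  ctmx (X *m Y) = ctmx Y *m ctmx X.
Proof.
apply/matrixP => i j; rewrite !mxE (big_morph conj conjD conj0).
by apply: eq_bigr => l _; rewrite !mxE conjM.
Qed.
Lemma ctmx_block m1 m2 n1 n2 (X : 'M[D]_(m1, n1)) (Y : 'M[D]_(m1, n2))
    (Z : 'M[D]_(m2, n1)) (W : 'M[D]_(m2, n2)) :
  ctmx (block_mx X Y Z W) = block_mx (ctmx X) (ctmx Z) (ctmx Y) (ctmx W).
Proof. by rewrite /ctmx tr_block_mx map_block_mx. Qed.

Definition mx_congruent n (H H' : 'M[D]_n) : Prop :=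
  exists T S : 'M[D]_n,
    [/\ T *m S = 1%:M, S *m T = 1%:M & H = ctmx T *m H' *m T].

Lemma mx_congruent_trans n (H1 H2 H3 : 'M[D]_n) :
  mx_congruent H1 H2 -> mx_congruent H2 H3 -> mx_congruent H1 H3.
Proof.
move=> [T [S [TS ST ->]]] [T' [S' [TS' ST' ->]]].
exists (T' *m T), (S *m S'); split; last by rewrite ctmxM !mulmxA.
- by rewrite -mulmxA (mulmxA T) TS mul1mx.
- by rewrite -mulmxA (mulmxA S') ST' mul1mx.
Qed.

Let herm_cong n (H H' : 'M[D]_n) :
  mx_congruent H H' -> ctmx H = H -> ctmx H' = H'.
Proof.
move=> [T [S [TS ST eH]]] hH.
have eH' : H' = ctmx S *m H *m S.
  have e1 : ctmx S *m ctmx T = 1%:M by rewrite -ctmxM TS ctmx1.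
  by rewrite eH -2!mulmxA TS mulmx1 mulmxA e1 mul1mx.
by rewrite eH' !ctmxM ctmxK hH mulmxA.
Qed.

Lemma cong_swap n (H : 'M[D]_n.+1) i : H i i != 0 ->
  exists2 H', mx_congruent H H' & H' 0 0 != 0.
Proof.
move=> Hi; pose P : 'M[D]_n.+1 := perm_mx (tperm 0 i).
have PP : P *m P = 1%:M by rewrite -perm_mxM tperm2 perm_mx1.
have cP : ctmx P = P.
  rewrite /ctmx tr_perm_mx tpermV; apply/matrixP => a b; rewrite !mxE.
  by case: (_ == _); rewrite ?conj0 ?conj1.
exists (P *m H *m P).
  exists P, P; split => //; rewrite cP -!mulmxA PP mulmx1 mulmxA PP.
  by rewrite mul1mx.
suff -> : (P *m H *m P) 0 0 = H i i by [].
rewrite /P -row_permE -[X in _ *m perm_mx X](tpermV 0 i).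
by rewrite -col_permE !mxE tpermL.
Qed.

Lemma cong_pivot n (H : 'M[D]_n.+1) : ctmx H = H -> H != 0 ->
  exists2 H', mx_congruent H H' & H' 0 0 != 0.
Proof.
move=> hH nH.
have [/existsP [i /cong_swap //]|] := boolP [exists i, H i i != 0].
rewrite negb_exists => /forallP H0.
have {}H0 i : H i i = 0 by apply/eqP; move: (H0 i); rewrite negbK.
have [i [j Hij]] : exists i j, H i j != 0.
  apply: contrapT => nex; case/eqP: nH; apply/matrixP => i j; rewrite mxE.
  by apply/eqP; apply: contrapT => /negP nij; apply: nex; exists i, j.
have nij : i != j by apply: contraNneq Hij => ->; rewrite H0.
have [c [Hc _]] := divD Hij.
have Hji : H j i = conj (H i j) by rewrite -{1}hH !mxE.
(* With a zero diagonal, replace $e_i$ by $e_i + e_j c$: its value is $H_{ij}c + \overline{H_{ij}c}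
   = 2$. Since $i \neq j$, $E^2 = 0$ and $1 + E$ has the inverse $1 - E$. *)
pose E := c *: delta_mx j i : 'M[D]_n.+1.
have EE : E *m E = 0.
  apply/matrixP => a b; rewrite !mxE big1 // => l _; rewrite !mxE.
  case: (eqVneq l i) => [->|_]; rewrite ?andbF ?mulr0 ?mul0r //.
  by rewrite (negbTE nij) /= ?mulr0.
have PS : (1%:M + E) *m (1%:M - E) = 1%:M.
  by rewrite mulmxDl mul1mx mulmxBr mulmx1 EE subr0 subrK.
have SP : (1%:M - E) *m (1%:M + E) = 1%:M.
  by rewrite mulmxDr mulmx1 mulmxBl mul1mx EE subr0 subrK.
pose H' := ctmx (1%:M + E) *m H *m (1%:M + E).
have cH : mx_congruent H H'.
  exists (1%:M - E), (1%:M + E); split => //.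
  rewrite /H' -2!mulmxA PS mulmx1 !mulmxA -ctmxM.
  by rewrite PS ctmx1 mul1mx.
have rowE M (b : 'I_n.+1) : (M *m E) b i = M b j * c.
  rewrite mxE (bigD1 j) //= !mxE !eqxx mulr1 big1 ?addr0 // => l nl.
  by rewrite !mxE (negbTE nl) /= !mulr0.
have Hii : H' i i = 2%:R.
  have -> : H' = H + H *m E + ctmx E *m H + ctmx E *m (H *m E).
    by rewrite /H' ctmxD ctmx1 mulmxDl mul1mx mulmxDr mulmx1 mulmxDl -mulmxA
      !addrA; congr (_ + _); rewrite -!addrA; congr (_ + _); exact: addrC.
  have cEE M : (ctmx E *m M) i i = conj c * M j i.
    rewrite mxE (bigD1 j) //= !mxE !eqxx mulr1 big1 ?addr0 // => l nl.
    by rewrite !mxE (negbTE nl) /= mulr0 conj0 mul0r.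
  rewrite mxE [X in X + _]mxE [X in X + _ + _]mxE !(rowE, cEE) !H0 Hc Hji.
  by rewrite -conjM Hc conj1 add0r mul0r mulr0 addr0.
have [|H'' c' n'] := @cong_swap _ H' i; first by rewrite Hii.
by exists H'' => //; exact: mx_congruent_trans c'.
Qed.

(** Induction on the size: move a nonzero entry to the corner and split off its Schur complement.
    Only the pivot has to be inverted, so commutativity plays no part in the argument. *)
Theorem herm_diag n (H : 'M[D]_n) : ctmx H = H ->
  exists2 u : 'rV[D]_n, forall i, conj (u 0 i) = u 0 i & mx_congruent H (diag_mx u).
Proof.
elim: n H => [|n IHn] H hH.
  exists 0; first by case.
  by exists 0, 0; split; apply/matrixP => -[].
have [->|nH] := eqVneq H 0.
  exists 0; first by move=> i; rewrite mxE conj0.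
  exists 1%:M, 1%:M; split; rewrite ?mulmx1 //.
  by apply/matrixP => i j; rewrite !mxE big1 // => l _; rewrite !mxE mul0rn mulr0.
have [H1 cH H10] := cong_pivot hH nH.
have h1 := herm_cong cH hH.
pose a : 'M[D]_1 := ulsubmx (H1 : 'M_(1 + n)).
pose b : 'M[D]_(1, n) := ursubmx (H1 : 'M_(1 + n)).
pose C : 'M[D]_n := drsubmx (H1 : 'M_(1 + n)).
have eH1 : H1 = block_mx a b (ctmx b) C :> 'M_(1 + n).
  rewrite -[LHS](@submxK _ 1 n 1 n); congr block_mx.
  by apply/matrixP => i j; rewrite !mxE -{1}h1 !mxE.
have ha : ctmx a = a.
  by apply/matrixP => i j; rewrite !mxE -{2}h1 !mxE.
have hC : ctmx C = C.
  by apply/matrixP => i j; rewrite !mxE -{2}h1 !mxE.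
have a0 : a 0 0 != 0.
  by move: H10; rewrite /a !mxE; congr (H1 _ _ != 0); apply: val_inj.
have [a' [aa' a'a]] := divD a0.
pose A' : 'M[D]_1 := a'%:M.
have aA : a *m A' = 1%:M.
  apply/matrixP => i j; rewrite !ord1 mxE big_ord1 !mxE !eqxx /= mulr1n.
  by move: aa'; rewrite !mxE.
have Aa : A' *m a = 1%:M.
  apply/matrixP => i j; rewrite !ord1 mxE big_ord1 !mxE !eqxx /= mulr1n.
  by move: a'a; rewrite !mxE.
have hA : ctmx A' = A'.
  have : ctmx (a *m A') = 1%:M by rewrite aA ctmx1.
  rewrite ctmxM ha => e; rewrite -[LHS]mulmx1 -aA mulmxA e.
  by rewrite mul1mx.
pose C' := C - ctmx b *m A' *m b.
have hC' : ctmx C' = C'.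
  by rewrite /C' ctmxD ctmxN hC !ctmxM ctmxK hA mulmxA.
have [u hu [T [S [TS ST eC]]]] := IHn _ hC'.
(* The unipotent matrix that clears the first row and column, leaving the Schur complement [C']. *)
pose L : 'M[D]_(1 + n) := block_mx 1%:M (A' *m b) 0 1%:M.
pose L' : 'M[D]_(1 + n) := block_mx 1%:M (- (A' *m b)) 0 1%:M.
have c2 : @mx_congruent (1 + n) (block_mx a b (ctmx b) C) (block_mx a 0 0 C').
  exists L, L'; split.
  - rewrite mulmx_block !(mul1mx, mulmx1, mul0mx, mulmx0, addr0, add0r).
    by rewrite addNr scalar_mx_block.
  - rewrite mulmx_block !(mul1mx, mulmx1, mul0mx, mulmx0, addr0, add0r).
    by rewrite subrr scalar_mx_block.
  rewrite ctmx_block !ctmx1 ctmx0 ctmxM hA.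
  rewrite !mulmx_block !(mul1mx, mulmx1, mul0mx, mulmx0, addr0, add0r).
  rewrite mulmxA aA mul1mx -(mulmxA _ A' a) Aa mulmx1; congr block_mx.
  by rewrite /C' mulmxA addrC subrK.
pose T2 : 'M[D]_(1 + n) := block_mx 1%:M 0 0 T.
pose S2 : 'M[D]_(1 + n) := block_mx 1%:M 0 0 S.
pose v : 'rV[D]_(1 + n) := row_mx (a 0 0)%:M u.
have c3 : @mx_congruent (1 + n) (block_mx a 0 0 C') (diag_mx v).
  exists T2, S2; split.
  - rewrite mulmx_block !(mul1mx, mulmx1, mul0mx, mulmx0, addr0, add0r) TS.
    by rewrite scalar_mx_block.
  - rewrite mulmx_block !(mul1mx, mulmx1, mul0mx, mulmx0, addr0, add0r) ST.
    by rewrite scalar_mx_block.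
  rewrite /v diag_mx_row ctmx_block !ctmx1 !ctmx0.
  rewrite !mulmx_block !(mul1mx, mulmx1, mul0mx, mulmx0, addr0, add0r).
  rewrite -eC; congr block_mx.
  by apply/matrixP => i j; rewrite !ord1 !mxE !eqxx !mulr1n.
exists v.
  move=> i; rewrite mxE; case: split_ordP => j _; rewrite ?hu //.
  have := ha; move/matrixP/(_ 0 0); rewrite !mxE !ord1 !eqxx /= !mulr1n.
  by [].
rewrite -eH1 in c2; apply: mx_congruent_trans cH _.
exact: mx_congruent_trans c2 c3.
Qed.

End HermitianDiag.

(** * The algebras [k], [k(i)] and the quaternions over a real closed field [k] *)

Section DRing.
Variable k : rcfType.

Definition ddim (d : dkind) : nat :=
  match d with DReal => 1 | DComplex => 2 | DQuat => 4 end.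

Definition dcoef (d : dkind) : dring k d -> 'I_(ddim d) -> k :=
  match d with
  | DReal => fun x _ => x
  | DComplex => fun x i => nth 0 [:: complex.Re x; complex.Im x] i
  | DQuat => fun x i =>
      nth 0 [:: x.1.1.1; x.1.1.2; x.1.2; x.2] i
  end.

Definition dbase (d : dkind) : 'I_(ddim d) -> dring k d :=
  match d with
  | DReal => fun _ => 1
  | DComplex => fun i => nth 0 [:: Complex 1 0; Complex 0 1] i
  | DQuat => fun i =>
      nth (0 : quat k) [:: (1, 0, 0, 0); (0, 1, 0, 0); (0, 0, 1, 0); (0, 0, 0, 1)] i
  end.

Definition dre (d : dkind) : dring k d -> k :=
  match d with
  | DReal => fun x => x
  | DComplex => fun x => complex.Re x
  | DQuat => fun x => x.1.1.1
  end.

(* [dsig d a] is the real part of the square of [dbase d a]. *)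
Definition dsig (d : dkind) (a : 'I_(ddim d)) : k := if a == 0%N :> nat then 1 else -1.

(* The signature of [(x, y) |-> Re (x y)]. *)
Definition dkappa (d : dkind) : int :=
  match d with DReal => 1 | DComplex => 0 | DQuat => - 2%:Z end.

Lemma quatD (x y : quat k) : x + y =
  (x.1.1.1 + y.1.1.1, x.1.1.2 + y.1.1.2, x.1.2 + y.1.2, x.2 + y.2).
Proof. by []. Qed.
Lemma quatM (x y : quat k) : x * y = qmul x y. Proof. by []. Qed.

Variable d : dkind.
Implicit Types x y z : dring k d.
Local Notation sc := (@dscalar k d).
Local Notation db := (@dbase d).

Lemma dscalarD a b : sc (a + b) = sc a + sc b.
Proof.
case: d => //=; first exact: rmorphD.
by rewrite quatD /quat_scalar /= !addr0.
Qed.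
Lemma dscalarM a b : sc (a * b) = sc a * sc b.
Proof.
case: d => //=; first exact: rmorphM.
by rewrite quatM /quat_scalar /=; congr (_, _, _, _); ring.
Qed.
Lemma dscalar1 : sc 1 = 1.
Proof. by case: d. Qed.
Lemma dscalar0 : sc 0 = 0.
Proof. by case: d. Qed.
Lemma dscalarN a : sc (- a) = - sc a.
Proof. by apply: (addrI (sc a)); rewrite -dscalarD !subrr dscalar0. Qed.
Lemma dscalarC a x : sc a * x = x * sc a.
Proof.
case: d x => //= x; first exact: mulrC.
  exact: mulrC.
by case: x => [[[x1 x2] x3] x4]; rewrite !quatM /=; congr (_, _, _, _); ring.
Qed.

Lemma dconjD : {morph (@dconj k d) : x y / x + y}.
Proof.
case: d => //= [] x y; first exact: rmorphD.
case: x => [[[x1 x2] x3] x4]; case: y => [[[y1 y2] y3] y4].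
by rewrite !quatD /=; congr (_, _, _, _); ring.
Qed.
Lemma dconjM x y : dconj (x * y) = dconj y * dconj x.
Proof.
case: d x y => //= x y; first exact: mulrC.
  by rewrite rmorphM mulrC.
case: x => [[[x1 x2] x3] x4]; case: y => [[[y1 y2] y3] y4].
by rewrite !quatM /=; congr (_, _, _, _); ring.
Qed.
Lemma dconjK : involutive (@dconj k d).
Proof.
case: d => //= [] x; first exact: conjcK.
by case: x => [[[x1 x2] x3] x4] /=; rewrite !opprK.
Qed.
Lemma dconj_scalar a : dconj (sc a) = sc a.
Proof.
case: d => //=; first by rewrite oppr0.
by rewrite /quat_scalar /= oppr0.
Qed.
Lemma dconj0 : dconj (0 : dring k d) = 0.
Proof. by rewrite -dscalar0 dconj_scalar. Qed.
Lemma dconj1 : dconj (1 : dring k d) = 1.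
Proof. by rewrite -dscalar1 dconj_scalar. Qed.

Lemma dreD x y : dre (x + y) = dre x + dre y.
Proof. by case: d x y => //= [] [a b] [a' b']. Qed.
Lemma dre0 : dre (0 : dring k d) = 0.
Proof. by case: d. Qed.
Lemma dre_scalar a : dre (sc a) = a.
Proof. by case: d. Qed.
Lemma dreM a x : dre (sc a * x) = a * dre x.
Proof.
case: d x => //= x.
  by case: x => x1 x2 /=; ring.
by case: x => [[[x1 x2] x3] x4] /=; ring.
Qed.
Lemma dreC x y : dre (x * y) = dre (y * x).
Proof.
case: d x y => //= x y; first exact: mulrC.
  by rewrite mulrC.
case: x => [[[x1 x2] x3] x4]; case: y => [[[y1 y2] y3] y4] /=; ring.
Qed.
Lemma dre_conj x : dre (dconj x) = dre x.
Proof. by case: d x => //= -[] // [[]]. Qed.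
Lemma dconj_fix x : dconj x = x -> x = sc (dre x).
Proof.
have opp0 (a : k) : - a = a -> a = 0 by move=> h; lra.
case: d x => //= x.
  by case: x => a b [] /opp0 ->.
by case: x => [[[x1 x2] x3] x4] [] /opp0 -> /opp0 -> /opp0 ->.
Qed.

Lemma dcoefE x a : dcoef x a = dre (dconj (db a) * x).
Proof.
case: d x a => /= x a; first by rewrite mul1r.
  by case: x => x1 x2; case: a => -[|[|[]]] //= _; ring.
case: x => [[[x1 x2] x3] x4]; case: a => -[|[|[|[|[]]]]] //= _; ring.
Qed.
Lemma dcoefD x y a : dcoef (x + y) a = dcoef x a + dcoef y a.
Proof. by rewrite !dcoefE mulrDr dreD. Qed.
Lemma dcoefZ c x a : dcoef (sc c * x) a = c * dcoef x a.
Proof. by rewrite !dcoefE mulrA -dscalarC -mulrA dreM. Qed.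
Lemma dcoef_base a b : dcoef (db a) b = (a == b)%:R.
Proof.
case: d a b => /= a b; first by rewrite !ord1.
  by case: a b => -[|[|[]]] //= ? [] [|[|[]]] //=.
by case: a b => -[|[|[|[|[]]]]] //= ? [] [|[|[|[|[]]]]] //=.
Qed.
Lemma dcoefK x : x = \sum_a sc (dcoef x a) * db a.
Proof.
case: d x => /= x; first by rewrite big_ord1 mulr1.
  rewrite !big_ord_recl big_ord0 /=; case: x => x1 x2 /=.
  by apply/eqP; rewrite eq_complex /=; apply/andP; split; apply/eqP; ring.
rewrite !big_ord_recl big_ord0 /=; case: x => [[[x1 x2] x3] x4] /=.
by rewrite !quatM !quatD /=; congr (_, _, _, _); ring.
Qed.
Lemma dcoef_sum (c : 'I_(ddim d) -> k) b : dcoef (\sum_a sc (c a) * db a) b = c b.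
Proof.
rewrite (big_morph (fun x => dcoef x b) (fun x y => dcoefD x y b) (id1 := 0)); last first.
  by rewrite dcoefE mulr0 dre0.
rewrite (bigD1 b) //= big1 ?addr0; first by rewrite dcoefZ dcoef_base eqxx mulr1.
by move=> a na; rewrite dcoefZ dcoef_base (negbTE na) mulr0.
Qed.

Lemma dre_conjM x y : dre (dconj x * y) = \sum_a dcoef x a * dcoef y a.
Proof.
case: d x y => /= x y; first by rewrite big_ord1.
  rewrite !big_ord_recl big_ord0 /=; case: x y => [x1 x2] [y1 y2] /=; ring.
rewrite !big_ord_recl big_ord0 /=.
case: x => [[[x1 x2] x3] x4]; case: y => [[[y1 y2] y3] y4] /=; ring.
Qed.
Lemma dre_mul x y : dre (x * y) = \sum_a dsig a * (dcoef x a * dcoef y a).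
Proof.
case: d x y => /= x y; first by rewrite big_ord1 mul1r.
  by rewrite !big_ord_recl big_ord0 /dsig /=; case: x y => [x1 x2] [y1 y2] /=; ring.
rewrite !big_ord_recl big_ord0 /dsig /=.
case: x => [[[x1 x2] x3] x4]; case: y => [[[y1 y2] y3] y4] /=; ring.
Qed.
Lemma sum_dsig : \sum_(a < ddim d) sgz (dsig a) = dkappa d.
Proof. by case: d; rewrite /dsig !big_ord_recl big_ord0 /= ?sgzN1 ?sgz1. Qed.

(** The left side is the trace over $k$ of left multiplication by $x$ on $D$. *)
Lemma sum_dcoef_mul x : \sum_a dcoef (x * db a) a = (ddim d)%:R * dre x.
Proof.
case: d x => /= x; first by rewrite big_ord1 mulr1 mul1r.
  by rewrite !big_ord_recl big_ord0 /=; case: x => [x1 x2] /=; ring.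
rewrite !big_ord_recl big_ord0 /=.
case: x => [[[x1 x2] x3] x4] /=; ring.
Qed.
(** The left side is the trace over $k$ of $z \mapsto x\bar z y$; this is how [dkappa] enters the
    trace of $\sigma$. *)
Lemma sum_dcoef_conj x y :
  \sum_a dcoef (x * dconj (db a) * y) a = (dkappa d)%:~R * dre (dconj x * y).
Proof.
case: d x y => /= x y; first by rewrite big_ord1 mulr1 mul1r.
  rewrite !big_ord_recl big_ord0 /=; case: x y => [x1 x2] [y1 y2] /=; ring.
rewrite !big_ord_recl big_ord0 /=.
case: x => [[[x1 x2] x3] x4]; case: y => [[[y1 y2] y3] y4] /=; ring.
Qed.

Lemma dnorm_ge0 x : 0 <= dre (dconj x * x).
Proof. by rewrite dre_conjM sumr_ge0 // => a _; rewrite -expr2 sqr_ge0. Qed.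
Lemma dnorm_eq0 x : dre (dconj x * x) = 0 -> x = 0.
Proof.
rewrite dre_conjM => /eqP; rewrite psumr_eq0 => [/allP h|a _]; last first.
  by rewrite -expr2 sqr_ge0.
rewrite [x]dcoefK big1 // => a _; have := h a (mem_index_enum _).
by rewrite mulf_eq0 orbb => /eqP ->; rewrite dscalar0 mul0r.
Qed.
Lemma ddiv x : x != 0 -> exists y, x * y = 1 /\ y * x = 1.
Proof.
move=> nx; have n0 (z : dring k d) : z != 0 -> dre (dconj z * z) != 0.
  by move=> nz; apply: contra_neq nz; exact: dnorm_eq0.
have e z : dconj z * z = sc (dre (dconj z * z)).
  by apply: dconj_fix; rewrite dconjM dconjK.
pose c := dre (dconj x * x).
have l : sc c^-1 * dconj x * x = 1.
  by rewrite -mulrA e -dscalarM mulVf ?dscalar1 // n0.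
have ncx : dconj x != 0.
  by apply: contra_neq nx => h; rewrite -[x]dconjK h dconj0.
pose c' := dre (dconj (dconj x) * dconj x).
have r : x * (sc c'^-1 * dconj x) = 1.
  by rewrite mulrA -dscalarC -mulrA -{1}(dconjK x) e -dscalarM mulVf ?dscalar1 // n0.
exists (sc c'^-1 * dconj x); split => //.
suff -> : sc c'^-1 * dconj x = sc c^-1 * dconj x by [].
by rewrite -[RHS]mulr1 -r mulrA l mul1r.
Qed.
Lemma dtwo_neq0 : (2%:R : dring k d) != 0.
Proof.
apply/eqP => h; have : dre (2%:R : dring k d) = 2%:R.
  by rewrite mulr2n -dscalar1 -dscalarD dre_scalar.
by rewrite h dre0 => /eqP; rewrite eq_sym pnatr_eq0.
Qed.

End DRing.

(** * Finitely generated separable algebras and base change *)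

Definition bilinear_over (K : Type) (B : pzRingType) (c : K -> B) (P : zmodType)
    (f : B -> B -> P) : Prop :=
  [/\ forall u u' v, f (u + u') v = f u v + f u' v,
      forall u v v', f u (v + v') = f u v + f u v' &
      forall z u v, f (c z * u) v = f u (c z * v)].

(* The elements [sep_l i], [sep_r i] are the components of a separability
   idempotent, [fin_gen] and [fin_coord] form a finite dual basis. *)
Record fsep_alg (K : comNzRingType) (B : pzRingType) (c : K -> B) (m : nat) := FSepAlg {
  scalD : {morph c : x y / x + y};
  scalM : {morph c : x y / x * y};
  scal1 : c 1 = 1;
  scalC : forall z b, c z * b = b * c z;
  fin_gen : 'I_m -> B;
  fin_coord : 'I_m -> B -> K;
  fin_coordD : forall i, {morph fin_coord i : u v / u + v};
  fin_coordZ : forall i z b, fin_coord i (c z * b) = z * fin_coord i b;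
  fin_coordK : forall b, b = \sum_i c (fin_coord i b) * fin_gen i;
  sep_num : nat;
  sep_l : 'I_sep_num -> B;
  sep_r : 'I_sep_num -> B;
  sep_lr : \sum_i sep_l i * sep_r i = 1;
  sepP : forall (P : zmodType) (f : B -> B -> P), bilinear_over c f ->
    forall b, \sum_i f (b * sep_l i) (sep_r i) = \sum_i f (sep_l i) (sep_r i * b)
}.
Arguments fin_gen {K B c m} _ _.
Arguments fin_coord {K B c m} _ _ _.
Arguments sep_num {K B c m} _.
Arguments sep_l {K B c m} _ _.
Arguments sep_r {K B c m} _ _.

Section BalancedExtra.
Variables (R : pzRingType) (M N : lmodType R) (P : zmodType) (f : M -> N -> P).
Hypothesis bf : balanced f.

Lemma balanced0l n : f 0 n = 0.
Proof. by case: bf => fD _ _; apply: (addrI (f 0 n)); rewrite -fD !addr0. Qed.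
Lemma balanced_suml (I : Type) (r : seq I) (Q : pred I) (F : I -> M) n :
  f (\sum_(i <- r | Q i) F i) n = \sum_(i <- r | Q i) f (F i) n.
Proof.
by case: bf => fD _ _; exact: (big_morph (f^~ n) (fun a b => fD a b n) (balanced0l n)).
Qed.
End BalancedExtra.

Section Azumaya.
Variables (R : comNzRingType) (A : algType R).
Hypotheses (sepA : separable A) (projA : projective A).

(** Projectivity over $A \otimes A^{op}$ splits the multiplication map $A \otimes A^{op} \to A$; the
    image of $1$ under the splitting is a separability idempotent, here written as a finite sum of
    pure tensors. *)
Lemma separable_elements : exists (n : nat) (x y : 'I_n -> A),
  \sum_i x i * y i = 1 /\
  forall (P : zmodType) (f : A -> A -> P), balanced f ->
    forall a, \sum_i f (a * x i) (y i) = \sum_i f (x i) (y i * a).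
Proof.
pose E := algtensor A A^c.
pose g (t : E^o) : envmod A := (t : E) *: (1 : envmod A).
have gE (s : seq (A * A^c)) : g (\pi_(tensor A A^c) s) = \sum_(p <- s) p.1 * (p.2 : A).
  rewrite /g /GRing.scale /= /env_scale tlift_pi /fsum_eval.
    by apply: eq_bigr => p _; rewrite mulr1.
  split=> [m m' p|m p p'|r m p]; first by rewrite !mulrDl.
    by rewrite mulr1; exact: (mulrDr m (p : A) p').
  by rewrite !mulr1 -scalerAl; exact: (scalerAr r m (p : A)).
have lin_g : linear g.
  move=> t u v; rewrite /g scalerDl; congr (_ + _).
  by rewrite scalerA.
pose gl : {linear E^o -> envmod A} := HB.pack g (GRing.isLinear.Build _ _ _ _ g lin_g).
have [|f' hf'] := @sepA _ _ gl idfun.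
  move=> a; exists (tens (a : A) (1 : A^c) : E).
  rewrite /= /tens gE big_seq1 /=; exact: mulr1.
pose e : E := f' (1 : A).
have eP (t : E) : g t = 0 -> t * e = 0.
  move=> gt; rewrite -[t * e]/((t : E) *: (e : E^o)) /e -linearZ.
  by rewrite -[t *: _]/(g t) gt linear0.
pose s := repr (e : tensor A A^c).
have es : e = \pi_(tensor A A^c) s by rewrite reprK.
exists (size s), (fun i => (tnth (in_tuple s) i).1), (fun i => (tnth (in_tuple s) i).2).
have sumE (P : zmodType) (F : A * A^c -> P) :
    \sum_(i < size s) F (tnth (in_tuple s) i) = \sum_(p <- s) F p.
  by rewrite (big_nth (0, 0)) big_mkord; apply: eq_bigr => i _; rewrite (tnth_nth (0, 0)).
split.
  rewrite (sumE _ (fun p => p.1 * (p.2 : A))) -gE -es.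
  by rewrite -[RHS](hf' 1).
move=> P f bf a.
(* [t] lies in the kernel of multiplication, hence annihilates the idempotent by linearity of the
   splitting; this is the commutation rule sought. *)
pose t : E := tens a (1 : A^c) - tens (1 : A) (a : A^c).
have gt : g t = 0.
  have gB (u v : E) : g (u - v) = g u - g v.
    have := lin_g (-1) v u; rewrite !scaleN1r [- (v : E^o) + _]addrC => ->.
    exact: addrC.
  by rewrite gB /tens !gE !big_seq1 /= mulr1 mul1r subrr.
have bf' : @balanced _ A A^c P f.
  by case: bf => h1 h2 h3; split.
pose f'' : A -> A^c -> P := f.
have tE (b : A) (c : A^c) : tlift f'' ((tens b c : E) * e : tensor A A^c) =
    \sum_(p <- s) f (b * p.1) ((p.2 : A) * (c : A)).
  have -> : (tens b c : E) * e =
      \pi_(tensor A A^c) [seq (b * p.1, c * p.2) | p <- s].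
    rewrite es; elim: (s) => [|[m n] r IHr].
      have -> : \pi_(tensor A A^c) [::] = (0 : E) by [].
      exact: mulr0.
    have consE q w : \pi_(tensor A A^c) (q :: w) = (tens q.1 q.2 : E) + \pi_(tensor A A^c) w.
      apply: tlift_inj => Q h bh.
      by rewrite (tliftD bh) (tliftE bh) !tlift_pi // /fsum_eval big_cons.
    rewrite consE mulrDr IHr /= consE; congr (_ + _).
    by rewrite [LHS]at_mulE.
  by rewrite tlift_pi // /fsum_eval big_map; apply: eq_bigr.
have := eP _ gt; rewrite mulrBl => /subr0_eq h.
transitivity (\sum_(p <- s) f (a * p.1) p.2).
  exact: (sumE _ (fun p => f (a * p.1) p.2)).
transitivity (\sum_(p <- s) f p.1 ((p.2 : A) * a)); last first.
  by rewrite -(sumE _ (fun p => f p.1 ((p.2 : A) * a))).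
transitivity (tlift f'' ((tens a (1 : A^c) : E) * e : tensor A A^c)).
  rewrite tE; apply: eq_bigr => p _; congr (f _ _).
  by rewrite mulr1.
by rewrite h tE; apply: eq_bigr => p _; rewrite mul1r.
Qed.

(** The free module on the whole set $A$ maps onto $A$, and a section of this map gives the
    coordinates. The dual basis is thus indexed by $A$ itself, with finite support at each
    argument. *)
Lemma projective_dual_basis : exists phi : A -> A -> R,
  [/\ forall c, {morph phi c : u v / u + v},
      forall c r a, phi c (r *: a) = r * phi c a &
      forall a, exists s : seq A, [/\ uniq s, forall c, c \notin s -> phi c a = 0 &
        a = \sum_(c <- s) phi c a *: c]].
Proof.
pose N : lmodType R := {freeg A / R}.
pose g : N -> A := @fglift R A A id.
have gB : {morph g : u v / u - v} by exact: lift_is_additive.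
have g0 : g 0 = 0 by have := gB 0 0; rewrite !subrr.
have gD : {morph g : u v / u + v}.
  move=> u v; have gN : g (- v) = - g v by rewrite -sub0r gB g0 sub0r.
  by rewrite -{1}[v]opprK gB gN opprK.
have gE D : g D = \sum_(c <- dom D) coeff c D *: c.
  rewrite -{1}(freeg_sumE D) (big_morph g gD g0).
  by apply: eq_bigr => c _; rewrite /g liftU.
have lin_g : linear g.
  move=> r u v; rewrite gD; congr (_ + _); rewrite [g u]gE scaler_sumr.
  rewrite [in LHS]/GRing.scale /= /fgscale (big_morph g gD g0).
  by apply: eq_bigr => c _; rewrite /g liftU scalerA.
pose gl : {linear N -> A} := HB.pack g (GRing.isLinear.Build _ _ _ _ g lin_g).
have [|f' hf'] := @projA _ _ gl idfun.
  by move=> a; exists (<< 1 *g a >> : N); rewrite /= /g liftU scale1r.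
exists (fun c a => coeff c (f' a)); split.
- by move=> c u v; rewrite linearD coeffD.
- by move=> c r a; rewrite linearZ coeffZ.
move=> a; exists (dom (f' a)); split.
- exact: uniq_dom.
- by move=> c; exact: coeff_outdom.
by rewrite -[LHS]/(idfun a) -hf'; exact: gE.
Qed.

(* The classical fact that a projective separable algebra is finitely generated:
   only the finitely many dual basis elements seen by the idempotent matter. *)
Lemma azumaya_fsep : exists m, inhabited (fsep_alg (fun r : R => r%:A : A) m).
Proof.
have [n [x [y [xy sepE]]]] := separable_elements.
have [phi [phiD phiZ phiS]] := projective_dual_basis.
have /choice [s sP] := phiS.
pose I := undup (flatten [seq s (x j) | j : 'I_n]).
have phi_sum c (J : Type) (r : seq J) (F : J -> A) :
    phi c (\sum_(j <- r) F j) = \sum_(j <- r) phi c (F j).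
  apply: (big_morph (phi c) (phiD c)).
  by apply: (addrI (phi c 0)); rewrite -phiD !addr0.
(* Moving $a$ to the other tensor factor shows that the left side vanishes as soon as [phi c] kills
   all [x j], that is for $c$ outside [I], whatever $a$ is. *)
have key c a : \sum_j phi c (a * x j) *: y j = \sum_j phi c (x j) *: (y j * a).
  apply: (sepE A (fun u v => phi c u *: v)); split=> [m m' p|m p p'|r m p].
  - by rewrite phiD scalerDl.
  - by rewrite scalerDr.
  - by rewrite phiZ scalerA mulrC.
have aE a : a = \sum_(c <- I) c * \sum_j phi c (a * x j) *: y j.
  pose T := undup (I ++ flatten [seq s (a * x j) | j : 'I_n]).
  have -> : \sum_(c <- I) c * \sum_j phi c (a * x j) *: y j =
            \sum_(c <- T) c * \sum_j phi c (a * x j) *: y j.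
    rewrite [RHS](bigID (mem I)) /= [X in _ + X]big1 ?addr0; last first.
      move=> c nc; rewrite key big1 ?mulr0 // => j _.
      have [_ h _] := sP (x j); rewrite h ?scale0r //.
      apply: contra nc; rewrite mem_undup => cs; apply/flattenP.
      by exists (s (x j)) => //; apply: map_f; rewrite mem_enum.
    rewrite -[RHS]big_filter; apply: perm_big; apply: uniq_perm.
    - exact: undup_uniq.
    - by rewrite filter_uniq // undup_uniq.
    move=> c; rewrite mem_filter [c \in T]mem_undup mem_cat.
    by case: (c \in I).
  rewrite -{1}[a]mulr1 -xy mulr_sumr.
  under [RHS]eq_bigr do rewrite mulr_sumr.
  rewrite exchange_big; apply: eq_bigr => j _ /=; rewrite mulrA.
  have [us h e] := sP (a * x j).
  rewrite {1}e mulr_suml.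
  have -> : \sum_(c <- T) c * (phi c (a * x j) *: y j) =
      \sum_(c <- T | c \in s (a * x j)) c * (phi c (a * x j) *: y j).
    rewrite [LHS](bigID (mem (s (a * x j)))) /= [X in _ + X]big1 ?addr0 //.
    by move=> c nc; rewrite h // scale0r mulr0.
  rewrite -[RHS]big_filter.
  rewrite (perm_big [seq c <- T | c \in s (a * x j)]); last first.
    apply: uniq_perm => //; first by rewrite filter_uniq // undup_uniq.
    move=> c; rewrite mem_filter mem_undup mem_cat.
    case: (boolP (c \in s _)) => //= cs; symmetry; apply/orP; right.
    by apply/flattenP; exists (s (a * x j)) => //; apply: map_f; rewrite mem_enum.
  by apply: eq_bigr => c _; rewrite -scalerAl -scalerAr.
pose mI := size I; pose J := ('I_mI * 'I_n)%type.
pose gen (p : J) := tnth (in_tuple I) p.1 * y p.2.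
pose crd (p : J) a := phi (tnth (in_tuple I) p.1) (a * x p.2).
exists #|{: J}|; constructor.
apply: (@FSepAlg R A _ _ _ _ _ _ (fun i => gen (enum_val i))
  (fun i => crd (enum_val i)) _ _ _ n x y xy).
- by move=> r r'; rewrite scalerDl.
- by move=> r r'; rewrite -scalerAl mul1r scalerA.
- by rewrite scale1r.
- by move=> z b; rewrite -scalerAl mul1r -scalerAr mulr1.
- by move=> i u v; rewrite /crd mulrDl phiD.
- by move=> i z b; rewrite /crd -scalerAl mul1r -scalerAl phiZ.
- move=> b; rewrite {1}(aE b) (big_nth 0) big_mkord.
  rewrite -(reindex (@enum_val _ (fun=> true))
     (P := xpredT) (F := fun p : J => (crd p b)%:A * gen p)) /=; last first.
    by exists enum_rank => p _; rewrite ?enum_valK ?enum_rankK.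
  rewrite -(pair_bigA _ (fun i j => (crd (i, j) b)%:A * gen (i, j))) /=.
  apply: eq_bigr => i _; rewrite mulr_sumr; apply: eq_bigr => j _.
  by rewrite /crd /gen /= (tnth_nth 0) -!scalerAl mul1r -scalerAr.
- move=> P f [fDl fDr fZ] b; apply: sepE; split=> // r m p.
  by have := fZ r m p; rewrite -!scalerAl !mul1r.
Qed.

End Azumaya.

(** * Base change of the algebra, its involution and its centre *)

Section BaseChangeTheory.
Variables (R : comNzRingType) (A : algType R) (sigma : {linear A -> A}).
Variables (K : comNzRingType) (rho : {rmorphism R -> K}).
Local Notation B := (bc_alg A rho).
Local Notation tn a z := (tens (a : A) (z : via rho) : B).
Local Notation c := (bc_scalar A rho).

Lemma bc_tensM (a b : A) (y z : K) : tn a y * tn b z = tn (a * b) (y * z).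
Proof. exact: at_mulE. Qed.

Lemma bc_tensDl (a b : A) (z : K) : tn (a + b) z = tn a z + tn b z.
Proof. by case: (balanced_tens A (via rho)). Qed.

Lemma bc_tensDr (a : A) (y z : K) : tn a (y + z) = tn a y + tn a z.
Proof. by case: (balanced_tens A (via rho)). Qed.

Lemma bc_tensZ (r : R) (a : A) (z : K) : tn (r *: a) z = tn a (rho r * z).
Proof. by case: (balanced_tens A (via rho)) => _ _ ->. Qed.

Lemma bc_ind (Q : B -> Prop) :
  Q 0 -> (forall t u, Q t -> Q u -> Q (t + u)) -> (forall a z, Q (tn a z)) ->
  forall t, Q t.
Proof. exact: tens_ind. Qed.

Lemma bc_tensE a z : tn a z = c z * tn a 1.
Proof. by rewrite /bc_scalar bc_tensM mul1r mulr1. Qed.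

Lemma bc_scalarD : {morph c : x y / x + y}.
Proof. by move=> x y; rewrite /bc_scalar bc_tensDr. Qed.
Lemma bc_scalarM : {morph c : x y / x * y}.
Proof. by move=> x y; rewrite /bc_scalar bc_tensM mulr1. Qed.
Lemma bc_scalarC z (t : B) : c z * t = t * c z.
Proof.
elim/bc_ind: t => [|t u IHt IHu|a y]; first by rewrite mulr0 mul0r.
  by rewrite mulrDr IHt IHu mulrDl.
by rewrite /bc_scalar !bc_tensM mulr1 mul1r mulrC.
Qed.

Lemma bc_tens_sum (I : Type) (r : seq I) (F : I -> A) z :
  tn (\sum_(i <- r) F i) z = \sum_(i <- r) tn (F i) z.
Proof. exact: (balanced_suml (balanced_tens A (via rho))). Qed.

Lemma bc_functional (phi : A -> R) :
  {morph phi : u v / u + v} -> (forall r a, phi (r *: a) = r * phi a) ->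
  exists psi : B -> K,
    [/\ {morph psi : u v / u + v}, forall z t, psi (c z * t) = z * psi t &
        forall a z, psi (tn a z) = rho (phi a) * z].
Proof.
move=> phiD phiZ.
have bal : balanced (fun (a : A) (z : via rho) => (rho (phi a) * z : K)).
  split=> [m m' n|m n n'|r m n].
  - by rewrite phiD rmorphD mulrDl.
  - exact: mulrDr.
  - by rewrite phiZ rmorphM -mulrA mulrCA.
pose psi (t : B) : K := tlift (fun (a : A) (z : via rho) => (rho (phi a) * z : K)) t.
have psiD : {morph psi : u v / u + v} by move=> u v; exact: (tliftD bal).
have psiE a z : psi (tn a z) = rho (phi a) * z by exact: (tliftE bal).
have psi0 : psi 0 = 0 by exact: (tlift0 bal).
exists psi; split=> // z t; elim/bc_ind: t => [|t u IHt IHu|a y].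
- by rewrite mulr0 psi0 mulr0.
- by rewrite mulrDr !psiD mulrDr IHt IHu.
- by rewrite /bc_scalar bc_tensM mul1r !psiE mulrCA.
Qed.

Lemma bc_fsep m (F : fsep_alg (fun r : R => r%:A : A) m) :
  exists F' : fsep_alg c m,
    (forall i, fin_gen F' i = tn (fin_gen F i) 1) /\
    (forall i a z, fin_coord F' i (tn a z) = rho (fin_coord F i a) * z).
Proof.
have /choice [psi psiP] : forall i : 'I_m, exists psi : B -> K,
    [/\ {morph psi : u v / u + v}, forall z t, psi (c z * t) = z * psi t &
        forall a z, psi (tn a z) = rho (fin_coord F i a) * z].
  move=> i; apply: bc_functional; first exact: fin_coordD.
  by move=> r a; rewrite -(fin_coordZ F) -scalerAl mul1r.
have crdK (b : B) : b = \sum_i c (psi i b) * tn (fin_gen F i) 1.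
  elim/bc_ind: b => [|t u IHt IHu|a z].
  - rewrite big1 // => i _; have [psiD _ _] := psiP i.
    have -> : psi i 0 = 0 by apply: (addrI (psi i 0)); rewrite -psiD !addr0.
    rewrite (_ : c 0 = 0) ?mul0r //.
    by apply: (addrI (c 0)); rewrite -bc_scalarD !addr0.
  - rewrite {1}IHt {1}IHu -big_split; apply: eq_bigr => i _ /=.
    by have [-> _ _] := psiP i; rewrite bc_scalarD mulrDl.
  - rewrite {1}(fin_coordK F a) bc_tens_sum; apply: eq_bigr => i _.
    have [_ _ ->] := psiP i; rewrite /bc_scalar bc_tensM mul1r mulr1.
    by rewrite -scalerAl mul1r bc_tensZ.
have sepK (P : zmodType) (f : B -> B -> P) : bilinear_over c f -> forall b,
    \sum_i f (b * tn (sep_l F i) 1) (tn (sep_r F i) 1) =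
    \sum_i f (tn (sep_l F i) 1) (tn (sep_r F i) 1 * b).
  case=> fDl fDr fZ.
  have f0l v : f 0 v = 0 by apply: (addrI (f 0 v)); rewrite -fDl !addr0.
  have f0r v : f v 0 = 0 by apply: (addrI (f v 0)); rewrite -fDr !addr0.
  elim/bc_ind => [|t u IHt IHu|a z].
  - rewrite !big1 // => i _; first by rewrite mulr0.
    by rewrite mul0r.
  - transitivity (\sum_i f (t * tn (sep_l F i) 1) (tn (sep_r F i) 1) +
                  \sum_i f (u * tn (sep_l F i) 1) (tn (sep_r F i) 1)).
      by rewrite -big_split; apply: eq_bigr => i _; rewrite mulrDl fDl.
    rewrite IHt IHu -big_split; apply: eq_bigr => i _ /=.
    by rewrite mulrDr fDr.
  (* The scalar [z] is kept in the left factor while the rule over $R$ moves [a]; bilinearity over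
     the new scalars then carries it to the right. *)
  have := @sepP _ _ _ _ F P (fun u v => f (tn u z) (tn v 1)) _ a.
  move=> h; transitivity (\sum_i f (tn (a * sep_l F i) z) (tn (sep_r F i) 1)).
    by apply: eq_bigr => i _; rewrite bc_tensM mulr1.
  rewrite h.
    apply: eq_bigr => i _; rewrite bc_tensM mul1r bc_tensE fZ.
    by rewrite /bc_scalar bc_tensM mul1r mulr1.
  split=> [u u' v|u v v'|r u v].
  - by rewrite bc_tensDl fDl.
  - by rewrite bc_tensDl fDr.
  rewrite -!scalerAl !mul1r !bc_tensZ mulr1 [tn u _]bc_tensE.
  by rewrite bc_scalarM -mulrA fZ -!bc_tensE.
have lrK : \sum_i tn (sep_l F i) 1 * tn (sep_r F i) 1 = (1 : B).
  under eq_bigr do rewrite bc_tensM mulr1.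
  by rewrite -bc_tens_sum sep_lr.
pose F' := @FSepAlg K B c m bc_scalarD bc_scalarM erefl bc_scalarC
  (fun i => tn (fin_gen F i) 1) psi
  (fun i => let: And3 h _ _ := psiP i in h)
  (fun i => let: And3 _ h _ := psiP i in h) crdK
  (sep_num F) (fun i => tn (sep_l F i) 1) (fun i => tn (sep_r F i) 1) lrK sepK.
exists F'; split=> // i a z.
by rewrite /=; have [_ _ ->] := psiP i.
Qed.

Section Involution.
Variables (m0 : nat).
Variable F : fsep_alg (fun r : R => r%:A : A) m0.
Hypothesis invS : is_involution sigma.
Hypothesis scal_inj : injective (fun r : R => r%:A : A).
Hypothesis sym_center : forall z : A,
  (exists r : R, z = r%:A) <-> ((forall a, z * a = a * z) /\ sigma z = z).
Hypothesis two_unit : exists t : R, 2%:R * t = 1.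
Local Notation inv := (bc_inv sigma (rho := rho)).

Let inv_bal : balanced (fun a (x : via rho) => tens (sigma a) x : B).
Proof.
split=> [a b z|a y z|r a z].
- by rewrite linearD bc_tensDl.
- by rewrite bc_tensDr.
- by rewrite linearZ bc_tensZ.
Qed.

Lemma bc_invE a z : inv (tn a z) = tn (sigma a) z.
Proof. exact: (tliftE inv_bal). Qed.
Lemma bc_invD : {morph inv : x y / x + y}.
Proof. by move=> t u; exact: (tliftD inv_bal). Qed.
Lemma bc_inv0 : inv 0 = 0.
Proof. exact: (tlift0 inv_bal). Qed.
Lemma bc_invM t u : inv (t * u) = inv u * inv t.
Proof.
elim/bc_ind: t => [|t t' IHt IHt'|a y].
- by rewrite mul0r bc_inv0 mulr0.
- by rewrite mulrDl !bc_invD IHt IHt' mulrDr.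
elim/bc_ind: u => [|u u' IHu IHu'|b z].
- by rewrite mulr0 bc_inv0 mul0r.
- by rewrite mulrDr !bc_invD IHu IHu' mulrDl.
by rewrite bc_tensM !bc_invE bc_tensM (proj1 invS) mulrC.
Qed.
Lemma bc_invK : involutive inv.
Proof.
elim/bc_ind => [|t t' IHt IHt'|a y]; first by rewrite !bc_inv0.
  by rewrite !bc_invD IHt IHt'.
by rewrite !bc_invE (proj2 invS).
Qed.
Lemma sigma1 : sigma 1 = 1.
Proof. by rewrite -[RHS](proj2 invS) -[sigma 1 in RHS]mulr1 (proj1 invS) (proj2 invS) mulr1. Qed.
Lemma bc_inv_scalar z : inv (c z) = c z.
Proof. by rewrite bc_invE sigma1. Qed.

(** Averaging against the separability idempotent, which projects $A$ onto its centre. *)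
Definition sep_mean (a : A) : A := \sum_i sep_l F i * a * sep_r F i.

Local Notation p := sep_mean.

Lemma sep_mean_central a b : p a * b = b * p a.
Proof.
rewrite /sep_mean mulr_suml mulr_sumr.
transitivity (\sum_i sep_l F i * a * (sep_r F i * b)).
  by apply: eq_bigr => i _; rewrite !mulrA.
rewrite -(@sepP _ _ _ _ F A (fun u v => u * a * v)).
  by apply: eq_bigr => i _; rewrite !mulrA.
split=> [u u' v|u v v'|r u v]; first by rewrite !mulrDl.
  by rewrite mulrDr.
by rewrite -!scalerAl !mul1r -scalerAr.
Qed.

Lemma sigma_central z : (forall a, z * a = a * z) -> forall a, sigma z * a = a * sigma z.
Proof.
by move=> h a; rewrite -[a](proj2 invS) -!(proj1 invS) h.
Qed.

(** Project onto the centre and take the symmetric half: the result lies in the symmetric centre,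
    which is $R$. Being a retraction of $R \to A$, it keeps scalars injective after base change. *)
Lemma sep_retraction : exists eps : A -> R,
  [/\ {morph eps : u v / u + v}, forall r a, eps (r *: a) = r * eps a & eps 1 = 1].
Proof.
have [t ht] := two_unit.
have /choice [eps epsP] : forall a, exists r : R, t *: (p a + sigma (p a)) = r%:A.
  move=> a; apply/sym_center; split=> [b|].
    rewrite -scalerAl -scalerAr mulrDl mulrDr sep_mean_central.
    by rewrite (sigma_central (sep_mean_central a)).
  by rewrite linearZ [sigma (_ + _)]linearD (proj2 invS) addrC.
have pD u v : p (u + v) = p u + p v.
  by rewrite /sep_mean -big_split; apply: eq_bigr => i _; rewrite mulrDr mulrDl.
have pZ r a : p (r *: a) = r *: p a.
  by rewrite /sep_mean scaler_sumr; apply: eq_bigr => i _; rewrite -scalerAr -scalerAl.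
exists eps; split.
- move=> u v; apply: scal_inj; rewrite -epsP pD [sigma _]linearD addrACA scalerDr !epsP.
  by rewrite scalerDl.
- move=> r a; apply: scal_inj; rewrite -epsP pZ [sigma _]linearZ -scalerDr scalerA mulrC.
  by rewrite -scalerA epsP scalerA.
apply: scal_inj; rewrite -epsP (_ : p 1 = 1).
  by rewrite sigma1 -mulr2n -scaler_nat scalerA mulrC ht.
by rewrite -[RHS](sep_lr F) /p; apply: eq_bigr => i _; rewrite mulr1.
Qed.

Lemma bc_scalar_inj : injective c.
Proof.
have [eps [epsD epsZ eps1]] := sep_retraction.
have [psi [_ _ psiE]] := bc_functional epsD epsZ.
by move=> x y /(congr1 psi); rewrite !psiE eps1 rmorph1 !mul1r.
Qed.

Lemma bc_sep_mean z : (forall t, z * t = t * z) ->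
  z = \sum_i tn (sep_l F i) 1 * z * tn (sep_r F i) 1.
Proof.
move=> zC; under eq_bigr do rewrite -zC -mulrA bc_tensM mulr1.
by rewrite -mulr_sumr -bc_tens_sum sep_lr mulr1.
Qed.

Lemma bc_sep_mean_tens a y :
  \sum_i tn (sep_l F i) 1 * tn a y * tn (sep_r F i) 1 = tn (sep_mean a) y.
Proof.
rewrite /sep_mean bc_tens_sum; apply: eq_bigr => i _.
by rewrite !bc_tensM mul1r mulr1.
Qed.

(** The symmetrized projection onto the centre sends every pure tensor to a scalar, and it fixes
    symmetric central elements. *)
Lemma bc_sym_center z :
  (forall t, z * t = t * z) -> inv z = z -> exists x, z = c x.
Proof.
move=> zC zS; have [t ht] := two_unit.
pose q (u : B) : B := \sum_i tn (sep_l F i) 1 * u * tn (sep_r F i) 1.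
have qz : q z = z by rewrite /q -bc_sep_mean.
have qtn a y : q (tn a y) = tn (p a) y := bc_sep_mean_tens a y.
have qD u v : q (u + v) = q u + q v.
  by rewrite /q -big_split; apply: eq_bigr => i _; rewrite mulrDr mulrDl.
have tE : rho t * 2%:R = 1.
  by rewrite -(rmorph_nat rho 2) -rmorphM mulrC ht rmorph1.
have main u : exists x, c (rho t) * (q u + inv (q u)) = c x.
  elim/bc_ind: u => [|u v [x xE] [y yE]|a y].
  - exists 0; rewrite /q big1 => [|i _]; last by rewrite mulr0 mul0r.
    rewrite bc_inv0 addr0 mulr0; apply: (addrI (c 0)).
    by rewrite -bc_scalarD !addr0.
  - exists (x + y); rewrite qD bc_invD addrACA mulrDr xE yE.
    by rewrite bc_scalarD.
  rewrite qtn bc_invE -bc_tensDl.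
  have [r rE] : exists r : R, p a + sigma (p a) = r%:A.
    apply/sym_center; split=> [b|].
      by rewrite mulrDl mulrDr sep_mean_central (sigma_central (sep_mean_central a)).
    by rewrite linearD (proj2 invS) addrC.
  exists (rho t * (rho r * y)); rewrite rE bc_tensZ.
  by rewrite /bc_scalar bc_tensM mul1r.
have [x xE] := main z; exists x; rewrite -xE qz zS -mulr2n -mulr_natr.
have -> : (2%:R : B) = c 2%:R.
  by rewrite !mulr2n bc_scalarD.
by rewrite -bc_scalarC mulrA -bc_scalarM tE mul1r.
Qed.

End Involution.
End BaseChangeTheory.

(** * Structure of separable algebras over a real closed field *)

Section VonNeumann.
Variables (k : fieldType) (B : nzRingType) (c : k -> B) (m : nat).
Variable F : fsep_alg c m.

Lemma fsep_scal0 : c 0 = 0.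
Proof. by apply: (addrI (c 0)); rewrite -(scalD F) !addr0. Qed.
Lemma fsep_scalN a : c (- a) = - c a.
Proof. by apply: (addrI (c a)); rewrite -(scalD F) !subrr fsep_scal0. Qed.
Lemma fin_coord_sum i (I : Type) (r : seq I) (G : I -> B) :
  fin_coord F i (\sum_(j <- r) G j) = \sum_(j <- r) fin_coord F i (G j).
Proof.
apply: (big_morph (fin_coord F i) (fin_coordD F i)).
by apply: (addrI (fin_coord F i 0)); rewrite -(fin_coordD F) !addr0.
Qed.
Lemma fin_coord_inj u v : (forall i, fin_coord F i u = fin_coord F i v) -> u = v.
Proof.
move=> e; rewrite (fin_coordK F u) (fin_coordK F v).
by apply: eq_bigr => i _; rewrite e.
Qed.

(* A k-linear pseudo-inverse of left multiplication by x, averaged over the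
   separability idempotent, is right B-linear. *)
Lemma von_neumann_regular (x : B) : exists y, x * y * x = x.
Proof.
pose crd (b : B) : 'rV[k]_m := \row_i fin_coord F i b.
pose vec (v : 'rV[k]_m) : B := \sum_i c (v 0 i) * fin_gen F i.
have crdK b : vec (crd b) = b.
  by rewrite [RHS](fin_coordK F); apply: eq_bigr => i _; rewrite mxE.
pose L : 'M[k]_m := \matrix_(i, j) fin_coord F j (x * fin_gen F i).
have crdL v : crd (x * vec v) = v *m L.
  apply/rowP => j; rewrite !mxE mulr_sumr fin_coord_sum; apply: eq_bigr => i _.
  by rewrite mulrA -(scalC F) -mulrA (fin_coordZ F) mxE.
pose g b := vec (crd b *m pinvmx L).
have xg b : x * g (x * b) = x * b.
  have : crd (x * g (x * b)) = crd (x * b).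
    rewrite crdL mulmxKpV // -{1}[b]crdK crdL; exact: submxMl.
  by move/(congr1 vec); rewrite !crdK.
have gD u v : g (u + v) = g u + g v.
  rewrite /g -[crd (u + v)]/(crd (u + v)).
  have -> : crd (u + v) = crd u + crd v.
    by apply/rowP => i; rewrite !mxE (fin_coordD F).
  rewrite mulmxDl /vec -big_split; apply: eq_bigr => i _ /=.
  by rewrite mxE (scalD F) mulrDl.
have gZ a u : g (c a * u) = c a * g u.
  rewrite /g.
  have -> : crd (c a * u) = a *: crd u.
    by apply/rowP => i; rewrite !mxE (fin_coordZ F).
  rewrite -scalemxAl /vec mulr_sumr; apply: eq_bigr => i _.
  by rewrite mxE (scalM F) mulrA.
pose g' b := \sum_j g (b * sep_l F j) * sep_r F j.
have g'M b : g' b = g' 1 * b.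
  rewrite /g' mulr_suml.
  have h := @sepP _ _ _ _ F B (fun u v => g u * v) _ b.
  under [RHS]eq_bigr do rewrite mul1r -mulrA.
  apply: h; split=> [u u' v|u v v'|a u v].
  - by rewrite gD mulrDl.
  - by rewrite mulrDr.
  - by rewrite gZ (scalC F a (g u)) -mulrA.
exists (g' 1); rewrite -mulrA -g'M /g' mulr_sumr.
under eq_bigr do rewrite mulrA xg -mulrA.
by rewrite -mulr_sumr (sep_lr F) mulr1.
Qed.

Definition orth_family (I : finType) (e : I -> B) : Prop :=
  [/\ forall i, e i != 0, forall i j, e i * e j = if i == j then e i else 0 &
      \sum_i e i = 1].

(** Nonzero orthogonal idempotents are linearly independent, while elements of $B$ are determined by
    $m$ coordinates. *)
Lemma orth_family_card (I : finType) (e : I -> B) :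
  orth_family e -> (#|I| <= m)%N.
Proof.
move=> [e0 ee _]; rewrite leqNgt; apply/negP => lt.
have [|a [[i ai] ha]] := @exists_left_kernel k I 'I_m (fun i j => fin_coord F j (e i)).
  by rewrite card_ord.
have s0 : \sum_i c (a i) * e i = 0.
  apply: fin_coord_inj => j; rewrite fin_coord_sum.
  have -> : fin_coord F j 0 = 0.
    by apply: (addrI (fin_coord F j 0)); rewrite -(fin_coordD F) !addr0.
  by rewrite -[RHS](ha j); apply: eq_bigr => l _; rewrite (fin_coordZ F).
have : c (a i) * e i = 0.
  rewrite -[RHS](mul0r (e i)) -s0 mulr_suml (bigD1 i) //= -mulrA ee eqxx.
  rewrite big1 ?addr0 // => j nj; rewrite -mulrA ee (negbTE nj) mulr0 //.
move/(congr1 (fun b => c (a i)^-1 * b)).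
rewrite mulrA -(scalM F) mulVf // (scal1 F) mul1r mulr0 => /eqP.
by rewrite (negbTE (e0 i)).
Qed.

Definition corner (e f x : B) : Prop := e * x = x /\ x * f = x.

(* A family of orthogonal idempotents of maximal length is made of primitive ones. *)
Lemma primitive_family : exists (I : finType) (e : I -> B), orth_family e /\
  forall i x, corner (e i) (e i) x -> x != 0 ->
    exists y, [/\ corner (e i) (e i) y, x * y = e i & y * x = e i].
Proof.
pose P n := `[< exists (I : finType) (e : I -> B), orth_family e /\ #|I| = n >].
have exP : exists n, P n.
  exists 1%N; apply/asboolP; exists unit, (fun=> 1); split; last exact: card_unit.
  split=> [_||]; first exact: oner_neq0.
    by move=> [] [] /=; rewrite mulr1.
  by rewrite (big_pred1 tt) // => -[].
have boundP n : P n -> (n <= m)%N.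
  by move=> /asboolP [I [e [/orth_family_card + <-]]].
case: (ex_maxnP exP boundP) => n /asboolP [I [e [fe cI]]] maxn.
have [e0 ee e1] := fe.
have right i x : corner (e i) (e i) x -> x != 0 ->
    exists y, corner (e i) (e i) y /\ x * y = e i.
  move=> [ex xe] nx; have [y yP] := von_neumann_regular x.
  (* An idempotent below [e i]. If it differed from [e i], splitting [e i] into [g] and [e i - g]
     would give a longer family. *)
  pose g := x * y * e i.
  have eg : e i * g = g by rewrite /g !mulrA ex.
  have ge : g * e i = g by rewrite /g -mulrA ee eqxx.
  have gx : g * x = x by rewrite /g -mulrA ex yP.
  have gg : g * g = g by rewrite {2}/g !mulrA gx.
  have ng : g != 0 by apply: contraNneq nx => g0; rewrite -gx g0 mul0r.
  have [g_e|nge] := eqVneq g (e i).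
    exists (e i * y * e i); split; last by rewrite !mulrA xe; exact: g_e.
    by split; rewrite ?mulrA ?ee ?eqxx // -!mulrA ee eqxx.
  pose e' (o : option I) := if o is Some j then (if j == i then g else e j) else e i - g.
  have gej j : j != i -> g * e j = 0.
    by move=> nj; rewrite -ge -mulrA ee eq_sym (negbTE nj) mulr0.
  have ejg j : j != i -> e j * g = 0.
    by move=> nj; rewrite -eg mulrA ee (negbTE nj) mul0r.
  suff /maxn : P n.+1 by rewrite ltnn.
  apply/asboolP; exists (option I), e'; split; last by rewrite card_option cI.
  split.
  - move=> [j|] /=; last by rewrite subr_eq0 eq_sym.
    by case: ifP => _ //; exact: e0.
  - move=> [j|] [l|] /=.
    + rewrite (inj_eq Some_inj); case: (eqVneq j i) => [->|nj].
        by rewrite eq_sym; case: (eqVneq l i) => [_|nl] //; exact: gej.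
      case: (eqVneq l i) => [->|nl]; first by rewrite (negbTE nj) ejg.
      exact: ee.
    + case: (eqVneq j i) => [_|nj]; rewrite mulrBr; first by rewrite ge gg subrr.
      by rewrite ee ejg // (negbTE nj) subrr.
    + case: (eqVneq l i) => [_|nl]; rewrite mulrBl; first by rewrite eg gg subrr.
      by rewrite ee gej // eq_sym (negbTE nl) subrr.
    + by rewrite mulrBl !mulrBr ee eqxx eg ge gg subrr subr0.
  rewrite (bigD1 None) //= (reindex_omap Some id) /=; last by case.
  rewrite (eq_bigl xpredT) => [|j]; last by rewrite /= eqxx.
  rewrite -e1 [RHS](bigD1 i) //= [X in _ + X](bigD1 i) //= eqxx.
  rewrite addrA subrK; congr (_ + _); apply: eq_bigr => j nj.
  by rewrite (negbTE nj).
exists I, e; split => // i x cx nx.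
have [y [cy xy]] := right i x cx nx.
have ny : y != 0 by apply: contraNneq (e0 i) => y0; rewrite -xy y0 mulr0.
have [z [cz yz]] := right i y cy ny.
exists y; split => //.
have [ez _] := cz; have [_ xe] := cx.
have <- : z = x by rewrite -ez -xy -mulrA yz xe.
by [].
Qed.

(** Data identifying the factor [cc * B] with matrices over the division ring $eBe$: the products
    [V p * U q] are the matrix units. *)
Record block (cc e : B) (n : nat) (U V : 'I_n.+1 -> B) : Prop := Block {
  block_central : forall b, cc * b = b * cc;
  block_idem : cc * cc = cc;
  block_e0 : e != 0;
  block_ee : e * e = e;
  block_div : forall x, corner e e x -> x != 0 ->
    exists y, [/\ corner e e y, x * y = e & y * x = e];
  block_eU : forall p, e * U p = U p;
  block_Ve : forall p, V p * e = V p;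
  block_UV : forall p q, U p * V q = if p == q then e else 0;
  block_VU : \sum_p V p * U p = cc
}.

(** Call primitive idempotents linked when $e_iBe_j \neq 0$. Linking is an equivalence relation, and
    the sum over one class is central because no nonzero element joins different classes. *)
Lemma exists_block : exists cc e n U V, @block cc e n U V.
Proof.
have [I [e [[e0 ee e1] dv]]] := primitive_family.
have [i0 _] : exists i : I, true.
  apply: contrapT => nI; have := oner_neq0 B; rewrite -e1 big1 ?eqxx // => i _.
  by case: nI; exists i.
pose lk i j := `[< exists u, corner (e i) (e j) u /\ u != 0 >].
(* If $uyu = u$ with $u \neq 0$ in $e_iBe_j$, then $v = e_jye_i$ makes $uv$ and $vu$ nonzero
   idempotents of the division rings $e_iBe_i$ and $e_jBe_j$, hence their units. *)
have lkP i j : lk i j -> exists u v, [/\ corner (e i) (e j) u,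
    corner (e j) (e i) v, u * v = e i & v * u = e j].
  move=> /asboolP [u [[eu ue] nu]].
  have [y yP] := von_neumann_regular u.
  have [v defv] : exists v, v = e j * y * e i by exists (e j * y * e i).
  have cv : corner (e j) (e i) v.
    by split; rewrite defv ?mulrA ?ee ?eqxx // -!mulrA ee eqxx.
  have [ev ve] := cv.
  have uvu : u * v * u = u by rewrite defv !mulrA ue -(mulrA _ (e i)) eu yP.
  have idem l w : corner (e l) (e l) w -> w * w = w -> w != 0 -> w = e l.
    move=> cw ww nw; have [z [_ wz _]] := dv l w cw nw.
    by have [_ we] := cw; rewrite -we -wz mulrA ww.
  have uv : u * v = e i.
    apply: idem.
    - by split; rewrite ?mulrA ?eu // -mulrA ve.
    - by rewrite !mulrA uvu.
    - by apply: contraNneq nu => h; rewrite -uvu h mul0r.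
  have vu : v * u = e j.
    apply: idem.
    - by split; rewrite ?mulrA ?ev // -mulrA ue.
    - by rewrite -mulrA (mulrA u) uvu.
    - by apply: contraNneq nu => h; rewrite -uvu -mulrA h mulr0.
  by exists u, v.
have lk_corner i j u : corner (e i) (e j) u -> ~~ lk i j -> u = 0.
  move=> cu nl; apply/eqP; apply: contraNT nl => nu.
  by apply/asboolP; exists u.
have lk_sym i j : lk i j -> lk j i.
  move=> /lkP [u [v [cu cv uv vu]]]; apply/asboolP; exists v; split=> //.
  by apply: contraNneq (e0 i) => v0; rewrite -uv v0 mulr0.
have lk_trans i j l : lk i j -> lk j l -> lk i l.
  move=> /lkP [u [v [[eu ue] cv uv vu]]] /asboolP [w [[ew we] nw]].
  apply/asboolP; exists (u * w); split.
    by split; rewrite ?mulrA ?eu // -mulrA we.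
  by apply: contraNneq nw => h; rewrite -ew -vu -mulrA h mulr0.
have lk0 : lk i0 i0.
  by apply/asboolP; exists (e i0); split; [split; rewrite ee eqxx|exact: e0].
pose cc := \sum_(i | lk i0 i) e i.
have bE b : b = \sum_i \sum_j e i * b * e j.
  under eq_bigr do rewrite -mulr_sumr e1 mulr1.
  by rewrite -mulr_suml e1 mul1r.
have ccC b : cc * b = b * cc.
  rewrite /cc mulr_suml mulr_sumr.
  transitivity (\sum_(i | lk i0 i) \sum_(j | lk i0 j) e i * b * e j).
    apply: eq_bigr => i li; rewrite -{1}[b]mulr1 -e1 !mulr_sumr.
    rewrite (bigID (lk i0)) /= [X in _ + X]big1 ?addr0; last first.
      move=> j nj; rewrite mulrA; apply: (@lk_corner i j).
        by split; rewrite ?mulrA ?ee ?eqxx // -!mulrA ee eqxx.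
      by apply: contra nj; exact: lk_trans.
    by apply: eq_bigr => j _; rewrite mulrA.
  rewrite exchange_big; apply: eq_bigr => j lj /=.
  rewrite -{2}[b]mul1r -e1 !mulr_suml.
  rewrite [RHS](bigID (lk i0)) /= [X in _ + X]big1 ?addr0 // => i ni.
  apply: (@lk_corner i j).
    by split; rewrite ?mulrA ?ee ?eqxx // -!mulrA ee eqxx.
  by apply: contra ni => lij; apply: lk_trans lj (lk_sym _ _ lij).
have ccidem : cc * cc = cc.
  rewrite {1}/cc mulr_suml; apply: eq_bigr => i li.
  rewrite /cc mulr_sumr (bigD1 i) //= ee eqxx big1 ?addr0 // => j /andP [_ nj].
  by rewrite ee eq_sym (negbTE nj).
pose s := enum [pred i | lk i0 i].
have s0 : (0 < size s)%N.
  by rewrite -cardE; apply/card_gt0P; exists i0.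
pose n := (size s).-1; have ns : n.+1 = size s by rewrite prednK.
pose t (p : 'I_n.+1) := nth i0 s p.
have tl p : lk i0 (t p).
  have : t p \in s by apply: mem_nth; rewrite -ns.
  by rewrite mem_enum.
have tinj p q : (t p == t q) = (p == q).
  by rewrite /t nth_uniq ?enum_uniq // -ns.
have /choice [U /choice [V UV]] : forall p : 'I_n.+1, exists u v,
   [/\ corner (e i0) (e (t p)) u, corner (e (t p)) (e i0) v,
       u * v = e i0 & v * u = e (t p)].
  by move=> p; exact: lkP.
exists cc, (e i0), n, U, V; split=> //.
- by rewrite ee eqxx.
- exact: dv.
- by move=> p; have [[]] := UV p.
- by move=> p; have [_ []] := UV p.
- move=> p q; case: eqVneq => [<-|npq]; first by have [] := UV p.
  have [[_ <-] _ _ _] := UV p; have [_ [<- _] _ _] := UV q.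
  by rewrite mulrA -(mulrA (U p)) ee tinj (negbTE npq) mulr0 mul0r.
transitivity (\sum_(p < n.+1) e (t p)).
  by apply: eq_bigr => p _; have [] := UV p.
transitivity (\sum_(i <- s) e i); last by rewrite /s big_enum.
rewrite (big_nth i0) big_mkord -ns.
by apply: eq_bigr.
Qed.

End VonNeumann.

(** [Q p] stands for $p$ vanishing at an element of a division algebra. Splitting off real roots and
    pairs of conjugate roots one at a time reaches an irreducible factor that still satisfies
    [Q]. *)
Lemma rcf_factor_ind (k : rcfType) (Q : {poly k} -> Prop) :
  (forall p q : {poly k}, Q (p * q) -> Q p \/ Q q) ->
  (forall a : k, a != 0 -> ~ Q a%:P) ->
  forall p : {poly k}, p != 0 -> Q p ->
  exists a b : k, (b = 0 /\ Q ('X - a%:P)) \/ (b != 0 /\ Q (('X - a%:P) ^+ 2 + (b ^+ 2)%:P)).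
Proof.
move=> QM QC p; have [n] := ubnP (size p); elim: n p => // n IHn p szp np Qp.
have [s1|ns1] := eqVneq (size p) 1%N.
  by move/eqP: s1 => /size_poly1P [a na ep]; case: (QC a na); rewrite -ep.
have /closed_rootP [z rz] : size (map_poly (real_complex k) p) != 1%N by rewrite size_map_poly.
suff [a [b [q [r [epq nr H]]]]] : exists a b : k, exists q r : {poly k},
   [/\ p = q * r, (1 < size r)%N &
     (b = 0 /\ r = 'X - a%:P) \/ (b != 0 /\ r = ('X - a%:P) ^+ 2 + (b ^+ 2)%:P)].
  have nq : q != 0 by apply: contraNneq np => q0; rewrite epq q0 mul0r.
  have nr0 : r != 0 by rewrite -size_poly_gt0 (ltn_trans _ nr).
  move: Qp; rewrite epq => /QM [Qq|Qr].
    apply: (IHn q _ nq Qq); move: szp nr; rewrite epq size_mul //.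
    by move: (size r) => t; move: (size q) => s; clear; case: s => [|s]; lia.
  by exists a, b; case: H => [[b0 er]|[b0 er]]; [left|right]; rewrite -er.
case: z rz => a b; have [b0|nb] := eqVneq b 0.
  rewrite b0 => rz; have ra : root p a.
    by move: rz; rewrite -[Complex a 0]/(real_complex k a) fmorph_root.
  have [q ->] := factor_theorem _ _ ra.
  by exists a, 0, q, ('X - a%:P); rewrite size_XsubC; split=> //; left.
(* This quadratic divides $p$: the remainder has degree at most $1$ and real coefficients, and it
   vanishes at the non-real root. *)
move=> rz; pose r := ('X - a%:P) ^+ 2 + (b ^+ 2)%:P.
have szr : size r = 3%N.
  rewrite /r size_polyDl ?size_exp_XsubC //.
  by rewrite (leq_ltn_trans (size_polyC_leq1 _)).
exists a, b, (divp p r), r; rewrite szr; split=> //; last by right.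
suff r0 : modp p r = 0 by rewrite {1}(divp_eq p r) r0 addr0.
have szm : (size (modp p r) <= 2)%N.
  by rewrite -ltnS -szr ltn_modp -size_poly_gt0 szr.
have : root (map_poly (real_complex k) (modp p r)) (Complex a b).
  have rr : root (map_poly (real_complex k) r) (Complex a b).
    rewrite /r rmorphD rmorphXn rmorphB /= map_polyX !map_polyC /root.
    rewrite !hornerE /=; apply/eqP/eqP; rewrite eq_complex /=.
    by apply/andP; split; apply/eqP; ring.
  move: rz; rewrite {1}(divp_eq p r) rmorphD rmorphM /root hornerD hornerM.
  by rewrite (eqP rr) mulr0 add0r.
rewrite /root; have -> : modp p r = ((modp p r)`_0)%:P + ((modp p r)`_1)%:P * 'X.
  apply/polyP => i; rewrite coefD coefC coefCM coefX.
  case: i => [|[|i]] /=; rewrite ?mulr1 ?mulr0 ?add0r ?addr0 //.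
  by rewrite nth_default // (leq_trans szm).
set u := _`_0; set v := _`_1.
rewrite rmorphD rmorphM /= map_polyX !map_polyC /= !hornerE /=.
rewrite eq_complex /= => /andP [/eqP h1 /eqP h2].
have v0 : v = 0.
  by apply: (mulIf nb); rewrite mul0r; move: h2; rewrite ?add0r ?mul0r ?addr0.
have u0 : u = 0 by move: h1; rewrite v0 !mul0r subr0 addr0.
by rewrite u0 v0 mul0r addr0.
Qed.

(** * Frobenius' theorem in the corner of a primitive idempotent *)

Section Frobenius.
Variables (k : rcfType) (B : nzRingType) (c : k -> B) (m : nat).
Variable F : fsep_alg c m.
Variable e : B.
Hypothesis e0 : e != 0.
Hypothesis ee : e * e = e.
Hypothesis dv : forall x, corner e e x -> x != 0 ->
    exists y, [/\ corner e e y, x * y = e & y * x = e].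
Local Notation D := (corner e e).

Let cD := scalD F. Let cM := scalM F. Let c1 := scal1 F. Let cC := scalC F.
Let c0 := fsep_scal0 F. Let cN := fsep_scalN F.

Let De : D e. Proof. by split; rewrite ee. Qed.
Let DD x y : D x -> D y -> D (x + y).
Proof. by move=> [h1 h2] [h3 h4]; split; rewrite ?mulrDr ?mulrDl ?h1 ?h2 ?h3 ?h4. Qed.
Let DN x : D x -> D (- x).
Proof. by move=> [h1 h2]; split; rewrite ?mulrN ?mulNr ?h1 ?h2. Qed.
Let DM x y : D x -> D y -> D (x * y).
Proof. by move=> [h1 h2] [h3 h4]; split; rewrite ?mulrA ?h1 // -mulrA h4. Qed.
Let DZ a x : D x -> D (c a * x).
Proof. by move=> [h1 h2]; split; rewrite ?mulrA -?cC -mulrA ?h1 ?h2. Qed.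
Let D_int x y : D x -> D y -> x * y = 0 -> x = 0 \/ y = 0.
Proof.
move=> dx dy xy; have [->|nx] := eqVneq x 0; first by left.
right; have [z [_ _ zx]] := dv dx nx.
by have [<- _] := dy; rewrite -zx -mulrA xy mulr0.
Qed.
Let cI a b x : x != 0 -> c a * x = c b * x -> a = b.
Proof.
move=> nx h; apply/eqP; rewrite -subr_eq0; apply: contraNT nx => nab.
rewrite -[x]mul1r -c1 -(mulVf nab) cM -mulrA cD cN mulrDl mulNr h subrr.
by rewrite mulr0.
Qed.

(** Each element of the division algebra is a root of some nonzero polynomial over $k$, hence of one
    of degree at most $2$. *)
Lemma corner_quadratic x : D x -> exists a b,
  (x - c a * e) * (x - c a * e) = - (c (b ^+ 2) * e) /\ (b = 0 -> x = c a * e).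
Proof.
move=> dx; have [ex xe] := dx.
pose cm : {rmorphism k -> B} := HB.pack c
  (GRing.isZmodMorphism.Build _ _ c (fun x y => etrans (cD x (- y)) (congr1 (+%R (c x)) (cN y))))
  (GRing.isMonoidMorphism.Build _ _ c (conj c1 cM)).
have cx : commr_rmorph cm x by move=> a; rewrite /GRing.comm /=; exact: esym (cC a x).
pose H : {rmorphism {poly k} -> B} := horner_morph cx.
have HC a : H a%:P = c a by exact: horner_morphC.
have HX : H 'X = x by exact: horner_morphX.
have eH p : e * H p = H p * e.
  elim/poly_ind: p => [|p a IHp]; first by rewrite rmorph0 mulr0 mul0r.
  rewrite rmorphD rmorphM /= HX HC mulrDr mulrDl -cC; congr (_ + _).
  by rewrite mulrA IHp -!mulrA ex xe.
have DH p : D (H p * e).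
  by split; [rewrite mulrA eH -mulrA ee|rewrite -mulrA ee].
pose Q p := H p * e = 0.
(* The $m + 1$ elements $x^a e$ have only $m$ coordinates, so they satisfy a linear relation. *)
have [cf [[i0 ni0] cf0]] : exists cf : 'I_m.+1 -> k, (exists a, cf a != 0) /\
    forall j : 'I_m, \sum_a cf a * fin_coord F j (x ^+ a * e) = 0.
  by apply: exists_left_kernel; rewrite !card_ord.
pose p := \poly_(i < m.+1) cf (inord i).
have np : p != 0.
  apply: contraNneq ni0 => /(congr1 (fun q : {poly k} => q`_i0)).
  by rewrite coef_poly ltn_ord inord_val coef0 => ->.
have Qp : Q p.
  rewrite /Q /p poly_def rmorph_sum mulr_suml.
  apply: (fin_coord_inj (F := F)) => j; rewrite fin_coord_sum.
  have -> : fin_coord F j 0 = 0.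
    by apply: (addrI (fin_coord F j 0)); rewrite -(fin_coordD F) !addr0.
  rewrite -[RHS](cf0 j); apply: eq_bigr => i _.
  rewrite -mul_polyC rmorphM rmorphXn /= HX HC -mulrA (fin_coordZ F).
  by rewrite inord_val.
have [|a na|a [b [[b0]|[nb]]]] := rcf_factor_ind _ _ np Qp.
- move=> q r; rewrite /Q => h; apply: D_int => //.
  by rewrite mulrA -(mulrA (H q)) eH mulrA -(mulrA _ e e) ee -rmorphM.
- rewrite /Q HC => h; have := cI e0 (etrans h (esym (etrans (congr1 ( *%R^~ e) c0) (mul0r e)))).
  by move/eqP; rewrite (negbTE na).
- rewrite /Q rmorphB /= HX HC mulrBl xe => h; have xa := subr0_eq h.
  by exists a, 0; rewrite h mulr0 expr0n c0 mul0r oppr0.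
rewrite /Q rmorphD rmorphXn rmorphB /= HX !HC mulrDl => h.
exists a, b; split=> [|b0]; last by rewrite b0 eqxx in nb.
apply/eqP; rewrite -addr_eq0; apply/eqP; rewrite -[RHS]h; congr (_ + _).
have ze : x - c a * e = (x - c a) * e by rewrite mulrBl xe.
have ez : x - c a * e = e * (x - c a) by rewrite mulrBr ex cC.
by rewrite {1}ze ez mulrA -(mulrA _ e e) ee -mulrA -ez ze mulrA expr2.
Qed.

(* Coordinates of the division algebra e B e in a basis u multiplying like the
   standard one. *)
Definition dmodel d (u : 'I_(ddim d) -> B) (x : dring k d) : B :=
  \sum_a c (dcoef x a) * u a.

Section Model.
Variables (d : dkind) (u : 'I_(ddim d) -> B).
Hypothesis uD : forall a, D (u a).
Hypothesis u1 : dmodel u 1 = e.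
Hypothesis uM : forall a b, u a * u b = dmodel u (@dbase k d a * @dbase k d b).

Lemma dmodelD : {morph dmodel u : x y / x + y}.
Proof.
move=> x y; rewrite /dmodel -big_split; apply: eq_bigr => a _ /=.
by rewrite dcoefD cD mulrDl.
Qed.
Lemma dmodelZ a x : dmodel u (dscalar d a * x) = c a * dmodel u x.
Proof.
rewrite /dmodel mulr_sumr; apply: eq_bigr => b _.
by rewrite dcoefZ cM mulrA.
Qed.
Lemma dmodel0 : dmodel u 0 = 0.
Proof. by apply: (addrI (dmodel u 0)); rewrite -dmodelD !addr0. Qed.
Lemma dmodelM : {morph dmodel u : x y / x * y}.
Proof.
move=> x y; rewrite {1}(dcoefK x) {1}(dcoefK y) mulr_suml.
rewrite (big_morph _ dmodelD dmodel0) [dmodel u x]/dmodel mulr_suml.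
apply: eq_bigr => a _; rewrite mulr_sumr (big_morph _ dmodelD dmodel0).
rewrite [dmodel u y]/dmodel mulr_sumr; apply: eq_bigr => b _.
have -> (s t : k) (v w : dring k d) : dscalar d s * v * (dscalar d t * w) =
    dscalar d s * (dscalar d t * (v * w)).
  by rewrite -mulrA; congr (_ * _); rewrite mulrA -dscalarC mulrA.
rewrite !dmodelZ -uM -!mulrA; congr (_ * _).
by rewrite mulrA cC -mulrA; congr (_ * _); rewrite cC.
Qed.
Lemma dmodel_corner x : D (dmodel u x).
Proof.
rewrite /dmodel; elim/big_ind: _ => [|y z dy dz|a _]; last exact: DZ.
- by split; rewrite ?mul0r ?mulr0.
- exact: DD.
Qed.
Lemma dmodel_inj : injective (dmodel u).
Proof.
move=> x y /eqP; rewrite -subr_eq0 => /eqP h.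
apply/eqP; rewrite -subr_eq0; apply: contraNT e0 => /ddiv [z [zx _]].
rewrite -u1 -zx dmodelM dmodelD.
have -> : dmodel u (- y) = - dmodel u y.
  by apply: (addrI (dmodel u y)); rewrite -dmodelD !subrr dmodel0.
by rewrite h mul0r.
Qed.
End Model.

Theorem frobenius : exists (d : dkind) (iota : dring k d -> B),
  [/\ {morph iota : x y / x + y}, {morph iota : x y / x * y},
      forall a, iota (dscalar d a) = c a * e, injective iota &
      forall x, D x <-> exists y, iota y = x].
Proof.
have fin d (u : 'I_(ddim d) -> B) :
    (forall a, D (u a)) -> dmodel u 1 = e ->
    (forall a b, u a * u b = dmodel u (@dbase k d a * @dbase k d b)) ->
    (forall x, D x -> exists y : dring k d, dmodel u y = x) ->
  exists (d : dkind) (iota : dring k d -> B),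
  [/\ {morph iota : x y / x + y}, {morph iota : x y / x * y},
      forall a, iota (dscalar d a) = c a * e, injective iota &
      forall x, D x <-> exists y, iota y = x].
  move=> uD u1 uM us; exists d, (dmodel u); split.
  - exact: dmodelD.
  - exact: dmodelM.
  - by move=> a; rewrite -[dscalar d a]mulr1 dmodelZ u1.
  - exact: dmodel_inj.
  by move=> x; split=> [/us //|[y <-]]; exact: dmodel_corner.
have simp0 := (mul0r, mul1r, mulr0, mulr1, subr0, addr0, add0r, sub0r).
have cM2 a b x y : (c a * x) * (c b * y) = c (a * b) * (x * y).
  by rewrite cM -!mulrA; congr (_ * _); rewrite !mulrA cC.
have [allc|] := pselect (forall x, D x -> exists a, x = c a * e).
  apply: (fin DReal (fun=> e)) => //.
  - by rewrite /dmodel big_ord1 c1 mul1r.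
  - by move=> a b; rewrite /dmodel big_ord1 /= mulr1 c1 mul1r.
  by move=> x /allc [a ->]; exists a; rewrite /dmodel big_ord1.
move=> /existsNP [x0 /not_implyP [dx0 nx0]].
(* Complete the square of a non-scalar element and divide by $b$. *)
have [i [di ii]] : exists i, D i /\ i * i = - e.
  have [a [b [h hb]]] := corner_quadratic dx0.
  have nb : b != 0 by apply/eqP => /hb xa; apply: nx0; exists a.
  exists (c b^-1 * (x0 - c a * e)); split.
    by apply: DZ; apply: DD => //; apply: DN; exact: DZ.
  rewrite cM2 h mulrN mulrA -cM -invfM -expr2 mulVf ?c1 ?mul1r //.
  by rewrite expf_neq0.
have [ei ie] := di.
(* For $y = x - a$ commuting with $i$ and $y^2 = -b^2$, the product $(y - bi)(y + bi)$ vanishes, so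
   $y = \pm bi$. *)
have centr x : D x -> i * x = x * i -> exists a b, x = c a * e + c b * i.
  move=> dx ix; have [a [b [h hb]]] := corner_quadratic dx.
  have [y yE] : exists y, y = x - c a * e by exists (x - c a * e).
  rewrite -yE in h.
  have dy : D y by rewrite yE; apply: DD => //; apply: DN; exact: DZ.
  have iy : i * y = y * i.
    by rewrite yE mulrBr mulrBl ix !mulrA -(cC a i) -!mulrA ei ie.
  have : (y - c b * i) * (y + c b * i) = 0.
    have yt : y * (c b * i) = c b * i * y by rewrite mulrA -cC -!mulrA iy.
    rewrite mulrDr !mulrBl yt addrA subrK cM2 ii h -expr2 mulrN opprK.
    exact: addNr.
  move/(D_int (DD dy (DN (DZ b di))) (DD dy (DZ b di))) => [h1|h1].
    by exists a, b; rewrite -(subr0_eq h1) yE addrC subrK.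
  exists a, (- b); rewrite cN mulNr; move/eqP: h1; rewrite addr_eq0 => /eqP <-.
  by rewrite yE addrC subrK.
have [allC|] := pselect (forall x, D x -> i * x = x * i).
  pose u (a : 'I_2) := nth 0 [:: e; i] a.
  have uE (x : k[i]) : @dmodel DComplex u x = c (complex.Re x) * e + c (complex.Im x) * i.
    by rewrite /dmodel !big_ord_recl big_ord0 /= addr0.
  apply: (fin DComplex u).
  - by move=> [[|[|[]]]] //=.
  - by rewrite uE /= c1 c0 mul1r mul0r addr0.
  - move=> [[|[|[]]]] // ? [[|[|[]]]] // ?;
      rewrite uE /u /= ?ee ?ei ?ie ?ii !simp0 ?cN ?c1 ?c0;
      by rewrite ?mulNr !simp0 ?oppr0 ?simp0.
  move=> x dx; have [a [b ->]] := centr x dx (allC x dx).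
  by exists (Complex a b); rewrite uE.
move=> /existsNP [y0 /not_implyP [dy0 ny0]].
have iS x : D x -> i * (x + i * x * i) = i * x - x * i.
  by move=> [ex xe]; rewrite mulrDr !mulrA ii !mulNr ex.
have Si x : D x -> (x + i * x * i) * i = x * i - i * x.
  by move=> [ex xe]; rewrite mulrDl -(mulrA (i * x)) ii mulrN -mulrA xe.
(* $x + ixi$ is twice the part of $x$ that anticommutes with $i$, and $x - ixi$ twice the part that
   commutes with it. *)
have anti x : D x -> D (x + i * x * i) /\ i * (x + i * x * i) = - ((x + i * x * i) * i).
  move=> dx; split; first by apply: DD => //; exact: DM (DM di dx) di.
  by rewrite iS // Si // opprB.
have [j [dj ij jj]] : exists j, [/\ D j, i * j = - (j * i) & j * j = - e].
  have [y yE] : exists y, y = y0 + i * y0 * i by exists (y0 + i * y0 * i).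
  have [dy iy] := anti y0 dy0; rewrite -yE in dy iy.
  have ny : y != 0.
    apply/eqP => y_0; apply: ny0; have [ey0 y0e] := dy0.
    by have := iS y0 dy0; rewrite -yE y_0 mulr0 => /esym /subr0_eq.
  have iyy : i * (y * y) = (y * y) * i.
    by rewrite [LHS]mulrA iy mulNr -[y * i * y]mulrA iy mulrN opprK mulrA.
  have [a [b yy]] := centr _ (DM dy dy) iyy.
  (* $y^2 = a + bi$ commutes with $y$, but $i$ anticommutes with $y$. *)
  have b0 : b = 0.
    have h : y * (y * y) = (y * y) * y by rewrite mulrA.
    move: h; have [ey ye] := dy.
    rewrite yy mulrDr mulrDl !mulrA -!cC -!mulrA ye ey iy mulrN => /addrI h.
    have h2 : c b * (y * i) = 0.
      have : c (2%:R) * (c b * (y * i)) = 0.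
        by rewrite mulr2n cD c1 mulrDl !mul1r {1}h addNr.
      move/(congr1 (fun z => c 2%:R^-1 * z)).
      by rewrite mulrA -cM mulVf ?c1 ?mul1r ?mulr0 // pnatr_eq0.
    apply/eqP; apply: contraNT ny => nb; apply/eqP.
    have : y * i = 0.
      by rewrite -[LHS]mul1r -c1 -(mulVf nb) cM -mulrA h2 mulr0.
    move/(D_int dy di) => [//|i_0]; move: ii; rewrite i_0 mulr0 => /eqP.
    by rewrite eq_sym oppr_eq0 (negbTE e0).
  rewrite b0 c0 mul0r addr0 in yy.
  (* For $a < 0$ rescale $y$ to get $j$. For $a \geq 0$, $y$ would be $\pm\sqrt a\,e$, which
     commutes with $i$ and cannot also anticommute with it. *)
  have [a0|a_ge0] := ltP a 0.
    pose s := Num.sqrt (- a); have ss : s ^+ 2 = - a by rewrite sqr_sqrtr // oppr_ge0 ltW.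
    have ns : s != 0 by apply: contraTneq a0 => s0; rewrite -[a]opprK -ss s0 expr0n oppr0 ltxx.
    exists (c s^-1 * y); split; first exact: DZ.
      by rewrite mulrA -cC -!mulrA iy mulrN.
    rewrite cM2 yy mulrA -cM -invfM -expr2 ss invrN mulNr mulVf ?cN ?c1 ?mulN1r //.
    exact: ltr0_neq0.
  pose s := Num.sqrt a; have ss : s ^+ 2 = a by rewrite sqr_sqrtr.
  have [ey ye] := dy.
  have : (y - c s * e) * (y + c s * e) = 0.
    have yt : y * (c s * e) = c s * e * y by rewrite mulrA -cC -!mulrA ye ey.
    by rewrite mulrDr !mulrBl yt addrA subrK cM2 ee yy -(expr2 s) ss subrr.
  have yscal t : y = c t * e -> False.
    move=> yt; move: iy; rewrite yt mulrA -cC -!mulrA ie ei => h.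
    have : c t * i = 0.
      have : c 2%:R * (c t * i) = 0.
        by rewrite mulr2n cD c1 mulrDl !mul1r {1}h addNr.
      move/(congr1 (fun z => c 2%:R^-1 * z)).
      by rewrite mulrA -cM mulVf ?c1 ?mul1r ?mulr0 // pnatr_eq0.
    have ni : i != 0.
      by apply: contraNneq e0 => i_0; rewrite -[e]opprK -ii i_0 mulr0 oppr0.
    rewrite -[RHS](mul0r i) -c0 => /(cI ni) t0.
    by move/eqP: ny; rewrite yt t0 c0 mul0r.
  move/(D_int (DD dy (DN (DZ s De))) (DD dy (DZ s De))) => [/subr0_eq /yscal []|].
  by move/eqP; rewrite addr_eq0 -mulNr -cN => /eqP /yscal.
have [ej je] := dj.
have ji : j * i = - (i * j) by rewrite ij opprK.
pose u (a : 'I_4) := nth 0 [:: e; i; j; i * j] a.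
have uE (x : quat k) : @dmodel DQuat u x =
    c x.1.1.1 * e + c x.1.1.2 * i + c x.1.2 * j + c x.2 * (i * j).
  by rewrite /dmodel !big_ord_recl big_ord0 /= addr0 !addrA.
have iji : i * j * i = j by rewrite -mulrA ji mulrN mulrA ii mulNr opprK ej.
have ijj : i * j * j = - i by rewrite -mulrA jj mulrN ie.
have iij : i * (i * j) = - j by rewrite mulrA ii mulNr ej.
have jij : j * (i * j) = i by rewrite mulrA ji mulNr ijj opprK.
have ijij : i * j * (i * j) = - e by rewrite mulrA iji jj.
have eij : e * (i * j) = i * j by rewrite mulrA ei.
have ije : i * j * e = i * j by rewrite -mulrA je.
apply: (fin DQuat u).
- move=> [[|[|[|[|[]]]]]] //= _; exact: DM.
- by rewrite uE /= c1 c0 mul1r !mul0r !addr0.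
- move=> [[|[|[|[|[]]]]]] // ? [[|[|[|[|[]]]]]] // ?; rewrite uE /u /=
      ?ee ?ei ?ie ?ii ?ej ?je ?jj ?eij ?ije ?iij ?jij ?ijij ?iji ?ijj ?ji;
    rewrite !simp0 ?cN ?c1 ?c0; by rewrite ?mulNr !simp0 ?oppr0 ?simp0.
move=> x dx; have [ex xe] := dx.
have [dxm ixm] := anti x dx; set xm := x + _ in dxm ixm.
have dxp : D (x - i * x * i) by apply: DD => //; apply: DN; exact: DM (DM di dx) di.
have [a [b xp]] : exists a b, x - i * x * i = c a * e + c b * i.
  apply: centr dxp _.
  rewrite mulrBr mulrBl -(mulrA (i * x)) ii mulrN -(mulrA i x e) xe !mulrA ii.
  by rewrite !mulNr ex !opprK addrC.
(* Both [xm] and $j$ anticommute with $i$, so their product commutes with it; multiplying by $-j$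
   recovers [xm]. *)
have [a' [b' xmj]] : exists a b, xm * j = c a * e + c b * i.
  apply: centr; first exact: DM.
  by rewrite mulrA ixm mulNr -!mulrA ij mulrN opprK.
exists (a / 2%:R, b / 2%:R, - a' / 2%:R, - b' / 2%:R); rewrite uE /=.
have xm_e : xm = - (c a' * j + c b' * (i * j)).
  have [_ xme] := dxm.
  have -> : xm = - (xm * j * j) by rewrite -mulrA jj mulrN xme opprK.
  by rewrite xmj mulrDl -!mulrA ej.
have two : x = c 2%:R^-1 * ((x - i * x * i) + xm).
  have -> : (x - i * x * i) + xm = c 2%:R * x.
    by rewrite /xm addrACA addNr addr0 mulr2n cD c1 mulrDl !mul1r.
  by rewrite mulrA -cM mulVf ?c1 ?mul1r // pnatr_eq0.
rewrite [RHS]two xp xm_e mulrDr mulrDr mulrN mulrDr opprD !mulrA -!cM.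
by rewrite ![_ / 2%:R]mulrC !mulrN !cN !mulNr !addrA.
Qed.

End Frobenius.

Section BlockIso.
Variables (k : rcfType) (B : nzRingType) (c : k -> B) (m : nat).
Variable F : fsep_alg c m.

(** The matrix of $b$ has entries $U_p b V_q$ in $eBe$, read in $D$ through [frobenius]. The inverse
    map reassembles $\sum V_p x_{pq} U_q$, which kills the other blocks; hence the factor [cc] in
    the last clause. *)
Theorem block_iso : exists (cc : B) (d : dkind) (n : nat)
    (f : B -> 'M[dring k d]_n.+1) (g : 'M[dring k d]_n.+1 -> B),
  [/\ (forall b, cc * b = b * cc) /\ (cc * cc = cc /\ cc != 0),
      (forall x y, f (x + y) = f x + f y) /\ (forall x y, f (x * y) = f x *m f y),
      f 1 = 1%:M /\ (forall a, f (c a) = (dscalar d a)%:M),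
      forall X, f (g X) = X &
      forall b, g (f b) = cc * b].
Proof.
have [cc [e [n [U [V [ccC ccK e0 ee dv eU Ve UV VU]]]]]] := exists_block F.
have [d [iota [iD iM iZ iI iP]]] := frobenius F e0 ee dv.
have i0 : iota 0 = 0 by apply: (addrI (iota 0)); rewrite -iD !addr0.
have i1 : iota 1 = e by rewrite -(dscalar1 k d) iZ (scal1 F) mul1r.
have isum I (r : seq I) (G : I -> dring k d) :
    iota (\sum_(j <- r) G j) = \sum_(j <- r) iota (G j).
  exact: (big_morph iota iD i0).
have ie x : iota x * e = iota x.
  by have [_] : corner e e (iota x) by apply/iP; exists x.
have ei x : e * iota x = iota x.
  by have [] : corner e e (iota x) by apply/iP; exists x.
have /choice [jj jP] : forall p : 'I_n.+1 * B * 'I_n.+1, exists y,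
    iota y = U p.1.1 * p.1.2 * V p.2.
  by move=> [[p b] q] /=; apply/iP; split; rewrite ?mulrA ?eU // -!mulrA Ve.
pose f b := \matrix_(p < n.+1, q < n.+1) jj (p, b, q).
pose g (X : 'M[dring k d]_n.+1) := \sum_p \sum_q V p * iota (X p q) * U q.
have fE b p q : iota (f b p q) = U p * b * V q by rewrite mxE jP.
have fI (X Y : 'M[dring k d]_n.+1) : (forall p q, iota (X p q) = iota (Y p q)) -> X = Y.
  by move=> h; apply/matrixP => p q; apply: iI.
have Ucc p : U p * cc = U p.
  rewrite -VU mulr_sumr (bigD1 p) //= mulrA UV eqxx eU big1 ?addr0 // => q nq.
  by rewrite mulrA UV eq_sym (negbTE nq) mul0r.
exists cc, d, n, f, g; split.
- split=> //; split=> //; apply: contraNneq e0 => cc0.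
  by have := UV 0 0; rewrite eqxx => <-; rewrite -Ucc cc0 mulr0 mul0r.
- split=> x y; apply: fI => p q.
    by rewrite [in RHS]mxE iD !fE mulrDr mulrDl.
  have xcc : U p * x * cc = U p * x by rewrite -mulrA -ccC mulrA Ucc.
  rewrite [in RHS]mxE isum fE mulrA -xcc -VU mulr_sumr !mulr_suml.
  by apply: eq_bigr => l _; rewrite iM !fE !mulrA.
- split=> [|a]; apply: fI => p q; rewrite fE mxE.
    by rewrite mulr1 UV; case: eqVneq; rewrite /= ?mulr1n ?mulr0n ?i1 ?i0.
  rewrite -(scalC F) -mulrA UV; case: eqVneq => _; rewrite /= ?mulr1n ?mulr0n.
    by rewrite iZ.
  by rewrite mulr0 i0.
- move=> X; apply: fI => p q; rewrite fE /g mulr_sumr mulr_suml (bigD1 p) //=.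
  rewrite [X in _ + X]big1 ?addr0 => [|r nr]; last first.
    rewrite mulr_sumr mulr_suml big1 // => s _.
    by rewrite !mulrA UV eq_sym (negbTE nr) !mul0r.
  rewrite mulr_sumr mulr_suml (bigD1 q) //= big1 ?addr0 => [|s ns]; last first.
    by rewrite -!mulrA UV (negbTE ns) !mulr0.
  by rewrite !mulrA UV eqxx ei -mulrA UV eqxx ie.
move=> b; rewrite /g.
under eq_bigr do under eq_bigr do rewrite fE.
rewrite -[RHS](mul1r _) -{1}ccK -mulrA ccC -{1}VU -{1}VU mul1r mulr_suml.
rewrite mulr_suml; apply: eq_bigr => p _; rewrite mulr_sumr.
by apply: eq_bigr => q _; rewrite !mulrA.
Qed.

End BlockIso.

Definition is_dcomplex (d : dkind) : bool := if d is DComplex then true else false.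

Lemma ddim_gt0 d : (0 < ddim d)%N. Proof. by case: d. Qed.
Definition dord0 d : 'I_(ddim d) := Ordinal (ddim_gt0 d).

Section DRingBase.
Variable k : rcfType.

Lemma dbase0 d : @dbase k d (dord0 d) = 1.
Proof. by case: d. Qed.

Lemma dcomplex_imag d : is_dcomplex d -> exists x : dring k d,
  (forall y, x * y = y * x) /\ (dconj x = - x /\ x * x = -1).
Proof.
case: d => // _; exists (Complex 0 1 : k[i]); split=> [y|]; first exact: mulrC.
by split; apply/eqP; rewrite eq_complex /=; apply/andP; split; apply/eqP; ring.
Qed.

Lemma dcomplex_base d : is_dcomplex d -> forall a, let b := @dbase k d a in
  (forall y, b * y = y * b) /\
  ((b = 1 /\ dconj b = 1) \/ (dconj b = - b /\ b * b = -1)).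
Proof.
case: d => // _ a /=; split=> [y|]; first exact: mulrC.
case: a => -[|[|[]]] //= _; [left|right].
  by split; apply/eqP; rewrite eq_complex /=; apply/andP; split; apply/eqP; ring.
by split; apply/eqP; rewrite eq_complex /=; apply/andP; split; apply/eqP; ring.
Qed.

Local Notation avg d a :=
  (\sum_c @dbase k d c * dconj (@dbase k d a) * dconj (@dbase k d c)).

Lemma dcomplex_avg d : is_dcomplex d ->
  \sum_a @dbase k d a * avg d a = dscalar d 4%:R.
Proof.
case: d => // _; rewrite !big_ord_recl !big_ord0 /=.
by apply/eqP; rewrite eq_complex /=; apply/andP; split; apply/eqP; ring.
Qed.

(** The sum over the standard basis projects onto the centre, which is $k$ for the reals and the
    quaternions, so only the basis element $1$ survives. *)
Lemma dquat_avg d a : ~~ is_dcomplex d ->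
  avg d a = if a == dord0 d then dscalar d (ddim d)%:R else 0.
Proof.
case: d a => // a _; first by rewrite big_ord1 /= !mulr1 ord1.
rewrite !big_ord_recl !big_ord0.
by case: a => -[|[|[|[|[]]]]] //= _; congr (_, _, _, _) => /=; ring.
Qed.

End DRingBase.

(** * Involutions of matrix rings: an explicit form of the Skolem-Noether theorem *)

Section MatrixInvolution.
Variables (k : rcfType) (d : dkind) (n : nat).
Local Notation D := (dring k d).
Local Notation M := 'M[D]_n.+1.
Local Notation sc a := ((dscalar d a)%:M : M).
Variable s : M -> M.
Hypothesis sD : {morph s : X Y / X + Y}.
Hypothesis sM : forall X Y, s (X *m Y) = s Y *m s X.
Hypothesis sK : involutive s.
Hypothesis sZ : forall a, s (sc a) = sc a.
Hypothesis matrix_regular : forall X : M, exists Y, X *m Y *m X = X.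
Hypothesis s_center : forall Z : M, (forall X, Z *m X = X *m Z) -> s Z = Z ->
  exists a, Z = sc a.

Lemma conjtrM (X Y : M) : conjtr (X *m Y) = conjtr Y *m conjtr X.
Proof. exact: (ctmxM (@dconjD k d) (@dconjM k d)). Qed.
Lemma conjtrD (X Y : M) : conjtr (X + Y) = conjtr X + conjtr Y.
Proof. exact: (ctmxD (@dconjD k d)). Qed.
Lemma conjtrK (X : M) : conjtr (conjtr X) = X.
Proof. exact: (ctmxK (@dconjK k d)). Qed.
Lemma conjtr_scalar (x : D) : conjtr (x%:M : M) = (dconj x)%:M.
Proof.
apply/matrixP => i j; rewrite !mxE eq_sym; case: eqVneq => // _.
by rewrite !mulr0n dconj0.
Qed.

(** A composite of two anti-automorphisms, hence a multiplicative map that ought to be conjugation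
    by some matrix. *)
Let phi (X : M) := s (conjtr X).
Let phiD X Y : phi (X + Y) = phi X + phi Y.
Proof. by rewrite /phi conjtrD sD. Qed.
Let phiM X Y : phi (X *m Y) = phi X *m phi Y.
Proof. by rewrite /phi conjtrM sM. Qed.
Let phiZ a : phi (sc a) = sc a.
Proof. by rewrite /phi conjtr_scalar dconj_scalar sZ. Qed.
Let phi0 : phi 0 = 0.
Proof. by apply: (addrI (phi 0)); rewrite -phiD !addr0. Qed.
Let phiN X : phi (- X) = - phi X.
Proof. by apply: (addrI (phi X)); rewrite -phiD !subrr phi0. Qed.
Let phi1 : phi 1%:M = 1%:M.
Proof. by rewrite -(dscalar1 k d) phiZ. Qed.

Let E (i j : 'I_n.+1) : M := delta_mx i j.
Let EE i j p q : E i j *m E p q = if j == p then E i q else 0.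
Proof.
case: eqVneq => [<-|nj]; first by rewrite /E mul_delta_mx.
by rewrite /E mul_delta_mx_0.
Qed.
Let scE (x : D) i j : x%:M *m E i j = E i j *m x%:M.
Proof.
apply/matrixP => p q; rewrite mul_scalar_mx !mxE (bigD1 q) //= !mxE eqxx mulr1n.
rewrite big1 ?addr0 => [|l nl]; last by rewrite !mxE (negbTE nl) mulr0n mulr0.
by case: (_ && _); rewrite ?mulr1 ?mul1r ?mulr0 ?mul0r.
Qed.
Let ME (X : M) : X = \sum_i \sum_j (X i j)%:M *m E i j.
Proof.
rewrite {1}[X]matrix_sum_delta; apply: eq_bigr => i _; apply: eq_bigr => j _.
by rewrite mul_scalar_mx.
Qed.

Local Notation db a := ((@dbase k d a)%:M : M).

(** Averaging $Y$ over the matrix units, and then in [G] over the standard basis of $D$, yields a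
    solution of $\varphi(X)G = GX$ for any starting matrix $Y$. *)
Let G0 (Y : M) := \sum_i phi (E i 0) *m Y *m E 0 i.
Let G (Y : M) := \sum_a phi (db a) *m G0 Y *m (dconj (@dbase k d a))%:M.

Let scalM (x y : D) : (x * y)%:M = x%:M *m y%:M :> M.
Proof. by rewrite -scalar_mxM. Qed.

Let G0E Y p q : phi (E p q) *m G0 Y = G0 Y *m E p q.
Proof.
rewrite /G0 mulmx_sumr mulmx_suml (bigD1 q) //= !mulmxA -phiM EE eqxx.
rewrite big1 ?addr0 => [|i ni]; last first.
  by rewrite !mulmxA -phiM EE eq_sym (negbTE ni) phi0 !mul0mx.
rewrite (bigD1 p) //= -!mulmxA EE eqxx big1 ?addr0 // => i ni.
by rewrite -!mulmxA EE (negbTE ni) !mulmx0.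
Qed.

Let GE Y p q : phi (E p q) *m G Y = G Y *m E p q.
Proof.
rewrite /G mulmx_sumr mulmx_suml; apply: eq_bigr => a _.
rewrite !mulmxA -phiM -scE phiM -(mulmxA (phi (db a))) G0E -!mulmxA.
by rewrite scE.
Qed.

(* The standard basis is a group up to sign, whence the invariance. *)
Let avg (S : D -> M) (b : 'I_(ddim d)) : (forall x, S (- x) = S x) ->
  \sum_a S (@dbase k d b * @dbase k d a) = \sum_a S (@dbase k d a).
Proof.
case: d S b => /= S b SN.
- by rewrite !big_ord1 mulr1.
- have e1 : Complex 1 0 * Complex 1 0 = Complex 1 0 :> k[i].
    by apply/eqP; rewrite eq_complex /=; apply/andP; split; apply/eqP; ring.
  have e2 : Complex 1 0 * Complex 0 1 = Complex 0 1 :> k[i].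
    by apply/eqP; rewrite eq_complex /=; apply/andP; split; apply/eqP; ring.
  have e3 : Complex 0 1 * Complex 0 1 = - Complex 1 0 :> k[i].
    by apply/eqP; rewrite eq_complex /=; apply/andP; split; apply/eqP; ring.
  rewrite !big_ord_recl !big_ord0 /= !addr0.
  case: b => -[|[|[]]] //= _; first by rewrite e1 e2.
  by rewrite mulrC e2 e3 SN addrC.
rewrite !big_ord_recl !big_ord0 /= !addr0.
have q4 (x y : quat k) : x.1.1.1 = y.1.1.1 -> x.1.1.2 = y.1.1.2 ->
    x.1.2 = y.1.2 -> x.2 = y.2 -> x = y.
  by case: x => [[[? ?] ?] ?]; case: y => [[[? ?] ?] ?] /= -> -> -> ->.
have key (o i j l : quat k) :
    o * o = o -> o * i = i -> o * j = j -> o * l = l ->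
    i * o = i -> i * i = - o -> i * j = l -> i * l = - j ->
    j * o = j -> j * i = - l -> j * j = - o -> j * l = i ->
    l * o = l -> l * i = j -> l * j = - i -> l * l = - o ->
    forall x, x \in [:: o; i; j; l] ->
    S (x * o) + (S (x * i) + (S (x * j) + S (x * l))) = S o + (S i + (S j + S l)).
  move=> h0 h1 h2 h3 h4 h5 h6 h7 h8 h9 h10 h11 h12 h13 h14 h15 x.
  rewrite !inE => /or4P [] /eqP ->.
  - by rewrite h0 h1 h2 h3.
  - rewrite h4 h5 h6 h7 !SN.
    by rewrite addrCA; congr (_ + (_ + _)); rewrite addrC.
  - rewrite h8 h9 h10 h11 !SN.
    by rewrite [RHS](AC (1*(1*(1*1))) (3*(4*(1*2)))).
  - rewrite h12 h13 h14 h15 !SN.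
    by rewrite [RHS](AC (1*(1*(1*1))) (4*(3*(2*1)))).
apply: key; last first.
  by case: b => -[|[|[|[|[]]]]] //= _; rewrite !inE eqxx ?orbT.
all: by apply: q4 => /=; ring.
Qed.

Let Gdb Y b : phi (db b) *m G Y = G Y *m db b.
Proof.
pose S (x : D) := phi x%:M *m G0 Y *m (dconj x)%:M.
have SN x : S (- x) = S x.
  rewrite /S !raddfN /= phiN mulNmx mulNmx.
  have -> : dconj (- x) = - dconj x.
    by apply: (addrI (dconj x)); rewrite -dconjD !subrr dconj0.
  by rewrite raddfN mulmxN opprK.
have nb : dconj (@dbase k d b) * @dbase k d b = 1.
  case: d b => /= b; first by rewrite mulr1.
    by case: b => -[|[|[]]] //= _; apply/eqP; rewrite eq_complex /=; apply/andP; split; apply/eqP; ring.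
  by case: b => -[|[|[|[|[]]]]] //= _; congr (_, _, _, _) => /=; ring.
rewrite {2}/G -[\sum_a _](avg b SN) mulmx_suml /G mulmx_sumr.
apply: eq_bigr => a _; rewrite /S dconjM !mulmxA -phiM -scalM -[in RHS]mulmxA.
by rewrite -[in RHS]scalM -mulrA nb mulr1.
Qed.

Let GX Y X : phi X *m G Y = G Y *m X.
Proof.
have phiS I (r : seq I) (f : I -> M) : phi (\sum_(i <- r) f i) = \sum_(i <- r) phi (f i).
  exact: (big_morph phi phiD phi0).
have Gx x : phi x%:M *m G Y = G Y *m x%:M.
  have -> : x%:M = \sum_a sc (dcoef x a) *m db a.
    by rewrite {1}[x]dcoefK raddf_sum; apply: eq_bigr => a _; exact: scalM.
  rewrite phiS mulmx_suml mulmx_sumr; apply: eq_bigr => a _.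
  rewrite phiM phiZ -mulmxA Gdb !mulmxA; congr (_ *m _).
  apply/matrixP => p q; rewrite mul_scalar_mx !mxE (bigD1 q) //= !mxE eqxx mulr1n.
  rewrite dscalarC big1 ?addr0 // => l nl.
  by rewrite !mxE (negbTE nl) mulr0n mulr0.
rewrite (ME X) phiS mulmx_suml mulmx_sumr; apply: eq_bigr => i _.
rewrite phiS mulmx_suml mulmx_sumr; apply: eq_bigr => j _.
by rewrite phiM -mulmxA GE mulmxA Gx mulmxA.
Qed.

Lemma center_mx_scalar (Z : M) : (forall X, Z *m X = X *m Z) -> Z = (Z 0 0)%:M.
Proof.
move=> h; apply/matrixP => i j; rewrite !mxE.
have /matrixP /(_ i 0) := h (E j 0).
rewrite mxE (bigD1 j) //= !mxE !eqxx mulr1 big1 ?addr0 => [->|l nl]; last first.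
  by rewrite !mxE (negbTE nl) mulr0.
rewrite (bigD1 0) //= !mxE eqxx andbT big1 ?addr0 => [|l nl]; last first.
  by rewrite !mxE (negbTE nl) andbF mul0r.
by case: (i == j); rewrite ?mul1r ?mul0r.
Qed.

(** $w = s(x)$ is central with $w^2 = -1$, so $(w - x)(w + x) = 0$. If $w = x$, then $x$ would be a
    symmetric central element, thus a real scalar with square $-1$. *)
Lemma s_imag (x : D) : (forall y, x * y = y * x) -> x * x = -1 -> s x%:M = - x%:M.
Proof.
move=> xC xx; have XC X : x%:M *m X = X *m x%:M.
  apply/matrixP => p q; rewrite mul_scalar_mx !mxE (bigD1 q) //= !mxE eqxx mulr1n.
  by rewrite xC big1 ?addr0 // => l nl; rewrite !mxE (negbTE nl) mulr0n mulr0.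
have WC X : s x%:M *m X = X *m s x%:M by rewrite -[X]sK -!sM XC.
have := center_mx_scalar WC; set w := s _ 0 0 => ew.
have wC y : w * y = y * w.
  have := WC y%:M; rewrite ew -!scalM => /matrixP /(_ 0 0).
  by rewrite !mxE eqxx !mulr1n.
have xX : x%:M *m x%:M = - 1%:M :> M by rewrite -scalM xx raddfN.
have sN X : s (- X) = - s X.
  have s0 : s 0 = 0 by apply: (addrI (s 0)); rewrite -sD !addr0.
  by apply: (addrI (s X)); rewrite -sD !subrr s0.
have ww : w * w = -1.
  have : s x%:M *m s x%:M = - 1%:M.
    by rewrite -sM xX sN -(dscalar1 k d) sZ.
  rewrite ew -scalM => /matrixP /(_ 0 0).
  by rewrite !mxE eqxx !mulr1n.
have wx0 : (w - x) * (w + x) = 0.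
  by rewrite mulrDr !mulrBl ww xx xC opprK addrA subrK addNr.
have [wx|nwx] := eqVneq (w - x) 0.
  have [a ea] : exists a, x%:M = sc a.
    by apply: s_center => //; rewrite ew (subr0_eq wx).
  have {}ea : x = dscalar d a by move/matrixP/(_ 0 0): ea; rewrite !mxE eqxx !mulr1n.
  move/(congr1 (@dre k d)): xx; rewrite ea -dscalarM dre_scalar.
  rewrite -(dscalar1 k d) -dscalarN dre_scalar => aa.
  by have := sqr_ge0 a; rewrite expr2 aa oppr_ge0 ler10.
have [z [_ zw]] := ddiv nwx.
have : w + x = 0 by rewrite -[LHS]mul1r -zw -mulrA wx0 mulr0.
by move/eqP; rewrite ew addr_eq0 => /eqP ->; rewrite raddfN.
Qed.

(** If every average vanished, compressing by $e_{11}$ and averaging once more would give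
    $\varphi(e_{11})Ye_{11} = 0$ for all $Y$, although $\varphi(e_{11}) \neq 0$. *)
Let G_neq0 : exists Y, G Y != 0.
Proof.
apply: contrapT => hn.
have G_0 Y : G Y = 0 by apply/eqP; apply: contrapT => h; apply: hn; exists Y; apply/negP.
have step1 Y : \sum_a phi (db a) *m phi (E 0 0) *m Y *m E 0 0 *m
    (dconj (@dbase k d a))%:M = 0.
  have := congr1 (fun X => phi (E 0 0) *m X *m E 0 0) (G_0 Y).
  rewrite mulmx0 mul0mx /G mulmx_sumr mulmx_suml => h; rewrite -[RHS]h.
  apply: eq_bigr => a _; rewrite !mulmxA -!phiM -scE phiM -!mulmxA.
  congr (_ *m _); rewrite scE !mulmxA; congr (_ *m _).
  rewrite /G0 mulmx_sumr mulmx_suml.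
  rewrite (bigD1 0) //= !mulmxA -phiM EE eqxx big1 ?addr0 => [|i ni]; last first.
    by rewrite !mulmxA -phiM EE eq_sym (negbTE ni) phi0 !mul0mx.
  by rewrite -[in RHS]mulmxA EE eqxx.
have two0 (X : M) : X + X = 0 -> X = 0.
  move=> h; have : sc (2%:R^-1) *m (X + X) = 0 by rewrite h mulmx0.
  rewrite mulmxDr -mulmxDl -raddfD -dscalarD -[X in X + X]mul1r -mulrDl.
  by rewrite -(natrD _ 1 1) mulfV ?pnatr_eq0 // dscalar1 mul1mx.
have step2 Y : phi (E 0 0) *m Y *m E 0 0 = 0.
  have avgY (y : D -> D) : \sum_c \sum_a phi (db a) *m phi (E 0 0) *m (Y *m db c) *m E 0 0 *m
      (dconj (@dbase k d a))%:M *m (y (@dbase k d c))%:M = 0.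
    by rewrite big1 // => c _; rewrite -mulmx_suml step1 mul0mx.
  have {avgY} := avgY (@dconj k d).
  rewrite exchange_big /=.
  have -> : \sum_a \sum_c phi (db a) *m phi (E 0 0) *m (Y *m db c) *m E 0 0 *m
      (dconj (@dbase k d a))%:M *m (dconj (@dbase k d c))%:M =
     \sum_a phi (db a) *m (phi (E 0 0) *m Y *m E 0 0) *m
      (\sum_c @dbase k d c * dconj (@dbase k d a) * dconj (@dbase k d c))%:M.
    apply: eq_bigr => a _; rewrite raddf_sum mulmx_sumr; apply: eq_bigr => c _ /=.
    rewrite !scalM !mulmxA; do 2 congr (_ *m _); rewrite -!mulmxA; do 3 congr (_ *m _).
    exact: scE.
  set Z := phi (E 0 0) *m Y *m E 0 0 => h.
  suff [r nr Zr] : exists2 r : k, r != 0 & Z *m sc r = 0.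
    have := congr1 (mulmx^~ (sc r^-1)) Zr.
    by rewrite mul0mx -mulmxA -scalM -dscalarM mulfV // dscalar1 mulmx1.
  (* In the complex case $\varphi$ fixes the basis elements, since [s] and conjugation both negate
     $i$, and the total coefficient is $4$. Otherwise only the term of the basis element $1$
     survives, with coefficient $\dim D$. *)
  have [dC|dnC] := boolP (is_dcomplex d).
    exists 4%:R; first by rewrite pnatr_eq0.
    rewrite -(dcomplex_avg k dC) raddf_sum mulmx_sumr -[RHS]h.
    apply: eq_bigr => a _ /=; rewrite scalM mulmxA; congr (_ *m _).
    have [bC b1] := dcomplex_base k dC a.
    have bX X : (db a) *m X = X *m db a.
      apply/matrixP => p q; rewrite mul_scalar_mx !mxE (bigD1 q) //= !mxE eqxx mulr1n.
      by rewrite bC big1 ?addr0 // => l nl; rewrite !mxE (negbTE nl) mulr0n mulr0.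
    rewrite -bX; congr (_ *m _); rewrite /phi conjtr_scalar.
    case: b1 => [[-> ->]|[-> bb]]; first by rewrite -(dscalar1 k d) sZ.
    have sN X : s (- X) = - s X.
      have s0 : s 0 = 0 by apply: (addrI (s 0)); rewrite -sD !addr0.
      by apply: (addrI (s X)); rewrite -sD !subrr s0.
    by rewrite raddfN sN s_imag ?opprK.
  exists (ddim d)%:R; first by rewrite pnatr_eq0; case: (d).
  rewrite -[RHS]h (bigD1 (dord0 d)) //= dquat_avg // eqxx.
  rewrite big1 ?addr0 => [|a na]; last first.
    by rewrite dquat_avg // (negbTE na) raddf0 mulmx0.
  by rewrite dbase0 phi1 mul1mx.
have nE : phi (E 0 0) != 0.
  apply: contraTneq isT => h; have : E 0 0 = 0.
    by rewrite -[E 0 0]conjtrK -[conjtr (E 0 0)]sK -/(phi _) h -phi0 /phi sK conjtrK.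
  by move/matrixP/(_ 0 0); rewrite !mxE !eqxx => /eqP; rewrite oner_eq0.
case/matrix0Pn: nE => p [q /negP []]; apply/eqP.
have /matrixP /(_ p 0) := step2 (E q 0).
rewrite -mulmxA EE eqxx !mxE (bigD1 q) //= !mxE !eqxx mulr1 big1 ?addr0 // => l nl.
by rewrite !mxE (negbTE nl) mulr0.
Qed.

(* Both a solution of the intertwining equation and its adjoint are solutions,
   so that a hermitian or a skew-hermitian one exists. *)
Theorem matrix_involution : exists (Psi Psi' : M) (eps : bool),
  [/\ Psi *m Psi' = 1%:M, Psi' *m Psi = 1%:M,
      conjtr Psi = (if eps then - Psi else Psi),
      (eps -> ~~ is_dcomplex d) &
      forall X, s X = Psi *m conjtr X *m Psi'].
Proof.
have [Y nG] := G_neq0; pose P := G Y.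
have sP X : s X *m P = P *m conjtr X.
  by rewrite -GX /phi conjtrK.
have sN X : s (- X) = - s X.
  have s0 : s 0 = 0 by apply: (addrI (s 0)); rewrite -sD !addr0.
  by apply: (addrI (s X)); rewrite -sD !subrr s0.
have sPc X : s X *m conjtr P = conjtr P *m conjtr X.
  have := congr1 (@conjtr _ _ _) (sP (s X)).
  by rewrite sK !conjtrM conjtrK.
have [Q [eps [nQ sQ hQ cQ]]] : exists (Q : M) (eps : bool), [/\ Q != 0,
    forall X, s X *m Q = Q *m conjtr X, conjtr Q = (if eps then - Q else Q) &
    (eps -> ~~ is_dcomplex d)].
  have [e0|n0] := eqVneq (P + conjtr P) 0; last first.
    exists (P + conjtr P), false; split=> //.
      by move=> X; rewrite mulmxDr mulmxDl sP sPc.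
    by rewrite conjtrD conjtrK addrC.
  have cP : conjtr P = - P by apply/eqP; rewrite -addr_eq0 addrC e0.
  have [dC|dC] := boolP (is_dcomplex d); last by exists P, true.
  (* Over the complex numbers a skew solution times $i$ is hermitian, and it remains a solution
     because $i$ is central. *)
  have [x [xC [cx xx]]] := dcomplex_imag k dC.
  have xX X : x%:M *m X = X *m x%:M.
    apply/matrixP => p q; rewrite mul_scalar_mx !mxE (bigD1 q) //= !mxE eqxx mulr1n.
    by rewrite xC big1 ?addr0 // => l nl; rewrite !mxE (negbTE nl) mulr0n mulr0.
  exists (x%:M *m P), false; split=> //.
  - apply: contraNneq nG => h; have := congr1 (mulmx x%:M) h.
    by rewrite mulmxA -scalM xx mulmx0 raddfN mulNmx mul1mx => /eqP; rewrite oppr_eq0.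
  - by move=> X; rewrite mulmxA -xX -!mulmxA sP.
  by rewrite conjtrM conjtr_scalar cx cP raddfN mulmxN mulNmx opprK xX.
(* Simplicity of the matrix ring: each nonzero $Z$ generates all matrix units. *)
have delta0 (Z : M) : Z != 0 -> forall r t, exists W1 W2 : M,
    W1 *m Z *m W2 = E r t.
  case/matrix0Pn => p [q nz] r t.
  have [z [_ zZ]] := ddiv nz.
  exists (z%:M *m E r p), (E q t).
  have EZE i j : E r p *m ((Z i j)%:M *m E i j) *m E q t =
      if (p == i) && (j == q) then (Z i j)%:M *m E r t else 0.
    rewrite mulmxA -scE -!mulmxA (mulmxA (E r p)) EE.
    by case: eqP => _ /=; rewrite ?mul0mx ?mulmx0 // EE; case: eqP => _; rewrite ?mulmx0.
  rewrite -!mulmxA (mulmxA (E r p)) {1}(ME Z) mulmx_sumr mulmx_suml (bigD1 p) //=.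
  rewrite [X in _ + X]big1 ?addr0 => [|i ni]; last first.
    rewrite mulmx_sumr mulmx_suml big1 // => j _.
    by rewrite EZE eq_sym (negbTE ni).
  rewrite mulmx_sumr mulmx_suml (bigD1 q) //= EZE !eqxx big1 ?addr0 => [|j nj]; last first.
    by rewrite EZE (negbTE nj) andbF.
  by rewrite mulmxA -scalM zZ mul1mx.
have Eall0 : ~ (forall r t, Q *m E r t = 0).
  move=> h; case/negP: nQ; apply/eqP/matrixP => i j; rewrite mxE.
  have /matrixP /(_ i j) := h j j; rewrite !mxE (bigD1 j) //= !mxE !eqxx mulr1.
  by rewrite big1 ?addr0 // => l nl; rewrite !mxE (negbTE nl) mulr0.
have Eall0' : ~ (forall r t, E r t *m Q = 0).
  move=> h; case/negP: nQ; apply/eqP/matrixP => i j; rewrite mxE.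
  have /matrixP /(_ i j) := h i i; rewrite !mxE (bigD1 i) //= !mxE !eqxx mul1r.
  by rewrite big1 ?addr0 // => l nl; rewrite !mxE (negbTE nl) andbF mul0r.
(* The intertwining relation turns the annihilator of $Q$ into a two-sided ideal, so a nonzero $Z$
   would force $Q$ to kill all matrix units. *)
have Qinj (Z : M) : Q *m Z = 0 -> Z = 0.
  move=> QZ; apply/eqP; apply: contrapT => /negP nZ; apply: Eall0 => r t.
  have [W1 [W2 <-]] := delta0 _ nZ r t.
  have -> : Q *m (W1 *m Z *m W2) = s (conjtr W1) *m (Q *m Z) *m W2.
    by rewrite !mulmxA sQ conjtrK.
  by rewrite QZ mulmx0 mul0mx.
have Qinj' (Z : M) : Z *m Q = 0 -> Z = 0.
  move=> QZ; apply/eqP; apply: contrapT => /negP nZ; apply: Eall0' => r t.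
  have [W1 [W2 <-]] := delta0 _ nZ r t.
  have -> : W1 *m Z *m W2 *m Q = W1 *m (Z *m Q) *m conjtr (s W2).
    by rewrite -!mulmxA -sQ sK.
  by rewrite QZ mulmx0 mul0mx.
(* A pseudo-inverse of a matrix that can be cancelled on both sides is an inverse. *)
have [Q' QQ] := matrix_regular Q.
have QQ1 : Q *m Q' = 1%:M.
  by apply/eqP; rewrite -subr_eq0; apply/eqP/Qinj'; rewrite mulmxBl QQ mul1mx subrr.
have Q1Q : Q' *m Q = 1%:M.
  apply/eqP; rewrite -subr_eq0; apply/eqP/Qinj; rewrite mulmxBr mulmxA QQ mulmx1.
  exact: subrr.
exists Q, Q', eps; split=> // X.
by rewrite -sQ -mulmxA QQ1 mulmx1.
Qed.

End MatrixInvolution.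

(* An isomorphism of the direct factor [cc * B] with a matrix ring. *)
Record block_isom (k : rcfType) (B : pzRingType) (c : k -> B) (cc : B)
    (d : dkind) (n : nat)
    (f : B -> 'M[dring k d]_n.+1) (g : 'M[dring k d]_n.+1 -> B) : Prop := BlockIsom {
  bi_central : forall b, cc * b = b * cc;
  bi_idem : cc * cc = cc;
  bi_neq0 : cc != 0;
  bi_D : {morph f : x y / x + y};
  bi_M : forall x y, f (x * y) = f x *m f y;
  bi_1 : f 1 = 1%:M;
  bi_Z : forall a, f (c a) = (dscalar d a)%:M;
  bi_fg : forall X, f (g X) = X;
  bi_gf : forall b, g (f b) = cc * b
}.

Section Classification.
Variables (k : rcfType) (B : nzRingType) (c : k -> B) (m : nat).
Variable F : fsep_alg c m.
Variable sg : B -> B.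
Hypothesis sgD : {morph sg : x y / x + y}.
Hypothesis sgM : forall x y, sg (x * y) = sg y * sg x.
Hypothesis sgK : involutive sg.
Hypothesis sgZ : forall a, sg (c a) = c a.
Hypothesis sg_center : forall z, (forall x, z * x = x * z) -> sg z = z ->
  exists a, z = c a.

(** The product of the block idempotent and its image is a symmetric central idempotent, so $0$ or
    $1$. If it is $1$, the block is all of $B$ and [matrix_involution] applies; if it is $0$, the
    involution exchanges two complementary blocks. *)
Theorem involution_classification :
  (exists (d : dkind) (n : nat) (f : B -> 'M[dring k d]_n.+1) g
      (Psi Psi' : 'M[dring k d]_n.+1) (eps : bool),
    [/\ block_isom c 1 f g, Psi *m Psi' = 1%:M /\ Psi' *m Psi = 1%:M,
        conjtr Psi = (if eps then - Psi else Psi), eps -> ~~ is_dcomplex d &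
        forall b, f (sg b) = Psi *m conjtr (f b) *m Psi']) \/
  (exists (cc : B) (d : dkind) (n : nat) (f : B -> 'M[dring k d]_n.+1) g,
    [/\ block_isom c cc f g, sg cc = 1 - cc & ~~ is_dcomplex d]).
Proof.
have [cc [d [n [f [g [[ccC [ccK cc0]] [fD fM] [f1 fZ] fg gf]]]]]] := block_iso F.
have bi : block_isom c cc f g by split.
have [cD [cM [c1 cC]]] := (scalD F, (scalM F, (scal1 F, scalC F))).
have sg0 : sg 0 = 0 by apply: (addrI (sg 0)); rewrite -sgD !addr0.
have sg1 : sg 1 = 1 by rewrite -c1 sgZ.
have sgN x : sg (- x) = - sg x.
  by apply: (addrI (sg x)); rewrite -sgD !subrr sg0.
have sgC z : (forall x, z * x = x * z) -> forall x, sg z * x = x * sg z.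
  by move=> h x; rewrite -[x]sgK -!sgM h.
have f0 : f 0 = 0 by apply: (addrI (f 0)); rewrite -fD !addr0.
have idem01 z a : z = c a -> z * z = z -> z = 0 \/ z = 1.
  move=> -> h; have [a0|na] := eqVneq a 0.
    by left; rewrite a0 (fsep_scal0 F).
  right; have -> : c a = c a^-1 * (c a * c a) by rewrite mulrA -cM mulVf // c1 mul1r.
  by rewrite h -cM mulVf.
have sccC := sgC _ ccC.
have [p0|p1] : cc * sg cc = 0 \/ cc * sg cc = 1.
- have [a ea] : exists a, cc * sg cc = c a.
    apply: sg_center => [x|]; last by rewrite sgM sgK.
    by rewrite -mulrA sccC mulrA ccC -mulrA.
  apply: (idem01 _ a) => //.
  by rewrite mulrA -(mulrA cc) sccC (mulrA cc cc) ccK -mulrA -sgM ccK.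
- right.
  have sccE : sg cc = 1 - cc.
    have [a ea] : exists a, cc + sg cc = c a.
      apply: sg_center => [x|]; last by rewrite sgD sgK addrC.
      by rewrite mulrDl mulrDr ccC sccC.
    have p0' : sg cc * cc = 0 by rewrite sccC p0.
    have [h|h] : cc + sg cc = 0 \/ cc + sg cc = 1.
      apply: (idem01 _ a) => //.
      by rewrite mulrDl !mulrDr ccK p0 p0' -sgM ccK addr0 add0r.
    - have := congr1 ( *%R cc) h; rewrite mulrDr mulr0 ccK p0 addr0 => cc_0.
      by move: cc0; rewrite cc_0 eqxx.
    by rewrite -h addrC addKr.
  (* If $D$ were complex, let $z$ be $i$ in the block. Then $z + \sigma(z)$ is symmetric and
     central, hence a real scalar, but its component in the block is $i$. *)
  exists cc, d, n, f, g; split=> //; apply/negP => dC.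
  have [x [xC [_ xx]]] := dcomplex_imag k dC.
  pose z := g x%:M.
  have ccz : cc * z = z by rewrite -gf /z fg.
  have kerf y : f y = 0 -> cc * y = 0.
    by move=> h; rewrite -gf h -f0 gf mulr0.
  have fN y : f (- y) = - f y by apply: (addrI (f y)); rewrite -fD !subrr f0.
  have zC y : z * y = y * z.
    apply/eqP; rewrite -subr_eq0.
    have <- : cc * (z * y - y * z) = z * y - y * z.
      by rewrite mulrBr mulrA ccz mulrA ccC -mulrA ccz.
    apply/eqP/kerf.
    rewrite fD fN !fM /z fg; apply/eqP; rewrite subr_eq0; apply/eqP/matrixP => i j.
    rewrite mul_scalar_mx !mxE (bigD1 j) //= !mxE eqxx mulr1n xC big1 ?addr0 // => l nl.
    by rewrite !mxE (negbTE nl) mulr0n mulr0.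
  have [a ea] : exists a, z + sg z = c a.
    apply: sg_center => [y|]; last by rewrite sgD sgK addrC.
    by rewrite mulrDl mulrDr zC (sgC _ zC).
  have fcc : f cc = 1%:M by rewrite -[cc]mulr1 -gf fg f1.
  have fsz : f (sg z) = 0.
    by rewrite -ccz sgM sccE fM fD fN f1 fcc subrr mulmx0.
  move/(congr1 f): ea; rewrite fD fsz addr0 /z fg fZ => /matrixP /(_ 0 0).
  rewrite !mxE !mulr1n => xa.
  move/(congr1 (@dre k d)): xx; rewrite xa -dscalarM dre_scalar.
  rewrite -(dscalar1 k d) -dscalarN dre_scalar => aa.
  by have := sqr_ge0 a; rewrite expr2 aa oppr_ge0 ler10.
left.
have cc1 : cc = 1 by rewrite -[cc]mulr1 -p1 mulrA ccK.
rewrite cc1 in bi gf; have {}gf b : g (f b) = b by rewrite gf mul1r.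
pose s X := f (sg (g X)).
have gD X Y : g (X + Y) = g X + g Y.
  by rewrite -{1}[X]fg -{1}[Y]fg -fD gf.
have gM X Y : g (X *m Y) = g X * g Y.
  by rewrite -{1}[X]fg -{1}[Y]fg -fM gf.
have [||||||Psi [Psi' [eps [PP P'P hP ce sP]]]] := @matrix_involution k d n s.
- by move=> X Y; rewrite /s gD sgD fD.
- by move=> X Y; rewrite /s gM sgM fM.
- by move=> X; rewrite /s gf sgK fg.
- by move=> a; rewrite /s -fZ gf sgZ fZ.
- move=> X; have [y yP] := von_neumann_regular F (g X).
  by exists (f y); rewrite -[X in RHS]fg -yP !fM !fg.
- move=> Z ZC sZ; have [a ea] : exists a, g Z = c a.
    apply: sg_center => [x|]; first by rewrite -[x]gf -!gM ZC.
    by rewrite -[LHS]gf -/(s Z) sZ.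
  by exists a; rewrite -fZ -ea fg.
exists d, n, f, g, Psi, Psi', eps; split=> // b.
by rewrite -sP /s gf.
Qed.

End Classification.

(** * Existence of Morita data outside the nil orderings *)

(* A faithful representation of the matrices over [dring k d] on a complex
   vector space, for which [J] turns the conjugate transpose into a transpose. *)
Record complex_model (k : rcfType) (d : dkind) (n N : nat)
    (Phi : 'M[dring k d]_n.+1 -> 'M[k[i]]_N.+1) (J J' : 'M[k[i]]_N.+1) (eta : k[i]) :
    Prop := ComplexModel {
  cm_D : {morph Phi : X Y / X + Y};
  cm_M : forall X Y, Phi (X *m Y) = Phi X *m Phi Y;
  cm_1 : Phi 1%:M = 1%:M;
  cm_Z : forall x, Phi (dscalar d x)%:M = (real_complex k x)%:M;
  cm_J : J *m J' = 1%:M /\ J' *m J = 1%:M;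
  cm_Jt : J^T = eta *: J;
  cm_adj : forall X, Phi (conjtr X) = J *m (Phi X)^T *m J';
  cm_surj : forall Y, exists X1 X2, Y = Phi X1 + 'i%C *: Phi X2;
  cm_inj : forall X1 X2, Phi X1 + 'i%C *: Phi X2 = 0 -> X1 = 0 /\ X2 = 0
}.

Lemma real_complexE (k : rcfType) (z : k[i]) :
  z = real_complex k (complex.Re z) + 'i%C * real_complex k (complex.Im z).
Proof. by case: z => a b; apply/eqP; rewrite eq_complex /=; apply/andP; split; apply/eqP; ring. Qed.

Lemma real_model (k : rcfType) n :
  @complex_model k DReal n n (fun X => map_mx (real_complex k) (X : 'M[k]_n.+1)) 1%:M 1%:M 1.
Proof.
split=> //=.
- by move=> X Y; rewrite map_mxD.
- by move=> X Y; rewrite map_mxM.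
- by rewrite map_mx1.
- by move=> x; rewrite map_scalar_mx.
- by rewrite mulmx1.
- by rewrite trmx1 scale1r.
- by move=> X; rewrite mul1mx mulmx1; apply/matrixP => i j; rewrite !mxE.
- move=> Y; exists (map_mx (@complex.Re k) Y), (map_mx (@complex.Im k) Y).
  by apply/matrixP => i j; rewrite !mxE -real_complexE.
move=> X1 X2 /matrixP h; split; apply/matrixP => i j; have := h i j; rewrite !mxE.
  by case; rewrite !(mul0r, mulr0, mul1r, subr0, addr0).
by case; rewrite !(mul0r, mulr0, mul1r, add0r, addr0).
Qed.

Section QuatModel.
Variables (k : rcfType) (n : nat).
Local Notation M := 'M[quat k]_n.+1.
Local Notation conjm := (map_mx (@conjc k)).
Let qu (x : quat k) : k[i] := Complex x.1.1.1 x.1.1.2.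
Let qv (x : quat k) : k[i] := Complex x.1.2 x.2.

(** Writing a quaternion as $u + vj$ with complex $u, v$ gives the usual embedding into $2 \times 2$
    complex matrices. *)
Definition quat_rep (X : M) : 'M[k[i]]_(n.+1 + n.+1) :=
  block_mx (map_mx qu X) (map_mx qv X) (- conjm (map_mx qv X)) (conjm (map_mx qu X)).

(** The standard alternating form, under which quaternionic conjugate transposition becomes the
    transpose. *)
Definition quat_J : 'M[k[i]]_(n.+1 + n.+1) := block_mx 0 1%:M (- 1%:M) 0.

Let quE x y : qu (x + y) = qu x + qu y. Proof. by []. Qed.
Let qvE x y : qv (x + y) = qv x + qv y. Proof. by []. Qed.
Let conjmK (X : 'M[k[i]]_n.+1) : conjm (conjm X) = X.
Proof. by apply/matrixP => i j; rewrite !mxE conjcK. Qed.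
Let conjmM (X Y : 'M[k[i]]_n.+1) : conjm (X *m Y) = conjm X *m conjm Y.
Proof. exact: map_mxM. Qed.
Let conjmD (X Y : 'M[k[i]]_n.+1) : conjm (X + Y) = conjm X + conjm Y.
Proof. exact: map_mxD. Qed.
Let conjmN (X : 'M[k[i]]_n.+1) : conjm (- X) = - conjm X.
Proof. exact: map_mxN. Qed.

Let quM (X Y : M) : map_mx qu (X *m Y) =
  map_mx qu X *m map_mx qu Y - map_mx qv X *m conjm (map_mx qv Y).
Proof.
apply/matrixP => i j; rewrite !mxE (big_morph qu quE (id1 := 0)) //.
rewrite -sumrB; apply: eq_bigr => l _; rewrite !mxE.
case: (X i l) => [[[x1 x2] x3] x4]; case: (Y l j) => [[[y1 y2] y3] y4].
by rewrite /qu /qv /=; apply/eqP; rewrite eq_complex /=; apply/andP; split; apply/eqP; ring.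
Qed.
Let qvM (X Y : M) : map_mx qv (X *m Y) =
  map_mx qu X *m map_mx qv Y + map_mx qv X *m conjm (map_mx qu Y).
Proof.
apply/matrixP => i j; rewrite !mxE (big_morph qv qvE (id1 := 0)) //.
rewrite -big_split; apply: eq_bigr => l _ /=; rewrite !mxE.
case: (X i l) => [[[x1 x2] x3] x4]; case: (Y l j) => [[[y1 y2] y3] y4].
by rewrite /qu /qv /=; apply/eqP; rewrite eq_complex /=; apply/andP; split; apply/eqP; ring.
Qed.

Let qmx (U V : 'M[k[i]]_n.+1) : M :=
  \matrix_(i, j) (complex.Re (U i j), complex.Im (U i j),
                  complex.Re (V i j), complex.Im (V i j)).
Let quK U V : map_mx qu (qmx U V) = U.
Proof. by apply/matrixP => i j; rewrite !mxE /qu /=; case: (U i j). Qed.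
Let qvK U V : map_mx qv (qmx U V) = V.
Proof. by apply/matrixP => i j; rewrite !mxE /qv /=; case: (V i j). Qed.
Let q_eq0 (X : M) : map_mx qu X = 0 -> map_mx qv X = 0 -> X = 0.
Proof.
move=> /matrixP hu /matrixP hv; apply/matrixP => i j.
have := hu i j; have := hv i j; rewrite !mxE /qu /qv.
by case: (X i j) => [[[x1 x2] x3] x4] /= [-> ->] [-> ->].
Qed.

Lemma quat_model :
  @complex_model k DQuat n (n + n.+1) quat_rep quat_J (- quat_J) (- 1).
Proof.
have qu1 : map_mx qu (1%:M : M) = 1%:M.
  by apply/matrixP => i j; rewrite !mxE; case: eqP.
have qv1 : map_mx qv (1%:M : M) = 0.
  by apply/matrixP => i j; rewrite !mxE; case: eqP.
have JJ : quat_J *m quat_J = - 1%:M.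
  rewrite /quat_J mulmx_block !(mul0mx, mulmx0, mul1mx, mulmx1, add0r, addr0).
  by rewrite [in RHS]scalar_mx_block opp_block_mx oppr0.
have two : (2%:R : k[i]) != 0 by rewrite pnatr_eq0.
have ii : 'i%C * 'i%C = -1 :> k[i].
  by apply/eqP; rewrite eq_complex /=; apply/andP; split; apply/eqP; ring.
have hD : {morph quat_rep : X Y / X + Y}.
  move=> X Y; rewrite /quat_rep add_block_mx.
  have -> : map_mx qu (X + Y) = map_mx qu X + map_mx qu Y.
    by apply/matrixP => i j; rewrite !mxE.
  have -> : map_mx qv (X + Y) = map_mx qv X + map_mx qv Y.
    by apply/matrixP => i j; rewrite !mxE.
  by rewrite !conjmD opprD.
have hM : forall X Y, quat_rep (X *m Y) = quat_rep X *m quat_rep Y.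
  move=> X Y; rewrite /quat_rep mulmx_block quM qvM !conjmD conjmN !conjmM !conjmK.
  rewrite !mulmxN !mulNmx; congr block_mx; first by rewrite opprD addrC.
  by rewrite addrC.
have h1 : quat_rep 1%:M = 1%:M.
  rewrite /quat_rep qu1 qv1 [RHS]scalar_mx_block; congr block_mx.
    by rewrite map_mx0 oppr0.
  by rewrite map_mx1.
have hZ : forall x, quat_rep (quat_scalar x)%:M = (real_complex k x)%:M.
  move=> x; rewrite [RHS]scalar_mx_block /quat_rep.
  have -> : map_mx qu ((quat_scalar x)%:M : M) = (real_complex k x)%:M.
    by apply/matrixP => i j; rewrite !mxE; case: eqP.
  have -> : map_mx qv ((quat_scalar x)%:M : M) = 0.
    by apply/matrixP => i j; rewrite !mxE; case: eqP.
  congr block_mx; first by rewrite map_mx0 oppr0.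
  by rewrite map_scalar_mx /= oppr0.
have hJ : quat_J *m - quat_J = 1%:M.
  by rewrite mulmxN JJ opprK.
have hJt : quat_J^T = - 1 *: quat_J.
  rewrite /quat_J tr_block_mx !trmx0 trmx1 raddfN /= trmx1 scaleN1r opp_block_mx.
  by rewrite oppr0 opprK.
have JX (a b e f : 'M[k[i]]_n.+1) : quat_J *m block_mx a b e f = block_mx e f (- a) (- b).
  by rewrite /quat_J mulmx_block !mul0mx !mulNmx !mul1mx !add0r !addr0.
have XJ (a b e f : 'M[k[i]]_n.+1) : block_mx a b e f *m - quat_J = block_mx b (- a) f (- e).
  rewrite /quat_J opp_block_mx mulmx_block !oppr0 opprK !mulmx0 !mulmxN !mulmx1.
  by rewrite !add0r !addr0.
have hadj : forall X : M, quat_rep (conjtr (X : 'M[dring k DQuat]_n.+1) : M) =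
    quat_J *m (quat_rep X)^T *m - quat_J.
  move=> X; rewrite /quat_rep tr_block_mx JX XJ.
  have -> : map_mx qu (conjtr (X : 'M[dring k DQuat]_n.+1) : M) = (conjm (map_mx qu X))^T.
    by apply/matrixP => i j; rewrite !mxE; case: (X j i) => [[[x1 x2] x3] x4].
  have -> : map_mx qv (conjtr (X : 'M[dring k DQuat]_n.+1) : M) = - (map_mx qv X)^T.
    by apply/matrixP => i j; rewrite !mxE; case: (X j i) => [[[x1 x2] x3] x4].
  rewrite conjmN opprK raddfN /= opprK; congr block_mx.
    by apply/matrixP => i j; rewrite !mxE.
  by apply/matrixP => i j; rewrite !mxE conjcK opprK.
have repq U V : quat_rep (qmx U V) = block_mx U V (- conjm V) (conjm U).
  by rewrite /quat_rep quK qvK.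
have repD U V U' V' : quat_rep (qmx U V) + 'i%C *: quat_rep (qmx U' V') =
    block_mx (U + 'i%C *: U') (V + 'i%C *: V') (- conjm V + 'i%C *: - conjm V')
      (conjm U + 'i%C *: conjm U').
  by rewrite !repq scale_block_mx add_block_mx.
have hS : forall Y : 'M[k[i]]_(n.+1 + n.+1), exists X1 X2, Y = quat_rep X1 + 'i%C *: quat_rep X2.
  move=> Y; rewrite -[Y]submxK; set P := ulsubmx _; set Q := ursubmx _.
  set S := dlsubmx _; set T := drsubmx _.
  pose h : k[i] := 2%:R^-1.
  have hh X : h *: (X + X) = X :> 'M[k[i]]_n.+1.
    by rewrite -mulr2n -scaler_nat scalerA mulVf // scale1r.
  have ih X : 'i%C *: (- ('i%C * h) *: X) = h *: X :> 'M[k[i]]_n.+1.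
    by rewrite scalerA mulrN mulrA ii mulN1r opprK.
  have ci (X : 'M[k[i]]_n.+1) : conjm (- ('i%C * h) *: X) = ('i%C * h) *: conjm X.
    rewrite map_mxZ; congr (_ *: _); rewrite /h.
    rewrite rmorphN rmorphM fmorphV rmorph_nat -mulNr; congr (_ * _).
    by apply/eqP; rewrite eq_complex /=; apply/andP; split; apply/eqP; ring.
  have ch (X : 'M[k[i]]_n.+1) : conjm (h *: X) = h *: conjm X.
    by rewrite map_mxZ /h fmorphV rmorph_nat.
  have iih X : 'i%C *: (('i%C * h) *: X) = - (h *: X) :> 'M[k[i]]_n.+1.
    by rewrite scalerA mulrA ii mulN1r scaleNr.
  (* These are the real and imaginary parts of [Y] for the antilinear involution that exchanges $P$
     with $\bar T$ and $Q$ with $-\bar S$; its fixed points are the image of [quat_rep]. *)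
  exists (qmx (h *: (P + conjm T)) (h *: (Q - conjm S))).
  exists (qmx (- ('i%C * h) *: (P - conjm T)) (- ('i%C * h) *: (Q + conjm S))).
  rewrite repD; congr block_mx.
  - by rewrite ih -scalerDr addrACA subrr addr0 hh.
  - by rewrite ih -scalerDr addrACA addNr addr0 hh.
  - rewrite scalerN ch ci iih opprK !conjmD conjmN !conjmK -scalerN -scalerDr.
    by rewrite opprB addrA subrK hh.
  rewrite ch ci iih !conjmD conjmN !conjmK -scalerN -scalerDr.
  by rewrite opprB addrC addrA subrK hh.
have hI : forall X1 X2, quat_rep X1 + 'i%C *: quat_rep X2 = 0 -> X1 = 0 /\ X2 = 0.
  move=> X1 X2; rewrite /quat_rep scale_block_mx add_block_mx.
  move=> h0; have := etrans h0 (esym (block_mx0 _ n.+1 n.+1 n.+1 n.+1)).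
  move=> /eq_block_mx [e1 e2 e3 e4].
  have half (X : 'M[k[i]]_n.+1) : X + X = 0 -> X = 0.
    rewrite -mulr2n -scaler_nat => /eqP; rewrite scaler_eq0 (negbTE two) /=.
    by move/eqP.
  have ci (X : 'M[k[i]]_n.+1) : conjm ('i%C *: X) = - ('i%C *: conjm X).
    rewrite map_mxZ -scaleNr; congr (_ *: _).
    by apply/eqP; rewrite eq_complex /=; apply/andP; split; apply/eqP; ring.
  have split0 (U V : 'M[k[i]]_n.+1) : U + 'i%C *: V = 0 -> conjm U + 'i%C *: conjm V = 0 ->
      U = 0 /\ V = 0.
    move=> a1 /(congr1 (map_mx (@conjc k))); rewrite conjmD ci !conjmK map_mx0 => a2.
    have U0 : U = 0.
      by apply: half; have := congr2 +%R a1 a2; rewrite addrACA subrr !addr0.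
    move: a1; rewrite U0 add0r => /eqP; rewrite scaler_eq0 => /orP [|/eqP //].
    by rewrite eq_complex /= oner_eq0 andbF.
  have [u1 u2] := split0 _ _ e1 e4.
  have [v1 v2] : map_mx qv X1 = 0 /\ map_mx qv X2 = 0.
    apply: (split0 _ _ e2); apply/eqP; rewrite -oppr_eq0 opprD -scalerN; apply/eqP; exact: e3.
  by split; apply: q_eq0.
split=> //; first by split=> //; rewrite mulNmx -mulmxN.
Qed.

End QuatModel.

Section NilOrDatum.
Variables (R : comNzRingType) (A : algType R) (sigma : {linear A -> A}).
Hypothesis invS : is_involution sigma.
Variables (alpha : sper R) (k : real_closure alpha).
Local Notation rho := (to_rc k).
Local Notation B := (bc_alg A rho).
Local Notation c := (bc_scalar A rho).
Local Notation inv := (bc_inv sigma (rho := rho)).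

Lemma bc_classification m (F : fsep_alg (fun r : R => r%:A : A) m) :
  injective (fun r : R => r%:A : A) ->
  (forall z : A,
    (exists r : R, z = r%:A) <-> ((forall a, z * a = a * z) /\ sigma z = z)) ->
  (exists t : R, 2%:R * t = 1) ->
  (exists (d : dkind) (n : nat) (f : B -> 'M[dring k d]_n.+1) g
      (Psi Psi' : 'M[dring k d]_n.+1) (eps : bool),
    [/\ block_isom c 1 f g, Psi *m Psi' = 1%:M /\ Psi' *m Psi = 1%:M,
        conjtr Psi = (if eps then - Psi else Psi), eps -> ~~ is_dcomplex d &
        forall b, f (inv b) = Psi *m conjtr (f b) *m Psi']) \/
  (exists (cc : B) (d : dkind) (n : nat) (f : B -> 'M[dring k d]_n.+1) g,
    [/\ block_isom c cc f g, inv cc = 1 - cc & ~~ is_dcomplex d]).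
Proof.
move=> sinj scen two.
have ci := bc_scalar_inj (rho := rho) F invS sinj scen two.
have nz : (1 : B) != 0.
  apply/eqP => h; have : c 1 = c 0.
    have c0 : c 0 = 0 by apply: (addrI (c 0)); rewrite -bc_scalarD !addr0.
    by rewrite c0 -h.
  by move/ci/eqP; rewrite oner_eq0.
pose B' : nzRingType := HB.pack B (GRing.PzSemiRing_isNonZero.Build B nz).
have [F' _] := bc_fsep rho F.
apply: (@involution_classification k B' c m F' inv).
- exact: bc_invD.
- exact: bc_invM.
- exact: bc_invK.
- exact: bc_inv_scalar.
- exact: (bc_sym_center F).
Qed.

Lemma block_isom_datum d n (f : B -> 'M[dring k d]_n.+1) g Psi Psi' :
  block_isom c 1 f g -> Psi *m Psi' = 1%:M -> Psi' *m Psi = 1%:M ->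
  conjtr Psi = Psi -> (forall b, f (inv b) = Psi *m conjtr (f b) *m Psi') ->
  inhabited (morita_datum sigma k).
Proof.
move=> bi PP P'P hP fS; constructor.
pose fm : {rmorphism B -> 'M[dring k d]_n.+1} := HB.pack f
  (GRing.isNmodMorphism.Build _ _ f
     (conj (addrI (f 0) (etrans (esym (bi_D bi 0 0)) (etrans (congr1 f (addr0 0)) (esym (addr0 (f 0)))))) (bi_D bi)))
  (GRing.isMonoidMorphism.Build _ _ f (conj (bi_1 bi) (bi_M bi))).
apply: (@MoritaDatum R A sigma alpha k d n fm g _ _ _ Psi Psi' PP P'P hP fS).
- by move=> b; rewrite /= (bi_gf bi) mul1r.
- exact: (bi_fg bi).
- exact: (bi_Z bi).
Qed.

Lemma block_isom_matrix_over d n (f : B -> 'M[dring k d]_n.+1) g :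
  block_isom c 1 f g -> matrix_over A k d.
Proof.
move=> bi.
pose fm : {rmorphism B -> 'M[dring k d]_n.+1} := HB.pack f
  (GRing.isNmodMorphism.Build _ _ f
     (conj (addrI (f 0) (etrans (esym (bi_D bi 0 0)) (etrans (congr1 f (addr0 0)) (esym (addr0 (f 0)))))) (bi_D bi)))
  (GRing.isMonoidMorphism.Build _ _ f (conj (bi_1 bi) (bi_M bi))).
exists n, fm; split; last exact: (bi_Z bi).
by exists g => x; [rewrite /= (bi_gf bi) mul1r|exact: (bi_fg bi)].
Qed.

End NilOrDatum.

Section Nil.
Variables (R : comNzRingType) (A : algType R) (sigma : {linear A -> A}).
Hypothesis invS : is_involution sigma.
Variables (alpha : sper R) (k : real_closure alpha).
Local Notation rho := (to_rc k).
Local Notation rhoC := (to_rcC k).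
Local Notation B := (bc_alg A rho).
Local Notation C := (bc_alg A rhoC).
Local Notation c := (bc_scalar A rho).
Local Notation cC := (bc_scalar A rhoC).
Local Notation tn a z := (tens (a : A) (z : via rho) : B).
Local Notation tC a z := (tens (a : A) (z : via rhoC) : C).
Local Notation inv := (bc_inv sigma (rho := rho)).
Local Notation invC := (bc_inv sigma (rho := rhoC)).

(** Extending [f] to complex coefficients turns $\sigma$ into the adjoint of a bilinear form. Its
    symmetry is that of [J] times $-1$, because [Psi] is skew; hence the type $-\eta$. *)
Lemma block_isom_adjoint d n N (f : B -> 'M[dring k d]_n.+1) g Psi Psi' Phi J J' eta :
  block_isom c 1 f g -> Psi *m Psi' = 1%:M -> Psi' *m Psi = 1%:M ->
  conjtr Psi = - Psi -> (forall b, f (inv b) = Psi *m conjtr (f b) *m Psi') ->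
  @complex_model (rc_field k) d n N Phi J J' eta -> eta * eta = 1 ->
  adjoint_type sigma (k := k) (- eta).
Proof.
move=> bi PP P'P hP fS cm ee.
have [JJ J'J] := cm_J cm.
pose h (a : A) (z : via rhoC) : 'M[k[i]]_N.+1 := (z : k[i]) *: Phi (f (tn a 1)).
have Phi0 : Phi 0 = 0 by apply: (addrI (Phi 0)); rewrite -(cm_D cm) !addr0.
have fr r a : f (tn (r *: a) 1) = (dscalar d (rho r))%:M *m f (tn a 1).
  by rewrite bc_tensZ mulr1 bc_tensE (bi_M bi) (bi_Z bi).
have bal : balanced h.
  split=> [a a' z|a z z'|r a z]; rewrite /h.
  - by rewrite bc_tensDl (bi_D bi) (cm_D cm) scalerDr.
  - by rewrite scalerDl.
  rewrite fr (cm_M cm) (cm_Z cm) mul_scalar_mx scalerA; congr (_ *: _).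
  exact: mulrC.
pose H (t : C) : 'M[k[i]]_N.+1 := tlift h t.
have HD : {morph H : t u / t + u} by move=> t u; exact: (tliftD bal).
have HE a z : H (tC a z) = (z : k[i]) *: Phi (f (tn a 1)) by exact: (tliftE bal).
have H0 : H 0 = 0 by exact: (tlift0 bal).
have HM t u : H (t * u) = H t *m H u.
  elim/bc_ind: t => [|t t' IHt IHt'|a y]; first by rewrite mul0r H0 mul0mx.
    by rewrite mulrDl !HD IHt IHt' mulmxDl.
  elim/bc_ind: u => [|u u' IHu IHu'|b z]; first by rewrite mulr0 H0 mulmx0.
    by rewrite mulrDr !HD IHu IHu' mulmxDr.
  rewrite bc_tensM !HE -scalemxAl -scalemxAr scalerA -(cm_M cm) -(bi_M bi).
  by rewrite bc_tensM mulr1.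
have H1 : H 1 = 1%:M by rewrite HE scale1r (bi_1 bi) (cm_1 cm).
have HZ z : H (cC z) = z%:M.
  by rewrite HE (bi_1 bi) (cm_1 cm) scalemx1.
pose Hm : {rmorphism C -> 'M[k[i]]_N.+1} := HB.pack H
  (GRing.isNmodMorphism.Build _ _ H (conj H0 HD))
  (GRing.isMonoidMorphism.Build _ _ H (conj H1 HM)).
have [j [jD jE]] : exists j : B -> C, {morph j : x y / x + y} /\
    forall a x, j (tn a x) = tC a (real_complex (rc_field k) x).
  have balj : balanced (fun (a : A) (x : via rho) => tC a (real_complex (rc_field k) x)).
    split=> [a a' x|a x x'|r a x]; first by rewrite bc_tensDl.
      by rewrite rmorphD bc_tensDr.
    rewrite bc_tensZ; congr (tens _ _).
    exact: (esym (rmorphM (real_complex (rc_field k)) (rho r) x)).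
  exists (fun t : B => tlift (fun (a : A) (x : via rho) => tC a (real_complex (rc_field k) x)) t).
  by split=> [t u|a x]; [exact: (tliftD balj)|exact: (tliftE balj)].
have j0 : j 0 = 0 by apply: (addrI (j 0)); rewrite -jD !addr0.
have f0 : f 0 = 0 by apply: (addrI (f 0)); rewrite -(bi_D bi) !addr0.
have Hj t : H (j t) = Phi (f t).
  elim/bc_ind: t => [|t u IHt IHu|a x]; first by rewrite j0 H0 f0 Phi0.
    by rewrite jD HD IHt IHu (bi_D bi) (cm_D cm).
  rewrite jE HE [tn a x]bc_tensE (bi_M bi) (bi_Z bi) (cm_M cm) (cm_Z cm).
  by rewrite mul_scalar_mx.
have HCZ z t : H (cC z * t) = z *: H t by rewrite HM HZ mul_scalar_mx.
have dec t : exists t1 t2, t = j t1 + cC 'i%C * j t2.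
  elim/bc_ind: t => [|t u [t1 [t2 ->]] [u1 [u2 ->]]|a z].
  - by exists 0, 0; rewrite j0 mulr0 addr0.
  - by exists (t1 + u1), (t2 + u2); rewrite !jD mulrDr addrACA.
  exists (tn a (complex.Re z)), (tn a (complex.Im z)).
  by rewrite !jE /bc_scalar bc_tensM mul1r -bc_tensDr -real_complexE.
have fI b : f b = 0 -> b = 0.
  by move=> e; rewrite -[b]mul1r -(bi_gf bi) e -f0 (bi_gf bi) mulr0.
have Hinj t : H t = 0 -> t = 0.
  have [t1 [t2 ->]] := dec t; rewrite HD HCZ !Hj => /(cm_inj cm) [/fI -> /fI ->].
  by rewrite j0 mulr0 addr0.
have HN t : H (- t) = - H t by apply: (addrI (H t)); rewrite -HD !subrr.
have Hinj2 : injective H.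
  move=> t u e; apply/eqP; rewrite -subr_eq0; apply/eqP/Hinj.
  by rewrite HD HN e subrr.
have Hsurj Y : exists t, H t = Y.
  have [X1 [X2 ->]] := cm_surj cm Y.
  by exists (j (g X1) + cC 'i%C * j (g X2)); rewrite HD HCZ !Hj !(bi_fg bi).
have /choice [Hi HiP] := Hsurj.
(* In the complex model $\sigma$ reads $Y \mapsto WY^tW'$, so [W'] is the Gram matrix required by
   [adjoint_type]. *)
pose W := Phi Psi *m J; pose W' := J' *m Phi Psi'.
have WW : W *m W' = 1%:M.
  rewrite /W /W' mulmxA -(mulmxA (Phi Psi)) JJ mulmx1 -(cm_M cm) PP.
  exact: (cm_1 cm).
have W'W : W' *m W = 1%:M.
  rewrite /W /W' mulmxA -(mulmxA J') -(cm_M cm) P'P (cm_1 cm) mulmx1.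
  exact: J'J.
have [uW' _] := mulmx1_unit W'W.
have iW : invmx W' = W.
  by rewrite -[LHS]mulmx1 -W'W (mulKmx uW').
have PhiN X : Phi (- X) = - Phi X.
  by apply: (addrI (Phi X)); rewrite -(cm_D cm) !subrr.
have Wt : W^T = - eta *: W.
  have e1 : (Phi Psi)^T = J' *m Phi (conjtr Psi) *m J.
    by rewrite (cm_adj cm) !mulmxA J'J mul1mx -mulmxA J'J mulmx1.
  rewrite /W trmx_mul e1 hP PhiN (cm_Jt cm) mulmxN !mulNmx mulmxN.
  by rewrite -!scalemxAl !mulmxA JJ mul1mx scaleNr.
have W't : W'^T = - eta *: W'.
  have ne : - eta != 0.
    rewrite oppr_eq0; apply: contra_eqN ee => /eqP ->.
    by rewrite mul0r eq_sym oner_eq0.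
  have e2 : W'^T *m W^T = 1%:M by rewrite -trmx_mul WW trmx1.
  rewrite Wt -scalemxAr in e2.
  rewrite -[LHS]mulmx1 -WW mulmxA -[W'^T *m W]scale1r.
  have -> : 1 = (- eta) * (- eta) :> k[i] by rewrite mulrNN ee.
  by rewrite -scalerA e2 -scalemxAl mul1mx.
exists N, Hm, W'; split => //.
- by exists Hi => t; [apply: Hinj2; rewrite HiP|exact: HiP].
move=> t; rewrite iW /=; elim/bc_ind: t => [|t u IHt IHu|a z].
- by rewrite bc_inv0 H0 trmx0 mulmx0 mul0mx.
- by rewrite bc_invD !HD IHt IHu linearD mulmxDr mulmxDl.
rewrite bc_invE !HE linearZ /= -scalemxAr -scalemxAl; congr (_ *: _).
have -> : tn (sigma a) 1 = inv (tn a 1) by rewrite bc_invE.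
by rewrite fS !(cm_M cm) (cm_adj cm) /W /W' !mulmxA.
Qed.

(** Transposition is orthogonal, so a skew twist of it over $k$ is symplectic. Quaternionic
    conjugate transposition is symplectic, so a skew twist of it is orthogonal. These are the nil
    cases of the first kind. *)
Lemma block_isom_skew_nil d n (f : B -> 'M[dring k d]_n.+1) g Psi Psi' :
  block_isom c 1 f g -> Psi *m Psi' = 1%:M -> Psi' *m Psi = 1%:M ->
  conjtr Psi = - Psi -> ~~ is_dcomplex d ->
  (forall b, f (inv b) = Psi *m conjtr (f b) *m Psi') ->
  nil_ordering sigma k.
Proof.
case: d f g Psi Psi' => //= f g Psi Psi' bi PP P'P hP _ fS.
  apply: Or32; split; last exact: block_isom_matrix_over bi.
  apply: block_isom_adjoint bi PP P'P hP fS (real_model (rc_field k) n) _.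
  exact: mulr1.
apply: Or31; split; last exact: block_isom_matrix_over bi.
rewrite /orthogonal_type -[1]opprK.
apply: block_isom_adjoint bi PP P'P hP fS (quat_model (rc_field k) n) _.
by rewrite mulrNN mulr1.
Qed.

(** The map $b \mapsto (f(b), \overline{f(\sigma b)}^t)$ is an isomorphism onto matrices over $D
    \times D$: the conjugate transpose makes the second component multiplicative, and it sees the
    block exchanged with the first. *)
Lemma block_isom_double_nil cc d n (f : B -> 'M[dring k d]_n.+1) g :
  block_isom c cc f g -> inv cc = 1 - cc -> ~~ is_dcomplex d ->
  nil_ordering sigma k.
Proof.
move=> bi sc nd.
have cc_ne : inv cc <> cc.
  rewrite sc => h; have := congr1 ( *%R cc) h.
  rewrite mulrBr mulr1 (bi_idem bi) subrr => /esym e.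
  by have := bi_neq0 bi; rewrite e eqxx.
apply: Or33; split; first by exists cc; split=> // t; exact: (bi_central bi).
suff dbl : matrix_over_double A k d by case: d nd f g bi dbl => // _ f g bi dbl; [left|right].
pose D2 : nzRingType := (dring k d * dring k d)%type.
pose f2 b : 'M[D2]_n.+1 := \matrix_(i, j) (f b i j, conjtr (f (inv b)) i j).
have f0 : f 0 = 0 by apply: (addrI (f 0)); rewrite -(bi_D bi) !addr0.
have fst_sum (I : Type) (r : seq I) (G : I -> D2) :
  \sum_(i <- r) G i = (\sum_(i <- r) (G i).1, \sum_(i <- r) (G i).2).
  by elim: r => [|i r IHr]; rewrite ?big_nil // !big_cons IHr.
have f2D : {morph f2 : x y / x + y}.
  move=> x y; apply/matrixP => i j.
  by rewrite !mxE (bi_D bi) bc_invD (bi_D bi) !mxE dconjD.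
have f20 : f2 0 = 0 by apply: (addrI (f2 0)); rewrite -f2D !addr0.
have f21 : f2 1 = 1%:M.
  apply/matrixP => i j; rewrite !mxE bc_inv_scalar // (bi_1 bi) !mxE eq_sym.
  by case: eqP => _; rewrite ?dconj1 ?dconj0.
have f2M x y : f2 (x * y) = f2 x *m f2 y.
  have f2E b i j : f2 b i j = (f b i j, conjtr (f (inv b)) i j) by rewrite mxE.
  apply/matrixP => i j; rewrite f2E bc_invM // !(bi_M bi) conjtrM.
  rewrite [in RHS]mxE fst_sum; congr (_, _).
    by rewrite mxE; apply: eq_bigr => l _; rewrite !f2E.
  by rewrite mxE; apply: eq_bigr => l _; rewrite !f2E.
pose fm : {rmorphism B -> 'M[D2]_n.+1} := HB.pack f2
  (GRing.isNmodMorphism.Build _ _ f2 (conj f20 f2D))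
  (GRing.isMonoidMorphism.Build _ _ f2 (conj f21 f2M)).
exists n, fm; split; last first.
  move=> x; apply/matrixP => i j; rewrite /= !mxE bc_inv_scalar // (bi_Z bi) !mxE eq_sym.
  by case: eqP => _; rewrite ?mulr1n ?mulr0n ?dconj_scalar ?dconj0.
have fN x : f (- x) = - f x by apply: (addrI (f x)); rewrite -(bi_D bi) !subrr f0.
have g0 : g 0 = 0 by rewrite -f0 (bi_gf bi) mulr0.
have fcc : f cc = 1%:M by rewrite -[cc]mulr1 -(bi_gf bi) (bi_fg bi) (bi_1 bi).
have inj0 b : f2 b = 0 -> b = 0.
  move=> /matrixP h.
  have fb : f b = 0 by apply/matrixP => i j; have := h i j; rewrite !mxE => -[].
  have fsb : f (inv b) = 0.
    rewrite -[LHS]conjtrK; apply/matrixP => i j; have := h j i; rewrite !mxE => -[_ ->].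
    by rewrite dconj0.
  have c1 : cc * b = 0 by rewrite -(bi_gf bi) fb g0.
  have : inv (cc * inv b) = 0 by rewrite -(bi_gf bi) fsb g0 bc_inv0.
  by rewrite bc_invM // bc_invK // sc mulrBr mulr1 -(bi_central bi) c1 subr0.
have f2N x : f2 (- x) = - f2 x by apply: (addrI (f2 x)); rewrite -f2D !subrr.
have f2inj : injective f2.
  move=> t u e; apply/eqP; rewrite -subr_eq0; apply/eqP/inj0.
  by rewrite f2D f2N e subrr.
have f2surj Y : exists b, f2 b = Y.
  pose X : 'M[dring k d]_n.+1 := \matrix_(i, j) (Y i j).1.
  pose Z : 'M[dring k d]_n.+1 := \matrix_(i, j) (Y i j).2.
  have gc W : cc * g W = g W by rewrite -(bi_gf bi) (bi_fg bi).
  have fsg W : f (inv (g W)) = 0.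
    by rewrite -gc bc_invM // sc (bi_M bi) (bi_D bi) fN (bi_1 bi) fcc subrr mulmx0.
  (* The summands lie in complementary blocks, so each one affects a single component. *)
  exists (g X + inv (g (conjtr Z))).
  apply/matrixP => i j; rewrite mxE bc_invD bc_invK // !(bi_D bi) !fsg.
  rewrite addr0 add0r !(bi_fg bi) conjtrK !mxE.
  by case: (Y i j).
have /choice [fi fiP] := f2surj.
by exists fi => t; [apply: f2inj; rewrite fiP|exact: fiP].
Qed.

End Nil.

(** * Traces *)

(** The trace of a $K$-linear map does not depend on the dual basis: expand each family in the other
    and exchange the sums. Linear independence of the families is not assumed, so projective modules
    are covered. *)
Lemma trace_indep (K : comNzRingType) (B : pzRingType) (c : K -> B)
    (I J : finType) (e : I -> B) (phi : I -> B -> K) (e' : J -> B) (phi' : J -> B -> K)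
    (T : B -> B) :
  {morph T : x y / x + y} -> (forall z b, T (c z * b) = c z * T b) ->
  (forall i, {morph phi i : x y / x + y}) -> (forall i z b, phi i (c z * b) = z * phi i b) ->
  (forall j, {morph phi' j : x y / x + y}) -> (forall j z b, phi' j (c z * b) = z * phi' j b) ->
  (forall b, b = \sum_i c (phi i b) * e i) -> (forall b, b = \sum_j c (phi' j b) * e' j) ->
  \sum_i phi i (T (e i)) = \sum_j phi' j (T (e' j)).
Proof.
move=> TD TZ pD pZ p'D p'Z eE e'E.
have sumE (C : zmodType) (h : B -> C) (hD : {morph h : x y / x + y}) L (G : L -> B) (r : seq L) :
    h (\sum_(l <- r) G l) = \sum_(l <- r) h (G l).
  by apply: (big_morph h hD); apply: (addrI (h 0)); rewrite -hD !addr0.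
transitivity (\sum_i \sum_j phi' j (T (e i)) * phi i (e' j)).
  apply: eq_bigr => i _; rewrite {1}(e'E (T (e i))) (sumE _ _ (pD i)).
  by apply: eq_bigr => j _; rewrite pZ.
rewrite exchange_big; apply: eq_bigr => j _ /=.
rewrite [in RHS](eE (e' j)) (sumE _ _ TD) (sumE _ _ (p'D j)).
by apply: eq_bigr => i _; rewrite TZ p'Z mulrC.
Qed.

Section RTrace.
Variables (R : comNzRingType) (A : algType R) (m : nat).
Variable F : fsep_alg (fun r : R => r%:A : A) m.

(** For $R$-linear [T], the trace on the projective module $A$, computed with a dual basis. *)
Definition rtrace (T : A -> A) : R := \sum_i fin_coord F i (T (fin_gen F i)).
Definition rtau (a : A) : R := rtrace (fun x => a * x).
Definition gram_tau (i j : 'I_m) : R := rtau (fin_gen F i * fin_gen F j).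

Lemma fin_coord_scale i r a : fin_coord F i (r *: a) = r * fin_coord F i a.
Proof. by rewrite -(fin_coordZ F) -scalerAl mul1r. Qed.

Lemma rtauC a b : rtau (a * b) = rtau (b * a).
Proof.
have tD x y : rtau (x * y) = \sum_i \sum_j fin_coord F j (y * fin_gen F i) *
    fin_coord F i (x * fin_gen F j).
  apply: eq_bigr => i _; rewrite -mulrA {1}(fin_coordK F (y * fin_gen F i)) mulr_sumr.
  rewrite (big_morph _ (fin_coordD F i) (id1 := 0)); last first.
    by apply: (addrI (fin_coord F i 0)); rewrite -(fin_coordD F) !addr0.
  by apply: eq_bigr => j _; rewrite -scalerAl mul1r -scalerAr fin_coord_scale.
rewrite !tD exchange_big; apply: eq_bigr => i _; apply: eq_bigr => j _ /=.
exact: mulrC.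
Qed.

Variables (K : comNzRingType) (rho : {rmorphism R -> K}).
Local Notation B := (bc_alg A rho).
Local Notation tn a z := (tens (a : A) (z : via rho) : B).

Lemma bc_rtrace : exists tr : (B -> B) -> K, exists tau : B -> K,
  [/\ forall (T : A -> A) (T' : B -> B), (forall a, T' (tn a 1) = tn (T a) 1) ->
        tr T' = rho (rtrace T),
      {morph tau : x y / x + y}, forall z b, tau (bc_scalar A rho z * b) = z * tau b,
      forall a, tau (tn a 1) = rho (rtau a) &
      (forall b, tau b = tr (fun x => b * x)) /\
      forall (J : finType) (e : J -> B) (phi : J -> B -> K) (T : B -> B),
        {morph T : x y / x + y} ->
        (forall z b, T (bc_scalar A rho z * b) = bc_scalar A rho z * T b) ->
        (forall j, {morph phi j : x y / x + y}) ->
        (forall j z b, phi j (bc_scalar A rho z * b) = z * phi j b) ->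
        (forall b, b = \sum_j bc_scalar A rho (phi j b) * e j) ->
        tr T = \sum_j phi j (T (e j))].
Proof.
have [F' [gE cE]] := bc_fsep rho F.
pose tr (T : B -> B) := \sum_i fin_coord F' i (T (fin_gen F' i)).
have trE (T : A -> A) (T' : B -> B) : (forall a, T' (tn a 1) = tn (T a) 1) ->
    tr T' = rho (rtrace T).
  move=> h; rewrite /tr /rtrace rmorph_sum; apply: eq_bigr => i _.
  by rewrite gE h cE mulr1.
exists tr, (fun b => tr (fun x => b * x)); split=> //.
- move=> x y; rewrite /tr -big_split; apply: eq_bigr => i _ /=.
  by rewrite mulrDl (fin_coordD F').
- move=> z b; rewrite /tr mulr_sumr; apply: eq_bigr => i _.
  by rewrite -mulrA (fin_coordZ F').
- by move=> a; apply: trE => b; rewrite bc_tensM mulr1.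
split=> // J e phi T TD TZ pD pZ eK.
apply: (trace_indep (c := bc_scalar A rho)) => //.
- exact: (fin_coordD F').
- exact: (fin_coordZ F').
- exact: (fin_coordK F').
Qed.

End RTrace.

(** The polarization that makes an off-diagonal pair of entries of the trace form the difference of
    two equal norm forms. *)
Lemma dre_polar (k : rcfType) d (x y x' y' : dring k d) :
  2%:R^-1 * dre (dconj (x + dconj y) * (x' + dconj y')) -
    2%:R^-1 * dre (dconj (x - dconj y) * (x' - dconj y')) =
  dre (x * y') + dre (y * x').
Proof.
case: d x y x' y' => /= x y x' y'; first by field.
  by case: x y x' y' => [x1 x2] [y1 y2] [z1 z2] [t1 t2] /=; field.
move: x y x' y' => [[[x1 x2] x3] x4] [[[y1 y2] y3] y4].
by move=> [[[z1 z2] z3] z4] [[[t1 t2] t3] t4] /=; field.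
Qed.

Section BlockTrace.
Variables (k : rcfType) (B : pzRingType) (c : k -> B) (d : dkind) (n : nat).
Variables (f : B -> 'M[dring k d]_n.+1) (g : 'M[dring k d]_n.+1 -> B).
Hypothesis bi : block_isom c 1 f g.
Local Notation M := 'M[dring k d]_n.+1.
Local Notation J := ('I_n.+1 * 'I_n.+1 * 'I_(ddim d))%type.

Let e (j : J) : B := g (@dbase k d j.2 *: delta_mx j.1.1 j.1.2).
Let phi (j : J) (b : B) : k := dcoef (f b j.1.1 j.1.2) j.2.

Lemma block_f0 : f 0 = 0.
Proof. by apply: (addrI (f 0)); rewrite -(bi_D bi) !addr0. Qed.
Lemma block_gf b : g (f b) = b. Proof. by rewrite (bi_gf bi) mul1r. Qed.
Lemma block_f_inj : injective f.
Proof. by move=> x y h; rewrite -[x]block_gf h block_gf. Qed.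
Lemma block_f_sum (I : Type) (r : seq I) (G : I -> B) :
  f (\sum_(i <- r) G i) = \sum_(i <- r) f (G i).
Proof. exact: (big_morph f (bi_D bi) block_f0). Qed.
Lemma block_fZ a b : f (c a * b) = dscalar d a *: f b.
Proof. by rewrite (bi_M bi) (bi_Z bi) mul_scalar_mx. Qed.

Lemma block_coordD j : {morph phi j : x y / x + y}.
Proof. by move=> x y; rewrite /phi (bi_D bi) mxE dcoefD. Qed.
Lemma block_coordZ j z b : phi j (c z * b) = z * phi j b.
Proof. by rewrite /phi block_fZ mxE dcoefZ. Qed.
Lemma block_coordK b : b = \sum_j c (phi j b) * e j.
Proof.
apply: block_f_inj; rewrite block_f_sum {1}[f b]matrix_sum_delta.
transitivity (\sum_p \sum_q \sum_a f (c (phi (p, q, a) b) * e (p, q, a))); last first.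
  by rewrite !pair_bigA; apply: eq_bigr => -[[p q] a].
apply: eq_bigr => p _; apply: eq_bigr => q _.
rewrite {1}(dcoefK (f b p q)) scaler_suml; apply: eq_bigr => a _.
by rewrite block_fZ (bi_fg bi) scalerA.
Qed.

Let sumJ (G : J -> k) : \sum_j G j = \sum_p \sum_q \sum_a G (p, q, a).
Proof.
by rewrite !pair_bigA; apply: eq_bigr => -[[p q] a].
Qed.

Lemma block_trace_mul X :
  \sum_j phi j (g X * e j) = (n.+1 * ddim d)%:R * \sum_p dre (X p p).
Proof.
rewrite sumJ natrM -mulrA mulr_sumr mulr_sumr; apply: eq_bigr => p _.
transitivity (\sum_(q < n.+1) (ddim d)%:R * dre (X p p)).
  apply: eq_bigr => q _; rewrite -sum_dcoef_mul; apply: eq_bigr => a _.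
  rewrite /phi (bi_M bi) !(bi_fg bi) /= mxE (bigD1 p) //= !mxE !eqxx mulr1.
  by rewrite big1 ?addr0 // => l nl; rewrite !mxE (negbTE nl) /= !mulr0.
by rewrite sumr_const card_ord -[LHS]mulr_natl.
Qed.

(** The $(p,q)$ place contributes $\kappa\,\mathrm{Re}(\overline{\Psi_{pq}}\Psi'_{pq})$. Hermitian
    symmetry replaces $\overline{\Psi_{pq}}$ by $\pm\Psi_{qp}$, and $\Psi\Psi' = 1$ leaves one
    $\pm\kappa$ per row. *)
Lemma block_trace_inv (Psi Psi' : M) (eps : bool) (s : B -> B) :
  Psi *m Psi' = 1%:M -> conjtr Psi = (if eps then - Psi else Psi) ->
  (forall b, f (s b) = Psi *m conjtr (f b) *m Psi') ->
  \sum_j phi j (s (e j)) = (-1) ^+ eps * (dkappa d)%:~R * n.+1%:R.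
Proof.
move=> PP hP fs.
have e1 p q a : phi (p, q, a) (s (e (p, q, a))) =
    dcoef (Psi p q * dconj (@dbase k d a) * Psi' p q) a.
  rewrite /phi fs (bi_fg bi) /=; congr (dcoef _ _).
  rewrite mxE (bigD1 p) //= mxE (bigD1 q) //= !mxE !eqxx mulr1.
  rewrite big1 ?addr0 => [|l nl]; last by rewrite !mxE (negbTE nl) andbF mulr0 dconj0 mulr0.
  rewrite big1 ?addr0 // => l nl; rewrite mxE big1 ?mul0r // => r _.
  by rewrite !mxE (negbTE nl) /= mulr0 dconj0 mulr0.
rewrite sumJ.
transitivity (\sum_p \sum_q (dkappa d)%:~R * dre (conjtr Psi q p * Psi' p q)).
  apply: eq_bigr => p _; apply: eq_bigr => q _; rewrite !mxE -sum_dcoef_conj.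
  by apply: eq_bigr => a _; rewrite e1.
rewrite exchange_big /=.
transitivity (\sum_(q < n.+1) (-1) ^+ eps * (dkappa d)%:~R : k); last first.
  by rewrite sumr_const card_ord -[LHS]mulr_natr.
apply: eq_bigr => q _; rewrite -mulr_sumr [RHS]mulrC; congr (_ * _).
have h : \sum_p Psi q p * Psi' p q = 1.
  by have := congr1 (fun X : M => X q q) PP; rewrite !mxE eqxx.
have dre1 : dre (1 : dring k d) = 1 by rewrite -[X in dre X](dscalar1 k d) dre_scalar.
have reN x : dre (- x) = - dre x :> k.
  by apply: (addrI (dre x)); rewrite -dreD !subrr dre0.
have <- : dre (\sum_p conjtr Psi q p * Psi' p q) = \sum_p dre (conjtr Psi q p * Psi' p q).
  exact: (big_morph _ (@dreD k d) (dre0 k d)).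
rewrite hP; case: eps {hP}; last by rewrite h dre1.
rewrite expr1 -dre1 -reN -h -sumrN; congr dre.
by apply: eq_bigr => p _; rewrite mxE mulNr.
Qed.

(* The contributions of the off-diagonal pairs of entries cancel. *)
Lemma has_sig_trace :
  has_sig (fun X Y : M => \sum_p dre ((X *m Y) p p)) (dkappa d * n.+1%:Z).
Proof.
pose u (j : J) : k := let: (p, q, a) := j in
  if p == q then dsig k a else if (p < q)%N then 2%:R^-1 else - 2%:R^-1.
pose L (X : M) (j : J) : k := let: (p, q, a) := j in
  if p == q then dcoef (X p p) a
  else if (p < q)%N then dcoef (X p q + dconj (X q p)) a
  else dcoef (X q p - dconj (X p q)) a.
have sumJ' (C : nmodType) (G : J -> C) : \sum_j G j = \sum_p \sum_q \sum_a G (p, q, a).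
  by rewrite !pair_bigA; apply: eq_bigr => -[[p q] a].
(* The coordinates attached to $(p,q)$ and $(q,p)$ both involve the two entries, so double sums are
   compared only after adding their transposes. *)
have symm (C : zmodType) (hC : forall x y : C, x + x = y + y -> x = y)
    (t a : 'I_n.+1 -> 'I_n.+1 -> C) :
    (forall p q, t p q + t q p = a p q + a q p) ->
    \sum_p \sum_q t p q = \sum_p \sum_q a p q.
  move=> h; apply: hC.
  have E (v : 'I_n.+1 -> 'I_n.+1 -> C) : \sum_p \sum_q v p q + \sum_p \sum_q v p q =
      \sum_p \sum_q (v p q + v q p).
    rewrite {2}exchange_big -big_split; apply: eq_bigr => p _ /=.
    by rewrite -big_split.
  by rewrite !E; apply: eq_bigr => p _; apply: eq_bigr => q _.
exists J, u, L; split; last first.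
  rewrite sumJ'.
  transitivity (\sum_(p < n.+1) \sum_(q < n.+1) (if p == q then dkappa d else 0)).
    transitivity (\sum_(p < n.+1) dkappa d); first by rewrite sumr_const card_ord -[RHS]mulr_natr natz.
    apply: eq_bigr => p _; rewrite (bigD1 p) //= eqxx big1 ?addr0 // => q nq.
    by rewrite eq_sym (negbTE nq).
  apply: symm => [x y|p q]; first by lia.
  have [<-|npq] := eqVneq p q.
    by rewrite /u; congr (_ + _); rewrite -(sum_dsig k); apply: eq_bigr => a _; rewrite eqxx.
  rewrite /u (eq_sym q p) (negbTE npq) -big_split big1 ?addr0 // => a _ /=.
  have /orP [lt|lt] : (p < q)%N || (q < p)%N by rewrite -neq_ltn.
    by rewrite lt ltnNge (ltnW lt) /= sgzN addrN.
  by rewrite lt ltnNge (ltnW lt) /= sgzN addNr.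
split=> [cf|X Y].
  pose Z p q : dring k d := \sum_a dscalar d (cf (p, q, a)) * @dbase k d a.
  pose h := dscalar d (2%:R^-1 : k).
  have hh x : h * (x + x) = x.
    rewrite mulrDr -mulrDl /h -dscalarD -[X in X + _]mulr1 -[X in _ + X]mulr1 -mulrDr.
    by rewrite -(natrD _ 1 1) mulVf ?pnatr_eq0 // dscalar1 mul1r.
  pose X : M := \matrix_(p, q) if p == q then Z p p else
    if (p < q)%N then h * (Z p q + Z q p) else dconj (h * (Z q p - Z p q)).
  exists X => -[[p q] a] /=; have Zc : dcoef (Z p q) a = cf (p, q, a) by exact: dcoef_sum.
  case: (eqVneq p q) => [epq|npq].
    by rewrite mxE eqxx -Zc epq.
  have /orP [lt|lt] : (p < q)%N || (q < p)%N by rewrite -neq_ltn.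
    rewrite lt !mxE (negbTE npq) (eq_sym q p) (negbTE npq) lt ltnNge (ltnW lt) /= dconjK.
    by rewrite -mulrDr addrACA subrr addr0 hh.
  rewrite ltnNge (ltnW lt) /= !mxE (negbTE npq) (eq_sym q p) (negbTE npq) lt ltnNge (ltnW lt) /=.
  have dN x : dconj (- x) = - dconj x :> dring k d.
    by apply: (addrI (dconj x)); rewrite -dconjD !subrr dconj0.
  by rewrite dconjK -mulrBr opprB [Z q p + _]addrC addrACA subrr addr0 hh.
rewrite sumJ'.
transitivity (\sum_p \sum_q dre (X p q * Y q p)).
  apply: eq_bigr => p _; rewrite mxE.
  exact: (big_morph _ (@dreD k d) (dre0 k d)).
apply/esym/symm => [x y xy|p q]; first by lra.
have [<-|npq] := eqVneq p q.
  by rewrite /u /L; congr (_ + _); rewrite dre_mul; apply: eq_bigr => a _; rewrite eqxx.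
wlog lt : p q npq / (p < q)%N.
  move=> H; have /orP [lt|lt] : (p < q)%N || (q < p)%N by rewrite -neq_ltn.
    exact: H.
  by rewrite addrC [RHS]addrC; apply: H; rewrite // eq_sym.
rewrite /u /L (eq_sym q p) (negbTE npq) lt ltnNge (ltnW lt) /= -!mulr_sumr -!dre_conjM.
rewrite !mulNr; exact: dre_polar.
Qed.

End BlockTrace.

(** * Hermitian forms with matrix coefficients *)

Section Flat.
Variables (D : nzRingType) (I : finType) (n : nat).
Local Notation N := #|{: I * 'I_n}|.
Local Notation ev := (@enum_val (I * 'I_n)%type predT).

(** A family of matrix blocks becomes one square matrix over $D$, to which [herm_diag] applies. *)
Definition flat (X : I -> I -> 'M[D]_n) : 'M[D]_N :=
  \matrix_(a, b) X (ev a).1 (ev b).1 (ev a).2 (ev b).2.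
Definition flatc (x : I -> 'cV[D]_n) : 'cV[D]_N :=
  \col_a x (ev a).1 (ev a).2 0.
Definition unflat (X : 'M[D]_N) (i j : I) : 'M[D]_n :=
  \matrix_(p, q) X (enum_rank (i, p)) (enum_rank (j, q)).
Definition unflatc (x : 'cV[D]_N) (i : I) : 'cV[D]_n :=
  \col_p x (enum_rank (i, p)) 0.

Lemma flat_sum (C : nmodType) (G : 'I_N -> C) :
  \sum_a G a = \sum_i \sum_p G (enum_rank (i, p)).
Proof.
rewrite pair_bigA (reindex (@enum_rank (I * 'I_n)%type)) /=.
  by apply: eq_bigr => -[i p].
by exists ev => a _; rewrite ?enum_valK ?enum_rankK.
Qed.
Lemma flatK X : flat (unflat X) = X.
Proof.
apply/matrixP => a b; rewrite !mxE -[in RHS](enum_valK a) -[in RHS](enum_valK b).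
by case: (ev a) => i p; case: (ev b).
Qed.
Lemma flatcK x : flatc (unflatc x) = x.
Proof.
apply/colP => a; rewrite !mxE -[in RHS](enum_valK a).
by case: (ev a).
Qed.
Lemma unflatcK x i : unflatc (flatc x) i = x i.
Proof. by apply/colP => p; rewrite !mxE enum_rankK. Qed.
Lemma flat_mul X Y : flat X *m flat Y = flat (fun i j => \sum_l X i l *m Y l j).
Proof.
apply/matrixP => a b; rewrite !mxE summxE flat_sum; apply: eq_bigr => l _.
by rewrite mxE; apply: eq_bigr => p _; rewrite !mxE enum_rankK.
Qed.
Lemma flat_col X y : flat X *m flatc y = flatc (fun i => \sum_j X i j *m y j).
Proof.
apply/colP => a; rewrite !mxE summxE flat_sum; apply: eq_bigr => l _.
by rewrite mxE; apply: eq_bigr => p _; rewrite !mxE enum_rankK.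
Qed.
Lemma eq_flat X Y : X =2 Y -> flat X = flat Y.
Proof. by move=> e; apply/matrixP => a b; rewrite !mxE e. Qed.
Lemma flat1 : flat (fun i j => if i == j then 1%:M else 0) = 1%:M.
Proof.
apply/matrixP => a b; rewrite !mxE -(inj_eq enum_val_inj).
case: (ev a) => i p; case: (ev b) => j q /=; rewrite xpair_eqE.
by case: eqP => _; rewrite !mxE.
Qed.
End Flat.

Section FlatHerm.
Variables (k : rcfType) (d : dkind) (n : nat) (I : finType).
Local Notation D := (dring k d).
Local Notation N := #|{: I * 'I_n}|.
Local Notation ct := (@ctmx D dconj _ _).

Lemma ct_flat (X : I -> I -> 'M[D]_n) : ct (flat X) = flat (fun i j => ct (X j i)).
Proof. by apply/matrixP => a b; rewrite !mxE. Qed.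

Lemma dre_sum (J : Type) (r : seq J) (G : J -> D) :
  dre (\sum_(j <- r) G j) = \sum_(j <- r) dre (G j).
Proof. exact: (big_morph _ (@dreD k d) (dre0 k d)). Qed.

Lemma dre_trC m1 m2 (X : 'M[D]_(m1, m2)) (Y : 'M[D]_(m2, m1)) :
  \sum_p dre ((X *m Y) p p) = \sum_q dre ((Y *m X) q q).
Proof.
under eq_bigr do rewrite mxE dre_sum.
under [RHS]eq_bigr do rewrite mxE dre_sum.
by rewrite exchange_big; apply: eq_bigr => q _; apply: eq_bigr => p _; rewrite dreC.
Qed.

Definition herm_diag_by (H : I -> I -> 'M[D]_n) (u : 'I_N -> k) (T T' : 'M[D]_N) : Prop :=
  [/\ T *m T' = 1%:M, T' *m T = 1%:M &
      flat H = ct T *m diag_mx (\row_a dscalar d (u a)) *m T].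

Lemma flat_herm_diag (H : I -> I -> 'M[D]_n) :
  (forall i j, ct (H i j) = H j i) -> exists u T T', herm_diag_by H u T T'.
Proof.
move=> hH; have h : ct (flat H) = flat H by rewrite ct_flat; apply: eq_flat.
have [u hu [T [T' [h1 h2 h3]]]] := herm_diag (@dconjD k d) (@dconjM k d) (@dconjK k d)
  (@ddiv k d) (dtwo_neq0 k d) h.
exists (fun a => dre (u 0 a)), T, T'; split=> //.
rewrite h3; congr (_ *m diag_mx _ *m _); apply/rowP => a; rewrite mxE.
exact: dconj_fix.
Qed.

Variables (H : I -> I -> 'M[D]_n) (u : 'I_N -> k) (T T' : 'M[D]_N).
Hypothesis hD : herm_diag_by H u T T'.

Definition herm_re (x y : I -> 'cV[D]_n) : k :=
  dre ((\sum_i \sum_j ct (x i) *m H i j *m y j) 0 0).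

Let diagE m (X : 'M[D]_(m, N)) (Y : 'M[D]_(N, m)) i j :
  (X *m diag_mx (\row_a dscalar d (u a)) *m Y) i j =
  \sum_a dscalar d (u a) * (X i a * Y a j).
Proof.
rewrite mxE; apply: eq_bigr => a _; rewrite mxE (bigD1 a) //= !mxE eqxx mulr1n.
rewrite big1 ?addr0 => [|b nb]; last by rewrite !mxE (negbTE nb) mulr0n mulr0.
by rewrite -dscalarC mulrA.
Qed.

Lemma herm_reE x y :
  herm_re x y = dre ((ct (flatc x) *m flat H *m flatc y) 0 0).
Proof.
rewrite /herm_re -mulmxA flat_col mxE summxE flat_sum; congr dre.
apply: eq_bigr => i _; rewrite summxE.
under [RHS]eq_bigr do rewrite !mxE enum_rankK summxE /= mulr_sumr.
rewrite [RHS]exchange_big; apply: eq_bigr => j _ /=.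
rewrite -mulmxA mxE; apply: eq_bigr => p _.
by rewrite !mxE.
Qed.

(** Each diagonal entry contributes a multiple of the norm form of $D$, which is positive definite
    of dimension $\dim D$. *)
Lemma has_sig_herm : has_sig herm_re ((ddim d)%:Z * \sum_a sgz (u a)).
Proof.
have [TT T'T eH] := hD.
exists ('I_N * 'I_(ddim d))%type, (fun j => u j.1).
exists (fun x j => dcoef ((T *m flatc x) j.1 0) j.2); split; last first.
  rewrite -(pair_bigA _ (fun a (_ : 'I_(ddim d)) => sgz (u a))) /= mulr_sumr.
  by apply: eq_bigr => a _; rewrite sumr_const card_ord -[RHS]mulr_natl natz.
split=> [c|x y].
  pose z : 'cV[D]_N := \col_a \sum_b dscalar d (c (a, b)) * @dbase k d b.
  exists (unflatc (T' *m z)) => -[a b] /=.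
  by rewrite flatcK mulmxA TT mul1mx mxE dcoef_sum.
rewrite herm_reE eH !mulmxA -(ctmxM (@dconjD k d) (@dconjM k d)) -mulmxA diagE dre_sum.
rewrite -(pair_bigA _ (fun a b => u a * (dcoef ((T *m flatc x) a 0) b *
  dcoef ((T *m flatc y) a 0) b))) /=.
by apply: eq_bigr => a _; rewrite dreM mxE [_^T _ _]mxE dre_conjM mulr_sumr.
Qed.

(* Diagonalizing H by T, the substitution Z = T X P T^* makes the form
   X, Y |-> Re tr (X^* H Y (P H P)) a tensor square of the diagonal form. *)
Lemma has_sig_herm_square (P P' : 'M[D]_n) :
  ct P = P -> P *m P' = 1%:M -> P' *m P = 1%:M ->
  has_sig (fun X Y : I -> I -> 'M[D]_n =>
      \sum_i \sum_i' \sum_j \sum_j' \sum_p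
        dre ((ct (X i i') *m H i j *m Y j j' *m (P *m H j' i' *m P)) p p))
    ((ddim d)%:Z * (\sum_a sgz (u a)) ^+ 2).
Proof.
move=> hP PP P'P; have [TT T'T eH] := hD.
pose fP : 'M[D]_N := flat (fun i j => if i == j then P else 0).
pose fP' : 'M[D]_N := flat (fun i j => if i == j then P' else 0).
have Pmul (Q Q' : 'M[D]_n) : flat (fun i j : I => if i == j then Q else 0) *m
    flat (fun i j : I => if i == j then Q' else 0) =
    flat (fun i j : I => if i == j then Q *m Q' else 0).
  rewrite flat_mul; apply: eq_flat => i j; rewrite (bigD1 i) //= eqxx big1 ?addr0.
    by case: eqP => _; rewrite ?mulmx0.
  by move=> l nl; rewrite eq_sym (negbTE nl) mul0mx.
have fPP : fP *m fP' = 1%:M by rewrite Pmul PP flat1.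
have fP'P : fP' *m fP = 1%:M by rewrite Pmul P'P flat1.
have cfP : ct fP = fP.
  rewrite ct_flat; apply: eq_flat => i j; rewrite eq_sym; case: eqP => // _.
  exact: (ctmx0 (@dconjD k d)).
have PHP : flat (fun i j => P *m H i j *m P) = fP *m flat H *m fP.
  rewrite !flat_mul; apply: eq_flat => i j.
  rewrite (bigD1 j) //= eqxx [X in _ + X]big1 ?addr0 => [|l nl]; last first.
    by rewrite (negbTE nl) mulmx0.
  rewrite (bigD1 i) //= eqxx big1 ?addr0 // => l nl.
  by rewrite eq_sym (negbTE nl) mul0mx.
have formE X Y : \sum_i \sum_i' \sum_j \sum_j' \sum_p
      dre ((ct (X i i') *m H i j *m Y j j' *m (P *m H j' i' *m P)) p p) =
    \sum_a dre ((ct (flat X) *m flat H *m flat Y *m (fP *m flat H *m fP)) a a).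
  rewrite -PHP ct_flat -!mulmxA !flat_mul flat_sum exchange_big /=.
  apply: eq_bigr => i' _.
  under [RHS]eq_bigr do rewrite mxE enum_rankK summxE dre_sum /=.
  rewrite [RHS]exchange_big; apply: eq_bigr => i _ /=.
  rewrite exchange_big /=.
  under [RHS]eq_bigr do rewrite mulmx_sumr summxE dre_sum.
  rewrite exchange_big [RHS]exchange_big; apply: eq_bigr => j _ /=.
  under [RHS]eq_bigr do rewrite !mulmx_sumr summxE dre_sum.
  rewrite [RHS]exchange_big; apply: eq_bigr => j' _ /=.
  by apply: eq_bigr => p _; rewrite !mulmxA.
pose Q := fP *m ct T.
pose Z X := T *m flat X *m Q.
have cQ : ct Q = T *m fP.
  by rewrite (ctmxM (@dconjD k d) (@dconjM k d)) cfP (ctmxK (@dconjK k d)).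
pose U := diag_mx (\row_a dscalar d (u a)).
have formZ X Y : \sum_a dre ((ct (flat X) *m flat H *m flat Y *m (fP *m flat H *m fP)) a a) =
    \sum_l \sum_j \sum_b u l * u j * (dcoef (Z X l j) b * dcoef (Z Y l j) b).
  transitivity (\sum_j dre ((ct (Z X) *m U *m (Z Y *m U)) j j)).
    rewrite eH -/U.
    have -> : ct (flat X) *m (ct T *m U *m T) *m flat Y *m (fP *m (ct T *m U *m T) *m fP) =
       (ct (flat X) *m ct T *m U *m (Z Y *m U)) *m ct Q.
      by rewrite cQ /Z /Q !mulmxA.
    rewrite dre_trC; apply: eq_bigr => j _; congr (dre (_ j j)).
    by rewrite /Z !(ctmxM (@dconjD k d) (@dconjM k d)) !mulmxA.
  rewrite exchange_big; apply: eq_bigr => j _ /=.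
  rewrite diagE dre_sum; apply: eq_bigr => l _.
  have -> (V : 'M[D]_N) : (V *m U) l j = V l j * dscalar d (u j).
    rewrite mxE (bigD1 j) //= !mxE eqxx mulr1n big1 ?addr0 // => r nr.
    by rewrite !mxE (negbTE nr) mulr0n mulr0.
  rewrite (mulrA (ct (Z X) j l)) -(dscalarC (u j)) !dreM mxE [_^T _ _]mxE dre_conjM mulr_sumr mulr_sumr.
  by apply: eq_bigr => b _; rewrite !mulrA.
exists ('I_N * 'I_N * 'I_(ddim d))%type, (fun t => u t.1.1 * u t.1.2).
exists (fun X t => dcoef (Z X t.1.1 t.1.2) t.2).
have sum3 (C : nmodType) (G : 'I_N * 'I_N * 'I_(ddim d) -> C) :
    \sum_t G t = \sum_l \sum_j \sum_b G (l, j, b).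
  by rewrite !pair_bigA; apply: eq_bigr => -[[p q] a].
split; last first.
  rewrite sum3 expr2 big_distrlr mulr_sumr /=; apply: eq_bigr => l _.
  rewrite mulr_sumr; apply: eq_bigr => j _.
  by rewrite sumr_const card_ord sgzM -[RHS]mulr_natl natz.
split=> [c|X Y]; last by rewrite formE formZ sum3.
pose W : 'M[D]_N := \matrix_(l, j) \sum_b dscalar d (c (l, j, b)) * @dbase k d b.
have QQ : ct T' *m fP' *m Q = 1%:M.
  rewrite /Q mulmxA -(mulmxA (ct T')) fP'P mulmx1 -(ctmxM (@dconjD k d) (@dconjM k d)).
  by rewrite TT (ctmx1 (@dconjD k d) (@dconjM k d) (@dconjK k d)).
exists (unflat (T' *m W *m (ct T' *m fP'))) => -[[l j] b] /=.
rewrite /Z flatK !mulmxA TT mul1mx -!mulmxA (mulmxA (ct T')) QQ mulmx1 mxE.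
by rewrite dcoef_sum.
Qed.

End FlatHerm.

(** * The hermitian form with a given Gram matrix, its base change and its signature *)

Section SForm.
Variables (R : comNzRingType) (A : algType R) (sigma : {linear A -> A}).
Hypothesis invS : is_involution sigma.
Variables (I : finType) (S : I -> I -> A).
Hypothesis hS : forall i j, sigma (S i j) = S j i.

Definition smod : lmodType A^c := {ffun I -> (A^c)^o}.
Definition sdelta (i : I) (a : A) : smod := [ffun j => if j == i then a else 0].
Definition scoord (x : smod) (i : I) : A := x i.

Lemma scoordD x y i : scoord (x + y) i = scoord x i + scoord y i.
Proof. by rewrite /scoord ffunE. Qed.
Lemma scoordZ (a : A) x i : scoord ((a : A^c) *: x) i = scoord x i * a.
Proof. by rewrite /scoord ffunE. Qed.
Lemma scoord_sum (J : Type) (r : seq J) (G : J -> smod) i :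
  scoord (\sum_(j <- r) G j) i = \sum_(j <- r) scoord (G j) i.
Proof. by rewrite /scoord sum_ffunE. Qed.
Lemma scoord_delta i a j : scoord (sdelta i a) j = if j == i then a else 0.
Proof. by rewrite /scoord ffunE. Qed.
Lemma smodP (x y : smod) : (forall i, scoord x i = scoord y i) -> x = y.
Proof. by move=> h; apply/ffunP => i; exact: h. Qed.
Lemma smodE (x : smod) : x = \sum_i ((scoord x i : A) : A^c) *: sdelta i 1.
Proof.
apply: smodP => j; rewrite scoord_sum (bigD1 j) //= scoordZ scoord_delta eqxx mul1r.
by rewrite big1 ?addr0 // => i ni; rewrite scoordZ scoord_delta eq_sym (negbTE ni) mul0r.
Qed.

Lemma smod_projective : projective smod.
Proof.
move=> N P g f sg; have /choice [e eP] : forall i, exists x, g x = f (sdelta i 1).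
  by move=> i; exact: sg.
pose f' (x : smod) : N := \sum_i ((scoord x i : A) : A^c) *: e i.
have lin : linear f'.
  move=> a x y; rewrite /f' scaler_sumr -big_split; apply: eq_bigr => i _ /=.
  by rewrite scoordD scoordZ scalerDl scalerA.
pose fl : {linear smod -> N} := HB.pack f' (GRing.isLinear.Build _ _ _ _ f' lin).
exists fl => x; rewrite /= /f' linear_sum [in RHS](smodE x) linear_sum.
by apply: eq_bigr => i _; rewrite !linearZ /= eP.
Qed.

Lemma smod_fin_generated : fin_generated smod.
Proof.
exists #|I|, (fun i => sdelta (enum_val i) 1) => x.
exists (fun i => (scoord x (enum_val i) : A) : A^c).
rewrite {1}(smodE x) (reindex (@enum_val I predT)) //=.
by exists enum_rank => i _; rewrite ?enum_valK ?enum_rankK.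
Qed.

Definition sval (x y : smod) : A :=
  \sum_i \sum_j sigma (scoord x i) * S i j * scoord y j.

Lemma svalDl x x' y : sval (x + x') y = sval x y + sval x' y.
Proof.
rewrite /sval -big_split; apply: eq_bigr => i _ /=.
rewrite -big_split; apply: eq_bigr => j _ /=.
by rewrite scoordD [sigma _]linearD !mulrDl.
Qed.
Lemma svalDr x y y' : sval x (y + y') = sval x y + sval x y'.
Proof.
rewrite /sval -big_split; apply: eq_bigr => i _ /=.
rewrite -big_split; apply: eq_bigr => j _ /=.
by rewrite scoordD mulrDr.
Qed.
Lemma svalM x y (a b : A) :
  sval ((a : A^c) *: x) ((b : A^c) *: y) = sigma a * sval x y * b.
Proof.
rewrite /sval mulr_sumr mulr_suml; apply: eq_bigr => i _.
rewrite mulr_sumr mulr_suml; apply: eq_bigr => j _.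
by rewrite !scoordZ (proj1 invS) !mulrA.
Qed.
Lemma svalC x y : sval y x = sigma (sval x y).
Proof.
rewrite /sval linear_sum exchange_big; apply: eq_bigr => i _ /=.
rewrite linear_sum; apply: eq_bigr => j _.
by rewrite !(proj1 invS) (proj2 invS) hS mulrA.
Qed.

Definition sform : hermitian_form sigma :=
  HermitianForm smod_projective smod_fin_generated svalDl svalDr svalM svalC.

Variables (alpha : sper R) (k : real_closure alpha).
Local Notation rho := (to_rc k).
Local Notation B := (bc_alg A rho).
Local Notation M_ := (bc_mod rho sform).
Local Notation inv := (bc_inv sigma (rho := rho)).
Local Notation tn a z := (tens (a : A) (z : via rho) : B).
Local Notation tm x z := (tens (x : rmod smod) (z : via rho) : M_).

Let balM := balanced_tens (rmod smod) (via rho).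
Let balA := balanced_tens A (via rho).

Let rscoord r (x : rmod smod) i : scoord (r *: x : rmod smod) i = r *: scoord x i.
Proof. by rewrite [LHS](scoordZ (r%:A : A) x i) -scalerAr mulr1. Qed.

Let bal_proj i : balanced (fun (x : rmod smod) (z : via rho) => tn (scoord x i) z).
Proof.
split=> [x x' z|x z z'|r x z].
- by rewrite [scoord _ _]scoordD bc_tensDl.
- exact: bc_tensDr.
- by rewrite rscoord bc_tensZ.
Qed.
Definition bproj i (v : M_) : B :=
  tlift (fun (x : rmod smod) (z : via rho) => tn (scoord x i) z) v.
Lemma bprojE i x z : bproj i (tm x z) = tn (scoord x i) z.
Proof. exact: (tliftE (bal_proj i)). Qed.
Lemma bprojD i : {morph bproj i : v w / v + w}.
Proof. by move=> v w; exact: (tliftD (bal_proj i)). Qed.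
Lemma bproj0 i : bproj i 0 = 0.
Proof. exact: (tlift0 (bal_proj i)). Qed.

Let bal_inc i : balanced (fun (a : A) (z : via rho) => tm (sdelta i a) z).
Proof.
have [tDl tDr tZ] := balM.
split=> [a a' z|a z z'|r a z]; last first.
- rewrite -tZ; congr (tens _ _); apply: smodP => j.
  by rewrite rscoord !scoord_delta; case: eqP => _; rewrite ?scaler0.
- exact: tDr.
rewrite -tDl; congr (tens _ _); apply: smodP => j.
by rewrite [RHS]scoordD !scoord_delta; case: eqP => _; rewrite ?addr0.
Qed.
Definition binc i (t : B) : M_ := tlift (fun (a : A) (z : via rho) => tm (sdelta i a) z) t.
Lemma bincE i a z : binc i (tn a z) = tm (sdelta i a) z.
Proof. exact: (tliftE (bal_inc i)). Qed.
Lemma bincD i : {morph binc i : t u / t + u}.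
Proof. by move=> t u; exact: (tliftD (bal_inc i)). Qed.
Lemma binc0 i : binc i 0 = 0.
Proof. exact: (tlift0 (bal_inc i)). Qed.

Lemma bproj_inc i j t : bproj j (binc i t) = if j == i then t else 0.
Proof.
elim/bc_ind: t => [|t u IHt IHu|a z].
- by rewrite binc0 bproj0; case: eqP.
- by rewrite bincD bprojD IHt IHu; case: eqP => // _; rewrite addr0.
rewrite bincE bprojE scoord_delta; case: eqP => // _.
exact: (balanced0l balA).
Qed.
Lemma binc_proj v : v = \sum_i binc i (bproj i v).
Proof.
elim/tens_ind: v => [|v w IHv IHw|x z].
- by rewrite big1 // => i _; rewrite bproj0 binc0.
- rewrite [LHS](congr2 +%R IHv IHw) -big_split; apply: eq_bigr => i _ /=.
  by rewrite [bproj i (v + w)]bprojD bincD.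
under eq_bigr do rewrite bprojE bincE.
rewrite -(balanced_suml balM); congr (tens _ _); apply: smodP => j.
rewrite scoord_sum (bigD1 j) //= scoord_delta eqxx big1 ?addr0 // => i ni.
by rewrite scoord_delta eq_sym (negbTE ni).
Qed.
Lemma bprojP v w : (forall i, bproj i v = bproj i w) -> v = w.
Proof. by move=> h; rewrite (binc_proj v) (binc_proj w); apply: eq_bigr => i _; rewrite h. Qed.

Let bal_act1 (x : rmod smod) (z : via rho) : balanced (fun (a : A) (y : via rho) =>
  tens (((a : A^c) *: (x : smod)) : rmod smod) (z * y) : M_).
Proof.
have [tDl tDr tZ] := balM.
split=> [a a' y|a y y'|r a y].
- rewrite -tDl; congr (tens _ _); apply: smodP => j.
  by rewrite [RHS]scoordD !scoordZ mulrDr.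
- by rewrite mulrDr tDr.
rewrite -[RHS](_ : tens (r *: (((a : A^c) *: (x : smod)) : rmod smod)) (z * y) = _).
  congr (tens _ _); apply: smodP => j.
  by rewrite rscoord !scoordZ -scalerAr.
by rewrite tZ scalerAr.
Qed.
Let bal_act t : balanced (fun (x : rmod smod) (z : via rho) =>
  tlift (fun (a : A) (y : via rho) =>
      tens (((a : A^c) *: (x : smod)) : rmod smod) (z * y) : M_) t).
Proof.
have [tDl tDr tZ] := balM.
split=> [x x' z|x z z'|r x z]; rewrite -?tlift_split; apply: eq_tlift => a y.
- by rewrite -tDl; congr (tens _ _); apply: smodP => j; rewrite [RHS]scoordD !scoordZ [scoord _ _]scoordD mulrDl.
- by rewrite mulrDl tDr.
transitivity (tens (r *: (((a : A^c) *: (x : smod)) : rmod smod)) (z * y) : M_).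
  apply: (congr1 (fun q : rmod smod => tens q (z * y) : M_)); apply: smodP => j.
  etransitivity; first exact: scoordZ.
  etransitivity; last by symmetry; exact: (rscoord r _ j).
  etransitivity; first by apply: (congr1 (fun q => q * a)); exact: (rscoord r x j).
  rewrite -scalerAl; apply: (congr1 (fun q => r *: q)).
  by symmetry; exact: scoordZ.
by rewrite tZ; apply: (congr1 (fun q => tens _ q : M_)); exact: scalerAl.
Qed.

Lemma bproj_act i v t : bproj i (bc_act (h := sform) v t) = bproj i v * t.
Proof.
elim/tens_ind: v => [|v w IHv IHw|x z].
- by rewrite [bc_act _ _](tlift0 (bal_act t)) bproj0 mul0r.
- rewrite [bc_act _ _](tliftD (bal_act t)) bprojD [bproj i (v + w)]bprojD mulrDl.
  by rewrite -IHv -IHw.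
rewrite [bc_act _ _](tliftE (bal_act t)).
elim/bc_ind: t => [|t u IHt IHu|a y].
- by rewrite (tlift0 (bal_act1 x z)) bproj0 mulr0.
- by rewrite (tliftD (bal_act1 x z)) bprojD IHt IHu mulrDr.
by rewrite (tliftE (bal_act1 x z)) !bprojE scoordZ bc_tensM.
Qed.

Let bal_form1 (x : rmod smod) (z : via rho) : balanced (fun (x' : rmod smod) (y : via rho) =>
  tens (sval x x') (z * y) : B).
Proof.
split=> [a a' y|a y y'|r a y].
- by rewrite svalDr bc_tensDl.
- by rewrite mulrDr bc_tensDr.
have -> : sval x (r *: a : rmod smod) = r *: sval x a.
  rewrite /sval scaler_sumr; apply: eq_bigr => i _; rewrite scaler_sumr.
  by apply: eq_bigr => j _; rewrite rscoord -scalerAr.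
by rewrite bc_tensZ; congr (tens _ _); exact: mulrCA.
Qed.
Let bal_form w : balanced (fun (x : rmod smod) (z : via rho) =>
  tlift (fun (x' : rmod smod) (y : via rho) => tens (sval x x') (z * y) : B) w).
Proof.
split=> [x x' z|x z z'|r x z]; rewrite -?tlift_split; apply: eq_tlift => a y.
- by rewrite svalDl bc_tensDl.
- by rewrite mulrDl bc_tensDr.
have -> : sval (r *: x : rmod smod) a = r *: sval x a.
  rewrite /sval scaler_sumr; apply: eq_bigr => i _; rewrite scaler_sumr.
  by apply: eq_bigr => j _; rewrite rscoord linearZ -!scalerAl.
by rewrite bc_tensZ; congr (tens _ _); exact: mulrA.
Qed.

Lemma bc_formE v w : bc_form (h := sform) v w =
  \sum_i \sum_j inv (bproj i v) * tn (S i j) 1 * bproj j w.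
Proof.
elim/tens_ind: v => [|v v' IHv IHv'|x z].
- rewrite [bc_form _ _](tlift0 (bal_form w)) big1 // => i _.
  by rewrite big1 // => j _; rewrite bproj0 bc_inv0 !mul0r.
- rewrite [bc_form _ _](tliftD (bal_form w)).
  rewrite -[tlift _ v]/(bc_form (h := sform) v w) -[tlift _ v']/(bc_form (h := sform) v' w).
  rewrite IHv IHv' -big_split; apply: eq_bigr => i _ /=.
  rewrite -big_split; apply: eq_bigr => j _ /=.
  by rewrite [bproj i (v + v')]bprojD bc_invD !mulrDl.
rewrite [bc_form _ _](tliftE (bal_form w)).
elim/tens_ind: w => [|w w' IHw IHw'|x' y].
- rewrite (tlift0 (bal_form1 x z)) big1 // => i _.
  by rewrite big1 // => j _; rewrite bproj0 mulr0.
- rewrite (tliftD (bal_form1 x z)) IHw IHw' -big_split; apply: eq_bigr => i _ /=.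
  rewrite -big_split; apply: eq_bigr => j _ /=.
  by rewrite [bproj j (w + w')]bprojD mulrDr.
rewrite (tliftE (bal_form1 x z)) /sval bc_tens_sum; apply: eq_bigr => i _.
rewrite bc_tens_sum; apply: eq_bigr => j _.
by rewrite !bprojE bc_invE !bc_tensM mulr1.
Qed.

End SForm.

Section DatumSign.
Variables (R : comNzRingType) (A : algType R) (sigma : {linear A -> A}).
Hypothesis invS : is_involution sigma.
Variables (alpha : sper R) (k : real_closure alpha).
Variable mu : morita_datum sigma k.
Local Notation rho := (to_rc k).
Local Notation B := (bc_alg A rho).
Local Notation inv := (bc_inv sigma (rho := rho)).
Local Notation tn a z := (tens (a : A) (z : via rho) : B).
Local Notation d := (md_kind mu).
Local Notation n := (md_size mu).
Local Notation D := (dring k d).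
Local Notation M := 'M[D]_n.+1.
Local Notation f := (md_iso mu : B -> M).
Local Notation g := (md_inv (m := mu) : M -> B).
Local Notation Psi := (md_Psi mu).
Local Notation Psi' := (md_Psi_inv mu).
Local Notation ct := (@ctmx D dconj _ _).

Lemma datum_block : (1 : B) != 0 -> block_isom (bc_scalar A rho) 1 f g.
Proof.
move=> nz; split=> //.
- by move=> b; rewrite mul1r mulr1.
- by rewrite mulr1.
- exact: rmorphD.
- by move=> x y; rewrite rmorphM.
- exact: rmorph1.
- exact: md_scalar.
- exact: md_invK.
- by move=> b; rewrite mul1r md_isoK.
Qed.

Lemma datum_Psi_inv_herm : conjtr Psi' = Psi'.
Proof.
have e : conjtr Psi' *m Psi = 1%:M.
  rewrite -{1}(md_Psi_herm mu) -conjtrM md_PsiK.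
  exact: (ctmx1 (@dconjD k d) (@dconjM k d) (@dconjK k d)).
by rewrite -[LHS]mulmx1 -(md_PsiK mu) mulmxA e mul1mx.
Qed.

Section Form.
Variables (I : finType) (S : I -> I -> A).
Hypothesis hS : forall i j, sigma (S i j) = S j i.

Definition datum_gram (i j : I) : M := Psi' *m f (tn (S i j) 1).

Lemma datum_gram_herm i j : ct (datum_gram i j) = datum_gram j i.
Proof.
rewrite /datum_gram.
have -> : tn (S j i) 1 = inv (tn (S i j) 1) by rewrite bc_invE hS.
rewrite md_sigma !mulmxA md_PsiVK mul1mx.
by rewrite -[ct _]/(conjtr _) conjtrM datum_Psi_inv_herm.
Qed.

Let colf (t : B) : 'cV[D]_n.+1 := col 0 (f t).

Let col0m (x : 'cV[D]_n.+1) : M := x *m delta_mx (0 : 'I_1) 0.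
Let col0mE x i j : col0m x i j = x i 0 *+ (j == 0).
Proof.
rewrite mxE big_ord1 !mxE eqxx /= eq_sym.
by case: eqP; rewrite ?mulr1 ?mulr0.
Qed.
Let corner_mul (X : M) (x : D) : X *m (x *: delta_mx 0 0) = col0m (col 0 X *m x%:M).
Proof.
apply/matrixP => i j; rewrite col0mE mxE (bigD1 0) //= !mxE eqxx /=.
rewrite big1 ?addr0 => [|l nl]; last by rewrite !mxE (negbTE nl) mulr0 mulr0.
rewrite big_ord1 !mxE eqxx mulr1n; case: eqP => _; rewrite ?mulr1 ?mulr0 //.
Qed.

Let corner_colE (X H Y : M) :
  (ct X *m H *m Y) 0 0 = (ct (col 0 X) *m H *m col 0 Y) 0 0.
Proof.
rewrite mxE [RHS]mxE; apply: eq_bigr => q _; rewrite [col 0 Y q 0]mxE; congr (_ * _).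
by rewrite mxE [RHS]mxE; apply: eq_bigr => p _; rewrite !mxE.
Qed.

Lemma md_formE (v w : bc_mod rho (sform invS hS)) :
  md_form mu v w = (\sum_i \sum_j ct (colf (bproj i v)) *m datum_gram i j *m
                      colf (bproj j w)) 0 0.
Proof.
rewrite /md_form bc_formE // !rmorph_sum mulmx_sumr !summxE; apply: eq_bigr => i _.
rewrite rmorph_sum mulmx_sumr !summxE; apply: eq_bigr => j _.
rewrite !rmorphM /= -[_ * _ * _]/(_ *m _ *m _) md_sigma.
rewrite -corner_colE /datum_gram !mulmxA md_PsiVK mul1mx.
by [].
Qed.

Variables (u : 'I_#|{: I * 'I_n.+1}| -> k) (T T' : 'M[D]_#|{: I * 'I_n.+1}|).
Hypothesis hD : herm_diag_by datum_gram u T T'.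
Local Notation N := #|{: I * 'I_n.+1}|.
Local Notation SF := (sform invS hS).

Let act0 (v : bc_mod rho SF) i x :
  f (bproj i (bc_act v (md_corner (mu := mu) x))) = col0m (colf (bproj i v) *m x%:M).
Proof. by rewrite bproj_act rmorphM /= md_invK; exact: corner_mul. Qed.

Let F0 (y : I -> 'cV[D]_n.+1) : bc_mod rho SF := \sum_i binc invS hS (k := k) i (g (col0m (y i))).
Let projF0 y i : bproj i (F0 y) = g (col0m (y i)).
Proof.
rewrite /F0 (big_morph _ (@bprojD _ _ _ invS _ _ hS _ k i) (bproj0 invS hS k i)).
by rewrite (bigD1 i) //= bproj_inc eqxx big1 ?addr0 // => j nj; rewrite bproj_inc eq_sym (negbTE nj).
Qed.
Let colF0 y i : colf (bproj i (F0 y)) = y i.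
Proof.
by rewrite projF0 /colf md_invK; apply/colP => p; rewrite mxE col0mE eqxx.
Qed.

(** The module cut out by $e_{11}$ is identified with families of first columns, where the form has
    Gram matrix [datum_gram]; [T'] then carries the diagonal coordinates over. *)
Lemma sform_sign : is_sign mu SF (\sum_a sgz (u a)).
Proof.
have [TT T'T eH] := hD.
exists N, u, (fun x => F0 (unflatc (T' *m x))); split; last exact: sum_sgz.
have inj_f := can_inj (md_isoK mu).
have ext v w : (forall i, f (bproj i v) = f (bproj i w)) -> v = w :> bc_mod rho SF.
  by move=> h; apply: bprojP => i; exact: inj_f.
split.
- move=> x y; apply: ext => i; rewrite [bproj i (_ + _)]bprojD !projF0 rmorphD !md_invK.
  apply/matrixP => p q; rewrite [RHS]mxE !col0mE -mulrnDl; congr (_ *+ _).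
  by rewrite mulmxDr !mxE.
- move=> x c; apply: ext => i; rewrite act0 colF0 projF0 md_invK; congr col0m.
  rewrite mulmxA; apply/colP => p; rewrite [LHS]mxE [LHS]mxE [RHS]mxE !big_ord1.
  by congr (_ * _); rewrite [RHS]mxE.
- move=> x y e; have h i : unflatc (T' *m x) i = unflatc (T' *m y) i.
    by rewrite -[LHS]colF0 e colF0.
  have {}h : T' *m x = T' *m y.
    by rewrite -[LHS]flatcK -[RHS]flatcK; congr flatc; exact/funext.
  by rewrite -[x]mul1mx -TT -mulmxA h mulmxA TT mul1mx.
- move=> v; split=> [[x <-]|[w ->]].
    exists (F0 (unflatc (T' *m x))); apply: ext => i; rewrite act0 colF0 projF0 md_invK.
    by congr col0m; apply/colP => p; rewrite !mxE big_ord1 !mxE eqxx mulr1n mulr1.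
  exists (T *m flatc (fun i => colf (bproj i w))).
  apply: ext => i; rewrite act0 projF0 md_invK mulmxA T'T mul1mx unflatcK; congr col0m.
  by apply/colP => p; rewrite !mxE big_ord1 !mxE eqxx mulr1n mulr1.
move=> x y; rewrite md_formE.
pose X i := unflatc (T' *m x) i; pose Y i := unflatc (T' *m y) i.
have -> : (\sum_i \sum_j ct (colf (bproj i (F0 (unflatc (T' *m x))))) *m datum_gram i j *m
             colf (bproj j (F0 (unflatc (T' *m y))))) =
          ct (flatc X) *m flat datum_gram *m flatc Y.
  apply/matrixP => a b; rewrite !ord1 -mulmxA flat_col summxE mxE flat_sum.
  apply: eq_bigr => i _; rewrite summxE.
  under [RHS]eq_bigr do rewrite !mxE enum_rankK summxE /= mulr_sumr.
  rewrite [RHS]exchange_big; apply: eq_bigr => j _ /=.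
  rewrite !colF0 -mulmxA mxE; apply: eq_bigr => p _.
  by rewrite !mxE.
rewrite !flatcK eH (ctmxM (@dconjD k d) (@dconjM k d)).
have e1 : ct T' *m ct T = 1%:M.
  by rewrite -(ctmxM (@dconjD k d) (@dconjM k d)) TT (ctmx1 (@dconjD k d) (@dconjM k d) (@dconjK k d)).
have -> : ct x *m ct T' *m (ct T *m diag_mx (\row_a dscalar d (u a)) *m T) *m (T' *m y) =
    ct x *m (ct T' *m ct T) *m diag_mx (\row_a dscalar d (u a)) *m (T *m T') *m y.
  by rewrite !mulmxA.
rewrite e1 TT !mulmx1 mxE; apply: eq_bigr => a _; rewrite mxE (bigD1 a) //= !mxE eqxx mulr1n.
by rewrite big1 ?addr0 // => b nb; rewrite !mxE (negbTE nb) mulr0n mulr0.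
Qed.

(** Sylvester's law over $D$ follows from the real one: any diagonalization also diagonalizes the
    real part of the form, with each entry repeated $\dim D$ times. *)
Lemma sform_sign_uniq s : is_sign mu SF s -> s = \sum_a sgz (u a).
Proof.
move=> [r [v [F [[FD FZ Finj Fim Fform] ->]]]]; rewrite -sum_sgz.
pose q (x : 'cV[D]_r) (i : I) : 'cV[D]_n.+1 := colf (bproj i (F x)).
have sq y : exists x, q x =1 y.
  pose w := F0 y.
  have [x xP] : exists x, F x = bc_act w (md_corner (mu := mu) 1) by apply/Fim; exists w.
  exists x => i; rewrite /q xP /colf act0 colF0.
  by apply/colP => p; rewrite mxE col0mE eqxx !mxE big_ord1 !mxE eqxx mulr1n mulr1.
have h1 : has_sig (fun x y => herm_re datum_gram (q x) (q y))
                  ((ddim d)%:Z * \sum_a sgz (u a)).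
  apply: has_sig_pull (has_sig_herm hD) => y.
  by have [x /funext xP] := sq y; exists x.
have h2 : has_sig (fun x y => herm_re datum_gram (q x) (q y))
                  ((ddim d)%:Z * \sum_i sgz (v i)).
  exists ('I_r * 'I_(ddim d))%type, (fun j => v j.1).
  exists (fun x j => dcoef (x j.1 0) j.2); split; last first.
    rewrite -(pair_bigA _ (fun a (_ : 'I_(ddim d)) => sgz (v a))) /= mulr_sumr.
    by apply: eq_bigr => a _; rewrite sumr_const card_ord -[RHS]mulr_natl natz.
  split=> [c|x y].
    exists (\col_a \sum_b dscalar d (c (a, b)) * @dbase k d b) => -[a b] /=.
    by rewrite mxE dcoef_sum.
  rewrite /herm_re /q -md_formE Fform dre_sum.
  rewrite -(pair_bigA _ (fun a b => v a * (dcoef (x a 0) b * dcoef (y a 0) b))) /=.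
  apply: eq_bigr => a _; rewrite -dscalarC -mulrA dreM dre_conjM mulr_sumr.
  by [].
have dpos : (ddim d)%:Z != 0 by case: (d).
by apply: (mulfI dpos); exact: has_sig_uniq h2 h1.
Qed.

End Form.
End DatumSign.

(** * Trace invariants of a block *)

Section Invariants.
Variables (R : comNzRingType) (A : algType R) (sigma : {linear A -> A}).
Hypothesis invS : is_involution sigma.
Variables (m : nat) (F : fsep_alg (fun r : R => r%:A : A) m).
Variables (alpha : sper R) (k : real_closure alpha).
Local Notation rho := (to_rc k).
Local Notation B := (bc_alg A rho).
Local Notation c := (bc_scalar A rho).
Local Notation inv := (bc_inv sigma (rho := rho)).
Local Notation tn a z := (tens (a : A) (z : via rho) : B).

(** Twice the skew part of the projection of $a$ to the centre. These elements are visible over $R$,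
    and the trace of their squares detects a centre that splits. *)
Definition sep_skew (a : A) : A := sep_mean F a - sigma (sep_mean F a).

Lemma bc_tensN (a : A) (z : k) : tn (- a) z = - tn a z.
Proof.
apply: (addrI (tn a z)); rewrite -bc_tensDl !subrr.
by apply: (addrI (tn 0 z)); rewrite -bc_tensDl !addr0.
Qed.

Lemma sep_skew_central (a : A) (b : B) :
  tn (sep_skew a) 1 * b = b * tn (sep_skew a) 1.
Proof.
elim/bc_ind: b => [|t u IHt IHu|b z]; first by rewrite mulr0 mul0r.
  by rewrite mulrDr IHt IHu mulrDl.
rewrite !bc_tensM mulr1 mul1r /sep_skew mulrBl mulrBr sep_mean_central.
by rewrite (sigma_central invS (sep_mean_central F a)).
Qed.

Lemma sep_skew_inv (a : A) : inv (tn (sep_skew a) 1) = - tn (sep_skew a) 1.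
Proof.
rewrite bc_invE // -bc_tensN /sep_skew linearB /=.
by rewrite [X in _ - X](proj2 invS) opprB.
Qed.

Local Notation N n d := ((n.+1 * ddim d)%:R : k).

(** The form $X, Y \mapsto \mathrm{Tr}(X^\sigma SYS)$ on $I \times I$ matrices over $A$; an index
    consists of a matrix position and the number of a generator of $A$. *)
Definition gram_square (I : finType) (S : I -> I -> A) (s t : (I * I) * 'I_m) : R :=
  rtau F (sigma (fin_gen F s.2) * S s.1.1 t.1.1 * fin_gen F t.2 * S t.1.2 s.1.2).

Section Block.
Variables (d : dkind) (n : nat).
Variables (f : B -> 'M[dring k d]_n.+1) (g : 'M[dring k d]_n.+1 -> B).
Hypothesis bi : block_isom c 1 f g.
Local Notation M := 'M[dring k d]_n.+1.

Lemma block_rtau a : rho (rtau F a) = N n d * \sum_p dre (f (tn a 1) p p).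
Proof.
have [tr [tau [_ _ _ <- [tauE trE]]]] := bc_rtrace F rho.
rewrite tauE; set b := tn a 1; rewrite -(block_trace_mul bi) (trE _ _ _ (fun x => b * x)
  _ _ (block_coordD bi) (block_coordZ bi) (block_coordK bi)) ?(block_gf bi) //.
- by move=> x y; rewrite mulrDr.
- by move=> z x; rewrite mulrA -bc_scalarC -mulrA.
Qed.

Lemma block_rtrace (Psi Psi' : M) (eps : bool) :
  Psi *m Psi' = 1%:M -> conjtr Psi = (if eps then - Psi else Psi) ->
  (forall b, f (inv b) = Psi *m conjtr (f b) *m Psi') ->
  rho (rtrace F sigma) = (-1) ^+ eps * (dkappa d)%:~R * n.+1%:R.
Proof.
move=> PP hP fS; have [tr [tau [trE _ _ _ [_ trE']]]] := bc_rtrace F rho.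
rewrite -(trE _ inv); last by move=> a; rewrite bc_invE.
rewrite (trE' _ _ _ _ _ _ (block_coordD bi) (block_coordZ bi) (block_coordK bi)).
- exact: (block_trace_inv bi PP hP).
- exact: bc_invD.
- by move=> z b; rewrite bc_invM // bc_inv_scalar // -bc_scalarC.
Qed.

Let comb (x : 'I_m -> k) : B := \sum_i tn (fin_gen F i) (x i).
Let comb_surj X : exists x, f (comb x) = X.
Proof.
have [F' [gE _]] := bc_fsep rho F.
exists (fun i => fin_coord F' i (g X)); rewrite -[RHS](bi_fg bi); congr f.
by rewrite [RHS](fin_coordK F'); apply: eq_bigr => i _; rewrite gE bc_tensE.
Qed.

Let tau (b : B) : k := N n d * \sum_p dre (f b p p).
Let tau_sum (J : Type) (r : seq J) (G : J -> B) :
  tau (\sum_(j <- r) G j) = \sum_(j <- r) tau (G j).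
Proof.
rewrite /tau (block_f_sum bi); under eq_bigr do rewrite summxE dre_sum.
by rewrite exchange_big mulr_sumr.
Qed.
Let tau_tens a z : tau (tn a z) = rho (rtau F a) * z.
Proof.
rewrite block_rtau /tau bc_tensE (block_fZ bi) -mulrA; congr (_ * _).
by rewrite mulr_suml; apply: eq_bigr => p _; rewrite mxE dreM mulrC.
Qed.

Let N_gt0 : 0 < N n d.
Proof. by rewrite ltr0n muln_gt0 /=; case: (d). Qed.

Lemma has_sig_gram_tau :
  has_sig (gram (fun i j => rho (gram_tau F i j))) (dkappa d * n.+1%:Z).
Proof.
have := has_sigZ (N n d) (has_sig_pull comb_surj (has_sig_trace k d n)).
rewrite gtr0_sgz // mul1r; apply: eq_has_sig => x y; rewrite /gram /gram_tau.
rewrite -(bi_M bi) -/(tau _) mulr_suml tau_sum; apply: eq_bigr => i _.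
rewrite mulr_sumr tau_sum; apply: eq_bigr => j _.
by rewrite bc_tensM tau_tens mulrCA mulrA.
Qed.

Lemma has_sig_gram_square (Psi Psi' : M) (I : finType) (S : I -> I -> A) u T T' :
  Psi *m Psi' = 1%:M -> Psi' *m Psi = 1%:M -> conjtr Psi = Psi ->
  (forall b, f (inv b) = Psi *m conjtr (f b) *m Psi') ->
  herm_diag_by (fun i j => Psi' *m f (tn (S i j) 1)) u T T' ->
  has_sig (gram (fun s t => rho (gram_square S s t))) ((ddim d)%:Z * (\sum_a sgz (u a)) ^+ 2).
Proof.
move=> PP P'P hP fS hD.
pose q (x : (I * I) * 'I_m -> k) (i i' : I) : M := f (comb (fun a => x (i, i', a))).
have sq Y : exists x, q x = Y.
  have /choice [h hh] : forall p : I * I, exists x, f (comb x) = Y p.1 p.2.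
    by move=> p; exact: comb_surj.
  exists (fun t => h t.1 t.2); apply/funext => i; apply/funext => i'.
  exact: (hh (i, i')).
have := has_sigZ (N n d) (has_sig_pull sq (has_sig_herm_square hD hP PP P'P)).
rewrite gtr0_sgz // mul1r; apply: eq_has_sig => x y; rewrite /gram /gram_square.
transitivity (\sum_i \sum_i' \sum_j \sum_j'
  tau (inv (comb (fun a => x (i, i', a))) * tn (S i j) 1 *
       comb (fun a => y (j, j', a)) * tn (S j' i') 1)).
  rewrite mulr_sumr; apply: eq_bigr => i _; rewrite mulr_sumr; apply: eq_bigr => i' _.
  rewrite mulr_sumr; apply: eq_bigr => j _; rewrite mulr_sumr; apply: eq_bigr => j' _.
  rewrite /tau; congr (_ * _).
  (* [Psi] is the matrix [P] of [has_sig_herm_square]. Moving the last [Psi] to the front under the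
     trace completes $\Psi\,\overline{f(x)}^t\,\Psi'$, which is $f(\sigma x)$. *)
  have -> : conjtr (q x i i') *m (Psi' *m f (tn (S i j) 1)) *m q y j j' *m
      (Psi *m (Psi' *m f (tn (S j' i') 1)) *m Psi) =
      (conjtr (q x i i') *m Psi' *m f (tn (S i j) 1) *m q y j j' *m f (tn (S j' i') 1)) *m Psi.
    by rewrite !mulmxA -(mulmxA _ Psi Psi') PP mulmx1.
  rewrite dre_trC; apply: eq_bigr => p _; congr (dre (_ p p)).
  by rewrite !(bi_M bi) fS !mulmxA.
have sum3 (C : nmodType) (G : (I * I) * 'I_m -> C) :
    \sum_t G t = \sum_i \sum_i' \sum_a G (i, i', a).
  by rewrite !pair_bigA; apply: eq_bigr => -[[p q'] a].
rewrite sum3; apply: eq_bigr => i _; apply: eq_bigr => i' _.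
under [RHS]eq_bigr do rewrite sum3.
rewrite [RHS]exchange_big; apply: eq_bigr => j _ /=.
rewrite [RHS]exchange_big; apply: eq_bigr => j' _ /=.
have -> : inv (comb (fun a => x (i, i', a))) * tn (S i j) 1 *
      comb (fun a => y (j, j', a)) * tn (S j' i') 1 =
    \sum_a \sum_b tn (sigma (fin_gen F a) * S i j * fin_gen F b * S j' i')
      (x (i, i', a) * y (j, j', b)).
  rewrite [inv _](big_morph _ (@bc_invD _ _ sigma _ rho) (@bc_inv0 _ _ sigma _ rho)).
  rewrite [X in X * _ * _]mulr_suml [X in X * _]mulr_suml mulr_suml.
  apply: eq_bigr => a _; rewrite [X in X * _]mulr_sumr mulr_suml; apply: eq_bigr => b _.
  by rewrite bc_invE !bc_tensM !mulr1.
rewrite tau_sum; apply: eq_bigr => a _; rewrite tau_sum; apply: eq_bigr => b _.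
by rewrite tau_tens mulrCA mulrA.
Qed.

(** On the centre $\sigma$ acts as conjugate transposition. A central skew $z$ therefore satisfies
    $z^2 = -\bar z^t z$, whose trace is at most $0$. *)
Lemma rtau_sep_skew_le0 (Psi Psi' : M) a :
  Psi *m Psi' = 1%:M ->
  (forall b, f (inv b) = Psi *m conjtr (f b) *m Psi') ->
  rho (rtau F (sep_skew a * sep_skew a)) <= 0.
Proof.
move=> PP fS; rewrite block_rtau; apply: mulr_ge0_le0; first exact: ltW.
set z := tn (sep_skew a) 1.
have zC X : f z *m X = X *m f z.
  by rewrite -[X](bi_fg bi) -!(bi_M bi) sep_skew_central.
have hz : conjtr (f z) = - f z.
  have cC X : conjtr (f z) *m X = X *m conjtr (f z).
    by rewrite -[X]conjtrK -!conjtrM zC.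
  have fN b : f (- b) = - f b.
    by apply: (addrI (f b)); rewrite -(bi_D bi) !subrr (block_f0 bi).
  by rewrite -fN -sep_skew_inv fS -cC -mulmxA PP mulmx1.
have -> : tn (sep_skew a * sep_skew a) 1 = z * z by rewrite bc_tensM mulr1.
rewrite (bi_M bi).
apply: sumr_le0 => p _; rewrite mxE dre_sum; apply: sumr_le0 => q _.
have -> : f z p q = - dconj (f z q p).
  by have := congr1 (fun X : M => - X p q) hz; rewrite !mxE opprK.
have reN x : dre (- x) = - dre x :> k.
  by apply: (addrI (dre x)); rewrite -dreD !subrr dre0.
by rewrite mulNr reN oppr_le0 dnorm_ge0.
Qed.
End Block.

Hypothesis scal_inj : injective (fun r : R => r%:A : A).
Hypothesis sym_center : forall z : A,
  (exists r : R, z = r%:A) <-> ((forall a, z * a = a * z) /\ sigma z = z).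
Hypothesis two_unit : exists t : R, 2%:R * t = 1.

(** A basis of one block together with its image under the involution is a basis of $B$, so the
    trace of the identity counts its elements. *)
Lemma double_trace_gt0 cc d n (f : B -> 'M[dring k d]_n.+1) g (tr : (B -> B) -> k) :
  block_isom c cc f g -> inv cc = 1 - cc ->
  (forall (J : finType) (e : J -> B) (phi : J -> B -> k) (T : B -> B),
        {morph T : x y / x + y} ->
        (forall z b, T (c z * b) = c z * T b) ->
        (forall j, {morph phi j : x y / x + y}) ->
        (forall j z b, phi j (c z * b) = z * phi j b) ->
        (forall b, b = \sum_j c (phi j b) * e j) ->
        tr T = \sum_j phi j (T (e j))) ->
  0 < tr (fun x => 1 * x).
Proof.
move=> bi hcc trE; pose J := ('I_n.+1 * 'I_n.+1 * 'I_(ddim d))%type.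
pose e (j : J) : B := g (@dbase k d j.2 *: delta_mx j.1.1 j.1.2).
pose phi (j : J) (b : B) : k := dcoef (f b j.1.1 j.1.2) j.2.
have phiD j : {morph phi j : x y / x + y}.
  by move=> x y; rewrite /phi (bi_D bi) mxE dcoefD.
have fZ a b : f (c a * b) = dscalar d a *: f b.
  by rewrite (bi_M bi) (bi_Z bi) mul_scalar_mx.
have phiZ j z b : phi j (c z * b) = z * phi j b by rewrite /phi fZ mxE dcoefZ.
have f0 : f 0 = 0 by apply: (addrI (f 0)); rewrite -(bi_D bi) !addr0.
have phiK b : cc * b = \sum_j c (phi j b) * e j.
  transitivity (cc * \sum_j c (phi j b) * e j); last first.
    rewrite mulr_sumr; apply: eq_bigr => j _.
    by rewrite mulrA -bc_scalarC -mulrA -(bi_gf bi) (bi_fg bi).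
  rewrite -!(bi_gf bi) (big_morph f (bi_D bi) f0) {1}[f b]matrix_sum_delta; congr g.
  transitivity (\sum_p \sum_q \sum_a f (c (phi (p, q, a) b) * e (p, q, a))); last first.
    by rewrite !pair_bigA; apply: eq_bigr => -[[p q] a].
  apply: eq_bigr => p _; apply: eq_bigr => q _.
  rewrite {1}(dcoefK (f b p q)) scaler_suml; apply: eq_bigr => a _.
  by rewrite fZ (bi_fg bi) scalerA.
have phie j : phi j (e j) = 1.
  by rewrite /phi /e (bi_fg bi) !mxE !eqxx mulr1 dcoef_base eqxx.
pose e2 (j : J + J) : B := match j with inl j => e j | inr j => inv (e j) end.
pose phi2 (j : J + J) (b : B) : k := match j with inl j => phi j b | inr j => phi j (inv b) end.
rewrite (trE _ e2 phi2).
- under eq_bigr do rewrite mul1r.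
  rewrite (eq_bigr (fun _ => 1)) => [|[j|j] _]; rewrite /= ?phie //; last first.
    by rewrite bc_invK // phie.
  rewrite sumr_const ltr0n cardT -cardE card_sum card_prod !card_prod !card_ord.
  by case: (d).
- by move=> x y; rewrite mulrDr.
- by move=> z b; rewrite !mul1r.
- by move=> [j|j] x y /=; rewrite ?bc_invD phiD.
- move=> [j|j] z b /=; first exact: phiZ.
  by rewrite bc_invM // bc_inv_scalar // -bc_scalarC phiZ.
move=> b; rewrite big_sumType /= -phiK.
have -> : \sum_j c (phi j (inv b)) * inv (e j) = inv (cc * inv b).
  rewrite phiK [RHS](big_morph _ (@bc_invD _ _ sigma _ rho) (@bc_inv0 _ _ sigma _ rho)).
  by apply: eq_bigr => j _; rewrite bc_invM // bc_inv_scalar // bc_scalarC.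
by rewrite bc_invM // bc_invK // hcc mulrBr mulr1 (bi_central bi) addrC subrK.
Qed.

(** The nonzero element $cc - \sigma(cc)$ is a combination of the skew central elements of the
    generators, so one of these is nonzero. It is a real multiple of $cc - \sigma(cc)$, whose square
    is $1$, so its own square is a positive scalar. *)
Lemma double_rtau_gt0 cc d n (f : B -> 'M[dring k d]_n.+1) g :
  block_isom c cc f g -> inv cc = 1 - cc ->
  exists j, 0 < rho (rtau F (sep_skew (fin_gen F j) * sep_skew (fin_gen F j))).
Proof.
move=> bi hcc; have [tr [tau [_ _ tauZ tauT [tauE trE]]]] := bc_rtrace F rho.
have tau1 : 0 < tau 1 by rewrite tauE; exact: double_trace_gt0 bi hcc trE.
have [F' [gE _]] := bc_fsep rho F.
have ccE : cc = \sum_j tn (fin_gen F j) (fin_coord F' j cc).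
  apply: (etrans (fin_coordK F' cc)); apply: eq_bigr => j _.
  by rewrite gE [RHS]bc_tensE.
have meanE : cc = \sum_j tn (sep_mean F (fin_gen F j)) (fin_coord F' j cc).
  rewrite [LHS](bc_sep_mean F (bi_central bi)); under eq_bigr do rewrite {1}ccE mulr_sumr mulr_suml.
  by rewrite exchange_big; apply: eq_bigr => j _ /=; rewrite bc_sep_mean_tens.
have skewE : cc - inv cc =
    \sum_j c (fin_coord F' j cc) * tn (sep_skew (fin_gen F j)) 1.
  rewrite {1 2}meanE [inv _](big_morph _ (@bc_invD _ _ sigma _ rho) (@bc_inv0 _ _ sigma _ rho)).
  rewrite -sumrB; apply: eq_bigr => j _.
  by rewrite -[RHS]bc_tensE bc_invE -bc_tensN -bc_tensDl.
have [j nz] : exists j, tn (sep_skew (fin_gen F j)) 1 != 0.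
  apply: contrapT => h; have e0 : cc - inv cc = 0.
    rewrite skewE big1 // => j _; have [->|nz] := eqVneq (tn (sep_skew (fin_gen F j)) 1) 0.
      by rewrite mulr0.
    by case: h; exists j.
  have h1 : cc = 1 - cc by rewrite -hcc; apply/eqP; rewrite -subr_eq0 e0.
  have : cc = 0 by rewrite -(bi_idem bi) {2}h1 mulrBr mulr1 (bi_idem bi) subrr.
  by move/eqP; rewrite (negbTE (bi_neq0 bi)).
exists j; set a := fin_gen F j in nz *; set z := tn (sep_skew a) 1 in nz.
have zC b : z * b = b * z by exact: sep_skew_central.
have zN : inv z = - z by exact: sep_skew_inv.
have ccC := bi_central bi.
have cc0 : cc * (1 - cc) = 0 by rewrite mulrBr mulr1 (bi_idem bi) subrr.
have invz : inv (cc * z) = - (z * (1 - cc)) by rewrite bc_invM // zN hcc mulNr.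
(* A symmetric central element is a scalar $x$; it follows that $z$ acts as $x$ on the first block
   and as $-x$ on the second. *)
have [x xE] : exists x, cc * z + inv (cc * z) = c x.
  apply: (bc_sym_center F invS sym_center two_unit) => [b|].
    have h1 : cc * z * b = b * (cc * z) by rewrite -mulrA zC mulrA ccC mulrA.
    have h2 : (1 - cc) * b = b * (1 - cc) by rewrite mulrBl mulrBr mul1r mulr1 ccC.
    have h3 : z * (1 - cc) * b = b * (z * (1 - cc)) by rewrite -mulrA h2 mulrA zC mulrA.
    by rewrite invz mulrDl [RHS]mulrDr h1 mulNr mulrN h3.
  by rewrite bc_invD bc_invK // addrC.
have e1 : cc * z = c x * cc.
  rewrite -xE invz mulrDl -ccC mulrA (bi_idem bi) mulNr -mulrA mulrBl mul1r (bi_idem bi).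
  by rewrite subrr mulr0 subr0.
have e2 : z * (1 - cc) = - (c x * (1 - cc)).
  have h1 : (1 - cc) * (1 - cc) = 1 - cc by rewrite mulrBl mul1r cc0 subr0.
  by rewrite -xE invz mulrDl -(zC cc) -(mulrA z cc) cc0 mulr0 add0r mulNr opprK -(mulrA z) h1.
have zE : z = c x * (cc - (1 - cc)).
  by rewrite mulrBr -e1 -e2 mulrBr mulr1 -zC addrC subrK.
have sq : (cc - (1 - cc)) * (cc - (1 - cc)) = 1.
  have h1 : (1 - cc) * (1 - cc) = 1 - cc by rewrite mulrBl mul1r cc0 subr0.
  have h2 : (1 - cc) * cc = 0 by rewrite mulrBl mul1r (bi_idem bi) subrr.
  rewrite mulrBl [X in X - _]mulrBr [X in _ - X]mulrBr (bi_idem bi) cc0 h1 h2 subr0 sub0r opprK.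
  by rewrite addrC subrK.
have zz : z * z = c (x * x) * 1.
  rewrite {1}zE zE bc_scalarM mulr1 -mulrA (mulrA (cc - (1 - cc))) -(bc_scalarC x (cc - _)).
  by rewrite -mulrA sq mulr1.
have x0 : x != 0.
  apply: contraNneq nz => x0; rewrite zE x0.
  by rewrite (_ : c 0 = 0) ?mul0r //; apply: (addrI (c 0)); rewrite -bc_scalarD !addr0.
rewrite -tauT; have -> : tn (sep_skew a * sep_skew a) 1 = z * z by rewrite bc_tensM mulr1.
by rewrite zz tauZ mulr_gt0 // -expr2 lt_def sqrf_eq0 x0 sqr_ge0.
Qed.

End Invariants.

(** * Integer signatures of symmetric matrices *)

Section GramDiag.
Variable K : fieldType.
Hypothesis two_neq0 : (2%:R : K) != 0.

Lemma gram_diag_exists (I : finType) (G : I -> I -> K) :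
  (forall i j, G i j = G j i) ->
  exists (u : 'I_#|I| -> K) T S, gram_diag G u T S.
Proof.
move=> hG; pose H := \matrix_(a < #|I|, b < #|I|) G (enum_val a) (enum_val b).
have idD : {morph (@id K) : x y / x + y} by [].
have idM (x y : K) : id (x * y) = id y * id x by rewrite /= mulrC.
have divK (x : K) : x != 0 -> exists y, x * y = 1 /\ y * x = 1.
  by move=> nx; exists x^-1; rewrite mulfV ?mulVf.
have [|u _ [T [S [TS _ HE]]]] := herm_diag idD idM (fun=> erefl) divK two_neq0 (H := H).
  by apply/matrixP => a b; rewrite !mxE hG.
exists (u 0), (fun a i => T a (enum_rank i)), (fun i b => S (enum_rank i) b); split.
  move=> a b; have := congr1 (fun X : 'M_#|I| => X a b) TS; rewrite !mxE => <-.
  rewrite (reindex (@enum_val I predT)) /=; last first.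
    by exists enum_rank => i _; rewrite ?enum_valK ?enum_rankK.
  by apply: eq_bigr => l _; rewrite enum_valK.
move=> i j; have := congr1 (fun X : 'M_#|I| => X (enum_rank i) (enum_rank j)) HE.
rewrite !mxE !enum_rankK => ->; apply: eq_bigr => a _.
rewrite mxE (bigD1 a) //= !mxE eqxx mulr1n big1 ?addr0 => [|b nb]; last first.
  by rewrite !mxE (negbTE nb) mulr0n mulr0.
by rewrite mulrAC mulrC.
Qed.

End GramDiag.

Section Sgn.
Variable k : realFieldType.

(** By [gsgnP] the default value $0$ is never reached for symmetric [G]. *)
Definition gsgn (I : finType) (G : I -> I -> k) : int := xget 0 (has_sig (gram G)).

Lemma gsgnE (I : finType) (G : I -> I -> k) s : has_sig (gram G) s -> gsgn G = s.
Proof.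
move=> h; rewrite /gsgn; case: xgetP => [s' _ h'|h']; last by case: (h' s).
exact: has_sig_uniq h' h.
Qed.

Let two0 : (2%:R : k) != 0. Proof. by rewrite pnatr_eq0. Qed.

Lemma gsgn_diag (I : finType) (G : I -> I -> k) (J : finType) (u : J -> k) T S :
  gram_diag G u T S -> gsgn G = \sum_a sgz (u a).
Proof. by move=> /gram_diag_by h; apply: gsgnE; exists J, u; eexists; split; first exact: h. Qed.

Lemma gsgnP (I : finType) (G : I -> I -> k) :
  (forall i j, G i j = G j i) -> has_sig (gram G) (gsgn G).
Proof.
move=> /(gram_diag_exists two0) [u [T [S h]]]; rewrite (gsgn_diag h).
by exists 'I_#|I|, u; eexists; split; first exact: gram_diag_by h.
Qed.

Lemma gsgn_bound (I : finType) (G : I -> I -> k) :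
  (forall i j, G i j = G j i) -> `|gsgn G| <= #|I|%:Z.
Proof.
move=> /(gram_diag_exists two0) [u [T [S h]]]; rewrite (gsgn_diag h).
apply: (le_trans (ler_norm_sum _ _ _)).
have -> : #|I|%:Z = \sum_(a < #|I|) 1 by rewrite sumr_const card_ord natz.
by apply: ler_sum => a _; rewrite normr_sgz; case: eqP.
Qed.

Lemma gsgn1 (r : k) : gsgn (fun _ _ : 'I_1 => r) = sgz r.
Proof.
apply: gsgnE; exists 'I_1, (fun _ => r), id; split; last by rewrite big_ord1.
split=> [c|x y]; first by exists c.
by rewrite /gram !big_ord1 mulrAC mulrC.
Qed.

Lemma gsgn_sum (I J : finType) (G : I -> I -> k) (H : J -> J -> k) :
  (forall i j, G i j = G j i) -> (forall i j, H i j = H j i) ->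
  gsgn (fun a b : I + J => match a, b with
    inl i, inl j => G i j | inr i, inr j => H i j | _, _ => 0 end) = gsgn G + gsgn H.
Proof.
move=> hG hH; apply: gsgnE.
have sp : forall y : (I -> k) * (J -> k), exists x : I + J -> k,
    ((fun i => x (inl i)), (fun j => x (inr j))) = y.
  by move=> [y1 y2]; exists (fun a => match a with inl i => y1 i | inr j => y2 j end).
apply: eq_has_sig (has_sig_pull sp (has_sigD (gsgnP hG) (gsgnP hH))) => x y /=.
rewrite /gram big_sumType /=; congr (_ + _); apply: eq_bigr => i _.
  rewrite big_sumType /= [X in _ = _ + X]big1 ?addr0 // => j _.
  by rewrite mulr0 mul0r.
rewrite big_sumType /= [X in _ = X + _]big1 ?add0r // => j _.
by rewrite mulr0 mul0r.
Qed.

Lemma gsgn_tensor (I J : finType) (G : I -> I -> k) (H : J -> J -> k) :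
  (forall i j, G i j = G j i) -> (forall i j, H i j = H j i) ->
  gsgn (fun a b : I * J => G a.1 b.1 * H a.2 b.2) = gsgn G * gsgn H.
Proof.
move=> hG hH; have [u [T [S h]]] := gram_diag_exists two0 hG.
rewrite (gsgn_diag h); apply: gsgnE.
have sp : forall y : I -> J -> k, exists x : I * J -> k, (fun i j => x (i, j)) = y.
  by move=> y; exists (fun p => y p.1 p.2).
apply: eq_has_sig (has_sig_pull sp (has_sig_tensor h (gsgnP hH))) => x y /=.
transitivity (\sum_i \sum_i' \sum_j \sum_j' x (i, i') * (G i j * H i' j') * y (j, j')).
  apply: eq_bigr => i _; rewrite [RHS]exchange_big; apply: eq_bigr => j _ /=.
  rewrite mulr_sumr; apply: eq_bigr => i' _; rewrite mulr_sumr.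
  by apply: eq_bigr => j' _; ring.
rewrite /gram pair_bigA; apply: eq_bigr => -[i i'] _ /=.
by rewrite pair_bigA; apply: eq_bigr => -[j j'] _.
Qed.

End Sgn.

(** * Signatures along the real spectrum *)

Lemma fraction_numden (D : idomainType) (x : {fraction D}) :
  exists n d : D, d != 0 /\ FracField.tofrac d * x = FracField.tofrac n.
Proof.
elim/quotW: x => x; exists (frac x).1, (frac x).2; split; first exact: denom_ratioP.
rewrite -[LHS]/(FracField.mul _ _) !piE; apply/eqmodP; rewrite /= FracField.equivfE.
have dx := denom_ratioP x.
rewrite /FracField.mulf !numden_Ratio ?oner_eq0 ?mulf_neq0 ?oner_eq0 //.
by rewrite !mul1r !mulr1 mulrC.
Qed.

Section Residue.
Variables (R : comNzRingType) (alpha : sper R).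

Lemma residue_map_eq0 r : residue_map alpha r = 0 <-> alpha r /\ alpha (- r).
Proof.
have -> : residue_map alpha r = 0 <-> r \in supp alpha.
  rewrite -[r in _ <-> r \in _]subr0 (@Quotient.idealrBE R (supp alpha)).
  have -> : \pi_({ideal_quot (supp alpha)}) 0 = 0 :> residue_ring alpha by rewrite raddf0.
  by rewrite -(tofrac_eq0 (\pi_(residue_ring alpha) r)); split=> /eqP.
by split=> /asboolP.
Qed.

Lemma residue_fracP (x : residue_field alpha) :
  exists a b, residue_map alpha b != 0 /\ residue_map alpha b * x = residue_map alpha a.
Proof.
have [n [d [dn e]]] := fraction_numden x; exists (repr n), (repr d).
have rmE (z : residue_ring alpha) : residue_map alpha (repr z) = FracField.tofrac z.
  by rewrite /residue_map /= reprK.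
by rewrite !rmE tofrac_eq0.
Qed.

Lemma common_denominator (P : finType) (x : P -> residue_field alpha) :
  exists d (y : P -> R), residue_map alpha d != 0 /\
    forall p, residue_map alpha d * x p = residue_map alpha (y p).
Proof.
have /choice [a /choice [b ab]] := fun p => residue_fracP (x p).
exists (\prod_p b p), (fun p => a p * \prod_(q | q != p) b q); split.
  by rewrite rmorph_prod; apply/prodf_neq0 => p _; exact: (ab p).1.
move=> p; rewrite (bigD1 p) //= !rmorphM mulrAC /=.
by have [_ /= ->] := ab p.
Qed.

Variable k : real_closure alpha.
Local Notation rho := (to_rc k).

Lemma to_rc_ge0 r : 0 <= rho r <-> alpha r.
Proof.
have pos s : alpha s -> 0 <= rho s.
  move=> h; apply: rc_nonneg; exists s, 1; split; last by rewrite rmorph1 divr1.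
    apply/negP => /asboolP; exact: ordering_proper.
  by rewrite mulr1.
split=> [h|]; last exact: pos.
have [//|h'] := ordering_total alpha r.
have : rho r = 0 by apply: le_anti; rewrite h -oppr_ge0 -rmorphN pos.
by move/eqP; rewrite fmorph_eq0 => /eqP/residue_map_eq0 [].
Qed.

Lemma to_rc_eq0 r : rho r = 0 <-> alpha r /\ alpha (- r).
Proof.
rewrite -residue_map_eq0; split=> [/eqP|h]; first by rewrite fmorph_eq0 => /eqP.
by rewrite /to_rc /= -[tofrac _]/(residue_map alpha r) h rmorph0.
Qed.

End Residue.

Section SperSgn.
Variables (R : comNzRingType) (k : forall alpha : sper R, real_closure alpha).

Definition asgn (alpha : sper R) (I : finType) (G : I -> I -> R) : int :=
  gsgn (fun i j => to_rc (k alpha) (G i j)).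

(* Diagonalize over the residue field and clear denominators. *)
Lemma asgn_locally_constant (alpha : sper R) (I : finType) (G : I -> I -> R) :
  (forall i j, G i j = G j i) ->
  exists (P : finType) (r : P -> R), forall beta : sper R,
    (forall p, sgz (to_rc (k beta) (r p)) = sgz (to_rc (k alpha) (r p))) ->
    asgn beta G = asgn alpha G.
Proof.
move=> hG; set rm := residue_map alpha.
have two0 : (2%:R : residue_field alpha) != 0.
  by rewrite -(fmorph_eq0 (rc_emb (k alpha))) rmorph_nat pnatr_eq0.
have [|u [T [S h]]] := gram_diag_exists two0 (G := fun i j => rm (G i j)).
  by move=> i j; rewrite hG.
pose J := 'I_#|I|.
pose Q := (J + (J * I + I * J))%type.
have [d [y [d0 yE]]] := common_denominator (fun q : Q => match q with
  inl a => u a | inr (inl p) => T p.1 p.2 | inr (inr p) => S p.1 p.2 end).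
pose u' a := y (inl a); pose T' a i := y (inr (inl (a, i))); pose S' i a := y (inr (inr (i, a))).
(* After clearing denominators, the vanishing of [e1] and [e2] says $T'S' = d^2$ and $d^3G = T'^t
   u'T'$. Any ordering giving these elements, [d] and the [u'] the same signs as [alpha] thus
   inherits the diagonalization. *)
pose e1 a b := \sum_i T' a i * S' i b - (a == b)%:R * d ^+ 2.
pose e2 i j := d ^+ 3 * G i j - \sum_a u' a * (T' a i * T' a j).
exists (option J + ((J * J) + (I * I)))%type.
exists (fun q => match q with inl None => d | inl (Some a) => u' a
   | inr (inl p) => e1 p.1 p.2 | inr (inr p) => e2 p.1 p.2 end).
have uE a : rm d * u a = rm (u' a) := yE (inl a).
have TE a i : rm d * T a i = rm (T' a i) := yE (inr (inl (a, i))).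
have SE i a : rm d * S i a = rm (S' i a) := yE (inr (inr (i, a))).
have e10 a b : rm (e1 a b) = 0.
  rewrite rmorphB rmorphM rmorphXn rmorph_nat rmorph_sum -(h.1 a b) mulr_suml -sumrB.
  by rewrite big1 // => i _; rewrite rmorphM -TE -SE; ring.
have e20 i j : rm (e2 i j) = 0.
  rewrite rmorphB rmorphM rmorphXn rmorph_sum h.2 mulr_sumr -sumrB.
  by rewrite big1 // => a _; rewrite !rmorphM -uE -!TE; ring.
have dia (beta : sper R) (rho := to_rc (k beta)) : rho d != 0 ->
    (forall a b, rho (e1 a b) = 0) -> (forall i j, rho (e2 i j) = 0) ->
    asgn beta G = \sum_a sgz (rho (u' a)) * sgz (rho d).
  move=> bd b1 b2; have bd' : rho d ^+ 3 != 0 by rewrite expf_eq0.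
  transitivity (\sum_a sgz (rho (u' a) / rho d)); last first.
    by apply: eq_bigr => a _; rewrite sgzM; congr (_ * _); rewrite /sgz invr_eq0 invr_lt0.
  apply: (gsgn_diag (T := fun a i => rho (T' a i) / rho d) (S := fun i a => rho (S' i a) / rho d)).
  split=> [a b|i j].
    have /eqP := b1 a b; rewrite rmorphB rmorphM rmorphXn rmorph_nat rmorph_sum subr_eq0 => /eqP e.
    have -> : (a == b)%:R = ((a == b)%:R * rho d ^+ 2) / rho d ^+ 2 by rewrite mulfK ?expf_eq0.
    by rewrite -e mulr_suml; apply: eq_bigr => i _; rewrite rmorphM; field.
  have /eqP := b2 i j; rewrite rmorphB rmorphM rmorphXn rmorph_sum subr_eq0 => /eqP e.
  have -> : rho (G i j) = (rho d ^+ 3 * rho (G i j)) / rho d ^+ 3 by field.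
  by rewrite e mulr_suml; apply: eq_bigr => a _; rewrite !rmorphM; field.
have d1 : to_rc (k alpha) d != 0 by rewrite fmorph_eq0.
have z r : rm r = 0 -> to_rc (k alpha) r = 0.
  by move=> r0; apply/to_rc_eq0/residue_map_eq0.
move=> beta hb.
have hu a : sgz (to_rc (k beta) (u' a)) = sgz (to_rc (k alpha) (u' a)) := hb (inl (Some a)).
have hd : sgz (to_rc (k beta) d) = sgz (to_rc (k alpha) d) := hb (inl None).
have b0 r : sgz (to_rc (k beta) r) = sgz (to_rc (k alpha) r) ->
    to_rc (k beta) r = 0 <-> to_rc (k alpha) r = 0.
  by move=> e; split=> h0; apply/eqP; rewrite -sgz_eq0; [rewrite -e|rewrite e]; rewrite h0 sgz0.
rewrite !dia //.
- by apply: eq_bigr => a _; rewrite hu hd.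
- by move=> a b; exact: z.
- by move=> i j; exact: z.
- by apply/eqP => /(b0 _ hd) /eqP; rewrite (negbTE d1).
- by move=> a b; apply/(b0 _ (hb (inr (inl (a, b))))); exact: z.
- by move=> i j; apply/(b0 _ (hb (inr (inr (i, j))))); exact: z.
Qed.

End SperSgn.

(** * Compactness of the real spectrum *)

Section Limit.
Variables (R : comNzRingType) (k : forall alpha : sper R, real_closure alpha).
Variable U : set_system (sper R).
Hypothesis UU : UltraFilter U.
Local Open Scope classical_set_scope.

Let UP (P Q : sper R -> Prop) : (forall a, P a -> Q a) -> U [set a | P a] -> U [set a | Q a].
Proof. by move=> PQ; apply: filterS. Qed.
Let UI (P Q : sper R -> Prop) :
  U [set a | P a] -> U [set a | Q a] -> U [set a | P a /\ Q a].
Proof. exact: filterI. Qed.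
Let Uno (P : sper R -> Prop) : (forall a, ~ P a) -> ~ U [set a | P a].
Proof. by move=> nP /filter_ex [a /nP]. Qed.
Let Uor (P Q : sper R -> Prop) : U [set a | P a \/ Q a] -> U [set a | P a] \/ U [set a | Q a].
Proof.
move=> h; have [|h'] := in_ultra_setVsetC [set a | P a] UU; first by left.
by right; apply: filterS (filterI h h') => a [[]].
Qed.

(** The prime cone axioms pass to the limit set; those with a disjunction do so because an
    ultrafilter decides between its two sides. *)
Lemma sper_limit : exists alpha : sper R, forall r, alpha r <-> U [set a | a r].
Proof.
pose o r := U [set a : sper R | a r].
have oD x y : o x -> o y -> o (x + y).
  by move=> hx hy; apply: UP (UI hx hy) => a [ax ay]; exact: orderingD.
have oM x y : o x -> o y -> o (x * y).
  by move=> hx hy; apply: UP (UI hx hy) => a [ax ay]; exact: orderingM.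
have ot x : o x \/ o (- x).
  by apply: Uor; apply: filterE => a; exact: ordering_total.
have op : ~ (o 1 /\ o (-1)).
  by case=> h1 h2; apply: Uno (UI h1 h2) => a; exact: ordering_proper.
have oP x y : o (x * y) /\ o (- (x * y)) -> (o x /\ o (- x)) \/ (o y /\ o (- y)).
  case=> h1 h2; have : U [set a : sper R | (a x /\ a (- x)) \/ (a y /\ a (- y))].
    by apply: UP (UI h1 h2) => a; exact: ordering_prime.
  by case/Uor => h; [left|right]; split; apply: UP h => a [].
by exists (Sper oD oM ot op oP).
Qed.

Variable alpha : sper R.
Hypothesis lim_alpha : forall r, alpha r <-> U [set a | a r].

(** The sign of $r$ is determined by whether $r$ and $-r$ belong to the ordering, and an ultrafilter
    decides non-membership as well as membership. *)
Lemma limit_sgz r : U [set a | sgz (to_rc (k a) r) = sgz (to_rc (k alpha) r)].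
Proof.
have N (P : sper R -> Prop) : ~ U [set a | P a] -> U [set a | ~ P a].
  by move=> h; have [|] := in_ultra_setVsetC [set a | P a] UU.
have sgE (a : sper R) : sgz (to_rc (k a) r) =
    if `[< a r >] then if `[< a (- r) >] then 0 else 1 else -1.
  have [h1|h1] := asboolP; last first.
    by apply/ltr0_sgz; rewrite ltNge; apply/negP => /to_rc_ge0.
  have [h2|h2] := asboolP; first by apply/eqP; rewrite sgz_eq0; apply/eqP/to_rc_eq0.
  apply/gtr0_sgz; rewrite lt_neqAle; apply/andP; split; last exact/to_rc_ge0.
  by apply/eqP => /esym /to_rc_eq0 [].
have h s : U [set a : sper R | `[< a s >] = `[< alpha s >]].
  have [h1|h1] := asboolP (alpha s).
    by apply: UP ((lim_alpha s).1 h1) => a; move/asboolP.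
  apply: (UP (P := fun a : sper R => ~ a s)); first by move=> a h; exact/asboolPn.
  by apply: N => /lim_alpha.
by apply: UP (UI (h r) (h (- r))) => a [e1 e2]; rewrite !sgE e1 e2.
Qed.

Lemma limit_asgn (I : finType) (G : I -> I -> R) : (forall i j, G i j = G j i) ->
  U [set a | asgn k a G = asgn k alpha G].
Proof.
move=> hG; have [P [r h]] := asgn_locally_constant k alpha hG.
by apply: UP h _; apply: filter_forall => p; exact: limit_sgz.
Qed.

End Limit.

(** * Algebraic elements over an ordered subfield *)

(* The trace of p on K[X] / (f), expressed without a splitting field of f. *)
Lemma trace_mod_prod (K : fieldType) (s : seq K) (p : {poly K})
    (f := \prod_(z <- s) ('X - z%:P)) :
  ((p * f^`()) %% f)`_(size s).-1 = \sum_(z <- s) p.[z].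
Proof.
(* Exhibiting quotient and remainder explicitly lets the induction add one root at a time, through
   $p = p(a) + q(X - a)$. *)
have [u [r [e sr cr]]] : exists u r : {poly K},
    [/\ p * f^`() = u * f + r, (size r <= size s)%N & r`_(size s).-1 = \sum_(z <- s) p.[z]].
  rewrite {}/f; elim: s => [|a s [u [r [e sr cr]]]].
    by exists 0, 0; rewrite big_nil derivC mulr0 mul0r addr0 size_poly0 coef0 big_nil.
  set h := \prod_(z <- s) ('X - z%:P) in e.
  have [q qE] : exists q, p - p.[a]%:P = q * ('X - a%:P).
    by apply/factor_theorem; rewrite /root !hornerE subrr.
  exists (u + q), (p.[a]%:P * h + ('X - a%:P) * r).
  have sh : size h = (size s).+1 by rewrite size_prod_XsubC.
  have hm : h`_(size s) = 1.
    by have /monicP := monic_prod_XsubC s predT id; rewrite lead_coefE -/h sh.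
  split.
  - rewrite big_cons -/h derivM derivXsubC mul1r mulrDr mulrCA e.
    by rewrite -[X in X * h + _](subrK p.[a]%:P p) qE; ring.
  - rewrite (leq_trans (size_polyD _ _)) // geq_max; apply/andP; split.
      by rewrite (leq_trans (size_polyMleq _ _)) // sh size_polyC; case: (_ != 0).
    rewrite (leq_trans (size_polyMleq _ _)) // size_XsubC.
    by rewrite addSn /= add1n ltnS.
  rewrite coefD coefCM big_cons /= hm mulr1; congr (_ + _).
  rewrite mulrBl coefB coefXM coefCM [r`_(size s)]nth_default // mulr0 subr0.
  case: eqP => [s0|_]; last exact: cr.
  by rewrite (size0nil s0) big_nil.
rewrite e modpD modp_mull add0r modp_small ?cr //.
by rewrite size_prod_XsubC ltnS.
Qed.

Lemma poly_interpolation (K : fieldType) (s : seq K) (v : K -> K) : uniq s ->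
  exists h : {poly K}, (size h <= size s)%N /\ forall z, z \in s -> h.[z] = v z.
Proof.
elim: s => [|a s IHs] /=; first by exists 0; rewrite size_poly0.
case/andP=> nas us; have [h [sh hv]] := IHs us.
pose w : {poly K} := \prod_(z <- s) ('X - z%:P).
have wa : w.[a] != 0 by rewrite -[_ == 0]/(root w a) root_prod_XsubC.
exists (h + ((v a - h.[a]) / w.[a])%:P * w); split.
  rewrite (leq_trans (size_polyD _ _)) // geq_max (leq_trans sh) //=.
  rewrite (leq_trans (size_polyMleq _ _)) // size_prod_XsubC size_polyC.
  by case: (_ != 0).
move=> z; rewrite inE => /orP [/eqP ->|zs]; rewrite hornerD hornerCM.
  by rewrite divfK // addrC subrK.
have /eqP -> : w.[z] == 0 by rewrite -[_ == 0]/(root w z) root_prod_XsubC.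
by rewrite mulr0 addr0 hv.
Qed.

(* Thom's lemma: by Rolle's theorem, a polynomial whose derivatives have the
   same signs at a and b does not vanish in between. *)
Lemma deriv_signs_no_root (k : rcfType) (p : {poly k}) (a b x : k) :
  p != 0 -> a < b -> (forall i, sgz p^`(i).[a] = sgz p^`(i).[b]) ->
  a <= x <= b -> p.[x] != 0.
Proof.
have [n le_n] := ubnP (size p); elim: n => // n IHn in p x le_n *.
move=> p0 ab sg xab; have [d0|d0] := eqVneq p^`() 0.
  have [c pc] : exists c, p = c%:P.
    exists p`_0; apply/polyP => -[|i]; rewrite coefC //=.
    have /eqP := congr1 (fun q : {poly k} => q`_i) d0.
    by rewrite coef_deriv coef0 mulrn_eq0 => /eqP.
  by rewrite pc hornerC; apply: contraNneq p0 => c0; rewrite pc c0 polyC0.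
have dn y : a <= y <= b -> p^`().[y] != 0.
  move=> yab; apply: IHn => // [|i].
    by apply: leq_trans (lt_size_deriv p0) _.
  by have := sg i.+1; rewrite !derivSn.
apply/eqP => px0; have sg0 := sg 0%N; rewrite !derivn0 in sg0.
have [ax xb] := andP xab.
have inab c y z : a <= y -> z <= b -> c \in `]y, z[ -> a <= c <= b.
  by move=> ay zb; rewrite in_itv /= => /andP [h1 h2]; lra.
have [e|nxa] := eqVneq x a.
  have pb0 : p.[b] = 0.
    by apply/eqP; rewrite -sgz_eq0 -sg0 -e px0 sgz0.
  have [c cab pc] := poly_rolle ab (etrans (etrans (congr1 (horner p) (esym e)) px0) (esym pb0)).
  by have := dn c (inab c a b (lexx _) (lexx _) cab); rewrite pc eqxx.
have [e|nxb] := eqVneq x b.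
  have pa0 : p.[a] = 0.
    by apply/eqP; rewrite -sgz_eq0 sg0 -e px0 sgz0.
  have [c cab pc] := poly_rolle ab (etrans pa0 (esym (etrans (congr1 (horner p) (esym e)) px0))).
  by have := dn c (inab c a b (lexx _) (lexx _) cab); rewrite pc eqxx.
have {}ax : a < x by rewrite lt_neqAle eq_sym nxa.
have {}xb : x < b by rewrite lt_neqAle nxb.
have [c cax hc] := poly_mvt p ax; have [e exb he] := poly_mvt p xb.
have cab := inab c a x (lexx _) (ltW xb) cax.
have eab := inab e x b (ltW ax) (lexx _) exb.
have lce : c < e.
  by move: cax exb; rewrite !in_itv /= => /andP [_ h1] /andP [h2 _]; exact: lt_trans h1 h2.
(* $p$ vanishes at $x$ and has the same nonzero sign at $a$ and $b$, so the mean slopes before and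
   after $x$ have opposite signs and $p'$ vanishes in between, against the induction hypothesis. *)
have neg : p^`().[c] * p^`().[e] < 0.
  rewrite px0 in hc he; rewrite sub0r in hc; rewrite subr0 in he.
  have /eqP s1 : sgz p^`().[c] == - sgz p.[a].
    by rewrite -sgzN hc sgzM [sgz (x - a)]gtr0_sgz ?subr_gt0 // mulr1.
  have /eqP s2 : sgz p^`().[e] == sgz p.[b].
    by rewrite he sgzM [sgz (b - x)]gtr0_sgz ?subr_gt0 // mulr1.
  have pb0 : p.[b] != 0 by rewrite -sgz_eq0 -s2 sgz_eq0 dn.
  by rewrite -sgz_lt0 sgzM s1 s2 sg0; case: sgzP pb0.
have [y yce ry] := poly_ivtoo (ltW lce) neg.
have yab : a <= y <= b.
  by move: yce; rewrite in_itv /=; case/andP: cab; case/andP: eab; lra.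
by have := dn y yab; rewrite (eqP ry) eqxx.
Qed.

(** The derivatives of [f] are themselves candidates for [q]; if none of them separated $a$ from
    $b$, then [deriv_signs_no_root] would contradict $f(a) = 0$. *)
Lemma separate_by_sign (k : rcfType) (K : fieldType) (iota : {rmorphism K -> k})
    (f : {poly K}) (a b : k) : f != 0 -> root (map_poly iota f) a ->
  a != b -> exists q : {poly K}, sgz (map_poly iota q).[a] != sgz (map_poly iota q).[b].
Proof.
move=> f0 fa nab; apply: contrapT => h.
have sg i : sgz (map_poly iota f)^`(i).[a] = sgz (map_poly iota f)^`(i).[b].
  apply/eqP; apply: contrapT => /negP ne; case: h.
  by exists (f^`(i)); rewrite -derivn_map.
have f0' : map_poly iota f != 0 by rewrite map_poly_eq0.
have := nab; rewrite neq_lt => /orP [lt|lt].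
  have := deriv_signs_no_root f0' lt sg (x := a).
  by rewrite lexx (ltW lt) (eqP fa) eqxx => /(_ isT).
have := deriv_signs_no_root f0' lt (fun i => esym (sg i)) (x := a).
by rewrite lexx (ltW lt) (eqP fa) eqxx => /(_ isT).
Qed.

(** * Primitive elements and separable polynomials in characteristic zero *)

Section PrimitiveElement.
Variables (K k : fieldType) (iota : {rmorphism K -> k}).
Hypothesis pchar0 : [pchar K] =i pred0.
Hypothesis alg : forall y : k, algebraicOver iota y.

Lemma primitive_element (s : seq k) :
  exists t, forall x, x \in s -> exists g : {poly K}, (map_poly iota g).[t] = x.
Proof.
elim: s => [|x s [t tP]]; first by exists 0 => x; rewrite in_nil.
have [p p0 px] := alg x; have [q q0 qt] := alg t.
have := pchar0_PET p0 px q0 qt pchar0; case=> n /= [[g1 g1E] [g2 g2E]].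
exists (t *+ n - x) => y; rewrite inE => /orP [/eqP ->|/tP [g gE]]; first by exists g1.
by exists (g \Po g2); rewrite map_comp_poly horner_comp g2E.
Qed.

(** Take a nonzero polynomial of least degree vanishing at $t$. A nontrivial gcd with the derivative
    would split it into two shorter factors, one of which vanishes at $t$. *)
Lemma minimal_separable (t : k) : exists f : {poly K},
  [/\ f \is monic, root (map_poly iota f) t & separable_poly f].
Proof.
pose P n := `[< exists f : {poly K}, [/\ f != 0, root (map_poly iota f) t & size f = n] >].
have exP : exists n, P n.
  by have [p p0 pt] := alg t; exists (size p); apply/asboolP; exists p.
case: (ex_minnP exP) => n /asboolP [f [f0 ft sf]] fmin.
have minf g : g != 0 -> root (map_poly iota g) t -> (size f <= size g)%N.
  by move=> g0 gt; rewrite sf; apply: fmin; apply/asboolP; exists g.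
have c0 : (lead_coef f)^-1 != 0 by rewrite invr_eq0 lead_coef_eq0.
exists ((lead_coef f)^-1 *: f); split.
- by rewrite monicE lead_coefZ mulVf ?lead_coef_eq0.
- by rewrite map_polyZ rootZ ?fmorph_eq0.
rewrite (eqp_separable (eqp_scale f c0)).
have d0 : f^`() != 0.
  apply/eqP => d0; have : f = (f`_0)%:P.
    apply/polyP => -[|i]; rewrite coefC //=.
    have /eqP := congr1 (fun q : {poly K} => q`_i) d0.
    rewrite coef_deriv coef0 -mulr_natr mulf_eq0 => /orP [/eqP //|].
    by rewrite ((pcharf0P K).1 pchar0).
  move=> fE; move: ft f0; rewrite fE map_polyC rootC fmorph_eq0 => /eqP ->.
  by rewrite eqxx.
rewrite unlock; apply/negPn/negP => ncop.
have gdvd := dvdp_gcdl f f^`(); have gn0 : gcdp f f^`() != 0 by rewrite gcdp_eq0 (negbTE f0).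
have sg : (size (gcdp f f^`()) < size f)%N.
  exact: leq_ltn_trans (dvdp_leq d0 (dvdp_gcdr _ _)) (lt_size_deriv f0).
have /dvdpP [h hE] := gdvd.
have h0 : h != 0 by apply: contraNneq f0 => h0; rewrite hE h0 mul0r.
have sg1 : (1 < size (gcdp f f^`()))%N.
  by rewrite ltn_neqAle eq_sym ncop size_poly_gt0.
have sh : (size h < size f)%N.
  have -> : size f = (size h + size (gcdp f f^`())).-1 by rewrite -size_mul // -hE.
  by case: (size _) sg1 => // -[] // n' _; rewrite !addnS /= ltnS leq_addr.
have : root (map_poly iota (h * gcdp f f^`())) t by rewrite -hE.
rewrite rmorphM rootM => /orP [/(minf h h0)|/(minf _ gn0)].
  by rewrite leqNgt sh.
by rewrite leqNgt sg.
Qed.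

End PrimitiveElement.

(** Multiplication by $i$ negates the form, so its signature is $0$ once it is known to have one. *)
Lemma has_sig_complex (k : rcfType) (P : finType) (W : P -> P -> k[i]) :
  (forall p q, W p q = W q p) ->
  has_sig (fun v w : P -> k[i] => complex.Re (\sum_p \sum_q W p q * (v p * w q))) 0.
Proof.
move=> hW; pose e (b : bool) : k[i] := if b then 'i%C else 1.
pose G (a b : P * bool) : k := complex.Re (W a.1 b.1 * (e a.2 * e b.2)).
pose rc := real_complex k.
pose c (v : P -> k[i]) (a : P * bool) : k :=
  if a.2 then complex.Im (v a.1) else complex.Re (v a.1).
have vE v p : v p = \sum_b rc (c v (p, b)) * e b.
  rewrite big_bool /= mulr1 addrC {1}[v p]complexE; congr (_ + _).
  by rewrite mulrC.
have cs y : exists v, c v = y.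
  exists (fun p => y (p, false) +i* y (p, true))%C.
  by apply/funext => -[p []].
have hG a b : G a b = G b a by rewrite /G hW [e _ * e _]mulrC.
have reZ x (z : k[i]) : complex.Re (rc x * z) = x * complex.Re z.
  by case: z => z1 z2 /=; ring.
have h := has_sig_pull cs (gsgnP hG).
have {}h : has_sig (fun v w : P -> k[i] => complex.Re (\sum_p \sum_q W p q * (v p * w q))) (gsgn G).
  apply: eq_has_sig h => v w; rewrite /gram.
  transitivity (\sum_p \sum_b \sum_q \sum_b' c v (p, b) * G (p, b) (q, b') * c w (q, b')).
    rewrite [RHS]pair_bigA; apply: eq_bigr => -[p b] _ /=.
    by rewrite [RHS]pair_bigA; apply: eq_bigr => -[q b'] _.
  rewrite raddf_sum; apply: eq_bigr => p _ /=; rewrite exchange_big raddf_sum.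
  apply: eq_bigr => q _ /=; rewrite [v p]vE [w q]vE big_distrlr mulr_sumr raddf_sum.
  apply: eq_bigr => b _ /=; rewrite mulr_sumr raddf_sum; apply: eq_bigr => b' _ /=.
  rewrite -[RHS]/(complex.Re (W p q * (rc (c v (p, b)) * e b * (rc (c w (q, b')) * e b')))).
  have -> : W p q * (rc (c v (p, b)) * e b * (rc (c w (q, b')) * e b')) =
    rc (c v (p, b)) * (rc (c w (q, b')) * (W p q * (e b * e b'))) by ring.
  by rewrite !reZ mulrC mulrCA.
have ii : 'i%C * 'i%C = -1 :> k[i] by rewrite -expr2 sqr_i.
rewrite -(has_sig_anti (T := fun v p => 'i%C * v p) _ _ h) //.
  move=> y; exists (fun p => - ('i%C * y p)); apply/funext => p.
  by rewrite mulrN mulrA ii mulN1r opprK.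
move=> v w; rewrite -raddfN -sumrN; congr complex.Re; apply: eq_bigr => p _.
rewrite -sumrN; apply: eq_bigr => q _.
have -> : 'i%C * v p * ('i%C * w q) = ('i%C * 'i%C) * (v p * w q) by ring.
by rewrite ii mulN1r mulrN.
Qed.

Lemma sum_conj_roots (k : rcfType) (s : seq k[i]) (h : k[i] -> k) :
  uniq s -> (forall z, z \in s -> conjc z \in s) -> (forall z, h (conjc z) = h z) ->
  \sum_(z <- s) h z = \sum_(z <- [seq z <- s | complex.Im z == 0]) h z +
    \sum_(z <- [seq z <- s | 0 < complex.Im z]) (h z + h z).
Proof.
move=> us cs hh; rewrite !big_filter (bigID (fun z => complex.Im z == 0)) /=; congr (_ + _).
rewrite (bigID (fun z => 0 < complex.Im z)) big_split /=; congr (_ + _).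
  by apply: eq_bigl => z; case: ltgtP.
have ps : perm_eq s (map conjc s).
  apply: uniq_perm => //; first by rewrite map_inj_uniq //; exact: (can_inj (@conjcK _)).
  move=> z; apply/idP/mapP => [zs|[w ws ->]]; last exact: cs.
  by exists (conjc z); rewrite ?conjcK // cs.
rewrite (perm_big _ ps) big_map /=; apply: eq_big => [[a b]|z _]; last exact: hh.
by rewrite /= oppr_eq0 oppr_gt0; case: ltgtP.
Qed.

(** * Hermite's theorem for scaled trace forms with matrix coefficients *)

Section TraceForm.
Variables (k : rcfType) (K : fieldType) (iota : {rmorphism K -> k}).
Variables (f : {poly K}) (d : nat).
Hypothesis f_monic : f \is monic.
Hypothesis f_sep : separable_poly f.
Hypothesis size_f : size f = d.+1.
Variables (L P : finType) (beta : L -> P -> P -> k) (g : L -> {poly K}).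
Hypothesis beta_sym : forall l p p', beta l p p' = beta l p' p.

(** The trace of the class of $p$ in $K[X]/(f)$, by [trace_mod_prod]. *)
Definition trace_form (p : {poly K}) : K := ((p * f^`()) %% f)`_d.-1.
(** The form $u, v \mapsto \mathrm{Tr}(uvqg_l)$ in the basis $1, X, \dots, X^{d-1}$. *)
Definition trace_gram (q : {poly K}) (l : L) (i j : 'I_d) : K :=
  trace_form ('X^(i + j) * q * g l).

Local Notation C := k[i].
Local Notation rc := (real_complex k).
Let iC : {rmorphism K -> C} := real_complex k \o iota.
Let ev (p : {poly K}) (z : C) : C := (map_poly iC p).[z].
Let evr (p : {poly K}) (t : k) : k := (map_poly iota p).[t].

Let conj_ev p z : ev p (conjc z) = conjc (ev p z).
Proof.
rewrite /ev -[RHS]horner_map; congr (_.[_]); rewrite -map_poly_comp.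
apply: eq_map_poly => a /=; exact/esym/conjc_real.
Qed.
Let ev_real p t : ev p (rc t) = rc (evr p t).
Proof. by rewrite /ev /evr -horner_map -map_poly_comp. Qed.

Variable q : {poly K}.
Let phi (z : C) (v w : P -> C) : C :=
  \sum_p \sum_p' (ev q z * \sum_l ev (g l) z * rc (beta l p p')) * (v p * w p').
Let at_ (x : 'I_d * P -> k) (z : C) (p : P) : C := \sum_i rc (x (i, p)) * z ^+ i.
Local Notation M := (fun a b : 'I_d * P => \sum_l iota (trace_gram q l a.1 b.1) * beta l a.2 b.2).

Lemma trace_roots : exists s : seq C,
  [/\ uniq s, size s = d, (forall z, (z \in s) = root (map_poly iC f) z) &
      forall p, iC (trace_form p) = \sum_(z <- s) ev p z].
Proof.
have [s sE] := closed_field_poly_normal (map_poly iC f).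
have mf : map_poly iC f \is monic by rewrite map_monic.
rewrite (monicP mf) scale1r in sE; exists s.
have sz : size s = d.
  by have := size_map_poly iC f; rewrite sE size_prod_XsubC size_f => -[].
split=> //.
- by rewrite -separable_prod_XsubC -sE separable_map.
- by move=> z; rewrite sE root_prod_XsubC.
move=> p; rewrite /trace_form -coef_map map_modp rmorphM /= -deriv_map sE -sz.
exact: trace_mod_prod.
Qed.

Let gramE x y (s : seq C) : (forall p, iC (trace_form p) = \sum_(z <- s) ev p z) ->
  rc (gram M x y) = \sum_(z <- s) phi z (at_ x z) (at_ y z).
Proof.
move=> sE; rewrite /gram rmorph_sum.
transitivity (\sum_i \sum_p \sum_j \sum_p' \sum_(z <- s)
    rc (x (i, p)) * rc (y (j, p')) * (z ^+ (i + j) * ev q z *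
      \sum_l ev (g l) z * rc (beta l p p'))).
  rewrite [RHS]pair_bigA; apply: eq_bigr => -[i p] _ /=; rewrite rmorph_sum.
  rewrite [RHS]pair_bigA; apply: eq_bigr => -[j p'] _ /=.
  rewrite !rmorphM rmorph_sum /= mulrAC -mulr_sumr; congr (_ * _).
  transitivity (\sum_l \sum_(z <- s) ev ('X^(i + j) * q * g l) z * rc (beta l p p')).
    by apply: eq_bigr => l _; rewrite rmorphM -mulr_suml -sE.
  rewrite exchange_big; apply: eq_bigr => z _ /=; rewrite mulr_sumr.
  apply: eq_bigr => l _; rewrite /ev !rmorphM /= !hornerM map_polyXn hornerXn.
  by rewrite mulrA.
rewrite exchange_big.
under eq_bigr => p _.
  under eq_bigr => i _ do rewrite exchange_big.
  rewrite exchange_big; over.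
rewrite /= /phi [RHS]exchange_big; apply: eq_bigr => p _ /=.
rewrite [RHS]exchange_big; apply: eq_bigr => p' _ /=.
under eq_bigr => i _ do rewrite exchange_big.
rewrite exchange_big; apply: eq_bigr => z _ /=; rewrite /at_ big_distrlr mulr_sumr /=.
apply: eq_bigr => i _; rewrite mulr_sumr; apply: eq_bigr => j _; rewrite exprD.
by ring.
Qed.

Let root_conj z : root (map_poly iC f) z -> root (map_poly iC f) (conjc z).
Proof. by rewrite /root -!/(ev f _) conj_ev => /eqP ->; rewrite conjc0. Qed.

(** Interpolate over the complex numbers and keep the real parts of the coefficients; for
    conjugation-invariant data this leaves the values unchanged. *)
Let at_surj (s : seq C) (v : C -> P -> C) : uniq s -> size s = d ->
  (forall z, z \in s -> conjc z \in s) ->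
  (forall z p, z \in s -> v (conjc z) p = conjc (v z p)) ->
  exists x, forall z p, z \in s -> at_ x z p = v z p.
Proof.
move=> us ss cs hv.
have /choice [h hP] : forall p, exists h : {poly C}, (size h <= size s)%N /\
    forall z, z \in s -> h.[z] = v z p.
  by move=> p; exact: poly_interpolation.
exists (fun a : 'I_d * P => complex.Re (h a.2)`_a.1) => z p zs; have [sh hE] := hP p.
have two0 : (2%:R : C) != 0 by rewrite pnatr_eq0.
apply: (mulfI two0).
have reE (a : C) : 2%:R * rc (complex.Re a) = a + conjc a.
  by case: a => a1 a2; apply/eqP; rewrite eq_complex /=; apply/andP; split; apply/eqP; ring.
have hsum : h p = \poly_(i < d) (h p)`_i.
  apply/polyP => i; rewrite coef_poly; case: ltnP => // le.
  by rewrite nth_default // (leq_trans sh) // ss.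
have hz y : (h p).[y] = \sum_(i < d) (h p)`_i * y ^+ i.
  by rewrite {1}hsum horner_poly.
have -> : 2%:R * v z p = (h p).[z] + conjc (h p).[conjc z].
  by rewrite !hE ?cs // hv // conjcK mulr2n mulrDl mul1r.
rewrite /at_ !hz rmorph_sum mulr_sumr -big_split; apply: eq_bigr => i _ /=.
rewrite mulrA reE mulrDl rmorphM rmorphXn; congr (_ + _ * _ ^+ _).
exact/esym/conjcK.
Qed.

(** Evaluation at the roots of $f$ splits the form. Real roots give the terms on the right, and a
    conjugate pair gives twice the real part of a complex symmetric form, of signature $0$. *)
Lemma trace_signature (T : seq k) : uniq T ->
  (forall t, (t \in T) = root (map_poly iota f) t) ->
  gsgn M = \sum_(t <- T) sgz (evr q t) *
    gsgn (fun p p' => \sum_l evr (g l) t * beta l p p').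
Proof.
move=> uT TE; have [s [us ss sroot trE]] := trace_roots.
have cs z : z \in s -> conjc z \in s by rewrite !sroot; exact: root_conj.
pose sc := [seq z <- s | 0 < complex.Im z].
have uc : uniq sc := filter_uniq _ us.
have TsE : perm_eq [seq z <- s | complex.Im z == 0] (map rc T).
  apply: uniq_perm; first exact: filter_uniq.
    by rewrite map_inj_uniq // => x y [].
  have rE t : (rc t \in s) = (t \in T).
    by rewrite sroot TE /root -/(ev f _) ev_real fmorph_eq0.
  move=> z; rewrite mem_filter; apply/andP/mapP => [[/eqP z0 zs]|[t tT ->]].
    have zE : z = rc (complex.Re z) by case: (z) z0 => a b /= ->.
    by exists (complex.Re z); rewrite -?rE -?zE.
  by rewrite /= rE.
pose nt := size T; pose nc := size sc.
pose t_ (i : 'I_nt) := tnth (in_tuple T) i; pose z_ (i : 'I_nc) := tnth (in_tuple sc) i.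
(* Evaluation at the real roots and at one root of each conjugate pair. *)
pose F (x : 'I_d * P -> k) : ('I_nt -> P -> k) * ('I_nc -> P -> C) :=
  ((fun i p => complex.Re (at_ x (rc (t_ i)) p)), (fun i => at_ x (z_ i))).
pose B t p p' := \sum_l evr (g l) t * beta l p p'.
have Bsym t p p' : B t p p' = B t p' p.
  by apply: eq_bigr => l _; rewrite beta_sym.
pose W z p p' : C := ev q z * \sum_l ev (g l) z * rc (beta l p p').
have Wsym z p p' : W z p p' = W z p' p.
  by congr (_ * _); apply: eq_bigr => l _; rewrite beta_sym.
have sigR (i : 'I_nt) : has_sig (fun v w : P -> k => evr q (t_ i) * gram (B (t_ i)) v w)
    (sgz (evr q (t_ i)) * gsgn (B (t_ i))).
  by apply/has_sigZ/gsgnP; exact: Bsym.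
have sigC (i : 'I_nc) := has_sigZ (2%:R : k) (has_sig_complex (Wsym (z_ i))).
have sig := has_sigD (has_sig_sum sigR) (has_sig_sum sigC).
have scs z : z \in sc -> z \in s by rewrite mem_filter => /andP [].
have scP z : z \in sc -> 0 < complex.Im z by rewrite mem_filter => /andP [].
have rE t : (rc t \in s) = (t \in T).
  by rewrite sroot TE /root -/(ev f _) ev_real fmorph_eq0.
have Fsurj y : exists x, F x = y.
  (* Extends [y] by $0$ away from the chosen roots, then to the lower half plane by conjugation,
     which is the symmetry that [at_surj] asks for. *)
  pose vr (t : k) p : k := oapp (fun i => y.1 i p) 0 (insub (index t T)).
  pose vc (z : C) p : C := oapp (fun i => y.2 i p) 0 (insub (index z sc)).
  pose v (z : C) p : C := if complex.Im z == 0 then rc (vr (complex.Re z) p) else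
    if 0 < complex.Im z then vc z p else conjc (vc (conjc z) p).
  have [z p _|x xE] := @at_surj s v us ss cs.
    rewrite /v; case: z => a b /=; rewrite oppr_eq0 oppr_gt0.
    by case: ltgtP => _; rewrite ?oppr0 ?opprK ?conjcK //= oppr0.
  exists x; case: y @vr @vc @v xE => y1 y2 vr vc v xE; congr (_, _).
    apply/funext => i; apply/funext => p; rewrite xE ?rE ?mem_tnth // /v /= eqxx /=.
    rewrite /vr /t_ (tnth_nth 0) index_uniq ?ltn_ord //.
    by case: insubP => [j _ ji|]; rewrite ?ltn_ord //=; congr (y1 _ p); exact: val_inj.
  apply/funext => i; apply/funext => p; have zsc : z_ i \in sc by exact: mem_tnth.
  rewrite xE ?scs // /v gt_eqF ?scP // /vc /z_ (tnth_nth 0) index_uniq ?ltn_ord //.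
  by case: insubP => [j _ ji|]; rewrite ?ltn_ord //=; congr (y2 _ p); exact: val_inj.
have {sig} := has_sig_pull Fsurj sig.
rewrite (_ : \sum_(i < nt) _ = \sum_(t <- T) sgz (evr q t) * gsgn (B t)); last first.
  by rewrite [RHS]big_tnth.
rewrite [X in _ + X]big1 => [|i _]; last by rewrite mulr0.
rewrite addr0 => sig; apply: gsgnE; apply: eq_has_sig sig => x y /=.
have Mre : gram M x y = complex.Re (\sum_(z <- s) phi z (at_ x z) (at_ y z)).
  by rewrite -gramE.
have at_conj w z p : at_ w (conjc z) p = conjc (at_ w z p).
  rewrite /at_ rmorph_sum; apply: eq_bigr => i _.
  by rewrite rmorphM rmorphXn; congr (_ * _); exact/esym/conjc_real.
have phi_conj z : phi (conjc z) (at_ x (conjc z)) (at_ y (conjc z)) =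
    conjc (phi z (at_ x z) (at_ y z)).
  rewrite /phi rmorph_sum; apply: eq_bigr => p _; rewrite rmorph_sum.
  apply: eq_bigr => p' _; rewrite !rmorphM !at_conj conj_ev; congr (_ * _ * _).
  rewrite rmorph_sum; apply: eq_bigr => l _.
  by rewrite rmorphM conj_ev; congr (_ * _); exact/esym/conjc_real.
rewrite Mre raddf_sum (sum_conj_roots (h := fun z => complex.Re (phi z (at_ x z) (at_ y z)))) //=;
  last by move=> z; rewrite phi_conj; case: (phi z _ _).
congr (_ + _); last first.
  rewrite [RHS]big_tnth; apply: eq_bigr => i _.
  by rewrite mulr2n mulrDl mul1r.
rewrite (perm_big _ TsE) big_map [RHS]big_tnth; apply: eq_bigr => i _.
rewrite -/(t_ i) /phi [RHS]raddf_sum /gram mulr_sumr; apply: eq_bigr => p _ /=.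
rewrite [RHS]raddf_sum mulr_sumr; apply: eq_bigr => p' _ /=.
have at_re w t p0 : at_ w (rc t) p0 = rc (complex.Re (at_ w (rc t) p0)).
  have := at_conj w (rc t) p0; rewrite conjc_real.
  case: (at_ w _ _) => a b /= [] /eqP; rewrite -subr_eq0 opprK -mulr2n mulrn_eq0 /=.
  by move/eqP ->.
rewrite ev_real (at_re x) (at_re y).
have -> : \sum_l ev (g l) (rc (t_ i)) * rc (beta l p p') = rc (B (t_ i) p p').
  by rewrite rmorph_sum; apply: eq_bigr => l _; rewrite ev_real rmorphM.
rewrite -!rmorphM /=; ring.
Qed.

End TraceForm.

(** * Transfer to the subfield with nonzero signature *)

Section Transfer.
Variables (k : rcfType) (K : fieldType) (iota : {rmorphism K -> k}).
Local Notation evr p t := (map_poly iota p).[t].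
Local Notation chi q t := (sgz (evr q t)).

(** The sign functions are closed under products. If all sums vanished, so would all sums weighted
    by polynomials in sign functions; such weights can be made $0$ at every $t \neq a$ in $T$ and
    nonzero at $a$, forcing $w(a) = 0$. *)
Lemma sign_combination (T : seq k) (a : k) (w : k -> int) :
  uniq T -> a \in T -> w a != 0 ->
  (forall t, t != a -> exists q, chi q a != chi q t) ->
  exists q, \sum_(t <- T) chi q t * w t != 0.
Proof.
move=> uT aT wa sep; apply: contrapT => H.
have {}H q : \sum_(t <- T) chi q t * w t = 0.
  by apply/eqP/negPn/negP => nz; apply: H; exists q.
have chiM p q t : chi (p * q) t = chi p t * chi q t by rewrite rmorphM hornerM sgzM.
have [phi [pa p0 pS]] : exists phi : k -> int, [/\ phi a != 0,
    forall t, t \in T -> t != a -> phi t = 0 &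
    forall q, \sum_(t <- T) phi t * (chi q t * w t) = 0].
  have : forall t, t \in T -> t \in T by [].
  elim: {1 3}T => [|t s IHs] sT.
    exists (fun=> 1); split=> // q.
    by under eq_bigr do rewrite mul1r; exact: H.
  have [phi [pa p0 pS]] := IHs (fun u us => sT u (mem_behead (s := t :: s) us)).
  have [ta|/[dup] nta /sep [q0 qne]] := eqVneq t a.
    by exists phi; split=> // u; rewrite inE ta => /orP [/eqP ->|/p0 //]; rewrite eqxx.
  (* On $\{-1, 0, 1\}$ one of $1 - X^2$, $X^2 + X$, $X^2 - X$ is nonzero exactly at the sign of [q0]
     at [a]. *)
  have [c0 [c1 [c2 [ca ct]]]] : exists c0 c1 c2 : int,
      c0 + c1 * chi q0 a + c2 * (chi q0 a * chi q0 a) != 0 /\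
      c0 + c1 * chi q0 t + c2 * (chi q0 t * chi q0 t) = 0.
    case: (sgzP (evr q0 a)) qne => _; case: (sgzP (evr q0 t)) => _ //= _.
    - by exists 1, 0, (-1).
    - by exists 1, 0, (-1).
    - by exists 0, 1, 1.
    - by exists 0, 1, 1.
    - by exists 0, (-1), 1.
    - by exists 0, (-1), 1.
  pose e u := c0 + c1 * chi q0 u + c2 * (chi q0 u * chi q0 u).
  exists (fun u => phi u * e u); split; first by rewrite mulf_neq0.
    move=> u; rewrite inE => /orP [/eqP -> _|us ua]; first by rewrite /e ct mulr0.
    by rewrite p0 // mul0r.
  move=> q; transitivity (c0 * \sum_(u <- T) phi u * (chi q u * w u) +
    c1 * \sum_(u <- T) phi u * (chi (q0 * q) u * w u) +
    c2 * \sum_(u <- T) phi u * (chi (q0 * (q0 * q)) u * w u)).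
    rewrite !mulr_sumr -!big_split; apply: eq_bigr => u _ /=.
    by rewrite !chiM /e; ring.
  by rewrite !pS !mulr0 !addr0.
have := pS 1; rewrite (bigD1_seq a) //= big1_seq ?addr0 => [|t /andP [ta tT]]; last first.
  by rewrite p0 // mul0r.
rewrite rmorph1 hornerC sgz1 mul1r => /eqP.
by rewrite mulf_eq0 (negbTE pa) (negbTE wa).
Qed.

Hypothesis alg : forall y : k, algebraicOver iota y.

(** With $x_l = g_l(t)$ for a primitive element $t$, the given form is the value at $t$ of a family
    indexed by the real roots of $f$. The scaled transfers realize the sums in [sign_combination],
    whose weight at $t$ is nonzero. *)
Lemma gsgn_transfer (L P : finType) (beta : L -> P -> P -> k) (x : L -> k) :
  (forall l p p', beta l p p' = beta l p' p) ->
  gsgn (fun p p' => \sum_l x l * beta l p p') != 0 ->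
  exists d (c : L -> 'I_d -> 'I_d -> K), (forall l i j, c l i j = c l j i) /\
    gsgn (fun a b : 'I_d * P => \sum_l iota (c l a.1 b.1) * beta l a.2 b.2) != 0.
Proof.
move=> bsym nz.
have pK : [pchar K] =i pred0.
  move=> p; rewrite -(fmorph_pchar iota); exact: pchar_num.
have [t tP] := primitive_element pK alg (codom x).
have /choice [g gP] : forall l, exists g : {poly K}, evr g t = x l.
  by move=> l; apply: tP; exact: codom_f.
have [f [fm ft fs]] := minimal_separable pK alg t.
have [d sf] : exists d, size f = d.+1.
  by exists (size f).-1; rewrite prednK // size_poly_gt0 monic_neq0.
have [s [us _ sroot _]] := trace_roots iota fm fs sf.
pose T := undup [seq complex.Re z | z <- s & complex.Im z == 0].
have TE u : (u \in T) = root (map_poly iota f) u.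
  have -> : root (map_poly iota f) u = (real_complex k u \in s).
    by rewrite sroot /root -(fmorph_eq0 (real_complex k)) -horner_map -map_poly_comp.
  rewrite mem_undup; apply/mapP/idP => [[z]|us']; last first.
    by exists (real_complex k u); rewrite // mem_filter eqxx.
  rewrite mem_filter => /andP [/eqP z0 zs] ->; move: zs.
  by case: z z0 => a b /= ->.
pose w u := gsgn (fun p p' => \sum_l evr (g l) u * beta l p p').
have wt : w t != 0.
  move: nz; congr (gsgn _ != 0); apply/funext => p; apply/funext => p'.
  by apply: eq_bigr => l _; rewrite gP.
have tT : t \in T by rewrite TE.
have sep u : u != t -> exists q, chi q t != chi q u.
  by rewrite eq_sym; exact: separate_by_sign (monic_neq0 fm) ft.
have [q qP] := sign_combination (undup_uniq _) tT wt sep.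
exists d, (fun l i j => trace_gram f g q l i j); split.
  by move=> l i j; rewrite /trace_gram addnC.
by rewrite (trace_signature fm fs sf g bsym q (undup_uniq _) TE).
Qed.

End Transfer.

(** * A form of nonzero signature at one ordering with a Morita datum *)

Section DatumNonzero.
Variables (R : comNzRingType) (A : algType R) (sigma : {linear A -> A}).
Hypothesis invS : is_involution sigma.
Variables (m : nat) (F : fsep_alg (fun r : R => r%:A : A) m).
Variables (alpha : sper R) (k : real_closure alpha).
Variable mu : morita_datum sigma k.
Local Notation rho := (to_rc k).
Local Notation B := (bc_alg A rho).
Local Notation c := (bc_scalar A rho).
Local Notation inv := (bc_inv sigma (rho := rho)).
Local Notation tn a z := (tens (a : A) (z : via rho) : B).
Local Notation d := (md_kind mu).
Local Notation n := (md_size mu).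
Local Notation D := (dring k d).
Local Notation M := 'M[D]_n.+1.
Local Notation f := (md_iso mu : B -> M).
Local Notation g := (md_inv (m := mu) : M -> B).
Local Notation Psi := (md_Psi mu).
Local Notation Psi' := (md_Psi_inv mu).
Local Notation ct := (@ctmx D dconj _ _).
Local Notation P := ('I_n.+1 * 'I_(ddim d))%type.

Let s_ (l : 'I_m) : A := fin_gen F l + sigma (fin_gen F l).
Let H_ l : M := Psi' *m f (tn (s_ l) 1).
(** The Gram matrix over $k$ of the real part of the hermitian form $H$ on columns over $D$. *)
Let real_gram (H : M) (p p' : P) : k :=
  dre (dconj (@dbase k d p.2) * H p.1 p'.1 * @dbase k d p'.2).

Let real_gramC (H : M) p p' : ct H = H -> real_gram H p p' = real_gram H p' p.
Proof.
move=> hH; rewrite /real_gram -dre_conj !dconjM dconjK mulrA.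
by have <- : dconj (H p.1 p'.1) = H p'.1 p.1; [rewrite -{2}hH !mxE|].
Qed.
Let ftens (a : A) z : f (tn a z) = dscalar d z *: f (tn a 1).
Proof. rewrite bc_tensE rmorphM /= md_scalar; exact: mul_scalar_mx. Qed.
Let scalL a (X Y : M) : X *m (dscalar d a *: Y) = dscalar d a *: (X *m Y).
Proof.
apply/matrixP => p q; rewrite [LHS]mxE [RHS]mxE [X in _ = _ * X]mxE mulr_sumr.
by apply: eq_bigr => v _; rewrite [X in _ * X = _]mxE mulrA -dscalarC mulrA.
Qed.
Let s_herm l : ct (H_ l) = H_ l.
Proof.
have hS (i j : 'I_1) : sigma (s_ l) = s_ l by rewrite /s_ linearD /= (proj2 invS) addrC.
exact: (datum_gram_herm mu hS 0 0).
Qed.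
Let real_gram_sum (J : finType) (y : J -> k) (H : J -> M) p p' :
  real_gram (\sum_j dscalar d (y j) *: H j) p p' = \sum_j y j * real_gram (H j) p p'.
Proof.
rewrite /real_gram summxE mulr_sumr mulr_suml dre_sum; apply: eq_bigr => j _.
by rewrite mxE mulrA -dscalarC -!mulrA dreM.
Qed.

Let real_gram1 : gsgn (real_gram (dscalar d 2%:R)%:M) != 0.
Proof.
have E p p' : real_gram (dscalar d 2%:R)%:M p p' = 2%:R * (p == p')%:R.
  rewrite /real_gram mxE; have -> : (p == p') = (p.1 == p'.1) && (p.2 == p'.2).
    by case: p p' => [a b] [a' b'].
  case: (p.1 == p'.1) => /=; last by rewrite mulr0n !mulr0 mul0r dre0.
  rewrite mulr1n -dscalarC -mulrA dreM dre_conjM (bigD1 p.2) //= !dcoef_base eqxx mul1r.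
  by rewrite big1 ?addr0 1?eq_sym // => b nb; rewrite dcoef_base eq_sym (negbTE nb) mul0r.
rewrite (@gsgn_diag _ _ _ _ (fun _ => 2%:R) (fun p p' => (p == p')%:R) (fun p p' => (p == p')%:R)).
  rewrite (eq_bigr (fun=> 1)) => [|p _]; last by rewrite gtr0_sgz.
  by rewrite sumr_const card_prod !card_ord pnatr_eq0 muln_eq0; case: (d).
have del (p p' : P) (G : P -> k) : \sum_i (p == i)%:R * G i = G p.
  rewrite (bigD1 p) //= eqxx mul1r big1 ?addr0 // => i ni.
  by rewrite eq_sym (negbTE ni) mul0r.
split=> [a b|i j]; first exact: (del a a).
rewrite E (bigD1 i) //= eqxx mul1r big1 ?addr0 // => a na.
by rewrite (negbTE na) mul0r mulr0.
Qed.

(** Over $k$ the form given by [Psi] is definite after the Morita twist. Transfer replaces its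
    coefficients by matrices over the residue field, and clearing denominators brings these to
    $R$. *)
Lemma datum_sign_nonzero : exists (I : finType) (S : I -> I -> A) u T T',
  [/\ forall i j, sigma (S i j) = S j i, herm_diag_by (datum_gram mu S) u T T' &
      \sum_a sgz (u a) != 0].
Proof.
(* [b] is symmetric, so $2b = b + \sigma(b)$ is a combination of the symmetric elements [s_ l], with
   coefficients [y l] in $k$; the twist by [Psi'] turns $2b$ into twice the identity. *)
have [F' [gE _]] := bc_fsep rho F; pose b := g Psi.
pose y l := fin_coord F' l b.
have bE : b = \sum_l tn (fin_gen F l) (y l).
  by rewrite {1}(fin_coordK F' b); apply: eq_bigr => l _; rewrite gE [RHS]bc_tensE.
have bS : inv b = b.
  apply: (can_inj (md_isoK mu)); rewrite md_sigma md_invK md_Psi_herm.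
  by rewrite -mulmxA md_PsiK mulmx1.
have b2 : \sum_l dscalar d (y l) *: H_ l = (dscalar d 2%:R)%:M.
  have -> : \sum_l dscalar d (y l) *: H_ l = Psi' *m f (b + b).
    rewrite -{2}bS bE [inv _](big_morph _ (@bc_invD _ _ sigma _ rho) (@bc_inv0 _ _ sigma _ rho)).
    rewrite -big_split rmorph_sum mulmx_sumr; apply: eq_bigr => l _ /=.
    by rewrite bc_invE -bc_tensDl ftens scalL.
  rewrite rmorphD /= md_invK mulmxDr md_PsiVK; apply/matrixP => p q; rewrite !mxE -mulrnDl.
  by congr (_ *+ _); rewrite mulr2n dscalarD dscalar1.
pose beta l := real_gram (H_ l).
have bsym l p p' : beta l p p' = beta l p' p := real_gramC _ _ (s_herm l).
have nz : gsgn (fun p p' => \sum_l y l * beta l p p') != 0.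
  move: real_gram1; rewrite -b2; congr (gsgn _ != 0).
  by apply/funext => p; apply/funext => p'; rewrite real_gram_sum.
have [e [cf [cfC nz']]] := gsgn_transfer (@rc_algebraic _ _ k) bsym nz.
have [dl [r0 [dl0 r0E]]] := common_denominator
  (fun q : 'I_m * 'I_e * 'I_e => cf q.1.1 q.1.2 q.2).
(* The numerators need not be symmetric in $R$ although the fractions are, so one entry of each
   symmetric pair is used twice. *)
pose r l (i j : 'I_e) := if (i <= j)%N then r0 (l, i, j) else r0 (l, j, i).
have rC l i j : r l i j = r l j i.
  by rewrite /r; case: ltngtP => // ij; congr (r0 (_, _, _)); apply: val_inj.
have rE l i j : rho (r l i j) = rho dl * rc_emb k (cf l i j).
  have h i' j' : rho (r0 (l, i', j')) = rho dl * rc_emb k (cf l i' j').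
    by rewrite -[LHS]/(rc_emb k (residue_map alpha (r0 (l, i', j')))) -(r0E (l, i', j')) rmorphM.
  by rewrite /r; case: ifP => _; rewrite h // cfC.
pose S i j := \sum_l r l i j *: s_ l.
have hS i j : sigma (S i j) = S j i.
  rewrite linear_sum; apply: eq_bigr => l _; rewrite linearZ rC /=.
  by rewrite /s_ linearD /= (proj2 invS) addrC.
have [u [T [T' hD]]] := flat_herm_diag (datum_gram_herm mu hS).
exists 'I_e, S, u, T, T'; split=> //.
pose G (a b : 'I_e * P) := \sum_l rho (r l a.1 b.1) * beta l a.2 b.2.
(* Clearing denominators scales the form by the nonzero [rho dl], which changes its signature at
   most by a sign. *)
have GE : gsgn G != 0.
  have hs := gsgnP (G := fun a b : 'I_e * P => \sum_l rc_emb k (cf l a.1 b.1) * beta l a.2 b.2).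
  have {}hs := has_sigZ (rho dl) (hs _); rewrite (gsgnE (s := sgz (rho dl) *
    gsgn (fun a b : 'I_e * P => \sum_l rc_emb k (cf l a.1 b.1) * beta l a.2 b.2))).
    rewrite mulf_neq0 // sgz_eq0.
    by apply/eqP => /to_rc_eq0 /residue_map_eq0 h0; rewrite h0 eqxx in dl0.
  apply: eq_has_sig (hs _) => [x z|i j]; last by apply: eq_bigr => l _; rewrite cfC bsym.
  rewrite /gram mulr_sumr; apply: eq_bigr => i _; rewrite mulr_sumr; apply: eq_bigr => j _.
  rewrite mulrA [_ * (x i * _)]mulrCA; congr (_ * _ * _); rewrite mulr_sumr.
  by apply: eq_bigr => l _; rewrite rE mulrA.
apply: contraNneq GE => s0; apply/eqP.
pose q (x : 'I_e * P -> k) (i : 'I_e) : 'cV[D]_n.+1 :=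
  \col_p \sum_a dscalar d (x (i, (p, a))) * @dbase k d a.
have sq z : exists x, q x = z.
  exists (fun t => dcoef (z t.1 t.2.1 0) t.2.2); apply/funext => i; apply/colP => p.
  by rewrite mxE [RHS]dcoefK.
have := has_sig_pull sq (has_sig_herm hD); rewrite s0 mulr0 => hs.
apply: gsgnE; apply: eq_has_sig hs => x z; rewrite /herm_re /gram.
rewrite summxE dre_sum.
transitivity (\sum_i \sum_t \sum_j \sum_t' x (i, t) * G (i, t) (j, t') * z (j, t')); last first.
  rewrite pair_bigA; apply: eq_bigr => -[i t] _ /=.
  by rewrite pair_bigA; apply: eq_bigr => -[j t'] _.
apply: eq_bigr => i _; rewrite [RHS]exchange_big summxE dre_sum; apply: eq_bigr => j _ /=.
have dgE : datum_gram mu S i j = \sum_l dscalar d (rho (r l i j)) *: H_ l.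
  rewrite /datum_gram /S bc_tens_sum rmorph_sum mulmx_sumr; apply: eq_bigr => l _ /=.
  by rewrite bc_tensZ mulr1 ftens scalL.
transitivity (\sum_t \sum_t' x (i, t) * real_gram (datum_gram mu S i j) t t' * z (j, t')); last first.
  by apply: eq_bigr => t _; apply: eq_bigr => t' _; rewrite dgE real_gram_sum.
rewrite -mulmxA mxE dre_sum.
transitivity (\sum_p \sum_a \sum_p' \sum_a' x (i, (p, a)) *
    real_gram (datum_gram mu S i j) (p, a) (p', a') * z (j, (p', a'))); last first.
  rewrite pair_bigA; apply: eq_bigr => -[p a] _ /=.
  by rewrite pair_bigA; apply: eq_bigr => -[p' a'] _.
apply: eq_bigr => p _; rewrite [RHS]exchange_big [(_ *m q z j) p 0]mxE mulr_sumr dre_sum.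
apply: eq_bigr => p' _ /=; rewrite [q z j p' 0]mxE [ct _ _ _]mxE [_^T _ _]mxE [q x i p 0]mxE.
rewrite (big_morph _ (@dconjD k d) (dconj0 k d)) mulr_suml dre_sum.
apply: eq_bigr => a _; rewrite !mulr_sumr dre_sum; apply: eq_bigr => a' _.
rewrite dconjM dconj_scalar -dscalarC -mulrA dreM -[RHS]mulrA; congr (_ * _).
rewrite [RHS]mulrC /real_gram -dreM /=; congr dre.
by rewrite !mulrA dscalarC -!mulrA; congr (_ * _); rewrite mulrA -dscalarC -mulrA.
Qed.

End DatumNonzero.

(** A form with a signature is symmetric, so adding the transpose doubles it. This permits a Gram
    matrix over $R$ that is symmetric everywhere. *)
Lemma gsgn_symmetrize (k : realFieldType) (I : finType) (G : I -> I -> k) s :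
  has_sig (gram G) s -> gsgn (fun i j => G i j + G j i) = s.
Proof.
move=> h; apply: gsgnE; have := has_sigZ (2%:R : k) h; rewrite gtr0_sgz // mul1r.
apply: eq_has_sig => x y; have [J [u [L [[_ bL] _]]]] := h.
have symm : gram G x y = gram G y x.
  by rewrite !bL; apply: eq_bigr => j _; rewrite [L x j * _]mulrC.
rewrite mulr2n mulrDl mul1r {2}symm /gram [X in _ + X]exchange_big -big_split.
apply: eq_bigr => i _; rewrite -big_split; apply: eq_bigr => j _ /=; ring.
Qed.

(** * The ring of signature functions on the real spectrum *)

Section SignFunctions.
Variables (R : comNzRingType) (k : forall alpha : sper R, real_closure alpha).

Definition sgn_fun (phi : sper R -> int) : Prop :=
  exists (J : finType) (G : J -> J -> R),
    (forall i j, G i j = G j i) /\ forall a, asgn k a G = phi a.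

Lemma sgn_funD phi psi : sgn_fun phi -> sgn_fun psi -> sgn_fun (fun a => phi a + psi a).
Proof.
move=> [I [G [hG GE]]] [J [H [hH HE]]].
exists (I + J)%type, (fun a b => match a, b with
    inl i, inl j => G i j | inr i, inr j => H i j | _, _ => 0 end); split.
  by move=> [i|i] [j|j].
move=> a; rewrite -GE -HE -gsgn_sum; first last.
- by move=> i j; rewrite hH.
- by move=> i j; rewrite hG.
by congr gsgn; apply/funext => -[i|i]; apply/funext => -[j|j]; rewrite ?rmorph0.
Qed.

Lemma sgn_funM phi psi : sgn_fun phi -> sgn_fun psi -> sgn_fun (fun a => phi a * psi a).
Proof.
move=> [I [G [hG GE]]] [J [H [hH HE]]].
exists (I * J)%type, (fun a b => G a.1 b.1 * H a.2 b.2); split.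
  by move=> a b; rewrite hG hH.
move=> a; rewrite -GE -HE -gsgn_tensor; first last.
- by move=> i j; rewrite hH.
- by move=> i j; rewrite hG.
by congr gsgn; apply/funext => p; apply/funext => q; rewrite rmorphM.
Qed.

Lemma sgn_fun_sgz r : sgn_fun (fun a => sgz (to_rc (k a) r)).
Proof. by exists 'I_1, (fun _ _ => r); split=> // a; exact: gsgn1. Qed.

Lemma sgn_fun_const (n : int) : sgn_fun (fun=> n).
Proof.
have one : sgn_fun (fun=> 1).
  have [I [G [hG GE]]] := sgn_fun_sgz 1.
  by exists I, G; split=> // a; rewrite GE rmorph1 sgz1.
have mone : sgn_fun (fun=> -1).
  have [I [G [hG GE]]] := sgn_fun_sgz (-1).
  by exists I, G; split=> // a; rewrite GE rmorphN1 sgzN1.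
elim/int_rect: n => [|n IHn|n IHn].
- exact: sgn_funD one mone.
- by rewrite intS; exact: sgn_funD one IHn.
- by rewrite intS opprD; exact: sgn_funD mone IHn.
Qed.

(** Only a positive multiple of the indicator function is asked to be a signature; products as in
    [clopen_level] do not yield the indicator itself. *)
Definition clopen (X : sper R -> bool) : Prop :=
  exists2 c : int, 0 < c & sgn_fun (fun a => if X a then c else 0).

Lemma clopenC X : clopen X -> clopen (fun a => ~~ X a).
Proof.
move=> [c c0 h]; exists c => //.
have [I [G [hG GE]]] := sgn_funD (sgn_fun_const c) (sgn_funM (sgn_fun_const (-1)) h).
exists I, G; split=> // a; rewrite GE; case: (X a); rewrite /= ?mulr0 ?addr0 //.
by rewrite mulN1r subrr.
Qed.

Lemma clopenI X Y : clopen X -> clopen Y -> clopen (fun a => X a && Y a).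
Proof.
move=> [c c0 h] [e e0 h']; exists (c * e); first exact: mulr_gt0.
have [I [G [hG GE]]] := sgn_funM h h'; exists I, G; split=> // a; rewrite GE.
by case: (X a); case: (Y a); rewrite /= ?mulr0 ?mul0r.
Qed.

Lemma clopenU X Y : clopen X -> clopen Y -> clopen (fun a => X a || Y a).
Proof.
move=> /clopenC h /clopenC h'; have [c c0 [I [G [hG GE]]]] := clopenC (clopenI h h').
by exists c => //; exists I, G; split=> // a; rewrite GE negb_and !negbK.
Qed.

(** A signature function takes finitely many values, so a polynomial in it that vanishes at all of
    them except [v], and is positive at [v], is a multiple of the indicator. *)
Lemma clopen_level phi v : sgn_fun phi -> clopen (fun a => phi a == v).
Proof.
move=> fphi; have [I [G [hG GE]]] := fphi.
(* All integers between $-|I|$ and $|I|$ except [v]; signatures are bounded by the size of the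
   matrix. *)
pose l := [seq w <- [seq i%:Z - #|I|%:Z | i <- iota 0 (#|I| + #|I|).+1] | w != v].
have inl_ a : phi a != v -> phi a \in l.
  have bd : `|phi a| <= #|I|%:Z by rewrite -GE; apply: gsgn_bound => i j; rewrite hG.
  move=> ne; rewrite mem_filter ne andTb; apply/mapP; exists `|(phi a + #|I|%:Z)%R|%N.
    by rewrite mem_iota; lia.
  lia.
have nl w : w \in l -> w != v by rewrite mem_filter => /andP [].
pose psi u := \prod_(w <- l) (u - w) ^+ 2 : int.
exists (psi v).
  rewrite /psi lt_def prodr_ge0 ?andbT => [|w _]; last exact: sqr_ge0.
  rewrite prodf_seq_neq0; apply/allP => w /nl ne.
  by rewrite sqrf_eq0 subr_eq0 eq_sym.
have [J [H [hH HE]]] : sgn_fun (fun a => psi (phi a)).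
  rewrite /psi; elim: (l) => [|w s [J [H [hH HE]]]].
    have [J [H [hH HE]]] := sgn_fun_const 1.
    by exists J, H; split=> // a; rewrite big_nil.
  have h := sgn_funD fphi (sgn_fun_const (- w)).
  have h' : sgn_fun (fun a => \prod_(w0 <- s) (phi a - w0) ^+ 2) by exists J, H.
  have [J' [H' [hH' HE']]] := sgn_funM (sgn_funM h h) h'.
  by exists J', H'; split=> // a; rewrite HE' big_cons expr2.
exists J, H; split=> // a; rewrite HE; case: eqP => [->//|/eqP ne].
apply/eqP; rewrite prodf_seq_eq0; apply/hasP; exists (phi a); first exact: inl_.
by rewrite /= subrr expr0n.
Qed.

End SignFunctions.

Section DatumSignature.
Variables (R : comNzRingType) (A : algType R) (sigma : {linear A -> A}).
Hypothesis invS : is_involution sigma.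
Variables (alpha : sper R) (k : real_closure alpha).
Variable mu : morita_datum sigma k.
Local Notation d := (md_kind mu).

(** The signature at one given datum, read from the real part of the form, whose signature is $\dim
    D$ times as large. *)
Definition dsign (I : finType) (S : I -> I -> A) : int :=
  xget 0 (fun s => has_sig (herm_re (datum_gram mu S)) ((ddim d)%:Z * s)).

Let ddim_neq0 : (ddim d)%:Z != 0. Proof. by case: (d). Qed.

Lemma dsignE (I : finType) (S : I -> I -> A) s :
  has_sig (herm_re (datum_gram mu S)) ((ddim d)%:Z * s) -> dsign S = s.
Proof.
move=> h; rewrite /dsign; case: xgetP => [s' _ h'|h']; last by case: (h' s).
by apply: (mulfI ddim_neq0); exact: has_sig_uniq h' h.
Qed.

Lemma dsign_diag (I : finType) (S : I -> I -> A) u T T' :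
  herm_diag_by (datum_gram mu S) u T T' -> dsign S = \sum_a sgz (u a).
Proof. by move=> h; apply: dsignE; exact: has_sig_herm h. Qed.

Lemma dsignP (I : finType) (S : I -> I -> A) : (forall i j, sigma (S i j) = S j i) ->
  has_sig (herm_re (datum_gram mu S)) ((ddim d)%:Z * dsign S).
Proof.
move=> hS; have [u [T [T' h]]] := flat_herm_diag (datum_gram_herm mu hS).
by rewrite (dsign_diag h); exact: has_sig_herm h.
Qed.

Lemma sform_sign_dsign (I : finType) (S : I -> I -> A) hS s :
  is_sign mu (@sform R A sigma invS I S hS) s <-> s = dsign S.
Proof.
have [u [T [T' h]]] := flat_herm_diag (datum_gram_herm mu hS).
rewrite (dsign_diag h); split=> [|->]; first by move=> hs; apply: (sform_sign_uniq h hs).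
exact: (sform_sign invS hS h).
Qed.

Let datum_gramZ (I : finType) (S : I -> I -> A) (J : finType) (G : J -> J -> R) j j' i i' :
  datum_gram mu (fun a b : J * I => G a.1 b.1 *: S a.2 b.2) (j, i) (j', i') =
  dscalar d (to_rc k (G j j')) *: datum_gram mu S i i'.
Proof.
rewrite /datum_gram /= bc_tensZ mulr1 bc_tensE rmorphM /= md_scalar.
rewrite -[_ * _]/(_ *m _) mul_scalar_mx; apply/matrixP => p q.
rewrite [LHS]mxE [RHS]mxE [X in _ = _ * X]mxE mulr_sumr.
by apply: eq_bigr => v _; rewrite [X in _ * X = _]mxE mulrA -dscalarC mulrA.
Qed.

Lemma dsign_sum (I J : finType) (S : I -> I -> A) (S' : J -> J -> A) :
  (forall i j, sigma (S i j) = S j i) -> (forall i j, sigma (S' i j) = S' j i) ->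
  dsign (fun a b : I + J => match a, b with
    inl i, inl j => S i j | inr i, inr j => S' i j | _, _ => 0 end) = dsign S + dsign S'.
Proof.
move=> hS hS'; apply: dsignE; rewrite mulrDr.
have sp : forall y : (I -> 'cV[dring k d]_(md_size mu).+1) * (J -> 'cV[dring k d]_(md_size mu).+1),
    exists x : I + J -> _, ((fun i => x (inl i)), (fun j => x (inr j))) = y.
  by move=> [y1 y2]; exists (fun a => match a with inl i => y1 i | inr j => y2 j end).
apply: eq_has_sig (has_sig_pull sp (has_sigD (dsignP hS) (dsignP hS'))) => x y /=.
have g0 : md_Psi_inv mu *m md_iso mu (tens (0 : A) (1 : via (to_rc k)) : bc_alg A (to_rc k)) = 0.
  by rewrite (balanced0l (balanced_tens A (via (to_rc k)))) rmorph0 mulmx0.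
rewrite /herm_re -dreD; congr dre; rewrite big_sumType [RHS]mxE /=.
congr (_ + _); congr (fun_of_matrix _ _ _).
  apply: eq_bigr => i _; rewrite big_sumType /= [X in _ = _ + X]big1 ?addr0 // => j _.
  by rewrite /datum_gram g0 mulmx0 mul0mx.
apply: eq_bigr => i _; rewrite big_sumType /= [X in _ = X + _]big1 ?add0r // => j _.
by rewrite /datum_gram g0 mulmx0 mul0mx.
Qed.

Lemma dsign_tensor (I J : finType) (S : I -> I -> A) (G : J -> J -> R) :
  (forall i j, sigma (S i j) = S j i) -> (forall i j, G i j = G j i) ->
  dsign (fun a b : J * I => G a.1 b.1 *: S a.2 b.2) =
  gsgn (fun i j => to_rc k (G i j)) * dsign S.
Proof.
move=> hS hG; apply: dsignE.
have two0 : (2%:R : k) != 0 by rewrite pnatr_eq0.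
have hG' i j : to_rc k (G i j) = to_rc k (G j i) by rewrite hG.
have [u [T [U h]]] := gram_diag_exists two0 hG'.
have sp : forall y : J -> I -> 'cV[dring k d]_(md_size mu).+1,
    exists x : J * I -> _, (fun j i => x (j, i)) = y.
  by move=> y; exists (fun p => y p.1 p.2).
rewrite (gsgn_diag h) mulrCA.
apply: eq_has_sig (has_sig_pull sp (has_sig_tensor h (dsignP hS))) => x y /=.
rewrite /herm_re [in RHS]summxE dre_sum.
transitivity (\sum_j \sum_i \sum_j' \sum_i' to_rc k (G j j') *
   dre ((@ctmx _ dconj _ _ (x (j, i)) *m datum_gram mu S i i' *m y (j', i')) 0 0)).
  apply: eq_bigr => j _; rewrite [RHS]exchange_big; apply: eq_bigr => j' _ /=.
  rewrite summxE dre_sum mulr_sumr; apply: eq_bigr => i _.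
  by rewrite summxE dre_sum mulr_sumr.
rewrite pair_bigA; apply: eq_bigr => -[j i] _ /=; rewrite summxE dre_sum.
rewrite pair_bigA; apply: eq_bigr => -[j' i'] _ /=.
rewrite datum_gramZ -dreM; congr dre.
rewrite !mxE mulr_sumr; apply: eq_bigr => q _; rewrite mulrA; congr (_ * _).
rewrite !mxE mulr_sumr; apply: eq_bigr => p _; rewrite !mxE !mulrA; congr (_ * _).
by rewrite dscalarC.
Qed.

End DatumSignature.

(** * Gluing over the real spectrum *)

Section Assembly.
Variables (R : comNzRingType) (A : algType R) (sigma : {linear A -> A}).
Hypothesis invS : is_involution sigma.
Variables (m : nat) (F : fsep_alg (fun r : R => r%:A : A) m).
Hypothesis scal_inj : injective (fun r : R => r%:A : A).
Hypothesis sym_center : forall z : A,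
  (exists r : R, z = r%:A) <-> ((forall a, z * a = a * z) /\ sigma z = z).
Hypothesis two_unit : exists t : R, 2%:R * t = 1.
Variable k : forall alpha : sper R, real_closure alpha.
Local Notation rho a := (to_rc (k a)).
Local Notation datum a := (morita_datum sigma (k a)).
Local Notation herm S := (forall i j, sigma (S i j) = S j i).

Lemma bc_neq0 a : (1 : bc_alg A (rho a)) != 0.
Proof.
have ci := bc_scalar_inj (rho := rho a) F invS scal_inj sym_center two_unit.
apply/eqP => h; have : bc_scalar A (rho a) 1 = bc_scalar A (rho a) 0.
  have c0 : bc_scalar A (rho a) 0 = 0.
    by apply: (addrI (bc_scalar A (rho a) 0)); rewrite -bc_scalarD !addr0.
  by rewrite c0 -h.
by move/ci/eqP; rewrite oner_eq0.
Qed.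

Let bi a (D : datum a) := datum_block D (bc_neq0 a).

Lemma datum_rtrace a (D : datum a) :
  sgz (rho a (rtrace F sigma)) = sgz (dkappa (md_kind D)).
Proof.
rewrite (block_rtrace invS F (bi D) (eps := false) (md_PsiK D) (md_Psi_herm D) (@md_sigma _ _ _ _ _ D)).
by rewrite mul1r sgzM sgz_int [sgz _%:R]gtr0_sgz ?mulr1 ?ltr0n.
Qed.

(* [gram_square] itself is only known to be symmetric at a datum. *)
Definition gram_squares (I : finType) (S : I -> I -> A) s t : R :=
  gram_square sigma F S s t + gram_square sigma F S t s.

Lemma datum_gram_squares a (D : datum a) (I : finType) (S : I -> I -> A) : herm S ->
  asgn k a (gram_squares S) = (ddim (md_kind D))%:Z * dsign D S ^+ 2.
Proof.
move=> hS; have [u [T [T' h]]] := flat_herm_diag (datum_gram_herm D hS).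
rewrite (dsign_diag h) -[RHS](gsgn_symmetrize (has_sig_gram_square F (bi D) (md_PsiK D)
  (md_PsiVK D) (md_Psi_herm D) (@md_sigma _ _ _ _ _ D) h)).
by congr gsgn; apply/funext => s; apply/funext => t; rewrite rmorphD.
Qed.

Lemma gram_tau_sym i j : gram_tau F i j = gram_tau F j i.
Proof. exact: rtauC. Qed.

Lemma datum_gram_tau a (D : datum a) :
  sgz (asgn k a (gram_tau F)) = sgz (dkappa (md_kind D)).
Proof.
by rewrite /asgn (gsgnE (has_sig_gram_tau F (bi D))) sgzM [sgz _.+1%:Z]gtr0_sgz ?mulr1.
Qed.

(** The markers of nil-orderings. A skew [Psi] reverses the sign of the trace of $\sigma$ but not
    the signature of $\mathrm{Tr}(xy)$, and both are nonzero as $D$ is not complex. An exchanged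
    pair of blocks gives a skew central element whose square has positive trace. *)
Lemma classify_sper a :
  [\/ inhabited (datum a),
      nil_ordering sigma (k a) /\
        sgz (asgn k a (gram_tau F)) <> sgz (rho a (rtrace F sigma)) |
      nil_ordering sigma (k a) /\
        exists j, 0 < rho a (rtau F (sep_skew sigma F (fin_gen F j) * sep_skew sigma F (fin_gen F j)))].
Proof.
have [[d [n [f [g [P [P' [eps [b [PP P'P] hP nd fS]]]]]]]]|[cc [d [n [f [g [b hc nd]]]]]]] :=
  bc_classification invS (k a) F scal_inj sym_center two_unit.
- case: eps hP nd => hP nd; last by apply: Or31; exact: (block_isom_datum b PP P'P hP fS).
  apply: Or32; split; first exact: (block_isom_skew_nil b PP P'P hP (nd isT) fS).
  rewrite (block_rtrace invS F b (eps := true) PP hP fS) /asgn (gsgnE (has_sig_gram_tau F b)).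
  rewrite !sgzM sgz_int [sgz (n.+1%:Z)]gtr0_sgz // [sgz (n.+1%:R)]gtr0_sgz ?ltr0n //.
  by rewrite expr1 sgzN1; case: (d) (nd isT).
apply: Or33; split; first exact: (block_isom_double_nil invS b hc nd).
exact: (double_rtau_gt0 invS F sym_center two_unit b hc).
Qed.

(** One form over $R$ together with its signature at every datum of every ordering, so that no
    choice of data enters. *)
Definition sign_family (s : forall a, datum a -> int) : Prop :=
  exists (I : finType) (S : I -> I -> A), herm S /\ forall a D, @dsign _ _ _ a (k a) D I S = s a D.

Lemma sign_familyD s t : sign_family s -> sign_family t ->
  sign_family (fun a D => s a D + t a D).
Proof.
move=> [I [S [hS SE]]] [J [T [hT TE]]].
exists (I + J)%type, (fun a b => match a, b with
    inl i, inl j => S i j | inr i, inr j => T i j | _, _ => 0 end); split.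
  by move=> [i|i] [j|j]; rewrite ?linear0.
by move=> a D; rewrite -SE -TE dsign_sum.
Qed.

Lemma sign_familyM phi s : sgn_fun k phi -> sign_family s ->
  sign_family (fun a D => phi a * s a D).
Proof.
move=> [J [G [hG GE]]] [I [S [hS SE]]].
exists (J * I)%type, (fun a b => G a.1 b.1 *: S a.2 b.2); split.
  by move=> a b; rewrite linearZ /= hS hG.
by move=> a D; rewrite -SE -GE dsign_tensor.
Qed.

(** Requiring signature $0$ outside [X], and not only constancy on it, is what allows forms for
    different sets to be added. *)
Definition good (X : sper R -> bool) : Prop :=
  clopen k X /\ exists (c : int) s, [/\ 0 < c, sign_family s &
    forall a D, `|s a D| = if X a then c else 0].

Lemma good0 : good (fun=> false).
Proof.
split; first by exists 1 => //; exact: sgn_fun_const.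
have h : sign_family (fun a D => @dsign _ _ _ a (k a) D _ (fun _ _ : 'I_1 => 1)).
  by exists 'I_1, (fun _ _ => 1); split=> // i j; exact: sigma1.
exists 1, (fun a D => 0 * dsign D (fun _ _ : 'I_1 => 1)); split=> //.
  exact: sign_familyM (sgn_fun_const k 0) h.
by move=> a D; rewrite mul0r normr0.
Qed.

Lemma goodU X Y : good X -> good Y -> good (fun a => X a || Y a).
Proof.
move=> [cX [c [s [c0 hs sE]]]] [cY [e [t [e0 ht tE]]]].
split; first exact: clopenU.
have [b b0 hb] := clopenC cX.
(* The second summand is cut off outside [X] by a multiple of the indicator of its complement; the
   factors $be$ and $c$ equalize the two constants to $bce$. *)
exists (b * c * e), (fun a D => b * e * s a D + c * ((if ~~ X a then b else 0) * t a D)); split.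
- by rewrite !mulr_gt0.
- apply: sign_familyD; first exact: sign_familyM (sgn_fun_const k _) hs.
  exact: sign_familyM (sgn_fun_const k _) (sign_familyM hb ht).
move=> a D; have := sE a D; have := tE a D; case: (X a) => /= ht' hs'.
  by rewrite mul0r mulr0 addr0 normrM hs' gtr0_norm ?mulr_gt0 // mulrAC.
move/eqP: hs'; rewrite normr_eq0 => /eqP ->; rewrite mulr0 add0r !normrM ht'.
rewrite (gtr0_norm c0) (gtr0_norm b0); case: (Y a); rewrite ?mulr0 // mulrA.
by rewrite [c * b]mulrC.
Qed.

(** Let $X$ be the set where the signature of the square form and the sign of the trace of $\sigma$
    agree with their values at [a]. At data over $X$ the second fixes $D$, and then the first fixes
    the square of the signature. *)
Lemma good_local a : datum a -> exists X, good X /\ X a.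
Proof.
move=> D; have [I [S [u [T [T' [hS h nz]]]]]] := datum_sign_nonzero invS F D.
have {nz} : dsign D S != 0 by rewrite (dsign_diag h).
set s0 := dsign D S => nz.
pose phi b := asgn k b (gram_squares S); pose psi b := sgz (rho b (rtrace F sigma)).
have fphi : sgn_fun k phi.
  by exists ((I * I) * 'I_m)%type, (gram_squares S); split=> // i j; rewrite /gram_squares addrC.
pose X b := (phi b == phi a) && (psi b == psi a).
have cX : clopen k X.
  exact: clopenI (clopen_level _ fphi) (clopen_level _ (sgn_fun_sgz k _)).
exists X; split; last by rewrite /X !eqxx.
split=> //; have [c c0 hc] := cX.
exists (c * `|s0|), (fun b E => (if X b then c else 0) * dsign E S); split.
- by rewrite mulr_gt0 // normr_gt0.
- by apply: sign_familyM hc _; exists I, S.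
move=> b E; case: ifP => [/andP [/eqP h1 /eqP h2]|_]; last by rewrite mul0r normr0.
rewrite normrM (gtr0_norm c0); congr (_ * _).
have kE : md_kind E = md_kind D.
  by move: h2; rewrite /psi (datum_rtrace E) (datum_rtrace D); case: (md_kind E); case: (md_kind D).
move: h1; rewrite /phi (datum_gram_squares E hS) (datum_gram_squares D hS) kE => h1.
have dd : (ddim (md_kind D))%:Z != 0 by case: (md_kind D).
by move/(mulfI dd)/eqP: h1; rewrite eqf_sqr => /orP [/eqP ->|/eqP ->]; rewrite ?normrN.
Qed.

Local Open Scope classical_set_scope.

(** Otherwise the orderings with a datum lying outside a good set generate a proper filter, since
    good sets are closed under union; an ultrafilter above it has a limit [a]. *)
Lemma good_cover : exists X, good X /\ forall a, datum a -> X a.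
Proof.
apply: contrapT => ncov.
pose B (X : sper R -> bool) : set (sper R) := [set a | inhabited (datum a) /\ ~~ X a].
have Bne X : good X -> B X !=set0.
  move=> gX; apply: contrapT => h; apply: ncov; exists X; split=> // a D.
  by apply/negPn/negP => nX; apply: h; exists a.
have FF : ProperFilter (filter_from [set X | good X] B).
  apply: filter_from_proper => //; apply: filter_from_filter; first by exists (fun=> false); exact: good0.
  move=> X Y gX gY; exists (fun a => X a || Y a); first exact: goodU.
  by move=> a [D]; rewrite negb_or => /andP [nX nY].
have [U [UU FU]] := ultraFilterLemma FF.
have UB X : good X -> U (B X) by move=> gX; apply: FU; exists X.
have UI (P Q : set (sper R)) : U P -> U Q -> exists b, P b /\ Q b.
  by move=> hP hQ; exact: filter_ex (filterI hP hQ).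
have [a aP] := sper_limit UU.
have UY : U [set b | inhabited (datum b)].
  by apply: filterS (UB _ good0) => b [].
(* With a datum at the limit, a good set around [a] is clopen and must meet a member of the
   ultrafilter that avoids it. In the nil cases the marker passes to nearby orderings with a datum,
   which exclude it. *)
have [[D]|[_ ne]|[_ [j jP]]] := classify_sper a.
- have [X [gX Xa]] := good_local D; have [[c c0 [J [G [hG GE]]]] _] := gX.
  have [b [[_ nX] /=]] := UI _ _ (UB _ gX) (limit_asgn k UU aP hG).
  by rewrite !GE Xa (negbTE nX) => e; rewrite e ltxx in c0.
- have UE : U ([set b | asgn k b (gram_tau F) = asgn k a (gram_tau F)] `&`
      [set b | sgz (rho b (rtrace F sigma)) = sgz (rho a (rtrace F sigma))]).
    by apply: filterI; [exact: (limit_asgn k UU aP gram_tau_sym)|exact: (limit_sgz k UU aP)].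
  have [b [[D] /= [e1 e2]]] := UI _ _ UY UE; apply: ne.
  by rewrite -e1 -e2 (datum_gram_tau D) (datum_rtrace D).
have [b [[D] /= e]] := UI _ _ UY (limit_sgz k UU aP
  (rtau F (sep_skew sigma F (fin_gen F j) * sep_skew sigma F (fin_gen F j)))).
have := rtau_sep_skew_le0 invS F (bi D) (fin_gen F j) (md_PsiK D) (@md_sigma _ _ _ _ _ D).
by rewrite leNgt -sgz_gt0 e sgz_gt0 jP.
Qed.

End Assembly.

Theorem theorem5p5 (R : comNzRingType) (two_unit : exists t : R, 2%:R * t = 1)
    (A : algType R) (sigma : {linear A -> A})
    (azA : azumaya_with_involution sigma)
    (k : forall alpha : sper R, real_closure alpha)
    (mu : morita_choice sigma k) :
  exists eta : hermitian_form sigma,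
    reference_form mu eta /\
    exists c : int, 0 < c /\
      forall alpha : sper R, ~ nil_ordering sigma (k alpha) ->
        `|msign mu alpha eta| = c.
Proof.
have [invS sepA projA scal_inj sym_center] := azA.
have [m [F]] := azumaya_fsep sepA projA.
have [X [[_ [c [s [c0 [I [S [hS SE]]] sE]]]] cov]] :=
  good_cover invS F scal_inj sym_center two_unit k.
have main alpha : ~ nil_ordering sigma (k alpha) ->
    `|msign mu alpha (sform invS hS)| = c.
  move=> nn; have exD : inhabited (morita_datum sigma (k alpha)).
    by case: (classify_sper invS F scal_inj sym_center two_unit k alpha) => [//|[/nn []]|[/nn []]].
  rewrite /msign; case: pselect => [/nn //|nn'] /=; case: pselect => [ex|/(_ exD) //] /=.
  (* Both default branches of [msign] are now excluded, and by [sform_sign_dsign] the value of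
     [xget] is the signature at the chosen datum. *)
  rewrite (_ : xget _ _ = s alpha (mu alpha ex)).
    by rewrite sE cov //; exact: (mu alpha ex).
  rewrite -SE; case: xgetP => [s' _ h|/(_ (dsign (mu alpha ex) S))]; first exact/sform_sign_dsign.
  by case; apply/sform_sign_dsign.
exists (sform invS hS); split; last by exists c.
by move=> alpha /main e h; rewrite h normr0 in e; rewrite -e ltxx in c0.
Qed.
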